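(* Let $E$ be a countable closed subset of the unit circle $\mathbb{T}$. The following conditions are equivalent: (i) there exist constants $C_1,C_2>0$ such that for every arc $L$ of $\mathbb{T}$, $$\frac{1}{|L|}\int_L\log^+\frac{1}{d(e^{it},E)}\,dt\le C_1\log\frac{1}{|L|}+C_2;$$ (ii) $\displaystyle\int_0^{2\pi}\log^+\frac{1}{d(e^{it},E)}\,dt<+\infty$, and for every real $s\ge 0$ there exists a real $t\ge s$ such that property $P(s,t,E)$ holds.
   Context: $|L|$ denotes the length of the arc $L$ and $d(e^{it},E)$ the distance from $e^{it}$ to $E$. ''Countable'' means finite or countably infinite. For a closed set $E\subset\mathbb{T}$ and reals $s,t\ge 0$, property $P(s,t,E)$ is the following: every invertible bounded operator $T$ on a (complex) Banach space with spectrum $\mathrm{Sp}\,T\subset E$ satisfying $\|T^n\|=O(n^s)$ as $n\to+\infty$ and, for every $\varepsilon>0$, $\|T^{-n}\|=O(e^{\varepsilon\sqrt n})$ as $n\to+\infty$, also satisfies $\|T^{-n}\|=O(n^t)$ as $n\to+\infty$. *)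

(* Defs.v *)
From HB Require Import structures.
From mathcomp Require Import all_boot all_order all_algebra.
From mathcomp Require Import all_classical all_reals all_analysis.
From mathcomp Require Export complex.
Import Order.TTheory GRing.Theory Num.Theory.
Import numFieldNormedType.Exports.

Set Implicit Arguments.
Unset Strict Implicit.
Unset Printing Implicit Defensive.

Local Open Scope classical_set_scope.
Local Open Scope ring_scope.

Section Circle.
Context {R : realType}.

Definition unit_circle : set R[i]^o := [set z | `|z| = 1].

Definition expi (t : R) : R[i] := (cos t +i* sin t)%C.

(* The infimum is taken in \bar R, so that dist z set0 = +oo. *)
Definition dist (z : R[i]) (E : set R[i]^o) : \bar R :=
  ereal_inf [set (complex.Re `|z - w|)%:E | w in E].

(* log^+ (1 / d(e^{it}, E)), with value +oo when the distance is 0, and value 0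
   when E is empty. *)
Definition logp_inv_dist (E : set R[i]^o) (t : R) : \bar R :=
  maxe 0%E (lne (dist (expi t) E)^-1%E).

End Circle.

Section Operators.
Context {R : realType} {V : completeNormedModType R[i]}.
Implicit Types (x : V) (T S : V -> V).

(* The library norm of V takes values in R[i]. *)
Definition rnorm x : R := complex.Re `|x|.

Definition bounded_operator T :=
  linear T /\ exists M : R, forall x, rnorm (T x) <= M * rnorm x.

Definition opnorm T : R := sup [set rnorm (T x) | x in [set x | rnorm x <= 1]].

Definition bounded_inverse T S :=
  [/\ bounded_operator S, cancel T S & cancel S T].

Definition spectrum T : set R[i]^o :=
  [set l | ~ exists S, bounded_inverse (fun x => l *: x - T x) S].

End Operators.

(* S is the inverse of T, so iter n S is T^{-n}. *)
Definition property_P {R : realType} (s t : R) (E : set R[i]^o) : Prop :=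
  forall (V : completeNormedModType R[i]) (T S : V -> V),
    bounded_operator T -> bounded_inverse T S ->
    spectrum T `<=` E ->
    ((fun n => opnorm (iter n T)) : nat -> R^o) =O_\oo
      ((fun n => n%:R `^ s) : nat -> R^o) ->
    (forall eps : R, 0 < eps ->
      ((fun n => opnorm (iter n S)) : nat -> R^o) =O_\oo
        ((fun n => expR (eps * Num.sqrt n%:R)) : nat -> R^o)) ->
    ((fun n => opnorm (iter n S)) : nat -> R^o) =O_\oo
      ((fun n => n%:R `^ t) : nat -> R^o).

(* Main.v *)
Require Import Defs.
From HB Require Import structures.
From mathcomp Require Import all_boot all_order all_algebra.
From mathcomp Require Import all_classical all_reals all_analysis.
From mathcomp Require Import measurable_realfun.
From mathcomp Require Import ring lra.
Import Order.TTheory GRing.Theory Num.Theory.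
Import numFieldNormedType.Exports.
Set Implicit Arguments.
Unset Strict Implicit.
Unset Printing Implicit Defensive.
Local Open Scope classical_set_scope.
Local Open Scope ring_scope.

(** Everything rests on one potential. At each scale 2^-n, every 2^n-th root of
    unity e lying within 16 2^-n of E carries the dipole
    ln |z - (1 + 2^-n) e| - ln |z - (1 + 2 2^-n) e|. If the integral of log^+ 1/d
    over the circle is finite, the sum g of the dipoles is harmonic on the domain
    Om = {|z| < 1 + eta d(z,E)^2}, satisfies g <= (ln d(z,E)) / 144 there, and
    -g = o(1 / (1 - |z|)) in the disc; condition (i) means that
    -g = O(1 + ln 1/(1 - |z|)).

    (i) -> (ii): for K large, ln |R(z) y| + K g is subharmonic on Om and bounded near
    the boundary points of Om outside E. The set of points of E near which it is
    unbounded is closed and countable; were it nonempty it would have an isolated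
    point, which a Phragmen-Lindelof argument excludes. Hence the resolvent
    R(z) is at most exp(-K g), which is polynomial in 1 / (1 - |z|), and Cauchy's
    formula bounds T^-n.

    (ii) -> (i): apply P(1,t) to multiplication by z on the functions on E that
    extend to the circle as uniform limits of polynomials, Lipschitz between points
    of E and of the circle. The bound on T^-n yields polynomials p for which
    1 - z^n p is small near E; comparing ln |1 - z^n p| with g by the maximum
    principle bounds -g logarithmically, and counting dipoles over an arc gives (i). *)

(** Three choices shape the argument. Harmonicity and subharmonicity are tested on means over three
    points only, with an error of order t^3, so no contour integral is needed. The domain Om passes
    the circle by a quantity quadratic in d(z,E). On its outer boundary the resolvent is at most a
    power of 1/(|z| - 1), hence of d(z,E)^-2, and g <= (ln d)/144 lets a multiple of g cancel it;
    nothing need be known in advance about the resolvent on the circle itself. The same quadratic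
    width keeps Om on the inner side of the tangent at any point of E, so that a Moebius map sends
    Om into a half-plane, the setting for Phragmen-Lindelof. For the converse an operator must be
    built out of E alone. The exponential of 144 g and its conjugate is at most d in modulus: it is
    Lipschitz between points of E, where it vanishes, and points of the circle. This is the
    regularity at hand and it dictates the norm of the space. There the powers of multiplication by
    z grow linearly, whence s = 1, and -g = o(1/(1 - |z|)) yields the growth e^(eps sqrt n) of the
    inverse powers that property P presupposes. *)

Definition nm {R : realType} {V : normedZmodType R[i]} (x : V) : R :=
  complex.Re `|x|.

(** * Real-valued norms of complex numbers and vectors *)

Section Modulus.
Context {R : realType}.
Implicit Types (V : normedZmodType R[i]) (z w : R[i]).

Lemma nmE V (x : V) : `|x| = (nm x)%:C%C.
Proof. by rewrite /nm RRe_real // ger0_real. Qed.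

Lemma nm_ge0 V (x : V) : 0 <= nm x.
Proof. by rewrite -ler0c -nmE. Qed.

Lemma nm0 V : nm (0 : V) = 0.
Proof. by rewrite /nm normr0. Qed.

Lemma nm_eq0 V (x : V) : (nm x == 0) = (x == 0).
Proof.
rewrite -[x == 0]normr_eq0 nmE; apply/eqP/eqP => [->//|H].
by apply: complexI.
Qed.

Lemma nm_gt0 V (x : V) : (0 < nm x) = (x != 0).
Proof. by rewrite lt_neqAle nm_ge0 andbT eq_sym nm_eq0. Qed.

Lemma nmN V (x : V) : nm (- x) = nm x.
Proof. by rewrite /nm normrN. Qed.

Lemma nmD V (x y : V) : nm (x + y) <= nm x + nm y.
Proof. by rewrite -lecR rmorphD /= -!nmE ler_normD. Qed.

Lemma nmB V (x y : V) : nm (x - y) <= nm x + nm y.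
Proof. by rewrite -[nm y]nmN nmD. Qed.

Lemma nmBC V (x y : V) : nm (x - y) = nm (y - x).
Proof. by rewrite -nmN opprB. Qed.

Lemma nm_tri V (y x z : V) : nm (x - z) <= nm (x - y) + nm (y - z).
Proof. by apply: le_trans (nmD _ _); rewrite addrA subrK. Qed.

Lemma nm_subl V (x y : V) : nm x - nm y <= nm (x - y).
Proof. by rewrite lerBlDr; apply: le_trans (nmD _ _); rewrite subrK. Qed.

Lemma nm_addl V (x y : V) : nm x - nm y <= nm (x + y).
Proof. by rewrite -[y]opprK nmN; apply: nm_subl. Qed.

Lemma nm_sum V (I : Type) (r : seq I) (P : pred I) (F : I -> V) :
  nm (\sum_(i <- r | P i) F i) <= \sum_(i <- r | P i) nm (F i).
Proof.
elim/big_ind2 : _ => //; first by rewrite nm0.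
by move=> x1 x2 y1 y2 h1 h2; apply: le_trans (nmD _ _) (lerD _ _).
Qed.

Lemma nmM z w : nm (z * w) = nm z * nm w.
Proof. by apply: complexI; rewrite rmorphM /= -!nmE normrM. Qed.

Lemma nm1 : nm (1 : R[i]) = 1.
Proof. by rewrite /nm normr1. Qed.

Lemma nmX z n : nm (z ^+ n) = nm z ^+ n.
Proof. by apply: complexI; rewrite rmorphXn /= -!nmE normrX. Qed.

Lemma nmV z : nm z^-1 = (nm z)^-1.
Proof. by apply: complexI; rewrite fmorphV /= -!nmE normfV. Qed.

Lemma nm_prod (I : Type) (r : seq I) (P : pred I) (F : I -> R[i]) :
  nm (\prod_(i <- r | P i) F i) = \prod_(i <- r | P i) nm (F i).
Proof. by apply: (big_morph (@nm R R[i]) nmM nm1). Qed.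

Lemma nmZ (V : normedModType R[i]) z (x : V) : nm (z *: x) = nm z * nm x.
Proof. by apply: complexI; rewrite rmorphM /= -!nmE normrZ. Qed.

Lemma nmR (x : R) : nm (x%:C%C) = `|x|.
Proof. by rewrite /nm normc_def /= expr0n addr0 sqrtr_sqr. Qed.

Lemma nmn (n : nat) : nm (n%:R : R[i]) = n%:R.
Proof. by rewrite -[n%:R](rmorph_nat (real_complex R)) nmR normr_nat. Qed.

Lemma nm_sq z : nm z ^+ 2 = complex.Re z ^+ 2 + complex.Im z ^+ 2.
Proof. by apply: complexI; rewrite rmorphXn /= -nmE -add_Re2_Im2. Qed.

Lemma nmJ z : nm (z^*%C) = nm z.
Proof. by rewrite /nm normcJ. Qed.

Lemma nm_Re z : `|complex.Re z| <= nm z.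
Proof.
by rewrite -lecR -nmE normc_ge_Re.
Qed.

Lemma nm_Im z : `|complex.Im z| <= nm z.
Proof.
rewrite -(@ler_pXn2r _ 2) ?nnegrE ?nm_ge0 // nm_sq real_normK ?num_real //.
by rewrite lerDr sqr_ge0.
Qed.

Lemma nm_le_ReIm z : nm z <= `|complex.Re z| + `|complex.Im z|.
Proof.
rewrite -(@ler_pXn2r _ 2) ?nnegrE ?nm_ge0 ?addr_ge0 // nm_sq sqrrD.
rewrite -[complex.Re z ^+ 2]real_normK ?num_real //.
rewrite -[complex.Im z ^+ 2]real_normK ?num_real //.
by rewrite lerD2r lerDl mulrn_wge0 // mulr_ge0.
Qed.

Lemma cReD z w : complex.Re (z + w) = complex.Re z + complex.Re w.
Proof. by case: z w => [a b] []. Qed.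
Lemma cReB z w : complex.Re (z - w) = complex.Re z - complex.Re w.
Proof. by case: z w => [a b] []. Qed.
Lemma cImB z w : complex.Im (z - w) = complex.Im z - complex.Im w.
Proof. by case: z w => [a b] []. Qed.
Lemma cReM z w : complex.Re (z * w) =
  complex.Re z * complex.Re w - complex.Im z * complex.Im w.
Proof. by case: z w => [a b] []. Qed.
Lemma cReJ z : complex.Re (z^*%C) = complex.Re z.
Proof. by case: z. Qed.
Lemma cImJ z : complex.Im (z^*%C) = - complex.Im z.
Proof. by case: z. Qed.

Lemma cRe_sum (I : Type) (r : seq I) (P : pred I) (F : I -> R[i]) :
  complex.Re (\sum_(i <- r | P i) F i) = \sum_(i <- r | P i) complex.Re (F i).
Proof. by apply: (big_morph _ cReD). Qed.

Lemma nm_sqB z w : nm (z - w) ^+ 2 =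
  nm z ^+ 2 + nm w ^+ 2 - 2 * complex.Re (z * w^*%C).
Proof. rewrite !nm_sq cReM cReB cImB cReJ cImJ; ring. Qed.

Lemma cRe_div z w : w != 0 ->
  complex.Re (z / w) = complex.Re (z * w^*%C) / nm w ^+ 2.
Proof.
move=> w0; rewrite invc_norm nmE mulrA -[in LHS]rmorphXn -fmorphV /= mulrAC.
rewrite [in LHS]cReM /= mulr0 subr0.
by rewrite mulrC mulrC.
Qed.

Lemma Re_le_nm z : complex.Re z <= nm z.
Proof. exact: le_trans (ler_norm _) (nm_Re _). Qed.

End Modulus.

(** * The maximum principle *)

(* Stands in for the compactness argument of the maximum principle when u is
   neither bounded nor defined on the closure of D. *)
Section SupCluster.
Context {R : realType}.

Lemma sup_cluster (D : R[i] -> Prop) (u : R[i] -> R) (B : R) (z0 : R[i]) :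
  D z0 -> (forall z, D z -> nm z <= B) ->
  exists xi, forall d, 0 < d -> forall z1, D z1 ->
    exists z, [/\ D z, nm (z - xi) < d & u z1 <= u z].
Proof.
move=> Dz0 DB.
pose K := (`[-B, B] : set R) `*` (`[-B, B] : set R).
have cK : compact K by apply: compact_setX; apply: segment_compact.
pose c (p : R * R) : R[i] := (p.1 +i* p.2)%C.
pose S (z1 : R[i]) : set (R * R) := [set p | D (c p) /\ u z1 <= u (c p)].
(* The sets [S z1] are superlevel sets of [u], nested according to the value [u z1]; they therefore
   generate a filter, and any cluster point of it in the compact square will do. *)
pose F : set_system (R * R) := fun A => exists2 z1, D z1 & S z1 `<=` A.
have cK1 (z : R[i]) : c (complex.Re z, complex.Im z) = z by case: z.
have FF : ProperFilter F.
  apply: Build_ProperFilter.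
    move=> [z1 D1 /(_ (complex.Re z1, complex.Im z1))].
    by rewrite /S /= cK1; apply.
  split.
  - by exists z0.
  - move=> P Q [z1 D1 H1] [z2 D2 H2].
    have [h|h] := leP (u z1) (u z2).
      exists z2 => // p [Dp up]; split; last exact: H2.
      by apply: H1; split => //; apply: le_trans h up.
    exists z1 => // p [Dp up]; split; first exact: H1.
    by apply: H2; split => //; apply: le_trans (ltW h) up.
  - by move=> P Q PQ [z1 D1 H1]; exists z1 => // p Sp; apply/PQ/H1.
have FK : F K.
  exists z0 => // p [/DB Dp _].
  split => /=; rewrite in_itv /= -ler_norml; apply: le_trans Dp.
    exact: (le_trans _ (nm_Re (c p))).
  exact: (le_trans _ (nm_Im (c p))).
have [p [Kp clp]] := cK F FF FK.
exists (c p) => d d0 z1 D1.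
have N : nbhs p (ball p (d / 2)) by apply: nbhsx_ballx; rewrite divr_gt0.
have F1 : F (S z1) by exists z1.
have [q [[Dq uq] [b1 b2]]] := clp _ _ F1 N.
exists (c q); split => //.
apply: le_lt_trans (nm_le_ReIm _) _.
rewrite [d]splitr /c /=.
by apply: ltrD; rewrite distrC; [exact: b1|exact: b2].
Qed.

End SupCluster.

Ltac pos := solve [repeat first
  [ by [] | assumption | apply: ltW; assumption | apply: mulr_gt0 | apply: divr_gt0 | apply: exprn_gt0
  | rewrite invr_gt0 | apply: expR_gt0 | apply: nm_ge0 | apply: normr_ge0
  | apply: sqr_ge0 | apply: mulr_ge0 | apply: divr_ge0 | apply: exprn_ge0
  | apply: expR_ge0 | rewrite invr_ge0 | apply: addr_gt0 | apply: addr_ge0 | apply: ltW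
  | apply: ler0n | rewrite ltr0n ]].

Section MaxPrinciple.
Context {R : realType}.
Implicit Types (u : R[i] -> R) (z : R[i]).

(** A primitive cube root of unity. Since [1 + om3 + om3 ^+ 2 = 0], terms of degree 1 and 2 cancel
    in the mean over the points z + t om3^k, so that three points do the work of a circle. *)
Definition om3 : R[i] := (- 2^-1 +i* (Num.sqrt 3 / 2))%C.

Lemma om3_sum : 1 + om3 + om3 ^+ 2 = 0.
Proof.
have s3 : Num.sqrt 3 * Num.sqrt 3 = 3 :> R by rewrite -expr2 sqr_sqrtr.
rewrite expr2 /om3; apply/eqP; rewrite eq_complex /=; apply/andP; split; apply/eqP.
  by rewrite mulrACA s3; field.
by field.
Qed.

Lemma om3_cube : om3 ^+ 3 = 1.
Proof.
have : (om3 - 1) * (1 + om3 + om3 ^+ 2) = 0 by rewrite om3_sum mulr0.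
by move=> h; apply/eqP; rewrite -subr_eq0 -h; apply/eqP; ring.
Qed.

Lemma nm_om3 : nm om3 = 1.
Proof.
have := nm_ge0 om3; have : nm om3 ^+ 3 = 1 by rewrite -nmX om3_cube nm1.
by move=> h3 h0; apply/eqP; rewrite -(@eqrXn2 _ 3) // h3 expr1n.
Qed.

Lemma nm_om3X k : nm (om3 ^+ k) = 1.
Proof. by rewrite nmX nm_om3 expr1n. Qed.

Definition avg3 u z (t : R) : R :=
  (u (z + t%:C%C) + u (z + t%:C%C * om3) + u (z + t%:C%C * om3 ^+ 2)) / 3.

Lemma avg3_le u z t c : (forall w, nm (w - z) = `|t| -> u w <= c) ->
  avg3 u z t <= c.
Proof.
move=> h; rewrite /avg3 ler_pdivrMr //.
have -> : c * 3 = c + c + c by ring.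
by apply: lerD; first apply: lerD; apply: h;
  rewrite addrC addKr ?nmM ?nmR ?nm_om3X ?nm_om3 ?mulr1.
Qed.

Lemma avg3_sq z t : avg3 (fun w => nm w ^+ 2) z t = nm z ^+ 2 + t ^+ 2.
Proof.
have s3 : Num.sqrt 3 ^+ 2 = 3 :> R by rewrite sqr_sqrtr.
rewrite /avg3 !nm_sq expr2 /om3 /=.
case: z => a b /=; move: s3; set s := Num.sqrt 3 => s3.
have -> : t ^+ 2 = t ^+ 2 * (s ^+ 2 / 3) by rewrite s3 divff // mulr1.
set q := s ^+ 2; have q3 : q = 3 by [].
apply/eqP; rewrite -subr_eq0; apply/eqP.
transitivity ((q - 3) * (- a * t / 6 + (q - 7) * t ^+ 2 / 48)); last by rewrite q3 subrr mul0r.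
by rewrite /q; field.
Qed.

Lemma avg3D u v z t : avg3 (fun w => u w + v w) z t = avg3 u z t + avg3 v z t.
Proof. by rewrite /avg3; field. Qed.

Lemma avg3Z c u z t : avg3 (fun w => c * u w) z t = c * avg3 u z t.
Proof. by rewrite /avg3; field. Qed.

Definition cont_at u z := forall e, 0 < e ->
  exists2 d, 0 < d & forall w, nm (w - z) < d -> `|u w - u z| < e.

(** The sub-mean property is asked only up to order t^3: a second-order expansion provides that
    much, and the t^2 gained by |z|^2 still beats it. *)
Definition sub3 u z := exists C d, 0 < d /\
  forall t, 0 < t -> t < d -> u z <= avg3 u z t + C * t ^+ 3.

Definition open3 (D : R[i] -> Prop) := forall z, D z ->
  exists2 d, 0 < d & forall w, nm (w - z) < d -> D w.

(** Adding k |z|^2 gains k t^2 at each mean, more than the error in [sub3], so the perturbed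
    function has no maximum inside [D] and its supremum is approached at a point outside. The
    boundary condition is put at every point outside [D]; away from the closure it holds
    vacuously. *)
Lemma max_principle (D : R[i] -> Prop) u (B m : R) :
  (forall z, D z -> nm z <= B) -> open3 D ->
  (forall z, D z -> cont_at u z /\ sub3 u z) ->
  (forall xi, ~ D xi -> forall e, 0 < e -> exists2 d, 0 < d &
     forall z, D z -> nm (z - xi) < d -> u z <= m + e) ->
  forall z, D z -> u z <= m.
Proof.
move=> DB Do Du Db z0 D0; rewrite leNgt; apply/negP => um.
have B20 : 0 < B ^+ 2 + 1 by rewrite ltr_wpDl ?sqr_ge0.
(* Small enough that the perturbation, together with the margin k in the boundary condition, takes
   up only half of [u z0 - m]. *)
pose k := (u z0 - m) / (2 * (B ^+ 2 + 1)).
have k0 : 0 < k by rewrite divr_gt0 ?subr_gt0 //; pos.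
pose v z := u z + k * nm z ^+ 2.
have [xi Hxi] := sup_cluster v D0 DB.
have [Dx|nDx] := pselect (D xi); last first.
  have [d d0 Hd] := Db _ nDx k k0.
  have [z [Dz zx vz]] := Hxi d d0 _ D0.
  have uz := Hd z Dz zx.
  have h2 : nm z ^+ 2 <= B ^+ 2.
    by rewrite ler_pXn2r ?nnegrE ?nm_ge0 ?DB // (le_trans (nm_ge0 z)) ?DB.
  have h3 : u z0 <= m + k * (B ^+ 2 + 1).
    have k1 : k * nm z ^+ 2 <= k * B ^+ 2 by rewrite ler_pM2l.
    have k2 : 0 <= k * nm z0 ^+ 2 by rewrite mulr_ge0 ?(ltW k0) ?sqr_ge0.
    move: vz; rewrite /v mulrDr mulr1 => vz; lra.
  have h4 : k * (B ^+ 2 + 1) = (u z0 - m) / 2 by rewrite /k; field; rewrite gt_eqF.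
  by move: h3 um; rewrite h4 => ? ?; lra.
have vmax z1 : D z1 -> v z1 <= v xi.
  move=> D1; apply/ler_addgt0Pr => e e0.
  have [cu _] := Du _ Dx.
  have [d d0 Hd] := cu _ (divr_gt0 e0 (ltr0n R 2)).
  pose M := nm xi + 1.
  have M0 : 0 < M by rewrite ltr_wpDl ?nm_ge0.
  have kM0 : 0 < k * (2 * M) by pos.
  pose d' := Num.min d (Num.min 1 (e / 2 / (k * (2 * M)))).
  have d'0 : 0 < d' by rewrite !lt_min d0 ltr01; pos.
  have [z [Dz zx vz]] := Hxi d' d'0 _ D1.
  apply: le_trans vz _.
  move: zx; rewrite !lt_min => /and3P [z1' z2 z3].
  have /ltr_normlW h1 := Hd z z1'.
  move: z3; rewrite ltr_pdivlMr // => z3.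
  have n1 : nm z <= nm xi + nm (z - xi) by rewrite -lerBlDl nm_subl.
  have n0 := nm_ge0 z; have n0' := nm_ge0 xi; have n0'' := nm_ge0 (z - xi).
  have h2 : nm z ^+ 2 - nm xi ^+ 2 <= nm (z - xi) * (2 * M).
    rewrite /M; apply: le_trans (_ : nm (z - xi) * (nm (z-xi) + 2 * nm xi) <= _).
      rewrite expr2 expr2; nra.
    by rewrite ler_wpM2l //; clear -z2; lra.
  have h3 : k * (nm z ^+ 2 - nm xi ^+ 2) <= nm (z - xi) * (k * (2 * M)).
    by rewrite [leRHS]mulrCA ler_pM2l.
  rewrite /v; clear -h1 z3 h3; lra.
have [_ [C [d [d0 Hd]]]] := Du _ Dx.
have [d2 d20 Hd2] := Do _ Dx.
pose C' := `|C| + 1.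
have C'0 : 0 < C' by rewrite ltr_wpDl.
pose t := Num.min (d / 2) (Num.min (d2 / 2) (k / 2 / C')).
have t0 : 0 < t by rewrite !lt_min; apply/and3P; split; pos.
have td : t < d by rewrite /t gt_min; apply/orP; left; lra.
have td2 : t < d2 by rewrite /t !gt_min; apply/orP; right; apply/orP; left; lra.
have tk : t * C' <= k / 2.
  by rewrite -ler_pdivlMr // /t !ge_min lexx !orbT.
have h := Hd t t0 td.
have h1 : avg3 v xi t <= v xi.
  apply: avg3_le => w hw; apply: vmax; apply: Hd2.
  by rewrite hw gtr0_norm.
move: h1; rewrite /v avg3D avg3Z avg3_sq => h1.
have h2 : C * t ^+ 3 <= t ^+ 2 * (k / 2).
  rewrite exprSr mulrC -mulrA ler_wpM2l ?sqr_ge0 //.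
  apply: le_trans tk; rewrite ler_wpM2l ?(ltW t0) // /C'.
  by rewrite ler_wpDr // ler_norm.
have t20 : 0 < t ^+ 2 by rewrite exprn_gt0.
have : 0 < k * t ^+ 2 by rewrite mulr_gt0.
lra.
Qed.

End MaxPrinciple.

Section ThreePoint.
Context {R : realType}.
Implicit Types (u v : R[i] -> R) (z : R[i]).

Lemma MVT0 (f df : R -> R) (x : R) :
  (forall y : R, is_derive y 1 f (df y)) ->
  exists2 c, `|c| <= `|x| & f x - f 0 = df c * x.
Proof.
move=> fd.
have cf (A : set R) : {within A, continuous f}.
  by apply: continuous_subspaceT => y; apply: differentiable_continuous;
    apply/derivable1_diffP; have [] := fd y.
have [x0|x0] := leP 0 x.
  have [c] := MVT_segment x0 (fun y _ => fd y) (cf _).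
  rewrite in_itv /= subr0 => /andP[c0 cx] H; exists c => //.
  by rewrite !ger0_norm.
have [c] := MVT_segment (ltW x0) (fun y _ => fd y) (cf _).
rewrite in_itv => /andP[c0 cx] H; exists c.
  by rewrite !ler0_norm ?lerN2 // ltW.
by rewrite -opprB H sub0r mulrN opprK.
Qed.

Lemma expR_taylor2 (x : R) : `|x| <= 1 ->
  `|expR x - (1 + x + x ^+ 2 / 2)| <= expR 1 * `|x| ^+ 3.
Proof.
move=> x1.
case: (@MVT0 (fun y => expR y - (1 + y + y ^+ 2 / 2))
  (fun y => expR y - (1 + y)) x) => [y|c cx H1].
  by apply: is_derive_eq; rewrite /GRing.scale /= /GRing.scale /=; field.
case: (@MVT0 (fun y => expR y - (1 + y)) (fun y => expR y - 1) c) => [y|c' cx' H2].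
  by apply: is_derive_eq; rewrite /GRing.scale /=; ring.
case: (@MVT0 (fun y => expR y - 1) (fun y => expR y) c') => [y|c'' cx'' H3].
  by apply: is_derive_eq; rewrite /GRing.scale /=; ring.
move: H1 H2 H3; rewrite expR0 expr0n /= mul0r !addr0 !subrr !subr0 => -> -> ->.
rewrite !normrM ger0_norm ?expR_ge0 //.
rewrite exprSr expr2 !mulrA.
have e1 : expR c'' <= expR 1.
  by rewrite ler_expR (le_trans (ler_norm _)) // (le_trans cx'') // (le_trans cx') // (le_trans cx).
apply: ler_pM => //; try by pos.
apply: ler_pM => //; try by pos.
by apply: ler_pM => //; try (by pos); rewrite (le_trans cx').
Qed.

(** With p and q the real and imaginary parts of x, the squared modulus differs from (1 - p +
    p^2/2)^2 by q^2 (p^2/2 - p) + q^4/4, which is of third order. The quadratic polynomial thus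
    stands in for exp(-x) when the logarithm of a norm is shown to be subharmonic. *)
Lemma nm_quad_le (x : R[i]) : nm x <= 1 ->
  nm (1 - x + x ^+ 2 / 2) <= expR (- complex.Re x) + (2 + expR 1) * nm x ^+ 3.
Proof.
move=> x1; set m := nm x.
have m0 : 0 <= m by pos.
set p := complex.Re x; set q := complex.Im x.
have pm : `|p| <= m by exact: nm_Re.
have qm : `|q| <= m by exact: nm_Im.
have m1 : m <= 1 by [].
have [p1 p2] : - m <= p /\ p <= m by apply/andP; rewrite -ler_norml.
have [q1 q2] : - m <= q /\ q <= m by apply/andP; rewrite -ler_norml.
have h := expR_taylor2 (_ : `|- p| <= 1); rewrite normrN sqrrN in h.
have {}h := h (le_trans pm x1).
have pm3 : expR 1 * `|p| ^+ 3 <= expR 1 * m ^+ 3.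
  by rewrite ler_wpM2l ?expR_ge0 // lerXn2r // nnegrE.
have /ler_normlP [h1 h2] := h.
set s := 1 - p + p ^+ 2 / 2 in h1 h2 *.
have s12 : 1 / 2 <= s by rewrite /s; nra.
suff : nm (1 - x + x ^+ 2 / 2) <= s + 2 * m ^+ 3 by clear -pm3 h1; lra.
have m30 : 0 <= m ^+ 3 by pos.
rewrite -(@ler_pXn2r _ 2) // ?nnegrE; try by [lra|exact: nm_ge0].
have -> : nm (1 - x + x ^+ 2 / 2) ^+ 2 =
    s ^+ 2 + q ^+ 2 * (- p + p ^+ 2 / 2) + q ^+ 4 / 4.
  rewrite nm_sq /s /p /q.
  have -> : x ^+ 2 / 2 = x ^+ 2 * (2^-1)%:C%C by rewrite fmorphV /= rmorph_nat.
  by rewrite expr2; case: (x) => a b /=; field.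
have m2 : m ^+ 2 = p ^+ 2 + q ^+ 2 by exact: nm_sq.
have q2m : 0 <= q ^+ 2 <= m ^+ 2 by rewrite m2 sqr_ge0 /= lerDr sqr_ge0.
have p2m : 0 <= p ^+ 2 <= m ^+ 2 by rewrite m2 sqr_ge0 /= lerDl sqr_ge0.
move/andP: q2m => [q20 q2m]; move/andP: p2m => [p20 p2m].
have m23 : m ^+ 2 * m = m ^+ 3 by rewrite -exprSr.
have m4 : m ^+ 2 * m ^+ 2 <= m ^+ 3 by rewrite -m23 ler_wpM2l ?sqr_ge0 // expr2; nra.
have a1 : q ^+ 2 * (- p) <= m ^+ 3.
  rewrite -m23; apply: le_trans (_ : q ^+ 2 * m <= _); [apply: ler_wpM2l => //; lra|exact: ler_wpM2r].
have a2 : q ^+ 2 * p ^+ 2 <= m ^+ 3 by apply: le_trans m4; apply: ler_pM.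
have a3 : q ^+ 4 <= m ^+ 3.
  by apply: le_trans m4; rewrite -[4%N]/(2 + 2)%N exprD; apply: ler_pM.
have a4 : (s + 2 * m ^+ 3) ^+ 2 >= s ^+ 2 + 2 * m ^+ 3 by nra.
clear -m30 a1 a2 a3 a4; lra.
Qed.

Lemma ln_near1 (x : R) : `|x - 1| <= 2^-1 -> `|ln x| <= 2 * `|x - 1|.
Proof.
move=> /[dup] H /ler_normlP [h1 h2].
have x0 : 0 < x by lra.
apply/ler_normlP; split.
  rewrite -lnV ?posrE //.
  have -> : x^-1 = 1 + (x^-1 - 1) by ring.
  apply: le_trans (le_ln1Dx _) _; first by rewrite ltrBrDr addrC subrr invr_gt0.
  have -> : x^-1 - 1 = (1 - x) * x^-1 by rewrite mulrBl mul1r divff // gt_eqF.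
  apply: le_trans (_ : `|x - 1| * x^-1 <= _).
    by rewrite ler_wpM2r ?invr_ge0 ?(ltW x0) // -normrN opprB ler_norm.
  rewrite mulrC ler_wpM2r // invf_ple ?posrE //; lra.
have -> : x = 1 + (x - 1) by ring.
apply: le_trans (le_ln1Dx _) _; first by lra.
have -> : 1 + (x - 1) - 1 = x - 1 by ring.
have := ler_norm (x - 1); have := normr_ge0 (x - 1); lra.
Qed.

End ThreePoint.

(** * Second-order expansions in place of analyticity *)

Section Expansions.
Context {R : realType}.
Implicit Types (u : R[i] -> R) (z : R[i]).

Definition rem3 {V : normedModType R[i]} (v : R[i] -> V) a1 a2 z h :=
  v (z + h) - (v z + (h *: a1 + h ^+ 2 *: a2)).

(** Analyticity reduced to what a three-point mean can see: a complex Taylor expansion of order 2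
    with cubic remainder. Sums, products and bounded operators preserve it. *)
Definition an3 {V : normedModType R[i]} (v : R[i] -> V) z :=
  exists a1 a2 C d, [/\ 0 < d, 0 <= C & forall h, nm h < d ->
    nm (rem3 v a1 a2 z h) <= C * nm h ^+ 3].

Lemma rem3E {V : normedModType R[i]} (v : R[i] -> V) a1 a2 z h :
  v (z + h) = rem3 v a1 a2 z h + (v z + (h *: a1 + h ^+ 2 *: a2)).
Proof. by rewrite subrK. Qed.

(* The weights e1, e2, e3 are allowed so that the same expansion serves the
   logarithm below. *)
Lemma three_point_sum {V : normedModType R[i]} (v : R[i] -> V) a1 a2 z (t e1 e2 e3 : R[i]) :
  e1 *: v (z + t) + e2 *: v (z + t * om3) + e3 *: v (z + t * om3 ^+ 2) =
  (e1 *: rem3 v a1 a2 z t + e2 *: rem3 v a1 a2 z (t * om3) +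
    e3 *: rem3 v a1 a2 z (t * om3 ^+ 2)) +
  ((e1 + e2 + e3) *: v z +
  ((t * (e1 + e2 * om3 + e3 * om3 ^+ 2)) *: a1 +
   (t ^+ 2 * (e1 + e2 * om3 ^+ 2 + e3 * om3)) *: a2)).
Proof.
have -> : t * (e1 + e2 * om3 + e3 * om3 ^+ 2) =
  e1 * t + e2 * (t * om3) + e3 * (t * om3 ^+ 2) by ring.
have -> : t ^+ 2 * (e1 + e2 * om3 ^+ 2 + e3 * om3) =
  e1 * t ^+ 2 + e2 * (t * om3) ^+ 2 + e3 * (t * om3 ^+ 2) ^+ 2.
  have o4 : (om3 ^+ 2) ^+ 2 = om3 :> R[i].
    by rewrite -[RHS]mul1r -om3_cube -exprM -exprSr.
  by rewrite 2!exprMn o4; ring.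
rewrite [in LHS](rem3E v a1 a2 z t) [in LHS](rem3E v a1 a2 z (t * om3)).
rewrite [in LHS](rem3E v a1 a2 z (t * om3 ^+ 2)) !scalerDr !scalerA !scalerDl.
by rewrite [LHS](AC ((1*(1*2))*(1*(1*2))*(1*(1*2)))
  ((1*5*9)*((2*6*10)*((3*7*11)*(4*8*12))))).
Qed.

Lemma an3_lip {V : normedModType R[i]} (v : R[i] -> V) z : an3 v z ->
  exists L d, [/\ 0 < d, 0 <= L & forall h, nm h < d ->
    nm (v (z + h) - v z) <= L * nm h].
Proof.
move=> [a1 [a2 [C [d [d0 C0 H]]]]].
exists (C + nm a1 + nm a2), (Num.min d 1); split.
- by rewrite lt_min d0 ltr01.
- by pos.
move=> h; rewrite lt_min => /andP[hd h1].
have -> : v (z + h) - v z = rem3 v a1 a2 z h + (h *: a1 + h ^+ 2 *: a2).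
  by rewrite (rem3E v a1 a2) addrCA [v z + _]addrC addrK.
apply: le_trans (nmD _ _) _.
have n0 := nm_ge0 h.
rewrite !mulrDl -addrA; apply: lerD.
  apply: le_trans (H _ hd) _; rewrite ler_wpM2l // exprS ler_piMr //.
  by rewrite exprn_ile1 // ltW.
apply: le_trans (nmD _ _) _; rewrite !nmZ ![_ * nm h]mulrC; apply: lerD => //.
rewrite ler_wpM2r ?nm_ge0 // nmX expr2 ler_piMr // ltW //.
Qed.

Lemma cont_nm {V : normedModType R[i]} (v : R[i] -> V) z : an3 v z ->
  cont_at (fun w => nm (v w)) z.
Proof.
move=> /an3_lip [L [d [d0 L0 H]]] e e0.
have L1 : 0 < L + 1 by rewrite ltr_wpDl.
exists (Num.min d (e / (L + 1))) => [|w]; first by rewrite lt_min d0 /=; pos.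
rewrite lt_min ltr_pdivlMr // => /andP[wd we].
have {}H := H _ wd; rewrite [z + _]addrC subrK in H.
have n0 := nm_ge0 (w - z).
apply: le_lt_trans (_ : nm (v w - v z) < _).
  by rewrite ler_norml nm_subl lerNl opprB [X in _ <= X]nmBC nm_subl.
by apply: le_lt_trans H _; rewrite mulrC; nra.
Qed.

Lemma an3_const {V : normedModType R[i]} (a : V) z : an3 (fun=> a) z.
Proof.
exists 0, 0, 0, 1; split=> // h _.
by rewrite /rem3 !scaler0 !addr0 subrr nm0 mul0r.
Qed.

Lemma an3D {V : normedModType R[i]} (v w : R[i] -> V) z :
  an3 v z -> an3 w z -> an3 (fun x => v x + w x) z.
Proof.
move=> [a1 [a2 [C [d [d0 C0 H]]]]] [b1 [b2 [C' [d' [d'0 C'0 H']]]]].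
exists (a1 + b1), (a2 + b2), (C + C'), (Num.min d d'); split.
- by rewrite lt_min d0.
- by pos.
move=> h; rewrite lt_min => /andP[h1 h2].
have -> : rem3 (fun x => v x + w x) (a1 + b1) (a2 + b2) z h =
   rem3 v a1 a2 z h + rem3 w b1 b2 z h.
  rewrite /rem3 !scalerDr !opprD.
  by rewrite [LHS](AC (2*((1*1)*((1*1)*(1*1)))) ((1*(3*(5*7)))*(2*(4*(6*8))))).
by apply: le_trans (nmD _ _) _; rewrite mulrDl lerD ?H ?H'.
Qed.

Lemma an3_sum {V : normedModType R[i]} (I : Type) (r : seq I) (v : I -> R[i] -> V) z :
  (forall i, an3 (v i) z) -> an3 (fun x => \sum_(i <- r) v i x) z.
Proof.
move=> H; elim: r => [|i r IH].
  by under eq_fun do rewrite big_nil; exact: an3_const.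
by under eq_fun do rewrite big_cons; apply: an3D.
Qed.

Lemma an3Z {V : normedModType R[i]} (c : R[i]) (v : R[i] -> V) z :
  an3 v z -> an3 (fun x => c *: v x) z.
Proof.
move=> [a1 [a2 [C [d [d0 C0 H]]]]].
exists (c *: a1), (c *: a2), (nm c * C), d; split=> //; first by pos.
move=> h hd.
have -> : rem3 (fun x => c *: v x) (c *: a1) (c *: a2) z h = c *: rem3 v a1 a2 z h.
  by rewrite /rem3 scalerBr !scalerDr !scalerA ![c * _]mulrC.
by rewrite nmZ -mulrA ler_wpM2l ?nm_ge0 ?H.
Qed.

Lemma an3_inv (a : R[i]) z : z != a ->
  an3 (fun x => (x - a)^-1 : R[i]^o) z.
Proof.
rewrite -subr_eq0 => za.
set x := z - a in za.
have x0 : 0 < nm x by rewrite nm_gt0.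
exists (- x ^- 2), (x ^- 3), (2 / nm x ^+ 4), (nm x / 2).
split; try by pos.
move=> h hd.
have xh : nm x / 2 <= nm (x + h).
  by have := nm_addl x h; lra.
have xh0 : x + h != 0 by rewrite -nm_gt0; lra.
rewrite /rem3 /GRing.scale /= -/x.
have -> : z + h - a = x + h by rewrite addrAC.
have -> : (x + h)^-1 - (x^-1 + (h * (- x ^- 2) + h ^+ 2 * x ^- 3)) =
   - (h ^+ 3 / (x ^+ 3 * (x + h))) by field; apply/andP.
rewrite nmN !nmM nmV nmM !nmX mulrC.
apply: ler_wpM2r; first by pos.
have xh1 : 0 < nm (x + h) by rewrite nm_gt0.
rewrite -[leRHS]invf_div lef_pV2 ?posrE; try by pos.
by rewrite [nm x ^+ 4]exprSr -mulrA ler_wpM2l ?exprn_ge0 ?nm_ge0.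
Qed.

Lemma an3M (f g : R[i] -> R[i]) z :
  an3 (f : R[i] -> R[i]^o) z -> an3 (g : R[i] -> R[i]^o) z ->
  an3 (fun x => f x * g x : R[i]^o) z.
Proof.
move=> [a1 [a2 [C [d [d0 C0 H]]]]] [b1 [b2 [C' [d' [d'0 C'0 H']]]]].
pose F := nm (f z) + nm a1 + nm a2; pose G := nm (g z) + nm b1 + nm b2.
have F0 : 0 <= F by rewrite /F; pos.
have G0 : 0 <= G by rewrite /G; pos.
exists (a1 * g z + f z * b1), (a2 * g z + a1 * b1 + f z * b2),
  (C * (G + C') + F * C' + F * G *+ 2), (Num.min 1 (Num.min d d')); split.
- by rewrite !lt_min ltr01 d0.
- by pos.
move=> h; rewrite !lt_min => /and3P[h1 h2 h3].
have {}H := H _ h2; have {}H' := H' _ h3.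
set r := rem3 _ _ _ _ _ in H; set s := rem3 _ _ _ _ _ in H'.
have fE : f (z + h) = r + (f z + (h * a1 + h ^+ 2 * a2)) by rewrite /r -rem3E.
have gE : g (z + h) = s + (g z + (h * b1 + h ^+ 2 * b2)) by rewrite /s -rem3E.
rewrite /rem3 fE gE /GRing.scale /=.
have h0 := nm_ge0 h; set m := nm h in h0 h1 H H' *.
have m3 : m ^+ 3 <= 1 by rewrite exprn_ile1 // ltW.
have m30 : 0 <= m ^+ 3 by pos.
have m2 : m ^+ 2 <= 1 by rewrite exprn_ile1 // ltW.
have fl : nm (f z + (h * a1 + h ^+ 2 * a2)) <= F.
  rewrite /F -addrA; apply: le_trans (nmD _ _) (lerD _ _) => //.
  apply: le_trans (nmD _ _) (lerD _ _); rewrite nmM ?nmX ler_piMl ?nm_ge0 //.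
  exact: ltW.
have gl : nm (g z + (h * b1 + h ^+ 2 * b2)) <= G.
  rewrite /G -addrA; apply: le_trans (nmD _ _) (lerD _ _) => //.
  apply: le_trans (nmD _ _) (lerD _ _); rewrite nmM ?nmX ler_piMl ?nm_ge0 //.
  exact: ltW.
set f' := f z + _ in fl *; set g' := g z + _ in gl *.
have -> : (r + f') * (s + g') - (f z * g z + (h * (a1 * g z + f z * b1) +
   h ^+ 2 * (a2 * g z + a1 * b1 + f z * b2))) =
   r * (s + g') + f' * s + h ^+ 3 * (a1 * b2 + a2 * b1 + h * (a2 * b2)).
  rewrite /f' /g'; ring.
apply: le_trans (nmD _ _) _; rewrite [leRHS]mulrDl; apply: lerD.
  apply: le_trans (nmD _ _) _; rewrite [leRHS]mulrDl; apply: lerD; rewrite nmM.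
    rewrite mulrAC; apply: ler_pM => //; try by pos.
    apply: le_trans (nmD _ _) _; rewrite addrC lerD //.
    by apply: le_trans H' _; rewrite ler_piMr.
  by rewrite -mulrA; apply: ler_pM => //; pos.
rewrite nmM nmX mulrC ler_wpM2r //.
have F1 : nm a1 + nm a2 <= F by rewrite /F -addrA lerDr nm_ge0.
have G1 : nm b1 + nm b2 <= G by rewrite /G -addrA lerDr nm_ge0.
have := nm_ge0 a1; have := nm_ge0 a2; have := nm_ge0 b1; have := nm_ge0 b2.
move=> p1 p2 p3 p4.
apply: le_trans (nmD _ _) _; apply: le_trans (_ : nm a1 * nm b2 + nm a2 * nm b1 + nm a2 * nm b2 <= _).
  apply: lerD; last by rewrite !nmM ler_piMl ?mulr_ge0 // ltW.
  by apply: le_trans (nmD _ _) _; rewrite !nmM.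
have : (nm a1 + nm a2) * (nm b1 + nm b2) <= F * G by apply: ler_pM => //; pos.
have : 0 <= F * G by pos.
rewrite mulr2n; nra.
Qed.

End Expansions.

Section Subharmonic.
Context {R : realType}.
Implicit Types (u v : R[i] -> R) (z a : R[i]).

Definition harm3 u z := exists C d, [/\ 0 < d, 0 <= C & forall t, 0 < t -> t < d ->
  `|avg3 u z t - u z| <= C * t ^+ 3].

Lemma sub3_harm u z : harm3 u z -> sub3 u z.
Proof.
move=> [C [d [d0 C0 H]]]; exists C, d; split=> // t t0 td.
have := H t t0 td; rewrite distrC => /ler_normlW; lra.
Qed.

Lemma sub3D u v z : sub3 u z -> sub3 v z -> sub3 (fun w => u w + v w) z.
Proof.
move=> [C [d [d0 H]]] [C' [d' [d'0 H']]].
exists (C + C'), (Num.min d d'); split; first by rewrite lt_min d0.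
move=> t t0; rewrite lt_min => /andP[h1 h2].
have := H t t0 h1; have := H' t t0 h2; rewrite avg3D; lra.
Qed.

Lemma harm3D u v z : harm3 u z -> harm3 v z -> harm3 (fun w => u w + v w) z.
Proof.
move=> [C [d [d0 C0 H]]] [C' [d' [d'0 C'0 H']]].
exists (C + C'), (Num.min d d'); split; [by rewrite lt_min d0|by pos|].
move=> t t0; rewrite lt_min => /andP[h1 h2].
rewrite avg3D opprD addrACA mulrDl.
by apply: le_trans (ler_normD _ _) (lerD _ _); [exact: H|exact: H'].
Qed.

Lemma harm3Z c u z : harm3 u z -> harm3 (fun w => c * u w) z.
Proof.
move=> [C [d [d0 C0 H]]]; exists (`|c| * C), d; split => //; first by pos.
move=> t t0 td; rewrite avg3Z -mulrBr normrM -mulrA ler_wpM2l ?H //.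
Qed.

Lemma harm3_const c z : harm3 (fun=> c) z.
Proof.
exists 0, 1; split=> // t _ _; rewrite /avg3 mul0r normr_le0 subr_eq0.
by apply/eqP; field.
Qed.

Lemma harm3_sum (I : Type) (r : seq I) (P : pred I) (v : I -> R[i] -> R) z :
  (forall i, P i -> harm3 (v i) z) ->
  harm3 (fun x => \sum_(i <- r | P i) v i x) z.
Proof.
move=> H; elim: r => [|i r IH].
  by under eq_fun do rewrite big_nil; exact: harm3_const.
case Pi: (P i); last by under eq_fun do rewrite big_cons Pi.
by under eq_fun do rewrite big_cons Pi; apply: harm3D => //; exact: H.
Qed.

Lemma contD u v z : cont_at u z -> cont_at v z -> cont_at (fun w => u w + v w) z.
Proof.
move=> cu cv e e0.
have [d d0 H] := cu _ (divr_gt0 e0 (ltr0n R 2)).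
have [d' d'0 H'] := cv _ (divr_gt0 e0 (ltr0n R 2)).
exists (Num.min d d') => [|w]; first by rewrite lt_min d0.
rewrite lt_min => /andP[h1 h2]; rewrite opprD addrACA [e]splitr.
by apply: le_lt_trans (ler_normD _ _) (ltrD _ _); [exact: H|exact: H'].
Qed.

Lemma contZ c u z : cont_at u z -> cont_at (fun w => c * u w) z.
Proof.
move=> cu e e0; have c1 : 0 < `|c| + 1 by rewrite ltr_wpDl.
have [d d0 H] := cu _ (divr_gt0 e0 c1); exists d => // w wd.
rewrite -mulrBr normrM; have := H _ wd; rewrite ltr_pdivlMr //.
have := normr_ge0 (u w - u z); have := normr_ge0 c; nra.
Qed.

Lemma cont_const c z : cont_at (fun=> c) z.
Proof. by move=> e e0; exists 1 => // w _; rewrite subrr normr0. Qed.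

Lemma cont_sum (I : Type) (r : seq I) (P : pred I) (v : I -> R[i] -> R) z :
  (forall i, P i -> cont_at (v i) z) ->
  cont_at (fun x => \sum_(i <- r | P i) v i x) z.
Proof.
move=> H; elim: r => [|i r IH].
  by under eq_fun do rewrite big_nil; exact: cont_const.
case Pi: (P i); last by under eq_fun do rewrite big_cons Pi.
by under eq_fun do rewrite big_cons Pi; apply: contD => //; exact: H.
Qed.

Lemma cont_ln u z : 0 < u z -> cont_at u z -> cont_at (fun w => ln (u w)) z.
Proof.
move=> u0 cu e e0.
pose e' := Num.min (2^-1) (e / 4) * u z.
have e'0 : 0 < e' by rewrite mulr_gt0 // lt_min; apply/andP; split; pos.
have [d d0 H] := cu _ e'0; exists d => // w wd.
have h : `|u w / u z - 1| < Num.min (2^-1) (e / 4).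
  have -> : u w / u z - 1 = (u w - u z) / u z by rewrite mulrBl divff ?gt_eqF.
  by rewrite normrM normfV (gtr0_norm u0) ltr_pdivrMr //; exact: H.
move: h; rewrite lt_min => /andP[h1 h2].
have uw : 0 < u w.
  by rewrite -(pmulr_lgt0 _ (_ : 0 < (u z)^-1)) ?invr_gt0 //; move: h1 => /ltr_normlP [h _]; lra.
rewrite -ln_div ?posrE //.
by apply: le_lt_trans (ln_near1 (ltW h1)) _; lra.
Qed.

Lemma cont_ln_nm {V : normedModType R[i]} (v : R[i] -> V) z : an3 v z -> v z != 0 ->
  cont_at (fun w => ln (nm (v w))) z.
Proof. by move=> av v0; apply: cont_ln; rewrite ?nm_gt0 //; exact: cont_nm. Qed.

Lemma an3_id z : an3 (fun x => x : R[i]^o) z.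
Proof.
exists 1, 0, 0, 1; split => // h _.
by rewrite /rem3 scaler0 addr0 /GRing.scale /= mulr1 subrr nm0 mul0r.
Qed.

Lemma an3_subr a z : an3 (fun x => x - a : R[i]^o) z.
Proof. by apply: an3D; [exact: an3_id|exact: an3_const]. Qed.

Lemma an3_scalar_sum3 {V : normedModType R[i]} (v : R[i] -> V) z : an3 v z ->
  exists C d, [/\ 0 < d, 0 <= C & forall t : R, 0 < t -> t < d ->
  nm (v (z + t%:C%C) + v (z + t%:C%C * om3) + v (z + t%:C%C * om3 ^+ 2) - (3 : R[i]) *: v z)
   <= C * t ^+ 3].
Proof.
move=> [a1 [a2 [C [d [d0 C0 H]]]]].
exists (C + C + C), d; split => //; first by pos.
move=> t t0 td.
have := three_point_sum v a1 a2 z t%:C%C 1 1 1; rewrite !scale1r !mul1r om3_sum.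
rewrite [X in t%:C%C ^+2 * X]addrAC om3_sum !mulr0 !scale0r !addr0 => ->.
have -> : 1 + 1 + 1 = 3 :> R[i] by ring.
rewrite addrK !mulrDl.
have nt h : nm h = t -> nm (rem3 v a1 a2 z h) <= C * t ^+ 3 by move=> ht; rewrite -ht; apply: H; rewrite ht.
apply: le_trans (nmD _ _) (lerD _ _).
  apply: le_trans (nmD _ _) (lerD _ _); apply: nt;
  by rewrite ?nmM ?nmR ?nm_om3 ?mulr1 gtr0_norm.
by apply: nt; rewrite nmM nm_om3X nmR mulr1 gtr0_norm.
Qed.

Lemma sub3_nm {V : normedModType R[i]} (v : R[i] -> V) z : an3 v z ->
  sub3 (fun w => nm (v w)) z.
Proof.
move=> /an3_scalar_sum3 [C [d [d0 C0 H]]]; exists C, d; split => // t t0 td.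
have := H t t0 td; rewrite /avg3; set s := _ + _ + v _ => h.
have h1 : nm ((3 : R[i]) *: v z) = nm (v z) * 3.
  by rewrite nmZ nmn mulrC.
have h2 : nm ((3 : R[i]) *: v z) <= nm s + C * t ^+ 3.
  by have := nm_subl ((3 : R[i]) *: v z) s; rewrite nmBC; lra.
have h3 : nm s <= nm (v (z + t%:C%C)) + nm (v (z + t%:C%C * om3)) + nm (v (z + t%:C%C * om3 ^+ 2)).
  by apply: le_trans (nmD _ _) _; rewrite lerD2r nmD.
have t30 : 0 <= C * t ^+ 3 by pos.
lra.
Qed.

Lemma harm3_Re (f : R[i] -> R[i]) z : an3 (f : R[i] -> R[i]^o) z ->
  harm3 (fun w => complex.Re (f w)) z.
Proof.
move=> /an3_scalar_sum3 [C [d [d0 C0 H]]]; exists C, d; split => // t t0 td.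
have := le_trans (nm_Re _) (H t t0 td).
have -> : (3 : R[i]) *: (f z : R[i]^o) = f z + (f z + f z) by rewrite /GRing.scale /=; ring.
rewrite !cReB !cReD /avg3 => h.
set x := (_ - _); have -> : x = (complex.Re (f (z + t%:C%C)) +
   complex.Re (f (z + t%:C%C * om3)) + complex.Re (f (z + t%:C%C * om3 ^+ 2)) -
   (complex.Re (f z) + (complex.Re (f z) + complex.Re (f z)))) / 3.
  by rewrite /x; field.
rewrite normrM normfV normr_nat ler_pdivrMr //.
have : 0 <= C * t ^+ 3 by pos.
lra.
Qed.

Lemma cont_Re (f : R[i] -> R[i]) z : an3 (f : R[i] -> R[i]^o) z ->
  cont_at (fun w => complex.Re (f w)) z.
Proof.
move=> /an3_lip [L [d [d0 L0 H]]] e e0.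
have L1 : 0 < L + 1 by rewrite ltr_wpDl.
exists (Num.min d (e / (L + 1))) => [|w]; first by rewrite lt_min d0 /=; pos.
rewrite lt_min ltr_pdivlMr // => /andP[wd we].
have {}H := H _ wd; rewrite [z + _]addrC subrK in H.
have n0 := nm_ge0 (w - z).
rewrite -cReB; apply: le_lt_trans (nm_Re _) _.
by apply: le_lt_trans H _; rewrite mulrC; nra.
Qed.

Lemma om3_prod (x t : R[i]) :
  (x + t) * (x + t * om3) * (x + t * om3 ^+ 2) = x ^+ 3 + t ^+ 3.
Proof.
have o2 : (om3 : R[i]) ^+ 2 = - (1 + om3) by apply/eqP; rewrite -addr_eq0 addrC om3_sum.
have o3 := om3_cube (R := R).
transitivity (x ^+ 3 + x ^+ 2 * t * (1 + om3 + om3 ^+ 2) +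
  x * t ^+ 2 * (om3 ^+ 3 + om3 + om3 ^+ 2) + t ^+ 3 * om3 ^+ 3); first by ring.
by rewrite o3 om3_sum !mulr0 !addr0 mulr1.
Qed.

(** The product of the three numbers x + t om3^k is x^3 + t^3, so the three logarithms combine into
    one; the error of the mean is explicit and of order t^3. *)
Lemma avg3_ln a z (t : R) : z != a -> 0 < t -> t < nm (z - a) ->
  avg3 (fun w => ln (nm (w - a))) z t - ln (nm (z - a)) =
  ln (nm (1 + t%:C%C ^+ 3 / (z - a) ^+ 3)) / 3.
Proof.
rewrite -subr_eq0 => za t0 tx; set x := z - a in za tx *.
have x0 : 0 < nm x by rewrite nm_gt0.
have nz h : nm h = t -> 0 < nm (x + h).
  by move=> ht; have := nm_addl x h; rewrite ht; lra.
have t' : nm (t%:C%C : R[i]) = t by rewrite nmR gtr0_norm.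
have n1 := nz _ t'.
have n2 : 0 < nm (x + t%:C%C * om3) by apply: nz; rewrite nmM nm_om3 mulr1.
have n3 : 0 < nm (x + t%:C%C * om3 ^+ 2) by apply: nz; rewrite nmM nm_om3X mulr1.
rewrite /avg3 ![z + _ - a]addrAC -/x.
have -> : 1 + t%:C%C ^+ 3 / x ^+ 3 =
  ((x + t%:C%C) * (x + t%:C%C * om3) * (x + t%:C%C * om3 ^+ 2)) / x ^+ 3.
  by rewrite om3_prod mulrDl divff // expf_neq0.
rewrite !nmM nmV nmX !lnM ?posrE; try by pos.
rewrite lnV ?posrE; last by pos.
by rewrite lnXn // -mulr_natl; field.
Qed.

Lemma harm3_ln a z : z != a -> harm3 (fun w => ln (nm (w - a))) z.
Proof.
move=> za; have x0 : 0 < nm (z - a) by rewrite nm_gt0 subr_eq0.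
exists (nm (z - a) ^- 3), (nm (z - a) / 2); split; try by pos.
move=> t t0 td; rewrite avg3_ln //; last by lra.
set y := t%:C%C ^+ 3 / _; have ny : nm y = t ^+ 3 * nm (z - a) ^- 3.
  by rewrite /y nmM nmV !nmX nmR gtr0_norm.
have y2 : nm y <= 2^-1.
  rewrite ny ler_pdivrMr ?exprn_gt0 //.
  apply: le_trans (_ : (nm (z - a) / 2) ^+ 3 <= _).
    by rewrite lerXn2r ?nnegrE //; try pos; exact: ltW.
  rewrite expr_div_n mulrC ler_wpM2r ?exprn_ge0 ?nm_ge0 //.
  by rewrite lef_pV2 ?posrE // !exprS expr0; lra.
have h : `|nm (1 + y) - 1| <= nm y.
  have n1 := nm1 (R := R); rewrite ler_norml; apply/andP; split.
    by have := nm_addl 1 y; lra.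
  by have := nmD 1 y; lra.
rewrite normrM normfV normr_nat ler_pdivrMr // [nm _ ^- 3 * _]mulrC -ny.
apply: le_trans (ln_near1 (le_trans h y2)) _; have := nm_ge0 y; lra.
Qed.

Lemma cont_ln_dist a z : z != a -> cont_at (fun w => ln (nm (w - a))) z.
Proof.
move=> za; apply: (cont_ln_nm (v := fun w => w - a : R[i]^o)); last by rewrite subr_eq0.
exact: an3_subr.
Qed.

End Subharmonic.

Section LogSubharmonic.
Context {R : realType}.

Let sq3 : Num.sqrt 3 * Num.sqrt 3 = 3 :> R.
Proof. by rewrite -expr2 sqr_sqrtr. Qed.

(** The cube roots of unity sum to 0, so the values of Re (b w) at them range over exactly the
    triples of sum 0. The bound keeps [b] proportional to the data. *)
Lemma om3_fit (l0 l1 l2 : R) : l0 + l1 + l2 = 0 ->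
  exists b : R[i], [/\ nm b <= `|l0| + `|2 * l1 + l0|, complex.Re b = l0,
    complex.Re (b * om3) = l1 & complex.Re (b * om3 ^+ 2) = l2].
Proof.
move=> l; have s3 := sq3.
have s0 : 0 <= Num.sqrt 3 :> R by exact: sqrtr_ge0.
set s := Num.sqrt 3 in s3 s0.
have s1 : 1 <= s by nra.
have sn0 : s != 0 by rewrite gt_eqF //; lra.
exists (l0 +i* (- (2 * l1 + l0) / s))%C.
have ss : s / s = 1 by rewrite divff.
have sE x : x / s * (s / 2) = x / 2 by field.
have sE' x : x / s * - (s / 2) = - (x / 2) by field.
split => //=.
- apply: le_trans (nm_le_ReIm _) _ => /=; rewrite lerD2l normrM normrN normfV.
  by rewrite ler_piMr // (ger0_norm s0) invf_le1 //; lra.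
- by rewrite -/s sE; field.
- have -> : (- 2^-1 * - 2^-1 - s / 2 * (s / 2)) = - 2^-1.
    by rewrite mulrACA s3; field.
  have -> : (- 2^-1 * (s / 2) + s / 2 * - 2^-1) = - (s / 2) by field.
  rewrite sE'.
  have -> : l2 = - (l0 + l1) by apply/eqP; rewrite -subr_eq0 opprK addrC l.
  by field.
Qed.

(* After multiplying v by a quadratic polynomial with the modulus of a suitable
   exponential, the three values have equal norms, so that the mean of the norms
   becomes the exponential of the mean of their logarithms. *)
Lemma sub3_ln {V : normedModType R[i]} (v : R[i] -> V) z : an3 v z -> v z != 0 ->
  sub3 (fun w => ln (nm (v w))) z.
Proof.
move=> av vz0; have r0 : 0 < nm (v z) by rewrite nm_gt0.
have [L [d1 [d10 L0 HL]]] := an3_lip av.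
have [a1 [a2 [C [d [d0 C0 H]]]]] := av.
set r := nm (v z) in r0 *.
pose K := 4 * L / r; have K0 : 0 <= K by rewrite /K; pos.
pose Q := (2 + expR 1) * (4 * K) ^+ 3; have Q0 : 0 <= Q by rewrite /Q; pos.
pose P := 2 * Q * r + 3 * C + 8 * K ^+ 2 * nm a1 + 4 * K * nm a2.
have P0 : 0 <= P by rewrite /P; pos.
pose dd := Num.min (Num.min d d1) (Num.min (r / (2 * (L + 1))) (1 / (4 * K + 1))).
have L10 : 0 < L + 1 by rewrite ltr_wpDl.
have K10 : 0 < 4 * K + 1 by rewrite ltr_wpDl //; pos.
exists (2 * P / r), dd; split.
  by rewrite !lt_min d0 d10 /=; apply/andP; split; pos.
move=> t t0; rewrite !lt_min => /andP[/andP[td td1] /andP[tr tK]].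
rewrite ltr_pdivlMr ?mulr_gt0 // in tr.
rewrite ltr_pdivlMr // mulrDr mulr1 in tK.
have t' : nm (t%:C%C : R[i]) = t by rewrite nmR gtr0_norm.
set t1 := t%:C%C in t'.
have th1 : nm (t1 * om3) = t by rewrite nmM nm_om3 mulr1.
have th2 : nm (t1 * om3 ^+ 2) = t by rewrite nmM nm_om3X mulr1.
have vk h : nm h = t -> [/\ 0 < nm (v (z + h)), nm (v (z + h)) <= 2 * r,
    `|ln (nm (v (z + h))) - ln r| <= K * t / 2 & r / 2 <= nm (v (z + h))].
  move=> ht; have h1 : nm (v (z + h) - v z) <= L * t.
    by rewrite -ht; apply: HL; rewrite ht.
  have h2 := nm_subl (v (z + h)) (v z).
  have h3 := nm_subl (v z) (v (z + h)); rewrite nmBC in h3.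
  rewrite -/r in h2 h3.
  have Lt : L * t <= r / 2 by nra.
  have v0 : 0 < nm (v (z + h)) by clear -h3 Lt h1 r0; lra.
  split=> //; try by clear -h1 h2 h3 Lt r0; lra.
  rewrite -ln_div ?posrE //.
  have h4 : `|nm (v (z + h)) / r - 1| <= L * t / r.
    have -> : nm (v (z + h)) / r - 1 = (nm (v (z + h)) - r) / r.
      by rewrite mulrBl divff // gt_eqF.
    rewrite normrM normfV (gtr0_norm r0) ler_pM2r ?invr_gt0 // ler_norml; clear -h1 h2 h3; lra.
  have h5 : L * t / r <= 2^-1 by rewrite ler_pdivrMr //; clear -t0 tr; lra.
  apply: le_trans (ln_near1 (le_trans h4 h5)) _; rewrite /K.
  apply: le_trans (_ : 2 * (L * t / r) <= _); first by rewrite ler_pM2l.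
  by rewrite le_eqVlt; apply/orP; left; apply/eqP; field; rewrite gt_eqF.
have [p0 q0 b0 c0] := vk _ t'; have [p1 q1 b1 c1] := vk _ th1.
have [p2 q2 b2 c2] := vk _ th2.
rewrite /avg3 -/t1; set L_0 := ln (nm (v (z + t1))) in b0 *.
set L_1 := ln (nm (v (z + t1 * om3))) in b1 *.
set L_2 := ln (nm (v (z + t1 * om3 ^+ 2))) in b2 *.
set m := _ / 3.
have mE : L_0 + L_1 + L_2 = 3 * m by rewrite /m; field.
move: b0 b1 b2 => /ler_normlP [b01 b02] /ler_normlP [b11 b12] /ler_normlP [b21 b22].
(* [b] is fitted so that Re (b om3^k) is the deviation of the k-th logarithm from the mean [m]; it
   is of order t. *)
have [|b [nb rb0 rb1 rb2]] := @om3_fit (L_0 - m) (L_1 - m) (L_2 - m); first by clear -mE; lra.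
have Kt0 : 0 <= K * t by pos.
have nb4 : nm b <= 4 * K * t.
  apply: le_trans nb _; apply: le_trans (_ : K * t + 3 * (K * t) <= _); last by clear; lra.
  apply: lerD; rewrite ler_norml; apply/andP; split; clear -b01 b02 b11 b12 b21 b22 mE Kt0; lra.
have nb1 : nm b <= 1 by clear -nb4 tK t0; lra.
(* [e k] is the Taylor polynomial of exp(- b om3^k): its modulus times the k-th norm is close to
   [expR m] for each k. *)
pose e (k : nat) : R[i] := 1 - b * om3 ^+ k + (b * om3 ^+ k) ^+ 2 / 2.
have ne k : nm (e k) <= expR (- complex.Re (b * om3 ^+ k)) + Q * t ^+ 3.
  have nbk : nm (b * om3 ^+ k) = nm b by rewrite nmM nm_om3X mulr1.
  apply: le_trans (nm_quad_le _) _; first by rewrite nbk.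
  rewrite nbk lerD2l /Q -mulrA; apply: ler_wpM2l; first by pos.
  by rewrite -exprMn lerXn2r // nnegrE; pos.
have ne3 k : nm (e k) <= 3.
  have nbk : nm (b * om3 ^+ k) <= 1 by rewrite nmM nm_om3X mulr1.
  rewrite /e; apply: le_trans (nmD _ _) _; apply: le_trans (lerD (nmB _ _) (lexx _)) _.
  have -> : nm ((b * om3 ^+ k) ^+ 2 / 2) = nm (b * om3 ^+ k) ^+ 2 / 2.
    by rewrite nmM nmV nmn nmX.
  rewrite nm1.
  have : nm (b * om3 ^+ k) ^+ 2 <= 1 by rewrite exprn_ile1 // nm_ge0.
  clear -nbk; lra.
have S := three_point_sum v a1 a2 z t1 (e 0%N) (e 1%N) (e 2%N).
have o3 := om3_sum (R := R); have oc := om3_cube (R := R).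
have o2 : (om3 : R[i]) ^+ 2 = - (1 + om3) by apply/eqP; rewrite -addr_eq0 addrC om3_sum.
(* Moments of the weights: their sum is 3, the other two are of order b^2 and b. These get
   multiplied by t and t^2, so the first- and second-order terms of [v] contribute only at order
   t^3. *)
have E0 : e 0%N + e 1%N + e 2%N = 3.
  rewrite /e expr0 expr1 mulr1.
  transitivity (3 - b * (1 + om3 + om3 ^+ 2) + b ^+ 2 / 2 * (1 + om3 ^+ 2 + om3 ^+ 3 * om3)).
    by field.
  rewrite oc mul1r o3 [1 + _ + om3]addrAC o3; ring.
have E1 : e 0%N + e 1%N * om3 + e 2%N * om3 ^+ 2 = 3 / 2 * b ^+ 2.
  rewrite /e expr0 expr1 mulr1.
  transitivity ((1 + om3 + om3 ^+ 2) - b * (1 + om3 ^+ 2 + om3 ^+ 3 * om3) +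
     b ^+ 2 / 2 * (1 + om3 ^+ 3 + (om3 ^+ 3) ^+ 2)); first by field.
  rewrite oc mul1r o3 [1 + _ + om3]addrAC o3; by field.
have E2 : e 0%N + e 1%N * om3 ^+ 2 + e 2%N * om3 = - 3 * b.
  rewrite /e expr0 expr1 mulr1.
  transitivity ((1 + om3 + om3 ^+ 2) - b * (1 + om3 ^+ 3 + om3 ^+ 3) +
     b ^+ 2 / 2 * (1 + om3 ^+ 3 * om3 + om3 ^+ 3 * om3 ^+ 2)); first by field.
  rewrite oc !mul1r o3; by ring.
rewrite E0 E1 E2 in S.
have {}S : (3 : R[i]) *: v z = (e 0%N *: v (z + t1) + e 1%N *: v (z + t1 * om3) +
   e 2%N *: v (z + t1 * om3 ^+ 2)) -
  (e 0%N *: rem3 v a1 a2 z t1 + e 1%N *: rem3 v a1 a2 z (t1 * om3) +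
   e 2%N *: rem3 v a1 a2 z (t1 * om3 ^+ 2)) -
   ((t1 * (3 / 2 * b ^+ 2)) *: a1 + (t1 ^+ 2 * (- 3 * b)) *: a2).
  rewrite S; move: (_ + _ + e 2%N *: rem3 _ _ _ _ _) (_ *: v z) (_ *: a1 + _).
  by move=> x y w; rewrite [x + _]addrC addrK addrK.
have nS : 3 * r <= (nm (e 0%N) * nm (v (z + t1)) + nm (e 1%N) * nm (v (z + t1 * om3)) +
   nm (e 2%N) * nm (v (z + t1 * om3 ^+ 2))) + 9 * C * t ^+ 3 +
   (t * (3 / 2 * nm b ^+ 2) * nm a1 + t ^+ 2 * (3 * nm b) * nm a2).
  have -> : 3 * r = nm ((3 : R[i]) *: v z) by rewrite nmZ nmn.
  rewrite S; apply: le_trans (nmB _ _) _; apply: lerD; last first.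
    have n1 : nm (t1 * (3 / 2 * b ^+ 2)) = t * (3 / 2 * nm b ^+ 2).
      by rewrite nmM nmM nmX nmM nmV !nmn t'.
    have n2 : nm (t1 ^+ 2 * (- 3 * b)) = t ^+ 2 * (3 * nm b).
      by rewrite nmM nmX nmM nmN nmn t'.
    by apply: le_trans (nmD _ _) _; rewrite !nmZ n1 n2.
  apply: le_trans (nmB _ _) _; apply: lerD.
    apply: le_trans (nmD _ _) _; rewrite nmZ lerD2r.
    by apply: le_trans (nmD _ _) _; rewrite !nmZ.
  have -> : 9 * C * t ^+ 3 = 3 * (C * t ^+ 3) + 3 * (C * t ^+ 3) + 3 * (C * t ^+ 3) by ring.
  have rk k h : nm h = t -> nm (e k *: rem3 v a1 a2 z h) <= 3 * (C * t ^+ 3).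
    move=> ht; rewrite nmZ; apply: ler_pM => //; try by pos.
    by rewrite -ht; apply: H; rewrite ht.
  apply: le_trans (nmD _ _) (lerD _ (rk _ _ th2)).
  by apply: le_trans (nmD _ _) (lerD (rk _ _ t') (rk _ _ th1)).
have t30 : 0 <= t ^+ 3 by pos.
have ek k w l : complex.Re (b * om3 ^+ k) = ln w - m -> 0 < w -> w <= 2 * r -> l = w ->
    nm (e k) * l <= expR m + Q * t ^+ 3 * (2 * r).
  move=> Hk w0 wr ->; apply: le_trans (ler_wpM2r (ltW w0) (ne k)) _.
  have -> : expR (- complex.Re (b * om3 ^+ k)) = expR m / w.
    by rewrite Hk opprB expRD expRN lnK ?posrE.
  rewrite mulrDl divfK ?gt_eqF // lerD2l; apply: ler_wpM2l => //; by pos.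
have f0 := ek 0%N _ _ _ p0 q0 erefl; have f1 := ek 1%N _ _ _ p1 q1 erefl.
have f2 := ek 2%N _ _ _ p2 q2 erefl.
rewrite expr0 mulr1 in f0; rewrite expr1 in f1.
have {}f0 := f0 rb0; have {}f1 := f1 rb1; have {}f2 := f2 rb2.
have g1 : t * (3 / 2 * nm b ^+ 2) * nm a1 <= 3 * (8 * K ^+ 2 * nm a1) * t ^+ 3.
  have : nm b ^+ 2 <= (4 * K * t) ^+ 2 by rewrite lerXn2r // nnegrE ?nm_ge0 //; pos.
  move=> hb; apply: le_trans (_ : t * (3 / 2 * (4 * K * t) ^+ 2) * nm a1 <= _).
    by rewrite ler_wpM2r ?nm_ge0 // ler_pM2l // ler_pM2l //; by clear; lra.
  by rewrite le_eqVlt; apply/orP; left; apply/eqP; field.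
have g2 : t ^+ 2 * (3 * nm b) * nm a2 <= 3 * (4 * K * nm a2) * t ^+ 3.
  apply: le_trans (_ : t ^+ 2 * (3 * (4 * K * t)) * nm a2 <= _).
    by rewrite ler_wpM2r ?nm_ge0 // ler_pM2l ?exprn_gt0 // ler_pM2l.
  by rewrite le_eqVlt; apply/orP; left; apply/eqP; ring.
have rP : r <= expR m + P * t ^+ 3 by rewrite /P; clear -nS f0 f1 f2 g1 g2; lra.
have em : expR (- m) <= 2 / r.
  have r20 : 0 < r / 2 by pos.
  have : ln (r / 2) <= m.
    have lr w : r / 2 <= w -> ln (r / 2) <= ln w.
      by move=> hw; rewrite ler_ln ?posrE // (lt_le_trans r20 hw).
    have := lr _ c0; have := lr _ c1; have := lr _ c2.
    rewrite -/L_0 -/L_1 -/L_2; clear -mE; lra.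
  move=> hm; rewrite -[2 / r]invf_div expRN lef_pV2 ?posrE ?expR_gt0 //.
  by rewrite -[r / 2]lnK ?posrE ?ler_expR.
rewrite -ler_expR lnK ?posrE //; apply: le_trans rP _.
rewrite expRD; apply: le_trans (_ : expR m * (1 + 2 * P / r * t ^+ 3) <= _); last first.
  by rewrite ler_pM2l ?expR_gt0 // expR_ge1Dx.
rewrite mulrDr mulr1 lerD2l.
have -> : P * t ^+ 3 = expR m * (P * t ^+ 3 * expR (- m)).
  by rewrite expRN; field; rewrite gt_eqF // expR_gt0.
rewrite ler_pM2l ?expR_gt0 //.
have -> : 2 * P / r * t ^+ 3 = P * t ^+ 3 * (2 / r) by ring.
by rewrite ler_wpM2l //; pos.
Qed.

End LogSubharmonic.

(** * Resolvents *)

Section Operators.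
Context {R : realType} {V : completeNormedModType R[i]}.
Implicit Types (x y : V) (A B T S : V -> V) (z w : R[i]).

Lemma rnormE x : rnorm x = nm x. Proof. by []. Qed.

Lemma lin_D A x y : linear A -> A (x + y) = A x + A y.
Proof. by move=> lA; have := lA 1 x y; rewrite !scale1r. Qed.

Lemma lin_0 A : linear A -> A 0 = 0.
Proof.
move=> lA; have := lin_D 0 0 lA; rewrite addr0 => /eqP.
by rewrite -subr_eq0 opprD addrA subrr add0r oppr_eq0 => /eqP.
Qed.

Lemma lin_Z A (c : R[i]) x : linear A -> A (c *: x) = c *: A x.
Proof. by move=> lA; have := lA c x 0; rewrite !addr0 lin_0 // addr0. Qed.

Lemma lin_N A x : linear A -> A (- x) = - A x.
Proof. by move=> lA; rewrite -scaleN1r lin_Z // scaleN1r. Qed.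

Lemma lin_B A x y : linear A -> A (x - y) = A x - A y.
Proof. by move=> lA; rewrite lin_D // lin_N. Qed.

Lemma lin_sum A (I : Type) (r : seq I) (F : I -> V) : linear A ->
  A (\sum_(i <- r) F i) = \sum_(i <- r) A (F i).
Proof. by move=> lA; elim: r => [|i r IH]; rewrite ?big_nil ?lin_0 // !big_cons lin_D // IH. Qed.

Lemma lin_iter A n : linear A -> linear (iter n A).
Proof. by move=> lA; elim: n => [|n IH] c x y //=; rewrite IH lA. Qed.

Lemma opnorm_ub A x : bounded_operator A -> nm (A x) <= opnorm A * nm x.
Proof.
move=> [lA [M HM]].
have ub : has_ubound [set rnorm (A x) | x in [set x | rnorm x <= 1]].
  exists `|M| => _ [u /= u1 <-]; apply: le_trans (HM u) _.
  rewrite rnormE in u1; rewrite rnormE.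
  apply: le_trans (_ : `|M| * nm u <= _); first by rewrite ler_wpM2r ?nm_ge0 ?ler_norm.
  by rewrite ler_piMr.
have [->|x0] := eqVneq x 0; first by rewrite lin_0 // !nm0 mulr0.
have nx : 0 < nm x by rewrite nm_gt0.
rewrite -ler_pdivrMr //.
have nx' : nm ((nm x)^-1%:C%C : R[i]) = (nm x)^-1.
  by rewrite nmR ger0_norm // invr_ge0 nm_ge0.
apply: ub_le_sup => //; exists ((nm x)^-1%:C%C *: x) => /=.
  by rewrite rnormE nmZ nx' mulVf // gt_eqF.
by rewrite rnormE lin_Z // nmZ nx' mulrC.
Qed.

Lemma opnorm_le A M : 0 <= M -> linear A -> (forall x, nm (A x) <= M * nm x) -> opnorm A <= M.
Proof.
move=> M0 lA H; apply: ge_sup.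
  by exists (rnorm (A 0)), 0 => //=; rewrite rnormE nm0.
move=> _ [u /= u1 <-]; rewrite rnormE; apply: le_trans (H u) _.
by rewrite ler_piMr.
Qed.

Lemma opnorm_ge0 A : bounded_operator A -> 0 <= opnorm A.
Proof.
move=> bA; have [x0|x0] := pselect (exists x : V, x != 0); last first.
  rewrite /opnorm (_ : [set _ | _ in _] = [set 0]) ?sup1 //.
  have x0' (x : V) : x = 0 by apply/eqP; apply: contra_notT x0 => h; exists x.
  apply/seteqP; split => [_ [u _ <-]|_ ->]; first by rewrite (x0' (A u)) rnormE nm0.
  by exists 0; rewrite /= ?rnormE ?(x0' (A 0)) ?nm0.
have [x xn] := x0; rewrite -(pmulr_lge0 _ (_ : 0 < nm x)) ?nm_gt0 //.
by apply: le_trans (opnorm_ub x bA); rewrite nm_ge0.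
Qed.

Lemma bounded_iter A n : bounded_operator A -> bounded_operator (iter n A).
Proof.
move=> [lA [M HM]]; split; first exact: lin_iter.
exists (`|M| ^+ n); elim: n => [|n IH] x /=; first by rewrite expr0 mul1r.
apply: le_trans (HM _) _; rewrite exprS -mulrA.
apply: le_trans (_ : `|M| * rnorm (iter n A x) <= _).
  by rewrite ler_wpM2r ?ler_norm // rnormE nm_ge0.
by rewrite ler_wpM2l.
Qed.

Lemma iter_ub A n x : bounded_operator A ->
  nm (iter n A x) <= opnorm (iter n A) * nm x.
Proof. by move=> bA; apply: opnorm_ub; exact: bounded_iter. Qed.

(** Substituting the equation into itself n times leaves a remainder of norm at most half that of
    [v], which the left side absorbs. A finite sum replaces the Neumann series. *)
Lemma neumann_bound A (c : R[i]) (v p : V) n : bounded_operator A ->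
  v = p + c *: A v -> nm c ^+ n * opnorm (iter n A) <= 2^-1 ->
  nm v <= 2 * (\sum_(j < n) nm c ^+ j * opnorm (iter j A)) * nm p.
Proof.
move=> bA vE cn; have [lA _] := bA.
have H m : v = \sum_(j < m) c ^+ j *: iter j A p + c ^+ m *: iter m A v.
  elim: m => [|m IH]; first by rewrite big_ord0 add0r expr0 scale1r.
  rewrite big_ord_recr /= -addrA {1}IH; congr (_ + _).
  rewrite [in LHS]vE lin_D; last exact: lin_iter.
  rewrite scalerDr (@lin_Z (iter m A)); last exact: lin_iter.
  by rewrite scalerA -exprSr -iterSr.
have h1 : nm v <= (\sum_(j < n) nm c ^+ j * opnorm (iter j A)) * nm p + 2^-1 * nm v.
  rewrite {1}(H n); apply: le_trans (nmD _ _) (lerD _ _).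
    apply: le_trans (nm_sum _ _ _) _; rewrite mulr_suml; apply: ler_sum => j _.
    by rewrite nmZ nmX -mulrA ler_wpM2l ?exprn_ge0 ?nm_ge0 // iter_ub.
  rewrite nmZ nmX; apply: le_trans (_ : nm c ^+ n * opnorm (iter n A) * nm v <= _).
    by rewrite -mulrA ler_wpM2l ?exprn_ge0 ?nm_ge0 // iter_ub.
  by rewrite ler_wpM2r ?nm_ge0.
by move: h1; set X := (X in X + _) => h1; rewrite -mulrA -/X; lra.
Qed.

Definition resolvent T (z : R[i]) (Q : V -> V) :=
  bounded_inverse (fun x => z *: x - T x) Q.

Lemma res_lin T z Q : resolvent T z Q -> linear Q.
Proof. by move=> [[]]. Qed.

Lemma resK T z Q x : resolvent T z Q -> z *: Q x - T (Q x) = x.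
Proof. by move=> [_ _ h]; exact: h. Qed.

Lemma resKV T z Q x : resolvent T z Q -> Q (z *: x - T x) = x.
Proof. by move=> [_ h _]; exact: h. Qed.

Lemma res_id T z w Q Q' y : linear T -> resolvent T z Q -> resolvent T w Q' ->
  Q' y = Q y - (w - z) *: Q (Q' y).
Proof.
move=> lT rQ rQ'; have lQ := res_lin rQ.
have h : y = (z *: Q' y - T (Q' y)) + (w - z) *: Q' y.
  by rewrite -{1}(resK y rQ') scalerBl addrAC [_ *: _ + (_ - _)]addrC subrK.
by rewrite {2}h lin_D // lin_Z // (resKV _ rQ) addrK.
Qed.

(** In the resolvent identity the correction is at most [nm (w - z0)] times M |R(w) y|, with M the
    norm of the resolvent at [z0]; near [z0] this is at most half of the left side. *)
Lemma res_local T (Rz : R[i] -> V -> V) z0 d : linear T -> 0 < d ->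
  (forall w, nm (w - z0) < d -> resolvent T w (Rz w)) ->
  exists C d', [/\ 0 < d', d' <= d, 0 <= C & forall w, nm (w - z0) < d' ->
    forall y, nm (Rz w y) <= C * nm y].
Proof.
move=> lT d0 H.
have r0 : resolvent T z0 (Rz z0) by apply: H; rewrite subrr nm0.
have [b0 _ _] := r0; set M := opnorm (Rz z0).
have M0 : 0 <= M by exact: opnorm_ge0.
have M1 : 0 < 2 * (M + 1) by rewrite mulr_gt0 // ltr_wpDl.
exists (2 * M), (Num.min d (1 / (2 * (M + 1)))); split.
- by rewrite lt_min d0 divr_gt0.
- by rewrite ge_min lexx.
- by pos.
move=> w; rewrite lt_min ltr_pdivlMr // => /andP[wd wM] y.
have h := res_id y lT r0 (H _ wd).
have : nm (Rz w y) <= M * nm y + nm (w - z0) * (M * nm (Rz w y)).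
  rewrite {1}h; apply: le_trans (nmB _ _) (lerD (opnorm_ub _ b0) _).
  by rewrite nmZ ler_wpM2l ?nm_ge0 // opnorm_ub.
have : nm (w - z0) * (M * nm (Rz w y)) <= 1 / 2 * nm (Rz w y).
  rewrite mulrA ler_wpM2r ?nm_ge0 //; have := nm_ge0 (w - z0); nra.
by lra.
Qed.

(** Three uses of the resolvent identity expand R(z0 + h) y to second order with the exact remainder
    - h^3 Q^3 R(z0 + h) y, whose last factor [res_local] bounds. *)
Lemma an3_resolvent T (Rz : R[i] -> V -> V) z0 d y : linear T -> 0 < d ->
  (forall w, nm (w - z0) < d -> resolvent T w (Rz w)) ->
  an3 (fun z => Rz z y) z0.
Proof.
move=> lT d0 H; have [C [d' [d'0 dd C0 HC]]] := res_local lT d0 H.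
have r0 : resolvent T z0 (Rz z0) by apply: H; rewrite subrr nm0.
have [b0 _ _] := r0; set M := opnorm (Rz z0); set Q := Rz z0 in b0 M *.
have M0 : 0 <= M by exact: opnorm_ge0.
have lQ := res_lin r0; rewrite -/Q in lQ.
exists (- Q (Q y)), (Q (Q (Q y))), (M ^+ 3 * (C * nm y)), d'; split => //.
  by pos.
move=> h hd.
have rw : resolvent T (z0 + h) (Rz (z0 + h)).
  by apply: H; rewrite addrC addKr; exact: lt_le_trans dd.
have E : Rz (z0 + h) y = Q y - h *: Q (Rz (z0 + h) y).
  by have := res_id y lT r0 rw; rewrite [z0 + h - z0]addrC addKr.
set v := Rz (z0 + h) y in E *.
have -> : rem3 (fun z => Rz z y) (- Q (Q y)) (Q (Q (Q y))) z0 h =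
   - (h ^+ 3 *: Q (Q (Q v))).
  have E1 : Q v = Q (Q y) - h *: Q (Q v) by rewrite {1}E lin_B // lin_Z.
  have E2 : Q (Q v) = Q (Q (Q y)) - h *: Q (Q (Q v)) by rewrite {1}E1 lin_B // lin_Z.
  have E3 : v = Q y - (h *: Q (Q y) - (h *: (h *: Q (Q (Q y))) - h *: (h *: (h *: Q (Q (Q v)))))).
    by rewrite {1}E {1}E1 {1}E2 !scalerBr.
  rewrite /rem3 -/v -/Q {1}E3 (exprS h 2) !expr2 -!scalerA scalerN.
  move: (Q y) (h *: Q _) (h *: (h *: Q _)) (h *: (h *: (h *: Q _))) => a b c e.
  rewrite opprB; apply/eqP; rewrite subr_eq; apply/eqP.
  by rewrite [LHS](AC (1*((1*1)*1)) (3*(1*(4*2)))).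
rewrite nmN nmZ nmX mulrC ler_wpM2r ?exprn_ge0 ?nm_ge0 //.
have Qb x : nm (Q x) <= M * nm x by exact: opnorm_ub.
apply: le_trans (Qb _) _; rewrite exprS -mulrA ler_wpM2l //.
apply: le_trans (Qb _) _; rewrite exprS -mulrA ler_wpM2l //.
apply: le_trans (Qb _) _; rewrite expr1 ler_wpM2l //.
by apply: HC; rewrite addrC addKr.
Qed.

End Operators.

(** * Resolvent growth on either side of the circle *)

Section ResolventGrowth.
Context {R : realType}.

Lemma bernoulli_le (d : R) n : 0 <= d -> 1 + n%:R * d <= (1 + d) ^+ n.
Proof.
move=> d0; elim: n => [|n IH]; first by rewrite mul0r addr0 expr0.
rewrite exprS; apply: le_trans (_ : (1 + d) * (1 + n%:R * d) <= _); last first.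
  by rewrite ler_wpM2l // addr_ge0.
rewrite -natr1; have : 0 <= n%:R * d * d by pos.
lra.
Qed.

Lemma ex_nat_ceil (x : R) : 0 <= x -> exists n : nat, [/\ (0 < n)%N, x < n%:R & n%:R <= x + 1].
Proof.
move=> x0; exists (Num.truncn x).+1; split => //; first exact: truncnS_gt.
by rewrite -natr1 lerD2r truncn_le.
Qed.

Context {V : completeNormedModType R[i]}.
Implicit Types (T S : V -> V).

(** R y = z^-1 y + z^-1 T R y is unrolled for a number of steps of order (|z| - 1)^-2, which makes
    the last term contractive. The exponent 2 (q + 1) is twice the one given by the power series,
    the price of using Bernoulli's inequality; any polynomial bound serves. *)
Lemma res_outer T (C : R) (q : nat) : bounded_operator T -> 0 <= C ->
  (forall n, opnorm (iter n T) <= C * n.+1%:R ^+ q) ->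
  exists2 C', 0 <= C' & forall z Qz, resolvent T z Qz -> 1 < nm z -> nm z <= 2 ->
    forall y, nm (Qz y) <= C' * (nm z - 1) ^- (2 * q.+1) * nm y.
Proof.
move=> bT C0 HT; pose P := (2 * q.+1)%N; pose p : R := P.+1%:R.
have p0 : 0 < p by rewrite ltr0n.
pose L : R := 1 + 2 * C * p ^+ q.
have L1 : 1 <= L by rewrite /L lerDl; pos.
exists (2 * C * p ^+ q.+1 * (L + 1) ^+ q.+1).
  have : 0 < L + 1 by lra.
  by move=> ?; pos.
move=> z Qz rz z1 z2 y; set d := nm z - 1.
have d0 : 0 < d by rewrite subr_gt0.
have d1 : d <= 1 by rewrite /d; lra.
have Ld0 : 0 <= L / d ^+ 2 by have : 0 < L by [lra|]; move=> ?; pos.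
have [l [l0 l1 l2]] := ex_nat_ceil Ld0.
have lR : 1 <= l%:R :> R by rewrite ler1n.
have z0 : z != 0 by rewrite -nm_gt0; lra.
have c1 : nm z^-1 <= 1 by rewrite nmV invf_le1 ?nm_gt0 //; lra.
(* Bernoulli gives |z|^n >= (l d)^(2 (q + 1)) >= (l L)^(q + 1), because l d^2 >= L, while the bound
   on T^n grows only like (p l)^q; [L] absorbs the constants. *)
pose n := (P * l)%N.
have np : n.+1%:R <= p * l%:R :> R.
  by rewrite /p -natrM ler_nat mulSn -addn1 addnC leq_add2r // .
have nS j : (j <= n)%N -> opnorm (iter j T) <= C * (p * l%:R) ^+ q.
  move=> jn; apply: le_trans (HT j) _; rewrite ler_wpM2l // lerXn2r ?nnegrE //.
    by pos.
  by apply: le_trans np; rewrite ler_nat.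
have vE : Qz y = z^-1 *: y + z^-1 *: T (Qz y).
  have h : y + T (Qz y) = z *: Qz y by rewrite -{1}(resK y rz) subrK.
  by rewrite -scalerDr h scalerA mulVf // scale1r.
have cn : nm z^-1 ^+ n * opnorm (iter n T) <= 2^-1.
  have zn : (l%:R * L) ^+ q.+1 <= nm z ^+ n.
    have -> : nm z = 1 + d by rewrite /d addrC subrK.
    rewrite /n mulnC exprM /P exprM.
    apply: lerXn2r; rewrite ?nnegrE; try by pos.
    apply: le_trans (_ : (l%:R * d) ^+ 2 <= _).
      rewrite exprMn expr2 -mulrA ler_wpM2l //.
      by rewrite -ler_pdivrMr ?exprn_gt0 // ltW.
    have d1' : 0 <= 1 + d by lra.
    apply: lerXn2r; rewrite ?nnegrE; [by pos|by pos|].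
    by apply: le_trans (bernoulli_le l (ltW d0)); rewrite lerDr.
  rewrite nmV exprVn mulrC ler_pdivrMr ?exprn_gt0 ?nm_gt0 //.
  apply: le_trans (nS _ (leqnn _)) _; apply: le_trans (_ : 2^-1 * (l%:R * L) ^+ q.+1 <= _); last first.
    by rewrite ler_pM2l ?invr_gt0.
  rewrite exprMn exprMn.
  have a1 : l%:R ^+ q <= l%:R ^+ q.+1 :> R by rewrite ler_weXn2l.
  have a2 : 2 * C * p ^+ q <= L ^+ q.+1.
    apply: le_trans (_ : L <= _); first by rewrite /L lerDr.
    by rewrite -{1}(expr1 L) ler_weXn2l.
  have a3 : 0 <= l%:R ^+ q :> R by pos.
  have a4 : 0 <= L ^+ q.+1 by rewrite exprn_ge0 //; clear -L1; lra.
  have -> : C * (p ^+ q * l%:R ^+ q) = 2^-1 * (l%:R ^+ q * (2 * C * p ^+ q)) by field.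
  rewrite ler_pM2l ?invr_gt0 //; apply: ler_pM => //; by pos.
have := neumann_bound bT vE cn.
rewrite nmZ mulrA => h; apply: le_trans h _; apply: ler_wpM2r; first exact: nm_ge0.
apply: le_trans (_ : 2 * (\sum_(j < n) nm z^-1 ^+ j * opnorm (iter j T)) <= _).
  rewrite ler_piMr // mulr_ge0 // sumr_ge0 // => j _.
  by rewrite mulr_ge0 ?exprn_ge0 ?nm_ge0 // opnorm_ge0 //; exact: bounded_iter.
have -> : 2 * C * p ^+ q.+1 * (L + 1) ^+ q.+1 * d ^- P =
  2 * (C * p ^+ q.+1 * ((L + 1) / d ^+ 2) ^+ q.+1).
  by rewrite expr_div_n /P exprM; ring.
rewrite ler_pM2l //.
apply: le_trans (_ : \sum_(j < n) C * (p * l%:R) ^+ q <= _).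
  apply: ler_sum => j _; rewrite -[leRHS]mul1r; apply: ler_pM.
  - by rewrite exprn_ge0 // nm_ge0.
  - by rewrite opnorm_ge0 //; exact: bounded_iter.
  - by rewrite exprn_ile1 // nm_ge0.
  - by apply: nS; exact: ltnW.
rewrite sumr_const card_ord -[leLHS]mulr_natr.
apply: le_trans (_ : C * (p * l%:R) ^+ q.+1 <= _).
  rewrite exprSr mulrA; apply: ler_wpM2l; first by pos.
  by apply: le_trans np; rewrite ler_nat.
rewrite exprMn mulrA; apply: ler_wpM2l; first by pos.
apply: lerXn2r; rewrite ?nnegrE; first by pos.
  by rewrite divr_ge0 ?sqr_ge0 //; lra.
rewrite mulrDl; apply: le_trans l2 _; rewrite lerD2l mul1r.
by rewrite invf_ge1 ?exprn_gt0 // exprn_ile1 // ltW.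
Qed.

(** With d = 1 - |z|, the terms z^j S^j are at most A exp(e sqrt j - d j), and completing the square
    bounds this by A exp(e^2/d - 3 d j/4). The number of terms is of order d^-2, which another small
    exponential swallows. *)
Lemma res_inner T S : bounded_inverse T S ->
  (forall eps, 0 < eps -> exists2 A : R, 0 <= A &
     forall n : nat, opnorm (iter n S) <= A * expR (eps * Num.sqrt n%:R)) ->
  forall eps, 0 < eps -> exists2 C : R, 0 <= C & forall z Qz, resolvent T z Qz -> nm z < 1 ->
    forall y, nm (Qz y) <= C * expR (eps / (1 - nm z)) * nm y.
Proof.
move=> [bS ST TS] HS eps eps0.
(* Then e + e^2 <= 2 e <= eps: e/d pays for the factor d^-2, and e^2/d comes from completing the
   square. *)
pose e := Num.min (eps / 2) 1.
have e0 : 0 < e by rewrite lt_min ltr01 andbT; pos.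
have e1 : e <= 1 by rewrite ge_min lexx orbT.
have e2 : e <= eps / 2 by rewrite ge_min lexx.
have [A0 A00 HA0] := HS e e0.
pose A := A0 + 1; have A1 : 1 <= A by rewrite lerDr.
have HA n : opnorm (iter n S) <= A * expR (e * Num.sqrt n%:R).
  by apply: le_trans (HA0 n) _; rewrite ler_wpM2r ?expR_ge0 // lerDl.
pose l2A := ln (2 * A).
have l2A0 : 0 <= l2A by rewrite ln_ge0 //; lra.
pose Y := 2 * (l2A + e ^+ 2) + 1.
have Y0 : 0 < Y by rewrite /Y ltr_wpDl // mulr_ge0 // addr_ge0 // sqr_ge0.
have nS0 : 0 <= opnorm S by exact: opnorm_ge0.
have A0' : 0 < A by lra.
exists (2 * (Y * (2 / e ^+ 2) * A) * opnorm S); first by pos.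
move=> z Qz rz z1 y; set d := 1 - nm z.
have d0 : 0 < d by rewrite subr_gt0.
have d1 : d <= 1 by rewrite /d lerBlDr lerDl nm_ge0.
have zd : nm z = 1 - d by rewrite /d opprB addrCA subrr addr0.
have zj j : nm z ^+ j <= expR (- d * j%:R).
  rewrite mulrC expRM_natl lerXn2r ?nnegrE ?nm_ge0 ?expR_ge0 //.
  by rewrite zd; exact: expR_ge1Dx.
have key (j : nat) : nm z ^+ j * opnorm (iter j S) <=
    A * expR (e ^+ 2 / d) * expR (- (3 / 4 * d * j%:R)).
  have s0 := sqrtr_ge0 (j%:R : R); set s := Num.sqrt _ in s0.
  have s2 : s ^+ 2 = j%:R by rewrite sqr_sqrtr.
  have am : e * s <= d * j%:R / 4 + e ^+ 2 / d.
    rewrite -s2 -subr_ge0; have -> : d * s ^+ 2 / 4 + e ^+ 2 / d - e * s = (d * s / 2 - e) ^+ 2 / d.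
      by field; rewrite gt_eqF.
    by rewrite divr_ge0 ?sqr_ge0 // ltW.
  apply: le_trans (_ : expR (- d * j%:R) * (A * expR (e * s)) <= _).
    apply: ler_pM => //; first by rewrite exprn_ge0 ?nm_ge0.
    by rewrite opnorm_ge0 //; exact: bounded_iter.
  rewrite mulrCA -!mulrA ler_pM2l // -!expRD ler_expR; clear -am; lra.
pose X := 4 / (3 * d) * (l2A + e ^+ 2 / d).
have X0 : 0 <= X by rewrite /X; pos.
have [n [n0 nX1 nX2]] := ex_nat_ceil X0.
have lS := bS.1.
have vE : Qz y = - S y + z *: S (Qz y).
  have /(congr1 S) := resK y rz.
  rewrite lin_B // lin_Z // ST => <-.
  by rewrite opprB subrK.
have cn : nm z ^+ n * opnorm (iter n S) <= 2^-1.
  apply: le_trans (key n) _.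
  have : l2A + e ^+ 2 / d <= 3 / 4 * d * n%:R.
    apply: le_trans (_ : 3 / 4 * d * X <= _); last by rewrite ler_wpM2l ?(ltW nX1) //; pos.
    by rewrite /X le_eqVlt; apply/orP; left; apply/eqP; field; rewrite gt_eqF.
  move=> h; rewrite -mulrA -expRD.
  apply: le_trans (_ : A * expR (- l2A) <= _).
    by rewrite ler_pM2l // ler_expR; clear -h; lra.
  by rewrite expRN lnK ?posrE; [rewrite invfM mulrCA divff ?mulr1 // gt_eqF|pos].
have := neumann_bound bS vE cn.
rewrite nmN => h; apply: le_trans h _.
have Sy : nm (S y) <= opnorm S * nm y by exact: opnorm_ub.
have nY : n%:R <= Y / d ^+ 2.
  apply: le_trans nX2 _; rewrite ler_pdivlMr ?exprn_gt0 //.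
  have -> : (X + 1) * d ^+ 2 = 4 / 3 * (l2A * d + e ^+ 2) + d ^+ 2.
    by rewrite /X; field; rewrite gt_eqF.
  have : d ^+ 2 <= 1 by rewrite exprn_ile1 // ltW.
  have : l2A * d <= l2A by rewrite ler_piMr.
  have := sqr_ge0 e; rewrite /Y; clear -l2A0; lra.
have d2 : (d ^+ 2)^-1 <= 2 / e ^+ 2 * expR (e / d).
  have ed0 : 0 <= e / d by pos.
  have := expR_ge1Dxn 1 ed0; rewrite (_ : 2`! = 2)%N // => h1.
  have {}h1 : (e / d) ^+ 2 / 2 <= expR (e / d) by clear -h1; lra.
  apply: le_trans (_ : 2 / e ^+ 2 * ((e / d) ^+ 2 / 2) <= _).
    by rewrite le_eqVlt; apply/orP; left; apply/eqP; field; rewrite !gt_eqF.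
  by rewrite ler_wpM2l //; pos.
have sum_le : \sum_(j < n) nm z ^+ j * opnorm (iter j S) <= n%:R * (A * expR (e ^+ 2 / d)).
  apply: le_trans (_ : \sum_(j < n) A * expR (e ^+ 2 / d) <= _).
    apply: ler_sum => j _; apply: le_trans (key j) _.
    rewrite ler_piMr //; first by pos.
    by rewrite expR_le1 oppr_le0; pos.
  by rewrite sumr_const card_ord [leRHS]mulr_natl.
have e12 : expR (e / d) * expR (e ^+ 2 / d) <= expR (eps / d).
  rewrite -expRD ler_expR -mulrDl ler_pM2r ?invr_gt0 //.
  by have : e ^+ 2 <= e by [rewrite expr2 ler_piMl // ltW|]; clear -e2; lra.
apply: le_trans (_ : 2 * (n%:R * (A * expR (e ^+ 2 / d))) * (opnorm S * nm y) <= _).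
  apply: ler_pM => //; try exact: nm_ge0.
    rewrite mulr_ge0 // sumr_ge0 // => j _.
    by rewrite mulr_ge0 ?exprn_ge0 ?nm_ge0 // opnorm_ge0 //; exact: bounded_iter.
  by rewrite ler_pM2l.
rewrite [leRHS](_ : _ = 2 * (Y * (2 / e ^+ 2) * (A * expR (eps / d))) * (opnorm S * nm y)); last by ring.
apply: ler_wpM2r; first by rewrite mulr_ge0 ?nm_ge0.
rewrite ler_pM2l //.
apply: le_trans (_ : Y * (2 / e ^+ 2 * expR (e / d)) * (A * expR (e ^+ 2 / d)) <= _).
  apply: ler_wpM2r; first by pos.
  by apply: le_trans nY _; rewrite ler_pM2l.
rewrite [leLHS](_ : _ = Y * (2 / e ^+ 2) * (A * (expR (e / d) * expR (e ^+ 2 / d)))); last by ring.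
by apply: ler_wpM2l; [pos|rewrite ler_pM2l].
Qed.

End ResolventGrowth.

(** * A discrete Cauchy formula *)

Section Cauchy.
Context {R : realType}.

Lemma expiD (s t : R) : expi (s + t) = expi s * expi t.
Proof.
rewrite /expi; apply/eqP; rewrite eq_complex /= cosD sinD eqxx /=.
by apply/eqP; ring.
Qed.

Lemma expi0 : expi 0 = 1 :> R[i].
Proof. by rewrite /expi cos0 sin0. Qed.

Lemma nm_expi (t : R) : nm (expi t) = 1.
Proof. by rewrite /nm normc_def /= cos2Dsin2 sqrtr1. Qed.

Lemma expiM (n : nat) (t : R) : expi (n%:R * t) = expi t ^+ n.
Proof.
elim: n => [|n IH]; first by rewrite mul0r expi0 expr0.
by rewrite -natr1 mulrDl mul1r expiD IH exprSr.
Qed.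

Lemma expi_pi : expi pi = -1 :> R[i].
Proof. by rewrite /expi cospi sinpi; apply/eqP; rewrite eq_complex /= oppr0 !eqxx. Qed.

Lemma expi_2pi : expi (2 * pi) = 1 :> R[i].
Proof. by rewrite expiM expi_pi sqrrN expr1n. Qed.

Lemma expi_neq1 (t : R) : 0 < t -> t < 2 * pi -> expi t != 1.
Proof.
move=> t0 t2; apply/negP => /eqP /(congr1 (@complex.Re R)) /= c1.
have : 0 < sin (t / 2) by apply: sin_gt0_pi; apply/andP; split; lra.
have E : (t / 2) *+ 2 = t by rewrite -mulr_natl; field.
have := cos_mulr2n (t / 2); rewrite E c1 => h.
have := cos2Dsin2 (t / 2); nra.
Qed.

Lemma sum_root_unity (w : R[i]) (N : nat) : w ^+ N = 1 -> w != 1 ->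
  \sum_(k < N) w ^+ k = 0.
Proof.
move=> wN w1; have := subrX1 w N; rewrite wN subrr => /esym/eqP.
by rewrite mulf_eq0 subr_eq0 (negbTE w1) => /eqP.
Qed.

Lemma an3_scale {V : normedModType R[i]} (f : R[i] -> V) (c z : R[i]) : nm c = 1 ->
  an3 f (z * c) -> an3 (fun w => f (w * c)) z.
Proof.
move=> nc [a1 [a2 [C [d [d0 C0 H]]]]].
exists (c *: a1), (c ^+ 2 *: a2), C, d; split => // h hd.
have := H (h * c); rewrite nmM nc mulr1 => /(_ hd).
by rewrite /rem3 mulrDl exprMn !scalerA.
Qed.

Lemma an3_linear {V : completeNormedModType R[i]} (A : V -> V) (f : R[i] -> V) z :
  bounded_operator A -> an3 f z -> an3 (fun w => A (f w)) z.
Proof.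
move=> bA [a1 [a2 [C [d [d0 C0 H]]]]]; have lA := bA.1.
exists (A a1), (A a2), (opnorm A * C), d; split => //.
  by rewrite mulr_ge0 // opnorm_ge0.
move=> h hd; have -> : rem3 (fun w => A (f w)) (A a1) (A a2) z h = A (rem3 f a1 a2 z h).
  by rewrite /rem3 (lin_B _ _ lA) !(lin_D _ _ lA) !(lin_Z _ _ lA).
by apply: le_trans (opnorm_ub _ bA) _; rewrite -mulrA ler_wpM2l ?opnorm_ge0 // H.
Qed.

Lemma max_disc {V : normedModType R[i]} (v : R[i] -> V) (r m : R) : 0 <= m ->
  (forall z, nm z <= r -> an3 v z) -> (forall z, nm z = r -> nm (v z) <= m) ->
  forall z, nm z < r -> nm (v z) <= m.
Proof.
move=> m0 av vm; apply: (@max_principle R (fun z => nm z < r) (fun z => nm (v z)) r).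
- by move=> z /ltW.
- move=> z zr; exists (r - nm z); first by rewrite subr_gt0.
  by move=> w; have := nm_subl w z; lra.
- by move=> z /ltW zr; split; [apply: cont_nm|apply: sub3_nm]; exact: av.
- move=> xi /negP; rewrite -leNgt le_eqVlt => /orP[/eqP xr|xr] e e0.
    have xr' : nm xi <= r by rewrite xr.
    have [d d0 H] := cont_nm (av xi xr') e0.
    exists d => // z _ /H /ltr_normlW; have := vm _ (esym xr); lra.
  exists (nm xi - r); first by rewrite subr_gt0.
  by move=> z zr; have := nm_subl xi z; rewrite nmBC; lra.
Qed.

(** Cauchy's formula with the integral replaced by a mean over n + 1 rotations. The function [v]
    equals - S^(n+1) x at 0. On |z| = r, z^n S^n R(z) is R(z) plus a polynomial of degree below n,
    whose terms, divided by z^n, average to zero. The maximum principle joins the two. *)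
Lemma cauchy_resolvent {V : completeNormedModType R[i]} (T S : V -> V)
    (Rz : R[i] -> V -> V) (r r' B : R) (n : nat) :
  bounded_operator T -> bounded_inverse T S -> 0 < r -> r < r' -> 0 <= B ->
  (forall z, nm z < r' -> resolvent T z (Rz z)) ->
  (forall z, nm z = r -> forall y, nm (Rz z y) <= B * nm y) ->
  forall x, nm (iter n.+1 S x) <= B / r ^+ n * nm x.
Proof.
move=> bT [bS ST TS] r0 rr' B0 HR HB x; have [lT _] := bT; have [lS _] := bS.
pose N := n.+1; pose w := expi (2 * pi / N%:R) : R[i].
have N0 : N%:R != 0 :> R[i] by rewrite pnatr_eq0.
have wN : w ^+ N = 1.
  by rewrite -expiM mulrCA divff ?pnatr_eq0 // mulr1 expi_2pi.
have nw k : nm (w ^+ k) = 1 by rewrite nmX nm_expi expr1n.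
pose v z := N%:R^-1 *: iter n S (\sum_(k < N) Rz (z * w ^+ k) x).
have av z : nm z <= r -> an3 v z.
  move=> zr; apply: an3Z; apply: an3_linear; first exact: bounded_iter.
  apply: an3_sum => k; apply: (an3_scale (f := fun w => Rz w x)) => //.
  have zk : nm (z * w ^+ k) <= r by rewrite nmM nw mulr1.
  apply: (an3_resolvent (T := T) (d := r' - r)) => //; first by rewrite subr_gt0.
  by move=> u; have := nm_subl u (z * w ^+ k) => h1 h2; apply: HR; lra.
have R0 y : Rz 0 y = - S y.
  have r00 : resolvent T 0 (Rz 0) by apply: HR; rewrite nm0; exact: lt_trans rr'.
  by have /(congr1 S) := resK y r00; rewrite scale0r sub0r lin_N // ST => <-; rewrite opprK.
have v0 : v 0 = - iter N S x.
  rewrite /v; under eq_bigr do rewrite mul0r R0.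
  have -> : \sum_(k < N) - S x = N%:R *: (- S x) by rewrite sumr_const card_ord scaler_nat.
  rewrite (lin_Z _ _ (lin_iter n lS)).
  by rewrite scalerA mulVf // scale1r (lin_N _ (lin_iter n lS)) -iterSr.
have key m z y : nm z = r -> z ^+ m *: iter m S (Rz z y) =
    Rz z y + \sum_(j < m) z ^+ j *: iter j.+1 S y.
  move=> zr; have rz : resolvent T z (Rz z) by apply: HR; rewrite zr.
  have E : z *: S (Rz z y) = Rz z y + S y.
    by have /(congr1 S) := resK y rz; rewrite (lin_B _ _ lS) (lin_Z _ _ lS) ST => <-; rewrite subrKC.
  elim: m => [|m IH]; first by rewrite expr0 scale1r big_ord0 addr0.
  rewrite exprS -scalerA iterS -(lin_Z _ _ lS) IH (lin_D _ _ lS) scalerDr E -addrA; congr (_ + _).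
  rewrite big_ord_recl /= expr0 scale1r; congr (_ + _).
  rewrite (lin_sum _ _ lS) scaler_sumr; apply: eq_bigr => j _.
  by rewrite (lin_Z _ _ lS) scalerA -exprS.
have vb z : nm z = r -> nm (v z) <= B / r ^+ n * nm x.
  move=> zr; have z0 : z != 0 by rewrite -nm_gt0 zr.
  have zk k : nm (z * w ^+ k) = r by rewrite nmM nw mulr1.
  have zkn k : z * w ^+ k != 0 by rewrite -nm_gt0 zk.
  have -> : v z = N%:R^-1 *: \sum_(k < N) (z * w ^+ k) ^- n *: Rz (z * w ^+ k) x.
    rewrite /v (lin_sum _ _ (lin_iter n lS)).
    congr (_ *: _).
    transitivity (\sum_(k < N) ((z * w ^+ k) ^- n *: Rz (z * w ^+ k) x +
       \sum_(j < n) ((z * w ^+ k) ^- n * (z * w ^+ k) ^+ j) *: iter j.+1 S x)).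
      apply: eq_bigr => k _.
      rewrite -[LHS]scale1r -(mulVf (expf_neq0 n (zkn k))) -scalerA (key n _ x (zk k)).
      by rewrite scalerDr scaler_sumr; congr (_ + _); apply: eq_bigr => j _; rewrite scalerA.
    rewrite big_split /= -[RHS]addr0; congr (_ + _).
    rewrite exchange_big /= big1 // => j _; rewrite -scaler_suml.
    (* Since 0 < n - j < N, [q] is an N-th root of unity other than 1, and its powers sum to 0. *)
    pose q := w ^- (n - j).
    have E (k : 'I_N) : (z * w ^+ k) ^- n * (z * w ^+ k) ^+ j = z ^- (n - j) * q ^+ k.
      have jn : n = ((n - j) + j)%N by rewrite subnK // ltnW.
      rewrite {1}jn exprD invfM -mulrA mulVf ?expf_neq0 // mulr1 exprMn invfM.
      by rewrite /q exprVn -!exprM mulnC.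
    under eq_bigr do rewrite E.
    rewrite -mulr_sumr sum_root_unity ?mulr0 ?scale0r //.
      by rewrite /q -exprVn -exprM mulnC exprM exprVn wN invr1 expr1n.
    rewrite /q -expiM invr_eq1 expi_neq1 //.
      by rewrite mulr_gt0 ?ltr0n ?subn_gt0 // divr_gt0 ?ltr0n // mulr_gt0 ?pi_gt0.
    rewrite mulrA ltr_pdivrMr ?ltr0n // mulrC ltr_pM2l; last by rewrite mulr_gt0 ?pi_gt0.
    by rewrite ltr_nat /N ltnS leq_subr.
  rewrite nmZ nmV nmn; apply: le_trans (ler_wpM2l _ (nm_sum _ _ _)) _; first by rewrite invr_ge0.
  rewrite mulrC ler_pdivrMr ?ltr0n //.
  apply: le_trans (_ : \sum_(k < N) B / r ^+ n * nm x <= _); last first.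
    by rewrite sumr_const card_ord [leRHS]mulr_natr.
  apply: ler_sum => k _; rewrite nmZ nmV nmX zk [B / _]mulrC -mulrA.
  by rewrite ler_wpM2l ?invr_ge0 ?exprn_ge0 ?(ltW r0) // HB.
have := max_disc _ av vb (z := 0).
rewrite v0 nmN nm0; apply => //.
by rewrite mulr_ge0 ?nm_ge0 // divr_ge0 // exprn_ge0 // ltW.
Qed.

End Cauchy.

(** * The potential of a closed subset of the circle *)

Section Distance.
Context {R : realType}.
Implicit Types (E : set R[i]^o) (z w : R[i]).

Definition dE E z : R := inf [set nm (z - w) | w in E].

Let has_inf_dE E z : E !=set0 -> has_inf [set nm (z - w) | w in E].
Proof.
move=> [w Ew]; split; first by exists (nm (z - w)), w.
by exists 0 => _ [w' _ <-]; exact: nm_ge0.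
Qed.

Lemma dE_le E z w : E w -> dE E z <= nm (z - w).
Proof.
by move=> Ew; apply: ge_inf; [have [] := @has_inf_dE E z (ex_intro _ w Ew)|exists w].
Qed.

Lemma dE_ge E z c : E !=set0 -> (forall w, E w -> c <= nm (z - w)) -> c <= dE E z.
Proof.
move=> [w Ew] H; apply: lb_le_inf; first by exists (nm (z - w)), w.
by move=> _ [w' Ew' <-]; exact: H.
Qed.

Lemma dE_ge0 E z : E !=set0 -> 0 <= dE E z.
Proof. by move=> E0; apply: dE_ge => // w _; exact: nm_ge0. Qed.

Lemma dE_adherent E z e : E !=set0 -> 0 < e -> exists2 w, E w & nm (z - w) < dE E z + e.
Proof.
move=> E0 e0; have [_ [w Ew <-] h] := inf_adherent e0 (has_inf_dE z E0).
by exists w.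
Qed.

Lemma dE_lip E z w : E !=set0 -> dE E z <= dE E w + nm (z - w).
Proof.
move=> E0; rewrite -lerBlDr; apply: dE_ge => // u Eu.
by rewrite lerBlDr; apply: le_trans (dE_le z Eu) _; rewrite [leRHS]addrC; exact: nm_tri.
Qed.

Lemma closed_nm E z : closed E -> (forall e : R, 0 < e -> exists2 w, E w & nm (z - w) < e) -> E z.
Proof.
move=> cE H; apply: cE => B /nbhs_ballP [e /= e0 He].
have er : e = (complex.Re e)%:C%C by rewrite RRe_real // gtr0_real.
have e0' : 0 < complex.Re e by rewrite -ltcR -er.
have [w Ew we] := H _ e0'; exists w; split => //; apply: He.
by rewrite /ball /= nmE er ltcR.
Qed.

Lemma dE_eq0 E z : closed E -> E !=set0 -> dE E z = 0 -> E z.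
Proof.
move=> cE E0 h; apply: closed_nm => // e e0.
by have := dE_adherent z E0 e0; rewrite h add0r.
Qed.

Lemma dE_mem E z : E z -> dE E z = 0.
Proof.
move=> Ez; apply/eqP; rewrite eq_le dE_ge0; last by exists z.
by rewrite andbT -(nm0 (R[i]^o : normedModType R[i])) -(subrr z) dE_le.
Qed.

Lemma dE_gt0 E z : closed E -> E !=set0 -> ~ E z -> 0 < dE E z.
Proof.
move=> cE E0 nE; rewrite lt_neqAle dE_ge0 // andbT; apply/eqP => h.
by apply: nE; apply: dE_eq0.
Qed.

Lemma dE_ge_circle E z : E !=set0 -> E `<=` unit_circle -> 1 - nm z <= dE E z.
Proof.
move=> E0 ET; apply: dE_ge => // w /ET; rewrite /unit_circle /= => w1.
have : nm w = 1 by rewrite /nm w1.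
by have := nm_subl w z; rewrite nmBC => h <-.
Qed.

Lemma dE_le_circle E z : E !=set0 -> E `<=` unit_circle -> dE E z <= nm z + 1.
Proof.
move=> [w Ew] ET; apply: le_trans (dE_le z Ew) _.
have w1 : nm w = 1 by rewrite /nm (ET _ Ew).
by rewrite -w1; exact: nmB.
Qed.

End Distance.

Section Dipoles.
Context {R : realType}.
Implicit Types (E : set R[i]^o) (z w : R[i]) (n k : nat).

Definition dl n : R := 2^-1 ^+ n.

Lemma dl0 : dl 0 = 1. Proof. by []. Qed.

Lemma dlS n : dl n.+1 = 2^-1 * dl n. Proof. by rewrite /dl exprS. Qed.

Lemma dlE n : dl n * (2 ^ n)%:R = 1.
Proof. by rewrite natrX -exprMn mulVf ?expr1n. Qed.

Lemma dl_gt0 n : 0 < dl n. Proof. by rewrite exprn_gt0 // invr_gt0. Qed.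

Lemma dl_le1 n : dl n <= 1.
Proof. by rewrite exprn_ile1 // invf_le1 // ler1n. Qed.

Lemma dl_le m n : (m <= n)%N -> dl n <= dl m.
Proof. by move=> h; rewrite ler_wiXn2l // invf_le1 // ler1n. Qed.

Opaque dl.

Definition pt n k : R[i] := expi (2 * pi * k%:R * dl n).

Definition zeta (a : R) n k : R[i] := a%:C%C * pt n k.

(** Why 16 is enough: a point of the circle within [dl n] of E lies within [8 * dl n] of the root
    opening its arc, as 2 pi <= 8, so that root is within [9 * dl n] of E and active. *)
Definition active E n k : bool := `[< dE E (pt n k) <= 16 * dl n >].

(* The logarithm of the modulus of (z - (1 + dl) e) / (z - (1 + 2 dl) e). For an
   active point e its singularities stay outside cl_dom E, at a distance from z
   comparable with dE E z. *)
Definition dipole n k z : R :=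
  ln (nm (z - zeta (1 + dl n) n k)) - ln (nm (z - zeta (1 + 2 * dl n) n k)).

Lemma eta_ex : exists e : R, 0 < e /\ e * (50 * 40) <= 1.
Proof.
by exists (50 * 40)^-1; split; [rewrite invr_gt0|rewrite mulVf // mulf_neq0].
Qed.

(** Taken from an existence statement so that later estimates see only its sign and the bound
    [eta_small]. *)
Definition eta : R := projT1 (cid eta_ex).

Lemma eta_gt0 : 0 < eta. Proof. by rewrite /eta; case: cid => e /= []. Qed.

Lemma eta_small : eta * (50 * 40) <= 1.
Proof. by rewrite /eta; case: cid => e /= []. Qed.

Definition cl_dom E z := nm z <= 2 /\ nm z <= 1 + eta * dE E z ^+ 2.

Lemma nm_pt n k : nm (pt n k) = 1. Proof. exact: nm_expi. Qed.

Lemma nm_zeta_pt a n k : 0 <= a - 1 -> nm (zeta a n k - pt n k) = a - 1.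
Proof.
move=> a1; have -> : zeta a n k - pt n k = (a - 1)%:C%C * pt n k.
  by rewrite /zeta rmorphB rmorph1 mulrBl mul1r.
by rewrite nmM nm_pt mulr1 nmR ger0_norm.
Qed.

Lemma nm_zeta a n k : 0 <= a -> nm (zeta a n k) = a.
Proof. by move=> a0; rewrite nmM nm_pt mulr1 nmR ger0_norm. Qed.

Definition xco n k z : R := complex.Re (z * (pt n k)^*%C).

Lemma nm_sub_zeta a n k z : nm (z - zeta a n k) ^+ 2 = nm z ^+ 2 + a ^+ 2 - 2 * a * xco n k z.
Proof.
rewrite nm_sqB nmM nm_pt mulr1 nmR real_normK ?num_real //; congr (_ - _).
rewrite -mulrA; congr (_ * _); rewrite /zeta /xco.
by case: z (pt n k) => [p q] [r s] /=; ring.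
Qed.

Lemma nm_sub_pt n k z : nm (z - pt n k) ^+ 2 = nm z ^+ 2 + 1 - 2 * xco n k z.
Proof.
have := nm_sub_zeta 1 n k z; rewrite /zeta.
by have -> : 1%:C%C = 1 :> R[i] by []; rewrite mul1r expr1n mulr1.
Qed.

Lemma dipole_sq n k z :
  nm (z - zeta (1 + 2 * dl n) n k) ^+ 2 - nm (z - zeta (1 + dl n) n k) ^+ 2 =
  dl n * (2 + 3 * dl n - 2 * xco n k z).
Proof. rewrite !nm_sub_zeta; ring. Qed.

Lemma xco_le n k z : xco n k z <= nm z.
Proof. by apply: le_trans (Re_le_nm _) _; rewrite nmM nmJ nm_pt mulr1. Qed.

(** Let u be the distance to the pole and d = d(z,E). The root is within [16 * dl n] of E, so d <=
    18 dl n + u; the pole is at least [dl n] outside the circle and z at most eta d^2. If u were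
    below [dl n / 2], then d <= 19 dl n and eta d^2 would be less than [dl n / 2], a
    contradiction. *)
Lemma far_from_zeta E n k z c : E !=set0 -> E `<=` unit_circle -> cl_dom E z -> active E n k ->
  1 <= c -> c <= 2 ->
  dl n / 2 <= nm (z - zeta (1 + c * dl n) n k) /\
  dE E z <= 40 * nm (z - zeta (1 + c * dl n) n k).
Proof.
move=> E0 ET [z2 zE] /asboolP An c1 c2.
have d0 := dl_gt0 n; have d1 := dl_le1 n; have D0 := dE_ge0 z E0.
have cd : 0 <= c * dl n by rewrite mulr_ge0 //; clear -c1 d0; lra.
have h1 : dE E z <= 18 * dl n + nm (z - zeta (1 + c * dl n) n k).
  apply: le_trans (dE_lip z (pt n k) E0) _.
  have := nm_tri (zeta (1 + c * dl n) n k) z (pt n k).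
  rewrite nm_zeta_pt ?[1 + _ - 1]addrC ?addKr // => h.
  have : c * dl n <= 2 * dl n by rewrite ler_pM2r.
  by move: An h; rewrite nmBC; clear; lra.
have h2 : dl n - eta * dE E z ^+ 2 <= nm (z - zeta (1 + c * dl n) n k).
  have := nm_subl (zeta (1 + c * dl n) n k) z; rewrite nmBC nm_zeta; last by clear -cd; lra.
  have : dl n <= c * dl n by rewrite ler_peMl // ltW.
  clear -zE; lra.
have h3 : dE E z <= 3 by have := dE_le_circle z E0 ET; clear -z2; lra.
have h0 := nm_ge0 (z - zeta (1 + c * dl n) n k).
set u := nm _ in h0 h1 h2 *.
have h4 : dl n / 2 <= u.
  rewrite leNgt; apply/negP => ud; set D := dE E z in D0 h1 h2 h3.
  have e0 := eta_gt0; have es := eta_small.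
  have D19 : D <= 19 * dl n by clear -h1 ud d0; lra.
  have : eta * D ^+ 2 <= eta * (3 * (19 * dl n)).
    by rewrite ler_pM2l // expr2; apply: ler_pM.
  have : eta * (50 * 40) * dl n <= dl n by rewrite ler_piMl // ltW.
  by clear -h2 ud d0; lra.
by split => //; clear -h1 h4 h0; lra.
Qed.

(** By [dipole_sq] the right side is the difference of the squared distances to the two poles
    divided by [dl n]. It vanishes on their bisector; z stays well inside because it passes the
    circle by at most eta d(z,E)^2, and d(z,E) is at most the distance to the root plus
    [16 * dl n]. *)
Lemma dipole_gap E n k z : E !=set0 -> E `<=` unit_circle -> cl_dom E z -> active E n k ->
  2 * dl n <= 2 + 3 * dl n - 2 * xco n k z.
Proof.
move=> E0 ET [z2 zE] /asboolP An.
have d0 := dl_gt0 n; have d1 := dl_le1 n; have D0 := dE_ge0 z E0.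
have h1 := dE_lip z (pt n k) E0.
have h3 : dE E z <= 3 by have := dE_le_circle z E0 ET; lra.
have := nm_sub_pt n k z; have := nm_ge0 (z - pt n k); have z0 := nm_ge0 z.
set u := nm (z - _) in h1 *; set x := xco _ _ _ => u0 ux.
set D := dE E z in zE D0 h1 h3; set d := dl n in An h1 d0 d1 *.
have e0 := eta_gt0; have es := eta_small; have q0 := sqr_ge0 D.
have q9 : D ^+ 2 <= 9 by clear -h3 D0; rewrite expr2; nra.
have zz : nm z ^+ 2 <= 1 + 3 * eta * D ^+ 2.
  apply: le_trans (_ : (1 + eta * D ^+ 2) ^+ 2 <= _).
    rewrite lerXn2r ?nnegrE // addr_ge0 // mulr_ge0 // ltW //.
  have h : eta * (eta * D ^+ 2 * D ^+ 2) <= eta * D ^+ 2.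
    rewrite ler_pM2l // ler_piMl //; clear -e0 es q9 q0.
    have : eta * D ^+ 2 <= eta * 9 by rewrite ler_pM2l.
    by lra.
  by move: h; clear; rewrite -subr_ge0 => h; rewrite -subr_ge0; move: h; set q := D ^+ 2; set e := eta; lra.
have DD : D ^+ 2 <= 2 * u ^+ 2 + 512 * d ^+ 2.
  have h : D <= u + 16 * d by clear -An h1; lra.
  apply: le_trans (_ : (u + 16 * d) ^+ 2 <= _).
    by rewrite lerXn2r // nnegrE; clear -D0 h; lra.
  by have := sqr_ge0 (u - 16 * d); clear; rewrite !expr2; lra.
have dd : d ^+ 2 <= d by rewrite expr2 ler_piMl // ltW.
have u2 := sqr_ge0 u; have d2 := sqr_ge0 d.
have : 3 * eta * D ^+ 2 <= 3 * eta * (2 * u ^+ 2 + 512 * d ^+ 2).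
  by rewrite ler_pM2l //; clear -e0; lra.
have : eta * (50 * 40) * u ^+ 2 <= u ^+ 2 by rewrite ler_piMl.
have : eta * (50 * 40) * d ^+ 2 <= d ^+ 2 by rewrite ler_piMl.
clear -zz ux dd u2 d2 e0; lra.
Qed.

Lemma disc_cl_dom E z : E !=set0 -> nm z <= 1 -> cl_dom E z.
Proof.
move=> E0 z1; split; first by lra.
by apply: le_trans z1 _; rewrite lerDl mulr_ge0 ?sqr_ge0 // ltW // eta_gt0.
Qed.

Lemma ln_ge1VB (x : R) : 0 < x -> 1 - x^-1 <= ln x.
Proof.
move=> x0; have xi : 0 < x^-1 by rewrite invr_gt0.
have h : ln x^-1 <= x^-1 - 1.
  have -> : x^-1 = 1 + (x^-1 - 1) by ring.
  apply: le_trans (le_ln1Dx _) _; lra.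
by move: h; rewrite lnV ?posrE //; lra.
Qed.

Lemma ln_leB1 (x : R) : 0 < x -> ln x <= x - 1.
Proof.
move=> x0; have {1}-> : x = 1 + (x - 1) by ring.
by apply: le_ln1Dx; lra.
Qed.

Lemma dipoleE n k z : 0 < nm (z - zeta (1 + dl n) n k) -> 0 < nm (z - zeta (1 + 2 * dl n) n k) ->
  dipole n k z = - (ln (nm (z - zeta (1 + 2 * dl n) n k) ^+ 2 / nm (z - zeta (1 + dl n) n k) ^+ 2) / 2).
Proof.
rewrite /dipole; move: (nm _) (nm _) => a b a0 b0.
have l2 x : 0 < x -> ln (x ^+ 2) = 2 * ln x :> R by move=> x0; rewrite lnXn // mulr_natl.
by rewrite ln_div ?posrE ?exprn_gt0 // !l2 //; field.
Qed.

Lemma dipole_le0 E n k z : E !=set0 -> E `<=` unit_circle -> cl_dom E z -> active E n k ->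
  dipole n k z <= 0.
Proof.
move=> E0 ET cz An; have d0 := dl_gt0 n.
have [] := far_from_zeta E0 ET cz An (lexx 1) (ler1n _ 2); rewrite mul1r => h1 _.
have [h2 _] := far_from_zeta E0 ET cz An (ler1n _ 2) (lexx 2).
rewrite /dipole subr_le0 ler_ln ?posrE; [|lra|lra].
rewrite -(@ler_pXn2r _ 2) ?nnegrE ?nm_ge0 // -subr_ge0 dipole_sq.
by have := dipole_gap E0 ET cz An => h; rewrite mulr_ge0 ?(ltW d0) //; lra.
Qed.

Lemma dipole_ge n k z : 0 < nm (z - zeta (1 + dl n) n k) -> 0 < nm (z - zeta (1 + 2 * dl n) n k) ->
  - (dl n / nm (z - zeta (1 + dl n) n k)) <= dipole n k z.
Proof.
move=> h1 h2; have d0 := dl_gt0 n.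
rewrite /dipole -ln_div ?posrE //; apply: le_trans (ln_ge1VB _); last by rewrite divr_gt0.
set a := nm _ in h1 *; set b := nm (_ - zeta (1 + 2 * _) _ _) in h2 *.
have -> : 1 - (a / b)^-1 = (a - b) / a by field; rewrite !gt_eqF.
rewrite -mulNr ler_pM2r ?invr_gt0 // lerNl opprB lerBlDl.
apply: le_trans (nm_tri (zeta (1 + dl n) n k) _ _) _; rewrite lerD2l.
rewrite /zeta -mulrBl nmM nm_pt mulr1 -rmorphB /= nmR.
have -> : 1 + dl n - (1 + 2 * dl n) = - dl n by ring.
by rewrite normrN gtr0_norm.
Qed.

End Dipoles.

Section Covering.
Context {R : realType}.
Implicit Types (E : set R[i]^o) (z w : R[i]) (n k : nat).

Lemma pi_le4 : pi <= 4 :> R.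
Proof. by have := pihalf_lt2 R; lra. Qed.

Lemma sin_le_abs (x : R) : `|sin x| <= `|x|.
Proof.
case: (@MVT0 R sin cos x) => c _.
rewrite sin0 subr0 => ->; rewrite normrM ler_piMl // ler_norml.
by rewrite cos_geN1 cos_le1.
Qed.

Lemma nm_expi_sub (s t : R) : nm (expi s - expi t) <= `|s - t|.
Proof.
have -> : expi s = expi t * expi (s - t) by rewrite -expiD addrC subrK.
rewrite -[X in _ - X]mulr1 -mulrBr nmM nm_expi mul1r; set h := s - t.
have E : (h / 2) *+ 2 = h by rewrite -mulr_natl; field.
rewrite -(@ler_pXn2r _ 2) ?nnegrE ?nm_ge0 // real_normK ?num_real //.
rewrite nm_sq /= -[h in cos h]E cos_mulr2n subr0.
have -> : (cos (h / 2) ^+ 2 *+ 2 - 1 - 1) ^+ 2 + sin h ^+ 2 =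
   4 * sin (h / 2) ^+ 2.
  rewrite -[h in sin h]E sin_mulr2n; have := cos2Dsin2 (h / 2).
  move: (cos (h / 2)) (sin (h / 2)) => c s' cs.
  have -> : c ^+ 2 = 1 - s' ^+ 2 by rewrite -cs addrK.
  by rewrite exprMn_n exprMn (_ : c ^+ 2 = 1 - s' ^+ 2) ?[RHS]cs; [ring|rewrite -cs addrK].
have h2 : `|sin (h / 2)| ^+ 2 <= `|h / 2| ^+ 2 by rewrite lerXn2r ?nnegrE // sin_le_abs.
move: h2; rewrite (real_normK (num_real (sin _))) (real_normK (num_real (h / 2))) expr_div_n.
by move: (sin _ ^+ 2) (h ^+ 2) => p q; lra.
Qed.

Lemma circle_expi z : nm z = 1 -> exists t : R, [/\ 0 <= t, t < 2 * pi & z = expi t].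
Proof.
move=> z1; have := nm_sq z; rewrite z1 expr1n; case: z z1 => a b z1 /= ab.
have a1 : -1 <= a <= 1 by nra.
have pi0 := pi_gt0 R; have [_ ca] := acos_def a1.
have sb : Num.sqrt (1 - a ^+ 2) = `|b|.
  by rewrite (_ : 1 - a ^+ 2 = b ^+ 2) ?sqrtr_sqr //; lra.
have [b0|b0] := leP 0 b.
  exists (acos a); split; [exact: acos_ge0| |].
    by have := acos_lepi a1; lra.
  by rewrite /expi ca sin_acos // sb ger0_norm.
exists (2 * pi - acos a); split.
- by have := acos_lepi a1; lra.
- have : 0 < acos a.
    rewrite lt_neqAle acos_ge0 // andbT; apply/eqP => h.
    have : a = 1 by rewrite -ca -h cos0.
    by move=> a1'; move: ab; rewrite a1' expr1n; nra.
  by lra.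
- rewrite addrC (_ : 2 * pi = pi *+ 2); last by rewrite mulr_natl.
  by rewrite /expi cosD2pi sinD2pi cosN sinN ca sin_acos // sb ltr0_norm // opprK.
Qed.

Lemma pt_near_expi (t : R) n k : (2 * pi * k%:R * dl n <= t <= 2 * pi * k.+1%:R * dl n) ->
  nm (expi t - pt n k) <= 8 * dl n.
Proof.
move=> /andP[h1 h2]; apply: le_trans (nm_expi_sub _ _) _.
have d0 := dl_gt0 (R := R) n; have p4 := pi_le4; have pi0 := pi_gt0 R.
move: h2; rewrite -natr1 => h2.
rewrite ger0_norm; last by lra.
apply: le_trans (_ : 2 * pi * dl n <= _); first by lra.
by rewrite ler_pM2r //; lra.
Qed.

Lemma pt_cover n (t : R) : 0 <= t -> t < 2 * pi ->
  exists2 k, (k < 2 ^ n)%N & 2 * pi * k%:R * dl n <= t < 2 * pi * k.+1%:R * dl n.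
Proof.
move=> t0 t2; have pi0 := pi_gt0 R; have d0 := dl_gt0 (R := R) n.
have c0 : 0 < 2 * pi * dl n :> R by pos.
have x0 : 0 <= t / (2 * pi * dl n) by pos.
have /andP[h1 h2] := truncn_itv x0; set k := Num.truncn _ in h1 h2.
move: h1 h2; rewrite ler_pdivlMr // ltr_pdivrMr // => h1 h2.
exists k; last by apply/andP; split; clear -h1 h2; lra.
have := dlE n; have := ler_nat R (2 ^ n) k; case: leqP => // _ /idP h h3.
exfalso; have : 2 * pi * dl n * (2 ^ n)%:R <= 2 * pi * dl n * k%:R :> R by rewrite ler_pM2l.
by rewrite -mulrA h3; lra.
Qed.

Lemma active_near E n z : E !=set0 -> E `<=` unit_circle -> dE E z <= dl n ->
  exists k, [/\ (k < 2 ^ n)%N, active E n k & nm (z - pt n k) <= 10 * dl n].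
Proof.
move=> E0 ET zE; have d0 := dl_gt0 (R := R) n.
have [w Ew zw] := dE_adherent z E0 d0.
have w1 : nm w = 1 by rewrite /nm (ET _ Ew).
have [t [t0 t2 wt]] := circle_expi w1.
have [k kn /andP[h1 h2]] := pt_cover n t0 t2.
have := @pt_near_expi t n k; rewrite h1 (ltW h2) -wt => /(_ isT) wk.
exists k; split => //.
  apply/asboolP; apply: le_trans (dE_le _ Ew) _; rewrite nmBC; lra.
by apply: le_trans (nm_tri w _ _) _; clear -zE zw wk; lra.
Qed.

(** Origin of 144: some active root is within [10 * dl n], so its outer pole is within [12 * dl n].
    The squared distances differ by at least twice the square of [dl n], a proportion 2/144, and the
    logarithm of a modulus is half that of its square. *)
Lemma dipole_drop E n z : E !=set0 -> E `<=` unit_circle -> cl_dom E z -> dE E z <= dl n ->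
  exists2 k, (k < 2 ^ n)%N & active E n k /\ dipole n k z <= - (1 / 144).
Proof.
move=> E0 ET cz zE; have d0 := dl_gt0 (R := R) n.
have [k [kn An zk]] := active_near E0 ET zE; exists k => //; split => //.
have [] := far_from_zeta E0 ET cz An (lexx 1) (ler1n _ 2); rewrite mul1r => h1 _.
have [h2 _] := far_from_zeta E0 ET cz An (ler1n _ 2) (lexx 2).
have p1 : 0 < nm (z - zeta (1 + dl n) n k) by lra.
have p2 : 0 < nm (z - zeta (1 + 2 * dl n) n k) by lra.
rewrite dipoleE // lerN2 ler_pdivlMr //.
apply: le_trans (ln_ge1VB _); last by pos.
rewrite [X in _ <= X](_ : _ = (nm (z - zeta (1 + 2 * dl n) n k) ^+ 2 -
   nm (z - zeta (1 + dl n) n k) ^+ 2) / nm (z - zeta (1 + 2 * dl n) n k) ^+ 2); last first.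
  by rewrite invf_div mulrBl divff // expf_neq0 // gt_eqF.
rewrite dipole_sq ler_pdivlMr ?exprn_gt0 //.
have gap := dipole_gap E0 ET cz An.
apply: le_trans (_ : 1 / 144 * 2 * (12 * dl n) ^+ 2 <= _).
  rewrite ler_pM2l //.
  rewrite lerXn2r ?nnegrE ?nm_ge0 //; first by lra.
  apply: le_trans (nm_tri (pt n k) _ _) _.
  rewrite [X in _ + X]nmBC nm_zeta_pt; last by lra.
  by clear -zk; lra.
have : dl n * (2 * dl n) <= dl n * (2 + 3 * dl n - 2 * xco n k z) by rewrite ler_pM2l.
by rewrite exprMn; clear; lra.
Qed.

End Covering.

(** * Sums over the roots of one scale *)

Section KernelSums.
Context {R : realType}.
Implicit Types (E : set R[i]^o) (z w y : R[i]) (n k : nat).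

Lemma pt_double n k : pt n.+1 k ^+ 2 = pt n k :> R[i].
Proof.
rewrite /pt -expiM; congr expi; rewrite dlS.
by field.
Qed.

Lemma pt_antipode n k : pt n.+1 (2 ^ n + k) = - pt n.+1 k :> R[i].
Proof.
rewrite /pt natrD mulrDr mulrDl expiD.
have -> : 2 * pi * (2 ^ n)%:R * dl n.+1 = pi :> R.
  have h := dlE (R := R) n; rewrite dlS.
  transitivity (pi * (dl n * (2 ^ n)%:R) : R); last by rewrite h mulr1.
  by field.
by rewrite expi_pi mulN1r.
Qed.

Lemma big_double (T : nmodType) n (f : nat -> T) :
  \sum_(k < 2 ^ n.+1) f k = \sum_(k < 2 ^ n) (f k + f (2 ^ n + k)%N).
Proof.
rewrite big_split /= -(big_mkord xpredT f) -(big_mkord xpredT (fun k => f (2 ^ n + k)%N)).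
rewrite -(big_mkord xpredT f) (@big_cat_nat _ _ _ (2 ^ n)) //=; last first.
  by rewrite leq_exp2l.
congr (_ + _); rewrite -{1}[(2 ^ n)%N]add0n big_addn.
have -> : (2 ^ n.+1 - 2 ^ n = 2 ^ n)%N by rewrite expnS mul2n -addnn addnK.
by apply: eq_bigr => i _; rewrite addnC.
Qed.

(** Antipodal roots pair up by 1/(1 - a) + 1/(1 + a) = 2/(1 - a^2), and squaring the roots of order
    2^(n+1) yields those of order 2^n; hence the induction. *)
Lemma root_kernel_sum n y : nm y < 1 ->
  \sum_(k < 2 ^ n) (1 - y * (pt n k)^*%C)^-1 = (2 ^ n)%:R / (1 - y ^+ (2 ^ n)).
Proof.
elim: n y => [|n IH] y y1.
  by rewrite big_ord_recl big_ord0 addr0 /pt [(val _)%:R]/(0%:R) mulr0 mul0r expi0 conjc1 mulr1 expr1 mul1r.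
rewrite (big_double n (fun k => (1 - y * (pt n.+1 k)^*%C)^-1)).
have y2 : nm (y ^+ 2) < 1 by rewrite nmX exprn_ilt1 // nm_ge0.
have E (k : 'I_(2 ^ n)) : (1 - y * (pt n.+1 k)^*%C)^-1 + (1 - y * (pt n.+1 (2 ^ n + k))^*%C)^-1 =
   2 * (1 - y ^+ 2 * (pt n k)^*%C)^-1.
  rewrite pt_antipode -(pt_double n k); set p := pt n.+1 k; set q := p^*%C.
  have -> : (- p)^*%C = - q by exact: rmorphN.
  have -> : (p ^+ 2)^*%C = q ^+ 2 by exact: rmorphXn.
  have nq : nm q = 1 by rewrite nmJ nm_pt.
  have np : nm (y * q) < 1 by rewrite nmM nq mulr1.
  have n1 : 1 - y * q != 0.
    by rewrite -nm_gt0; have := nm_subl 1 (y * q); rewrite nm1; lra.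
  have n2 : 1 + y * q != 0.
    by rewrite -nm_gt0; have := nm_addl 1 (y * q); rewrite nm1; lra.
  have -> : 1 - y ^+ 2 * q ^+ 2 = (1 - y * q) * (1 + y * q) by ring.
  by rewrite mulrN opprK; field; apply/andP.
under eq_bigr do rewrite E.
by rewrite -mulr_sumr IH // -exprM expnS natrM mulrA -expnS.
Qed.

(** A Poisson-type kernel: a times it is the real part of 1/(1 - y conj(e)) with y = z/a and e the
    root, so its sum over all roots of a scale is explicit. *)
Definition ker (a : R) n k z : R := (a - xco n k z) / nm (z - zeta a n k) ^+ 2.

Lemma zeta_far (a : R) n k z : 1 <= a -> a - nm z <= nm (z - zeta a n k).
Proof.
move=> a1; have := nm_subl (zeta a n k) z; rewrite nmBC nm_zeta //; lra.
Qed.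

Lemma ker_ge0 a n k z : nm z <= 1 -> 1 <= a -> 0 <= ker a n k z.
Proof.
by move=> z1 a1; rewrite divr_ge0 ?sqr_ge0 // subr_ge0 (le_trans (xco_le n k z)) // (le_trans z1).
Qed.

Lemma kerE a n k z : nm z <= 1 -> 1 < a ->
  complex.Re ((1 - (z / a%:C%C) * (pt n k)^*%C)^-1) = a * ker a n k z.
Proof.
move=> z1 a1.
have a0 : 0 < a by lra.
have aC : a%:C%C != 0 :> R[i] by rewrite -nm_gt0 nmR gtr0_norm.
set v := 1 - _.
have nv : nm v = nm (z - zeta a n k) / a.
  have -> : v = - (pt n k)^*%C * (z - zeta a n k) / a%:C%C.
    have pp : (pt n k)^*%C * pt n k = 1 :> R[i].
      by rewrite mulrC -sqr_normc nmE nm_pt expr1n.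
    transitivity ((pt n k)^*%C * pt n k - z / a%:C%C * (pt n k)^*%C); first by rewrite pp.
    by rewrite /zeta; field.
  by rewrite !nmM nmN nmJ nm_pt mul1r nmV nmR gtr0_norm.
have Rv : complex.Re v = 1 - xco n k z / a.
  rewrite /v cReB /=; congr (_ - _).
  have -> : z / a%:C%C * (pt n k)^*%C = (z * (pt n k)^*%C) * (a^-1)%:C%C.
    by rewrite fmorphV mulrAC.
  by rewrite cReM /= mulr0 subr0.
have zf : 0 < nm (z - zeta a n k) by have := zeta_far n k z (ltW a1); lra.
have v0 : v != 0 by rewrite -nm_gt0 nv divr_gt0.
rewrite -[v^-1]mul1r cRe_div // mul1r cReJ Rv nv /ker; field.
by rewrite !gt_eqF.
Qed.

(** The terms are nonnegative, so the sum may be extended to all roots and evaluated. Bernoulli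
    gives (1 + dl n)^(2^n) >= 2, so the denominator 1 - y^(2^n) has modulus at least 1/2, and the
    factors [dl n] and 2^n cancel: the bound is the same at every scale. *)
Lemma ker_sum a n z (P : pred nat) : nm z <= 1 -> 1 + dl n <= a ->
  \sum_(k < 2 ^ n | P k) dl n * ker a n k z <= 2.
Proof.
move=> z1 an; have d0 := dl_gt0 (R := R) n.
have a1 : 1 < a by lra.
have a0 : 0 < a by lra.
apply: le_trans (_ : \sum_(k < 2 ^ n) dl n * ker a n k z <= _).
  rewrite [leRHS](bigID (fun k : 'I__ => P k)) /= lerDl sumr_ge0 // => k _.
  by rewrite mulr_ge0 ?(ltW d0) // ker_ge0 // ltW.
pose y := z / a%:C%C.
have ny : nm y <= a^-1.
  by rewrite /y nmM nmV nmR gtr0_norm // ler_piMl // invr_ge0 ltW.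
have ai : a^-1 < 1 by rewrite invf_lt1.
have N2 : nm y ^+ (2 ^ n) <= 2^-1.
  apply: le_trans (_ : a^-1 ^+ (2 ^ n) <= _).
    by rewrite lerXn2r ?nnegrE ?nm_ge0 // invr_ge0 ltW.
  rewrite exprVn lef_pV2 ?posrE ?exprn_gt0 //.
  apply: le_trans (_ : (1 + dl n) ^+ (2 ^ n) <= _); last first.
    by rewrite lerXn2r ?nnegrE //; lra.
  apply: le_trans (bernoulli_le _ (ltW d0)).
  by rewrite mulrC dlE; lra.
have S : \sum_(k < 2 ^ n) dl n * ker a n k z =
    dl n * a^-1 * complex.Re ((2 ^ n)%:R / (1 - y ^+ (2 ^ n))).
  rewrite -root_kernel_sum; last exact: le_lt_trans ny ai.
  rewrite cRe_sum mulr_sumr; apply: eq_bigr => k _.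
  by rewrite kerE // -mulrA mulKf // gt_eqF.
rewrite S; apply: le_trans (_ : dl n * a^-1 * ((2 ^ n)%:R * 2) <= _).
  rewrite ler_pM2l; last by pos.
  apply: le_trans (Re_le_nm _) _.
  rewrite nmM nmn nmV; apply: ler_wpM2l => //.
  rewrite -[leRHS]invrK lef_pV2 ?posrE ?invr_gt0 //.
    by have := nm_subl 1 (y ^+ (2 ^ n)); rewrite nm1 nmX; lra.
  by have := nm_subl 1 (y ^+ (2 ^ n)); rewrite nm1 nmX; lra.
have -> : dl n / a * ((2 ^ n)%:R * 2) = 2 / a.
  have h := dlE (R := R) n; transitivity (dl n * (2 ^ n)%:R * (2 / a)); first by ring.
  by rewrite h mul1r.
by rewrite ler_pdivrMr //; lra.
Qed.

Lemma dipole_ker n k z : nm z <= 1 -> - dipole n k z <= 3 / 2 * (dl n * ker (1 + dl n) n k z).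
Proof.
move=> z1; have d0 := dl_gt0 (R := R) n.
have p1 : 0 < nm (z - zeta (1 + dl n) n k).
  by have := @zeta_far (1 + dl n) n k z; lra.
have p2 : 0 < nm (z - zeta (1 + 2 * dl n) n k).
  by have := @zeta_far (1 + 2 * dl n) n k z; lra.
rewrite dipoleE // opprK ler_pdivrMr //.
apply: le_trans (ln_leB1 _) _; first by pos.
have := dipole_sq n k z; rewrite /ker.
set A := nm (z - zeta (1 + dl n) n k) ^+ 2; set B := nm _ ^+ 2 => BA.
have A0 : 0 < A by rewrite /A exprn_gt0.
have -> : B / A - 1 = (B - A) / A by rewrite mulrBl divff // gt_eqF.
rewrite BA ler_pdivrMr //.
rewrite [leRHS](_ : _ = dl n * (3 * (1 + dl n - xco n k z))); last by field; rewrite gt_eqF.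
rewrite ler_pM2l //; have := xco_le n k z; lra.
Qed.

Lemma level_le n z (P : pred nat) : nm z <= 1 ->
  \sum_(k < 2 ^ n | P k) - dipole n k z <= 3.
Proof.
move=> z1; apply: le_trans (_ : 3 / 2 * \sum_(k < 2 ^ n | P k) dl n * ker (1 + dl n) n k z <= _).
  by rewrite mulr_sumr; apply: ler_sum => k _; exact: dipole_ker.
by have := ker_sum P z1 (lexx (1 + dl n)); lra.
Qed.

(** With e the root, 2 (1 - xco) = 1 - |z|^2 + |z - e|^2 splits the numerator, and the last term is
    comparable with the denominator because |z - e| is at most twice the distance to the pole. *)
Lemma ker_le n k z : nm z <= 1 ->
  ker (1 + dl n) n k z <= 2 + (dl n + (1 - nm z)) / nm (z - zeta (1 + dl n) n k) ^+ 2.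
Proof.
move=> z1; have d0 := dl_gt0 (R := R) n.
have p1 := @zeta_far (1 + dl n) n k z; have z0 := nm_ge0 z.
set A := nm (z - _) in p1 *.
have {}p1 : 1 + dl n - nm z <= A by apply: p1; lra.
have A0 : 0 < A by lra.
rewrite /ker -/A ler_pdivrMr ?exprn_gt0 // mulrDl divfK ?expf_neq0 ?gt_eqF //.
have h := nm_sub_pt n k z.
have e2 : nm (z - pt n k) <= 2 * A.
  apply: le_trans (nm_tri (zeta (1 + dl n) n k) _ _) _.
  rewrite nm_zeta_pt; last by lra.
  by rewrite -/A; lra.
have e4 : nm (z - pt n k) ^+ 2 <= 4 * A ^+ 2.
  by rewrite [leRHS](_ : _ = (2 * A) ^+ 2); [rewrite lerXn2r ?nnegrE ?nm_ge0 //; lra|ring].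
have : nm z ^+ 2 >= 2 * nm z - 1 by have := sqr_ge0 (nm z - 1); lra.
lra.
Qed.

End KernelSums.

Section Potential.
Context {R : realType}.
Implicit Types (E : set R[i]^o) (z w : R[i]) (n k N : nat).

Definition psum E N (f : nat -> nat -> R) : R :=
  \sum_(n < N) \sum_(k < 2 ^ n | active E n k) f n k.

(** Each active root is weighted by the length of its arc, up to the factor 2 pi. The mass thus
    integrates the number of scales at which a point of the circle is near E, which is log^+ 1/d up
    to constants. *)
Definition mass E N : R := psum E N (fun n _ => dl n).

Lemma psumS E N f : psum E N.+1 f = psum E N f + \sum_(k < 2 ^ N | active E N k) f N k.
Proof. by rewrite /psum big_ord_recr. Qed.

Lemma psum_mass_le E N f c M : 0 <= c -> mass E N <= M ->
  (forall n k, active E n k -> f n k <= c * dl n) -> psum E N f <= c * M.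
Proof.
move=> c0 mM H; apply: le_trans (ler_wpM2l c0 mM).
rewrite /mass /psum mulr_sumr; apply: ler_sum => n _.
by rewrite mulr_sumr; apply: ler_sum => k; exact: H.
Qed.

Lemma psum_norm E N f : `|psum E N f| <= psum E N (fun n k => `|f n k|).
Proof.
by apply: le_trans (ler_norm_sum _ _ _) _; apply: ler_sum => n _; exact: ler_norm_sum.
Qed.

Lemma psumB E N f g : psum E N f - psum E N g = psum E N (fun n k => f n k - g n k).
Proof. by rewrite /psum -sumrB; apply: eq_bigr => n _; rewrite sumrB. Qed.

Lemma psumN E N f : - psum E N f = psum E N (fun n k => - f n k).
Proof. by rewrite /psum -sumrN; apply: eq_bigr => n _; rewrite sumrN. Qed.

Definition gN E N z := psum E N (fun n k => dipole n k z).

Lemma avg3_psum E N z t :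
  avg3 (gN E N) z t = psum E N (fun n k => avg3 (dipole n k) z t).
Proof.
rewrite /avg3 /gN /psum -!big_split /= mulr_suml; apply: eq_bigr => n _.
by rewrite -!big_split /= mulr_suml.
Qed.

Lemma zeta_sub n k : nm (zeta (1 + 2 * dl n) n k - zeta (1 + dl n) n k) = dl n :> R.
Proof.
rewrite /zeta -mulrBl nmM nm_pt mulr1 -rmorphB /= nmR.
have -> : 1 + 2 * dl n - (1 + dl n) = dl n :> R by ring.
by rewrite gtr0_norm // dl_gt0.
Qed.

(** [avg3_ln] makes the error of each logarithm explicit; subtracting the two errors gains the
    factor [dl n], the distance of the poles. The errors can then be summed against the mass,
    uniformly in the number of scales. *)
Lemma dipole_avg n k z b t : 0 < b -> b <= nm (z - zeta (1 + dl n) n k) ->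
  b <= nm (z - zeta (1 + 2 * dl n) n k) -> 0 < t -> t <= b / 2 ->
  `|avg3 (dipole n k) z t - dipole n k z| <= 4 / b ^+ 4 * dl n * t ^+ 3.
Proof.
move=> b0 h1 h2 t0 tb; have d0 := dl_gt0 (R := R) n.
set a := zeta (1 + dl n) n k in h1 *; set a' := zeta (1 + 2 * dl n) n k in h2 *.
have za : z != a by rewrite -subr_eq0 -nm_gt0; lra.
have za' : z != a' by rewrite -subr_eq0 -nm_gt0; lra.
have -> : avg3 (dipole n k) z t - dipole n k z =
   (avg3 (fun w => ln (nm (w - a))) z t - ln (nm (z - a))) -
   (avg3 (fun w => ln (nm (w - a'))) z t - ln (nm (z - a'))).
  by rewrite /avg3 /dipole -/a -/a'; field.
rewrite !avg3_ln //; try lra.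
set x := z - a in h1 *; set x' := z - a' in h2 *.
have x0 : x != 0 by rewrite -nm_gt0; lra.
have x'0 : x' != 0 by rewrite -nm_gt0; lra.
have xx : nm (x' - x) = dl n.
  have -> : x' - x = a - a' by rewrite /x /x'; ring.
  by rewrite nmBC zeta_sub.
set p := _ / x ^+ 3; set p' := _ / x' ^+ 3.
have tb3 y : b <= nm y -> nm (t%:C%C ^+ 3 / y ^+ 3) <= 1 / 8.
  move=> yb; rewrite nmM nmV !nmX nmR gtr0_norm // ler_pdivrMr ?exprn_gt0 //; last by
    clear za' h1 h2 x0 x'0 xx tb d0 za t0; lra.
  apply: le_trans (_ : (b / 2) ^+ 3 <= _); first by rewrite lerXn2r ?nnegrE //; clear -b0 t0; lra.
  apply: le_trans (_ : 1 / 8 * b ^+ 3 <= _); first by rewrite expr_div_n !exprS expr0; clear; lra.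
  by rewrite ler_pM2l // lerXn2r ?nnegrE //; clear -b0 yb; lra.
have np := tb3 _ h1; have np' := tb3 _ h2; rewrite -/p in np; rewrite -/p' in np'.
have q1 : 7 / 8 <= nm (1 + p) by have := nm_addl 1 p; rewrite nm1; clear -np; lra.
have q2 : 7 / 8 <= nm (1 + p') by have := nm_addl 1 p'; rewrite nm1; clear -np'; lra.
have pp : nm (p - p') <= t ^+ 3 * dl n * (3 / b ^+ 4).
  have -> : p - p' = t%:C%C ^+ 3 * (x' - x) * ((x' ^+ 2 + x' * x + x ^+ 2) / (x ^+ 3 * x' ^+ 3)).
    by rewrite /p /p'; field; apply/andP.
  rewrite nmM nmM nmX nmR gtr0_norm // xx; apply: ler_wpM2l; first by pos.
  have -> : (x' ^+ 2 + x' * x + x ^+ 2) / (x ^+ 3 * x' ^+ 3) =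
     (x ^+ 3 * x')^-1 + (x ^+ 2 * x' ^+ 2)^-1 + (x * x' ^+ 3)^-1.
    by field; apply/andP.
  have bb (c d : nat) : (c + d = 4)%N -> nm (x ^+ c * x' ^+ d)^-1 <= (b ^+ 4)^-1.
    move=> cd; rewrite nmV nmM !nmX lef_pV2 ?posrE; try by [rewrite exprn_gt0|
      rewrite mulr_gt0 // exprn_gt0 //; lra].
    by rewrite -cd exprD; apply: ler_pM; rewrite ?exprn_ge0 ?(ltW b0) ?lerXn2r ?nnegrE //;
      clear -b0 h1 h2; lra.
  rewrite (_ : 3 / b ^+ 4 = (b ^+ 4)^-1 + (b ^+ 4)^-1 + (b ^+ 4)^-1); last by ring.
  apply: le_trans (nmD _ _) (lerD _ (bb 1%N 3%N erefl)).
  by apply: le_trans (nmD _ _) (lerD (bb 3%N 1%N erefl) (bb 2%N 2%N erefl)).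
rewrite -mulrBl -ln_div ?posrE; try lra.
have y1 : `|nm (1 + p) / nm (1 + p') - 1| <= 2 * nm (p - p').
  have -> : nm (1 + p) / nm (1 + p') - 1 = (nm (1 + p) - nm (1 + p')) / nm (1 + p').
    by rewrite mulrBl divff // gt_eqF //; lra.
  have e1 := nm_subl (1 + p) (1 + p'); have e2 := nm_subl (1 + p') (1 + p).
  have E : 1 + p - (1 + p') = p - p' by rewrite opprD addrACA subrr add0r.
  rewrite nmBC in e2; rewrite E in e1 e2.
  rewrite normrM normfV [`|nm (1 + p')|]ger0_norm ?nm_ge0 // ler_pdivrMr; last by clear -q2; lra.
  have := nm_ge0 (p - p') => P0; rewrite ler_norml; nra.
have y2 : `|nm (1 + p) / nm (1 + p') - 1| <= 2^-1.
  by apply: le_trans y1 _; have := nmB p p'; clear pp q2 q1 xx x0 x'0 b0 t0 tb d0 za za' h1 h2; lra.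
rewrite normrM normfV normr_nat ler_pdivrMr //.
apply: le_trans (ln_near1 y2) _.
by move: pp y1; rewrite [_ * _ * (3 / _)](_ : _ = 3 / 4 * (4 / b ^+ 4 * dl n * t ^+ 3)); [lra|field; rewrite gt_eqF].
Qed.

(** The difference is the logarithm of the modulus of a cross-ratio of w, z and the two poles, and
    the distance of that cross-ratio from 1 carries the factor |w - z| dl n. Again the mass controls
    the sum. *)
Lemma dipole_lip n k z w b : 0 < b -> b <= nm (z - zeta (1 + dl n) n k) ->
  b <= nm (z - zeta (1 + 2 * dl n) n k) -> nm (w - z) <= b / 2 -> nm (w - z) <= b ^+ 2 / 4 ->
  `|dipole n k w - dipole n k z| <= 4 / b ^+ 2 * nm (w - z) * dl n.
Proof.
move=> b0 h1 h2 wz1 wz2; have d0 := dl_gt0 (R := R) n; have d1 := dl_le1 (R := R) n.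
rewrite /dipole; have zs := zeta_sub n k.
set a := zeta (1 + dl n) n k in h1 zs *; set a' := zeta (1 + 2 * dl n) n k in h2 zs *.
have k1 := nm_tri w z a; have k2 := nm_tri w z a'.
rewrite [nm (z - w)]nmBC in k1 k2; rewrite -/a -/a' in k1 k2.
have A0 : 0 < nm (z - a) by lra.
have A'0 : 0 < nm (z - a') by lra.
have B0 : 0 < nm (w - a) by clear -b0 wz1 h1 k1; lra.
have B'0 : 0 < nm (w - a') by clear -b0 wz1 h2 k2; lra.
have -> : ln (nm (w - a)) - ln (nm (w - a')) - (ln (nm (z - a)) - ln (nm (z - a'))) =
  ln ((nm (w - a) / nm (w - a')) / (nm (z - a) / nm (z - a'))).
  by rewrite !ln_div ?posrE //; pos.
have E : nm (w - a) / nm (w - a') / (nm (z - a) / nm (z - a')) =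
  nm ((w - a) * (z - a') / ((w - a') * (z - a))).
  by rewrite nmM nmV !nmM; field; rewrite !gt_eqF.
have F : (w - a) * (z - a') / ((w - a') * (z - a)) - 1 =
   (w - z) * (a - a') / ((w - a') * (z - a)).
  have wa' : w - a' != 0 by rewrite -nm_gt0.
  have za : z - a != 0 by rewrite -nm_gt0.
  by field; apply/andP.
have G : nm ((w - z) * (a - a') / ((w - a') * (z - a))) <= 2 / b ^+ 2 * nm (w - z) * dl n.
  rewrite nmM nmV !nmM (nmBC a) zs ler_pdivrMr; last by pos.
  have n0 : 0 <= nm (w - z) * dl n by rewrite mulr_ge0 ?nm_ge0 // ltW.
  rewrite [leRHS](_ : _ = nm (w - z) * dl n * (2 / b ^+ 2 * (nm (w - a') * nm (z - a)))); last by ring.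
  rewrite ler_peMr //.
  apply: le_trans (_ : 2 / b ^+ 2 * (b / 2 * b) <= _).
    by rewrite le_eqVlt; apply/orP; left; apply/eqP; field; rewrite gt_eqF.
  rewrite ler_pM2l; last by pos.
  by apply: ler_pM => //; [pos|pos|lra].
have G2 : 2 / b ^+ 2 * nm (w - z) * dl n <= 2^-1.
  apply: le_trans (_ : 2 / b ^+ 2 * nm (w - z) * 1 <= _).
    by apply: ler_wpM2l => //; pos.
  rewrite mulr1; apply: le_trans (_ : 2 / b ^+ 2 * (b ^+ 2 / 4) <= _).
    by rewrite ler_pM2l //; pos.
  by rewrite le_eqVlt; apply/orP; left; apply/eqP; field; rewrite gt_eqF.
rewrite E.
have H : `|nm ((w - a) * (z - a') / ((w - a') * (z - a))) - 1| <= 2 / b ^+ 2 * nm (w - z) * dl n.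
  apply: le_trans G; rewrite -F; have n1 := nm1 (R := R); rewrite ler_norml; apply/andP; split.
    by have := nm_subl 1 ((w - a) * (z - a') / ((w - a') * (z - a))); rewrite nmBC n1; clear; lra.
  by have := nm_subl ((w - a) * (z - a') / ((w - a') * (z - a))) 1; rewrite n1; clear; lra.
apply: le_trans (ln_near1 (le_trans H G2)) _.
by move: H; rewrite [4 / _ * _ * _](_ : _ = 2 * (2 / b ^+ 2 * nm (w - z) * dl n)); [lra|ring].
Qed.

End Potential.

Section PotentialLimit.
Context {R : realType}.
Implicit Types (E : set R[i]^o) (z w : R[i]) (n k N : nat).

(** Dipoles are nonpositive on [cl_dom], so the partial sums decrease; once the mass is bounded, the
    infimum is their limit at each point of [cl_dom] off E. *)
Definition gE E z : R := inf (range (fun N => gN E N z)).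

Definition Om E z := nm z < 2 /\ nm z < 1 + eta * dE E z ^+ 2.

Lemma Om_cl_dom E z : Om E z -> cl_dom E z.
Proof. by move=> [h1 h2]; split; exact: ltW. Qed.

Lemma Om_dE_gt0 E z : E !=set0 -> E `<=` unit_circle -> Om E z -> 0 < dE E z.
Proof.
move=> E0 ET [_ h]; rewrite lt_neqAle dE_ge0 // andbT; apply/eqP => h0.
by move: h; rewrite -h0 expr0n mulr0; have := dE_ge_circle z E0 ET; lra.
Qed.

Lemma gN0 E z : gN E 0 z = 0. Proof. by rewrite /gN /psum big_ord0. Qed.

Lemma gN_anti E z N N' : E !=set0 -> E `<=` unit_circle -> cl_dom E z -> (N <= N')%N ->
  gN E N' z <= gN E N z.
Proof.
move=> E0 ET cz /subnK <-; elim: (N' - N)%N => [|m IH]; first by rewrite add0n.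
rewrite addSn {1}/gN psumS; apply: le_trans IH; rewrite gerDl.
by apply: sumr_le0 => k ak; exact: (dipole_le0 E0).
Qed.

Lemma gN_le0 E z N : E !=set0 -> E `<=` unit_circle -> cl_dom E z -> gN E N z <= 0.
Proof. by move=> E0 ET cz; rewrite -(gN0 E z); exact: gN_anti. Qed.

Lemma far_from_poles E z n k : E !=set0 -> E `<=` unit_circle -> cl_dom E z -> active E n k ->
  dE E z / 40 <= nm (z - zeta (1 + dl n) n k) /\ dE E z / 40 <= nm (z - zeta (1 + 2 * dl n) n k).
Proof.
move=> E0 ET cz ak.
have [_] := far_from_zeta E0 ET cz ak (lexx 1) (ler1n _ 2); rewrite mul1r => h1.
have [_ h2] := far_from_zeta E0 ET cz ak (ler1n _ 2) (lexx 2).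
by split; rewrite ler_pdivrMr // mulrC.
Qed.

Lemma gN_ge E z N M : E !=set0 -> E `<=` unit_circle -> mass E N <= M ->
  cl_dom E z -> 0 < dE E z -> - (40 / dE E z * M) <= gN E N z.
Proof.
move=> E0 ET mM cz D0; rewrite lerNl psumN; apply: psum_mass_le mM _; first by pos.
move=> n k ak; have [h1 h2] := far_from_poles E0 ET cz ak; rewrite lerNl.
have d0 := dl_gt0 (R := R) n.
have h40 : 0 < dE E z / 40 by pos.
apply: le_trans (dipole_ge (lt_le_trans h40 h1) (lt_le_trans h40 h2)).
rewrite lerN2 ler_pdivrMr; last exact: lt_le_trans h1.
apply: le_trans (ler_wpM2l _ h1); last by pos.
by rewrite le_eqVlt; apply/orP; left; apply/eqP; field; rewrite gt_eqF.
Qed.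

Transparent dl.
Lemma ln_dl n : ln (dl n) = - (n%:R * ln 2) :> R.
Proof. by rewrite /dl exprVn lnV ?posrE ?exprn_gt0 // lnXn // mulr_natl. Qed.
Opaque dl.

Lemma ln2_le1 : ln 2 <= 1 :> R.
Proof. by have := @ln_leB1 R 2 (ltr0n _ 2); lra. Qed.

Lemma dl_small (e : R) : 0 < e -> exists n, dl n < e.
Proof.
move=> e0; have [n] := ex_nat_ceil (ltW (divr_gt0 ltr01 e0)); rewrite mul1r => -[n0 h _].
exists n; have n1 : 0 < n%:R :> R by rewrite ltr0n.
apply: lt_trans (_ : n%:R^-1 < e); last first.
  by rewrite -[e]invrK ltf_pV2 ?posrE ?invr_gt0.
have -> : dl n = (2 ^ n)%:R^-1 :> R.
  by apply: (mulIf (x := (2 ^ n)%:R)); rewrite ?dlE ?mulVf // pnatr_eq0 expn_eq0.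
by rewrite ltf_pV2 ?posrE ?ltr0n ?expn_gt0 // ltr_nat ltn_expl.
Qed.

Section Bounded.
Variables (E : set R[i]^o) (M : R).
Hypotheses (E0 : E !=set0) (ET : E `<=` unit_circle) (mM : forall N, mass E N <= M).

Let has_inf_g z : cl_dom E z -> 0 < dE E z -> has_inf (range (fun N => gN E N z)).
Proof.
move=> cz D0; split; first by exists (gN E 0 z), 0%N.
by exists (- (40 / dE E z * M)) => _ [N _ <-]; apply: gN_ge => //.
Qed.

Lemma gE_le_gN z N : cl_dom E z -> 0 < dE E z -> gE E z <= gN E N z.
Proof. by move=> cz D0; apply: ge_inf; [have [] := has_inf_g cz D0|exists N]. Qed.

Lemma gE_le0 z : cl_dom E z -> 0 < dE E z -> gE E z <= 0.
Proof. by move=> cz D0; rewrite -(gN0 E z); exact: gE_le_gN. Qed.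

Lemma gE_ge_lb z c : (forall N, c <= gN E N z) -> c <= gE E z.
Proof.
move=> H; apply: lb_le_inf; first by exists (gN E 0 z), 0%N.
by move=> _ [N _ <-].
Qed.

Lemma gN_cvg z e : cl_dom E z -> 0 < dE E z -> 0 < e ->
  exists N0, forall N, (N0 <= N)%N -> `|gN E N z - gE E z| <= e.
Proof.
move=> cz D0 e0; have [_ [N0 _ <-] h] := inf_adherent e0 (has_inf_g cz D0).
exists N0 => N NN; rewrite ger0_norm ?subr_ge0 ?gE_le_gN // lerBlDl addrC.
by apply: le_trans (gN_anti E0 ET cz NN) _; rewrite addrC; exact: ltW.
Qed.

Lemma level_drop z n : cl_dom E z -> dE E z <= dl n ->
  \sum_(k < 2 ^ n | active E n k) dipole n k z <= - (1 / 144).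
Proof.
move=> cz dz; have [k kn [ak h]] := dipole_drop E0 ET cz dz.
rewrite (bigD1 (Ordinal kn)) //=; rewrite -[leRHS]addr0; apply: lerD => //.
by apply: sumr_le0 => j /andP[aj _]; exact: (dipole_le0 E0).
Qed.

Lemma gN_drop z N : cl_dom E z -> (forall n, (n < N)%N -> dE E z <= dl n) ->
  gN E N z <= - (N%:R / 144).
Proof.
move=> cz; elim: N => [|N IH] H; first by rewrite gN0 mul0r oppr0.
have := level_drop cz (H N (ltnSn N)).
have := IH (fun n nN => H n (leq_trans nN (leqnSn N))).
by rewrite {2}/gN psumS -/(gN E N z) -natr1; lra.
Qed.

(** Let m be the least scale with dl m < d. Each of the m coarser scales lowers the sum by 1/144,
    and m >= - ln d because ln 2 <= 1. The finite m is kept for the finite products used later. *)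
Lemma gN_le_ln z : cl_dom E z -> 0 < dE E z -> exists m, gN E m z <= ln (dE E z) / 144.
Proof.
move=> cz D0; have /ex_minnP [m mD mmin] := dl_small D0; exists m.
have drop : gN E m z <= - (m%:R / 144).
  apply: gN_drop => // n nm; rewrite leNgt; apply/negP => /mmin.
  by rewrite leqNgt nm.
have h3 : ln (dl m) <= ln (dE E z) by rewrite ler_ln ?posrE ?dl_gt0 // ltW.
rewrite ln_dl in h3; have h4 : m%:R * ln 2 <= m%:R :> R by rewrite ler_piMr // ln2_le1.
lra.
Qed.

Lemma gE_le_ln z : cl_dom E z -> 0 < dE E z -> gE E z <= ln (dE E z) / 144.
Proof.
move=> cz D0; have [m h] := gN_le_ln cz D0.
by apply: le_trans h; exact: gE_le_gN.
Qed.

Lemma open3_Om : open3 (Om E).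
Proof.
move=> z [h1 h2]; have D0 := dE_ge0 z E0; have e0 := eta_gt0 (R := R).
have D3 := dE_le_circle z E0 ET; have es := eta_small (R := R).
pose s := 1 + eta * dE E z ^+ 2 - nm z; have s0 : 0 < s by rewrite /s; lra.
exists (Num.min (2 - nm z) (s / 2)); first by rewrite lt_min; apply/andP; split; lra.
move=> w; rewrite lt_min => /andP[w1 w2].
have k1 := nm_subl w z; split; first by lra.
have k2 := dE_lip z w E0; rewrite nmBC in k2.
have n0 := nm_ge0 (w - z); have Dw := dE_ge0 w E0; have D1 := D3.
have Dz3 : dE E z <= 3 by lra.
have L : dE E z ^+ 2 - 6 * nm (w - z) <= dE E w ^+ 2.
  have [c|c] := leP (nm (w - z)) (dE E z).
    have : (dE E z - nm (w - z)) ^+ 2 <= dE E w ^+ 2 by rewrite lerXn2r ?nnegrE //; clear -k2 c; lra.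
    by rewrite sqrrB; have := sqr_ge0 (nm (w - z)); nra.
  by have := sqr_ge0 (dE E w); nra.
have es2 : eta * 6 <= 1 :> R by clear w2 k1 k2 n0 Dw D1 Dz3 L s0 w1 D3 h1 h2 D0 e0; lra.
have : eta * (dE E z ^+ 2 - 6 * nm (w - z)) <= eta * dE E w ^+ 2 by rewrite ler_wpM2l // ltW.
have : eta * 6 * nm (w - z) <= nm (w - z) by rewrite ler_piMl.
by move: w2 k1; rewrite /s; clear Dw D1 Dz3 L es2 k2 n0 h1 h2 D0 e0 D3 es s0 w1; lra.
Qed.

Let M_ge0 : 0 <= M.
Proof. by apply: le_trans (mM 0); rewrite /mass /psum big_ord0. Qed.

Lemma cont_gE z : Om E z -> cont_at (gE E) z.
Proof.
move=> oz e e0; have cz := Om_cl_dom oz; have D0 := Om_dE_gt0 E0 ET oz.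
set b := dE E z / 40; have b0 : 0 < b by rewrite /b; pos.
have [d d0 dO] := open3_Om oz; have M0 := M_ge0.
pose L := 4 / b ^+ 2 * M + 1; have L0 : 0 < L by rewrite /L ltr_wpDl //; pos.
exists (Num.min d (Num.min (b / 2) (Num.min (b ^+ 2 / 4) (e / (2 * L))))).
  by rewrite !lt_min d0 /=; apply/and3P; split; pos.
move=> w; rewrite !lt_min => /and4P[w1 w2 w3 w4].
have ow := dO _ w1; have cw := Om_cl_dom ow; have Dw := Om_dE_gt0 E0 ET ow.
have e8 : 0 < e / 8 by lra.
have [N1 H1] := gN_cvg cz D0 e8; have [N2 H2] := gN_cvg cw Dw e8.
have {}H1 := H1 _ (leq_maxl N1 N2); have {}H2 := H2 _ (leq_maxr N1 N2).
set N := maxn N1 N2 in H1 H2.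
have H3 : `|gN E N w - gN E N z| <= 4 / b ^+ 2 * nm (w - z) * M.
  rewrite /gN psumB; apply: le_trans (psum_norm _ _ _) _.
  apply: psum_mass_le (mM N) _; first by have := nm_ge0 (w - z); pos.
  move=> n k ak; have [f1 f2] := far_from_poles E0 ET cz ak.
  by apply: dipole_lip => //; exact: ltW.
have H4 : 4 / b ^+ 2 * nm (w - z) * M <= e / 2.
  apply: le_trans (_ : L * nm (w - z) <= _).
    by have := nm_ge0 (w - z); rewrite /L; clear e e0 D0 b0 d0 M0 L0 w1 w2 w3 w4 Dw e8 H1 H2 H3; lra.
  by rewrite mulrC -ler_pdivlMr // -mulrA -invfM ltW.
move: H1 H2 H3 H4; rewrite !ler_norml ltr_norml => /andP[a1 a2] /andP[a3 a4] /andP[a5 a6] a7.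
apply/andP; split; clear -e e0 a1 a2 a3 a4 a5 a6 a7; lra.
Qed.

(** Summed over the dipoles, the constant of [dipole_avg] is bounded by the mass, so the mean value
    estimate holds for [gN] uniformly in N and passes to the limit. *)
Lemma harm3_gE z : Om E z -> harm3 (gE E) z.
Proof.
move=> oz; have cz := Om_cl_dom oz; have D0 := Om_dE_gt0 E0 ET oz.
set b := dE E z / 40; have b0 : 0 < b by rewrite /b; pos.
have [d d0 dO] := open3_Om oz; have M0 := M_ge0.
exists (4 / b ^+ 4 * M), (Num.min d (b / 2)).
split; [by rewrite lt_min d0 /=; pos|by pos|].
move=> t t0; rewrite lt_min => /andP[t1 t2]; apply/ler_addgt0Pr => e e0.
have e8 : 0 < e / 8 by lra.
have near (u : R[i]) : nm u = 1 -> exists N0, forall N, (N0 <= N)%N ->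
    `|gN E N (z + t%:C%C * u) - gE E (z + t%:C%C * u)| <= e / 8.
  move=> u1; have ou : Om E (z + t%:C%C * u).
    by apply: dO; rewrite addrC addKr nmM u1 mulr1 nmR gtr0_norm.
  by apply: gN_cvg => //; [exact: Om_cl_dom|exact: Om_dE_gt0].
have [N1 H1] := gN_cvg cz D0 e8; have [N2 H2] := near 1 nm1.
have [N3 H3] := near _ (nm_om3 (R := R)); have [N4 H4] := near _ (nm_om3X (R := R) 2).
pose N := maxn (maxn N1 N2) (maxn N3 N4).
have {}H1 : `|gN E N z - gE E z| <= e / 8 by apply: H1; rewrite !leq_max leqnn.
have {}H2 : `|gN E N (z + t%:C%C) - gE E (z + t%:C%C)| <= e / 8.
  by have := H2 N; rewrite mulr1; apply; rewrite !leq_max leqnn orbT.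
have {}H3 := H3 N; have {}H4 := H4 N.
have {}H3 := H3 _; have {}H4 := H4 _.
move: H3 H4; rewrite !leq_max !leqnn !orbT /= => /(_ isT) H3 /(_ isT) H4.
have H5 : `|avg3 (gN E N) z t - gN E N z| <= 4 / b ^+ 4 * M * t ^+ 3.
  rewrite avg3_psum /gN psumB; apply: le_trans (psum_norm _ _ _) _.
  rewrite mulrAC; apply: psum_mass_le (mM N) _; first by pos.
  move=> n k ak; have [f1 f2] := far_from_poles E0 ET cz ak.
  by rewrite mulrAC; apply: dipole_avg => //; exact: ltW.
move: H1 H2 H3 H4 H5; rewrite /avg3 !ler_norml.
move=> /andP[a1 a2] /andP[a3 a4] /andP[a5 a6] /andP[a7 a8] /andP[a9 b1].
apply/andP; split; lra.
Qed.

End Bounded.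
End PotentialLimit.

(** * Lower bounds for the potential *)

Section PotentialGrowth.
Context {R : realType}.
Implicit Types (E : set R[i]^o) (z w : R[i]) (n k m N : nat).

Lemma dl_add m p : dl (m + p) = dl m * dl p :> R.
Proof. by elim: m => [|m IH]; rewrite ?dl0 ?mul1r // addSn !dlS IH mulrA. Qed.

Lemma pt_parent m n k : (m <= n)%N ->
  nm (pt n k - pt m (k %/ 2 ^ (n - m)) : R[i]) <= 8 * dl m.
Proof.
move=> mn; set p := (n - m)%N; set j := (k %/ 2 ^ p)%N.
have nE : dl n = dl m * dl p :> R by rewrite -dl_add subnKC.
have d0 := dl_gt0 (R := R) m; have p0 := dl_gt0 (R := R) p; have pi0 := pi_gt0 R.
have h1 : j%:R <= k%:R * dl p :> R.
  have : (j * 2 ^ p)%:R <= k%:R :> R by rewrite ler_nat leq_trunc_div.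
  by rewrite natrM => /(ler_wpM2r (ltW p0)); rewrite -mulrA [(2 ^ p)%:R * dl p]mulrC dlE mulr1.
have h2 : k%:R * dl p <= j.+1%:R :> R.
  have : k%:R <= (j.+1 * 2 ^ p)%:R :> R by rewrite ler_nat ltnW // ltn_ceil // expn_gt0.
  by rewrite natrM => /(ler_wpM2r (ltW p0)); rewrite -mulrA [(2 ^ p)%:R * dl p]mulrC dlE mulr1.
apply: pt_near_expi; rewrite nE.
have -> : 2 * pi * k%:R * (dl m * dl p) = 2 * pi * dl m * (k%:R * dl p) :> R by ring.
have e (x : R) : 2 * pi * x * dl m = 2 * pi * dl m * x by ring.
by rewrite !e; apply/andP; split; apply: ler_wpM2l => //; pos.
Qed.

Lemma ker_ge a n k z : nm z <= 1 -> 1 < a -> (a - nm z) / nm (z - zeta a n k) ^+ 2 <= ker a n k z.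
Proof.
move=> z1 a1; rewrite /ker; apply: ler_wpM2r; first by rewrite invr_ge0 sqr_ge0.
by rewrite lerD2l lerN2 xco_le.
Qed.

(** At this height z cannot tell a fine root from its ancestor at scale m: their poles are within
    [10 * dl m] of each other and z is at least [dl m] from the finer one, so the distances have
    ratio at most 11. *)
Lemma ker_parent m n k z : (m <= n)%N -> nm z <= 1 -> dl m <= 1 - nm z -> 1 - nm z <= 2 * dl m ->
  ker (1 + dl n) n k z <= 2 + 3 * 11 ^+ 2 * ker (1 + dl m) m (k %/ 2 ^ (n - m)) z.
Proof.
move=> mn z1 h1 h2; set j := (k %/ _)%N.
have d0 := dl_gt0 (R := R) m; have n0 := dl_gt0 (R := R) n; have nm' := dl_le (R := R) mn.
apply: le_trans (ker_le _ _ z1) _; rewrite lerD2l.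
have dm1 : 1 < 1 + dl m :> R by rewrite ltrDl.
have kg := ker_ge m j z1 dm1.
suff : (dl n + (1 - nm z)) / nm (z - zeta (1 + dl n) n k) ^+ 2 <=
    3 * 11 ^+ 2 * ((1 + dl m - nm z) / nm (z - zeta (1 + dl m) m j) ^+ 2).
  by move=> h; apply: le_trans h _; exact: ler_wpM2l.
clear kg; have a1 := @zeta_far R (1 + dl n) n k z; have a2 := @zeta_far R (1 + dl m) m j z.
have {}a1 := a1 ltac:(clear -n0; lra); have {}a2 := a2 ltac:(clear -d0; lra).
have t1' := nm_tri (zeta (1 + dl n) n k) z (zeta (1 + dl m) m j).
have t2 := nm_tri (pt n k : R[i]) (zeta (1 + dl n) n k) (zeta (1 + dl m) m j).
have t3 := nm_tri (pt m j : R[i]) (pt n k) (zeta (1 + dl m) m j).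
have t4 := pt_parent k mn; rewrite -/j in t4.
have t5 := @nm_zeta_pt R (1 + dl n) n k ltac:(clear -n0; lra).
have t6 := @nm_zeta_pt R (1 + dl m) m j ltac:(clear -d0; lra).
rewrite nmBC in t6.
move: a1 a2 t1' t2 t3 t4 t5 t6.
set A := nm (z - zeta _ n k); set B := nm (z - zeta _ m j) => a1 a2 t1' t2 t3 t4 t5 t6.
have BA : B <= 11 * A by clear -t1' t2 t3 t4 t5 t6 a1 nm' n0 d0 h1 h2; lra.
have A0 : 0 < A by clear -a1 h1 d0 n0; lra.
have B0 : 0 < B by clear -a2 h1 d0; lra.
have B2 : B ^+ 2 <= 11 ^+ 2 * A ^+ 2.
  have : B ^+ 2 <= (11 * A) ^+ 2 by rewrite lerXn2r ?nnegrE //; clear -A0 B0; lra.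
  by rewrite exprMn.
rewrite mulrA ler_pdivrMr; last by pos.
rewrite mulrAC ler_pdivlMr; last by pos.
apply: le_trans (_ : 3 * dl m * B ^+ 2 <= _).
  by apply: ler_wpM2r; [exact: sqr_ge0|clear -h2 nm' z1; lra].
apply: le_trans (_ : 3 * dl m * (11 ^+ 2 * A ^+ 2) <= _); first by apply: ler_wpM2l; [clear -d0; lra|].
have -> : 3 * dl m * (11 ^+ 2 * A ^+ 2) = 3 * 11 ^+ 2 * dl m * A ^+ 2 by ring.
by apply: ler_wpM2r; [exact: sqr_ge0|clear -h1 d0; lra].
Qed.

Lemma psum_sumr E N (I : finType) (F : I -> nat -> nat -> R) :
  psum E N (fun n k => \sum_j F j n k) = \sum_j psum E N (F j).
Proof.
by rewrite /psum [RHS]exchange_big; apply: eq_bigr => n _; rewrite exchange_big.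
Qed.

Lemma psumZ E N c f : psum E N (fun n k => c * f n k) = c * psum E N f.
Proof. by rewrite /psum mulr_sumr; apply: eq_bigr => n _; rewrite mulr_sumr. Qed.

Lemma gN_level E N z c : nm z <= 1 -> c <= gN E N z -> c - 3 <= gN E N.+1 z.
Proof.
move=> z1 h; rewrite /gN psumS -/(gN E N z).
by have := @level_le R N z (active E N) z1; rewrite sumrN; lra.
Qed.

Lemma gN_levels E N z : nm z <= 1 -> - (3 * N%:R) <= gN E N z.
Proof.
move=> z1; elim: N => [|N IH]; first by rewrite gN0 mulr0 oppr0.
by have := gN_level z1 IH; rewrite -natr1; lra.
Qed.

Definition desc m j n k : R := if (m <= n)%N && (k %/ 2 ^ (n - m) == j)%N then dl n else 0.

(** Discrete form of condition (i): the j-th arc of scale m has length 2 pi dl m, the left side is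
    the mass of the active roots descending from it, and [m.+1] plays the part of log 1/|L|. *)
Definition log_dense E C := forall m j N, (j < 2 ^ m)%N ->
  psum E N (desc m j) <= C * dl m * m.+1%:R.

Lemma desc_ge0 m j n k : 0 <= desc m j n k.
Proof. by rewrite /desc; case: ifP => // _; rewrite ltW // dl_gt0. Qed.

Lemma psum_ge0 E N f : (forall n k, active E n k -> 0 <= f n k) -> 0 <= psum E N f.
Proof. by move=> H; apply: sumr_ge0 => n _; apply: sumr_ge0 => k; exact: H. Qed.

(** The m coarser scales cost at most 3 each. Finer dipoles are charged to their ancestors at scale
    m through [ker_parent]; the descendants of one arc have mass at most C dl m (m + 1), and
    [ker_sum] bounds the total weight of the ancestors by 3/2 (2 + 363 . 2) = 1092. *)
Lemma gN_log_dense E C m N z : 0 <= C -> log_dense E C -> nm z <= 1 -> dl m <= 1 - nm z ->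
  1 - nm z <= 2 * dl m -> - ((3 + 1092 * C) * m.+1%:R) <= gN E N z.
Proof.
move=> C0 HC z1 h1 h2; have d0 := dl_gt0 (R := R) m.
pose W j := 3 / 2 * (2 + 3 * 11 ^+ 2 * ker (1 + dl m) m j z).
have W0 j : 0 <= W j.
  by have := @ker_ge0 R (1 + dl m) m j z z1 ltac:(lra); rewrite /W; lra.
pose F n k := \sum_(j < 2 ^ m) W j * desc m j n k.
have F0 n k : 0 <= F n k by apply: sumr_ge0 => j _; rewrite mulr_ge0 // desc_ge0.
have FN : psum E N F <= 1092 * C * m.+1%:R.
  rewrite /F psum_sumr; under eq_bigr do rewrite psumZ.
  apply: le_trans (_ : \sum_(j < 2 ^ m) W j * (C * dl m * m.+1%:R) <= _).
    by apply: ler_sum => j _; apply: ler_wpM2l; [exact: W0|exact: HC].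
  rewrite -mulr_suml (_ : _ * _ = (\sum_(j < 2 ^ m) dl m * W j) * (C * m.+1%:R)); last first.
    transitivity ((\sum_(j < 2 ^ m) W j) * (dl m * (C * m.+1%:R))); first by congr (_ * _); ring.
    by rewrite mulrA [_ * dl m]mulrC mulr_sumr.
  rewrite -mulrA; apply: ler_wpM2r; first by rewrite mulr_ge0.
  rewrite (_ : \sum_(j < 2 ^ m) dl m * W j = 3 / 2 * (2 * \sum_(j < 2 ^ m) dl m +
     3 * 11 ^+ 2 * \sum_(j < 2 ^ m) dl m * ker (1 + dl m) m j z)); last first.
    by rewrite !mulr_sumr -big_split mulr_sumr; apply: eq_bigr => j _ /=; rewrite /W; ring.
  have -> : \sum_(j < 2 ^ m) dl m = 1 :> R by rewrite sumr_const card_ord -mulr_natr dlE.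
  by have := @ker_sum R (1 + dl m) m z xpredT z1 (lexx _); lra.
have C1 : 0 <= C * m.+1%:R by rewrite mulr_ge0.
suff H : - (3 * m%:R + psum E N F) <= gN E N z.
  by apply: le_trans H; rewrite lerN2; move: FN; have := natr1 (R := R) m; set x := m.+1%:R => e;
    clear -e; lra.
have [Nm|/ltnW] := leqP N m.
  apply: le_trans (gN_levels E N z1); rewrite lerN2.
  have : N%:R <= m%:R :> R by rewrite ler_nat.
  by have := @psum_ge0 E N F (fun n k _ => F0 n k); clear; lra.
move=> /subnK <-; elim: (N - m)%N => [|p IH].
  rewrite add0n; apply: le_trans (gN_levels E m z1).
  by have := @psum_ge0 E m F (fun n k _ => F0 n k); clear; lra.
rewrite addSn /gN !psumS -/(gN E (p + m) z) addrA opprD.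
apply: lerD IH _; rewrite lerNl -sumrN; apply: ler_sum => k ak.
have mp : (m <= p + m)%N by rewrite leq_addl.
pose j := (k %/ 2 ^ (p + m - m))%N.
have jm : (j < 2 ^ m)%N by rewrite /j addnK ltn_divLR ?expn_gt0 // -expnD (addnC m) ltn_ord.
rewrite /F (bigD1 (Ordinal jm)) //= {1}/desc mp /= eqxx; apply: ler_wpDr.
  by apply: sumr_ge0 => i _; rewrite mulr_ge0 // desc_ge0.
apply: le_trans (dipole_ker _ _ z1) _; rewrite /W.
have -> : 3 / 2 * (2 + 3 * 11 ^+ 2 * ker (1 + dl m) m j z) * dl (p + m) =
  3 / 2 * (dl (p + m) * (2 + 3 * 11 ^+ 2 * ker (1 + dl m) m j z)) by ring.
apply: ler_wpM2l => //; apply: ler_wpM2l; first by rewrite ltW // dl_gt0.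
exact: ker_parent.
Qed.

Lemma ln2_ge : 1 / 2 <= ln 2 :> R.
Proof. by have := @ln_ge1VB R 2 (ltr0n _ 2); lra. Qed.

Lemma dl_scale (s : R) : 0 < s -> s <= 2 -> exists m, dl m <= s /\ s <= 2 * dl m.
Proof.
move=> s0 s2; have ex : exists n, dl n <= s.
  by have [n h] := dl_small s0; exists n; exact: ltW.
have /ex_minnP [m ms mmin] := ex; exists m; split => //.
case: m ms mmin => [|m] ms mmin; first by rewrite dl0 mulr1.
rewrite dlS mulrA divff ?mul1r // leNgt; apply/negP => h.
by have := mmin m (ltW h); rewrite ltnn.
Qed.

Lemma dl_log m (s : R) : 0 < s -> s <= 2 * dl m -> m%:R <= 2 * ln s^-1 + 2.
Proof.
move=> s0 h; have d0 := dl_gt0 (R := R) m.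
have : ln s <= ln (2 * dl m) by rewrite ler_ln ?posrE //; pos.
rewrite lnM ?posrE // ln_dl lnV ?posrE //.
have := ln2_ge; have := @ln2_le1 R => h1 h2 h3.
have : m%:R * (1 / 2) <= m%:R * ln 2 :> R by rewrite ler_wpM2l.
lra.
Qed.

Lemma gE_log_dense E C M : E !=set0 -> E `<=` unit_circle -> (forall N, mass E N <= M) ->
  0 <= C -> log_dense E C ->
  exists2 C', 0 <= C' & forall z, nm z < 1 -> - gE E z <= C' * (1 + ln (1 - nm z)^-1).
Proof.
move=> E0 ET mM C0 HC; exists (3 * (3 + 1092 * C)); first by lra.
move=> z z1; have s0 : 0 < 1 - nm z by lra.
have [m [m1 m2]] := dl_scale s0 ltac:(have := nm_ge0 z; lra).
rewrite lerNl; apply: gE_ge_lb => N.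
apply: le_trans (gN_log_dense N C0 HC (ltW z1) m1 m2); rewrite lerN2.
have := dl_log s0 m2; rewrite -natr1 => h.
rewrite [3 * _]mulrC -mulrA; apply: ler_wpM2l; first by lra.
have : 0 <= ln (1 - nm z)^-1 by rewrite lnV ?posrE // oppr_ge0; apply: ln_le0; have := nm_ge0 z; lra.
lra.
Qed.

Lemma massS E N : mass E N <= mass E N.+1.
Proof. by rewrite /mass psumS lerDl; apply: sumr_ge0 => k _; rewrite ltW // dl_gt0. Qed.

Lemma mass_tail E M e : (forall N, mass E N <= M) -> 0 < e ->
  exists N0, forall N, mass E N <= mass E N0 + e.
Proof.
move=> mM e0; have hs : has_sup (range (mass E)).
  by split; [exists (mass E 0), 0%N|exists M => _ [N _ <-]].
have [_ [N0 _ <-] h] := sup_adherent e0 hs.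
exists N0 => N; rewrite -lerBlDr; apply: le_trans (ltW h); rewrite lerD2r.
by apply: ub_le_sup; [have [] := hs|exists N].
Qed.

(** In the disc a dipole of scale n is at least - dl n/(1 - |z|). N0 is chosen so that the mass
    beyond it is at most e; the scales before it cost at most 3 each. *)
Lemma gE_small E M e : E !=set0 -> E `<=` unit_circle -> (forall N, mass E N <= M) -> 0 < e ->
  exists2 C, 0 <= C & forall z, nm z < 1 -> - gE E z <= e / (1 - nm z) + C.
Proof.
move=> E0 ET mM e0; have [N0 H] := mass_tail mM e0.
exists (3 * N0%:R) => [|z z1]; first by rewrite mulr_ge0.
have s0 : 0 < 1 - nm z by lra.
have cz := disc_cl_dom E0 (ltW z1).
rewrite lerNl; apply: gE_ge_lb => N.
apply: le_trans (gN_anti E0 ET cz (leq_maxl N N0)).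
set N' := maxn N N0; have : (N0 <= N')%N by exact: leq_maxr.
suff K : forall N, (N0 <= N)%N -> - (3 * N0%:R + (mass E N - mass E N0) / (1 - nm z)) <= gN E N z.
  move=> h; apply: le_trans (K _ h); rewrite lerN2 addrC lerD2r.
  by apply: ler_wpM2r; [rewrite invr_ge0 ltW|have := H N'; lra].
move=> N1 /subnK <-; elim: (N1 - N0)%N => [|p IH].
  by rewrite add0n subrr mul0r addr0; exact: gN_levels (ltW z1).
rewrite addSn /gN /mass !psumS -/(gN E (p + N0) z) -/(mass E (p + N0)) -/(mass E N0).
have -> : forall a b c d : R, - (a + (b + c - d) / (1 - nm z)) = - (a + (b - d) / (1 - nm z)) - c / (1 - nm z).
  by move=> a b c d; field; rewrite gt_eqF.
apply: lerD IH _; rewrite lerNl -sumrN mulr_suml; apply: ler_sum => k ak.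
have d0 := dl_gt0 (R := R) (p + N0).
have a1 := @zeta_far R (1 + dl (p + N0)) (p + N0) k z ltac:(lra).
have a2 := @zeta_far R (1 + 2 * dl (p + N0)) (p + N0) k z ltac:(lra).
rewrite lerNl; apply: le_trans (dipole_ge _ _); try by [lra | clear -a1 d0 s0; lra|clear -a2 d0 s0; lra].
by rewrite lerN2; apply: ler_pM => //; try pos; rewrite lef_pV2 ?posrE //; clear -a1 d0 s0; lra.
Qed.

(** At distance s from E all poles are at least s/40 away, so the kernel of radius 1 + dl n is at
    most 2 plus 41^2 dl n/s times that of radius 1 + s, whose sum is bounded. Over the finer scales
    the first part adds up to the mass, the second to a geometric series. *)
Lemma level_tail E w n : E !=set0 -> E `<=` unit_circle -> nm w = 1 -> dl n <= dE E w ->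
  \sum_(k < 2 ^ n | active E n k) - dipole n k w <=
  3 * \sum_(k < 2 ^ n | active E n k) dl n + (3 * 41 ^+ 2) * (dl n / dE E w).
Proof.
move=> E0 ET w1 hs; have d0 := dl_gt0 (R := R) n; set s := dE E w in hs *.
have w1' : nm w <= 1 by rewrite w1.
have s0 : 0 < s by exact: lt_le_trans hs.
have cw := disc_cl_dom E0 w1'.
apply: le_trans (_ : \sum_(k < 2 ^ n | active E n k)
    (3 * dl n + 3 * 41 ^+ 2 / 2 * (dl n / s) * (dl n * ker (1 + s) n k w)) <= _); last first.
  rewrite big_split /= -mulr_sumr lerD2l -mulr_sumr.
  apply: le_trans (ler_wpM2l _ (@ker_sum R (1 + s) n w (active E n) w1' _)) _.
  - by clear -d0 s0; pos.
  - by rewrite lerD2l.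
  - by rewrite le_eqVlt; apply/orP; left; apply/eqP; field; rewrite gt_eqF.
apply: ler_sum => k ak.
apply: le_trans (dipole_ker _ _ w1') _.
have [f1 _] := far_from_poles E0 ET cw ak; rewrite -/s in f1.
have K2 : ker (1 + dl n) n k w <= 2 + 41 ^+ 2 * (dl n / s) * ker (1 + s) n k w.
  apply: le_trans (ker_le _ _ w1') _; rewrite lerD2l w1 subrr addr0.
  apply: le_trans (ler_wpM2l _ (ker_ge n k w1' _)); [|by pos|by lra].
  rewrite w1 addrAC subrr add0r.
  have t1 := nm_tri (zeta (1 + dl n) n k) w (zeta (1 + s) n k).
  have t2 : nm (zeta (1 + dl n) n k - zeta (1 + s) n k) = s - dl n.
    rewrite /zeta -mulrBl nmM nm_pt mulr1 -rmorphB /= nmR.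
    have -> : 1 + dl n - (1 + s) = - (s - dl n) by ring.
    by rewrite normrN ger0_norm //; clear -hs; lra.
  have a2 := @zeta_far R (1 + s) n k w ltac:(lra).
  move: f1 t1 a2; set A := nm (w - zeta _ n k); set B := nm (w - zeta (1 + s) n k) => f1 t1 a2.
  have A0 : 0 < A by clear -d0 hs f1; lra.
  have B0 : 0 < B by clear -w1 d0 hs a2; lra.
  have BA : B <= 41 * A by clear -d0 t2 f1 t1; lra.
  have B2 : B ^+ 2 <= 41 ^+ 2 * A ^+ 2.
    have : B ^+ 2 <= (41 * A) ^+ 2 by rewrite lerXn2r ?nnegrE //; clear -w1 d0 hs f1 a2; lra.
    by rewrite exprMn.
  have -> : 41 ^+ 2 * (dl n / s) * (s / B ^+ 2) = 41 ^+ 2 * dl n / B ^+ 2.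
    by field; rewrite !gt_eqF.
  rewrite ler_pdivrMr; last by pos.
  rewrite mulrAC ler_pdivlMr; last by pos.
  by rewrite [41 ^+ 2 * _]mulrC -mulrA ler_pM2l.
apply: le_trans (_ : 3 / 2 * (dl n * (2 + 41 ^+ 2 * (dl n / s) * ker (1 + s) n k w)) <= _).
  by apply: ler_wpM2l => //; apply: ler_wpM2l; [exact: ltW|].
by rewrite le_eqVlt; apply/orP; left; apply/eqP; field; rewrite gt_eqF.
Qed.

(** Scales coarser than d + dl N cost 3 each, and [level_tail] bounds the others together. The slope
    6 is 3/ln 2 with ln 2 >= 1/2; it decides the exponent of the polynomial later compared with
    [gN]. *)
Lemma gN_circle E M : E !=set0 -> E `<=` unit_circle -> (forall N, mass E N <= M) ->
  exists2 C, 0 <= C & forall w N, nm w = 1 -> - gN E N w <= C - 6 * ln (dE E w + dl N).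
Proof.
move=> E0 ET mM; have M0 : 0 <= M.
  by apply: le_trans (mM 0); rewrite /mass /psum big_ord0.
have l3 : 0 <= ln 4 :> R by rewrite ln_ge0 // ler1n.
have l2 := ln2_ge; have l1 := @ln2_le1 R.
exists (3 * M + 2 * (3 * 41 ^+ 2) + 6 * ln 4); first by lra.
move=> w N w1; have w1' : nm w <= 1 by rewrite w1.
have D0 := dE_ge0 w E0; have D2 := dE_le_circle w E0 ET; rewrite w1 in D2.
have N0 := dl_gt0 (R := R) N.
(* It suffices to find a scale m comparable with d + dl N such that the scales beyond m contribute a
   bounded amount. *)
have fin m : - gN E N w <= 3 * m%:R + 3 * M + 2 * (3 * 41 ^+ 2) -> dE E w + dl N <= 4 * dl m ->
    - gN E N w <= 3 * M + 2 * (3 * 41 ^+ 2) + 6 * ln 4 - 6 * ln (dE E w + dl N).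
  move=> h1 h2; have dm := dl_gt0 (R := R) m.
  have : ln (dE E w + dl N) <= ln (4 * dl m) by rewrite ler_ln ?posrE //; [lra|pos].
  rewrite lnM ?posrE // ln_dl => h3.
  have h4 : m%:R * (1 / 2) <= m%:R * ln 2 :> R by rewrite ler_wpM2l.
  by clear -h1 h3 h4; lra.
have [big|] := pselect (forall n, (n < N)%N -> dE E w < dl n).
  apply: (fin N); first by have := gN_levels E N w1'; clear -M0; lra.
  case: N N0 big fin => [|N] N0 big _; first by rewrite dl0; clear -D2; lra.
  by have := big N (ltnSn N); rewrite dlS in N0 *; clear -N0; lra.
move=> /existsNP [n /not_implyP [nN /negP]]; rewrite -leNgt => dn.
have s0 : 0 < dE E w by apply: lt_le_trans dn; exact: dl_gt0.
have [m [m1 m2]] := dl_scale s0 ltac:(clear -D2; lra).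
have mm : dl N <= dE E w by apply: le_trans dn; exact: dl_le (ltnW nN).
apply: (fin m); last by clear -m2 mm m1 N0; have := dl_gt0 (R := R) m; lra.
have [Nm|/ltnW mN] := leqP N m.
  have := gN_levels E N w1'; have : N%:R <= m%:R :> R by rewrite ler_nat.
  by clear -M0; lra.
have H p : - gN E (p + m) w <= 3 * m%:R + 3 * mass E (p + m) + (3 * 41 ^+ 2) * ((2 * dl m - 2 * dl (p + m)) / dE E w).
  elim: p => [|p IH].
    rewrite add0n subrr mul0r mulr0 addr0; have := gN_levels E m w1'.
    by have : 0 <= mass E m; [apply: psum_ge0 => *; rewrite ltW // dl_gt0|clear; lra].
  have pm : dl (p + m) <= dE E w by apply: le_trans m1; rewrite dl_le // leq_addl.
  have := level_tail E0 ET w1 pm; rewrite sumrN.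
  rewrite addSn /gN /mass !psumS -/(gN E (p + m) w) -/(mass E (p + m)) dlS.
  set S := \sum_(k < _ | _) dipole _ _ _; set S' := \sum_(k < _ | _) dl _.
  have -> : (2 * dl m - 2 * (2^-1 * dl (p + m))) / dE E w =
    (2 * dl m - 2 * dl (p + m)) / dE E w + dl (p + m) / dE E w by field; rewrite gt_eqF.
  by move: IH; clear; lra.
have := H (N - m)%N; rewrite subnK //; have := mM N => h1 h2.
have : (2 * dl m - 2 * dl N) / dE E w <= 2 by rewrite ler_pdivrMr //; clear -m1 N0; lra.
by clear -h1 h2; lra.
Qed.

End PotentialGrowth.

(** * Integrals over arcs and the potential *)

Section IntegralVsPotential.
Context {R : realType}.
Implicit Types (E : set R[i]^o) (n k m N : nat) (t : R).

Lemma dist_dE E z : E !=set0 -> dist z E = (dE E z)%:E.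
Proof.
move=> [w Ew]; rewrite /dist /dE -ereal_inf_EFin; last by exists (nm (z - w)), w.
  by congr ereal_inf; apply/seteqP; split => [_ [u Eu <-]|_ [_ [u Eu <-] <-]];
    [exists (nm (z - u)) => //; exists u|exists u].
by exists 0 => _ [u Eu <-]; exact: nm_ge0.
Qed.

Lemma logpE E t : E !=set0 -> logp_inv_dist E t =
  if dE E (expi t) == 0 then +oo%E else (Num.max 0 (- ln (dE E (expi t))))%:E.
Proof.
move=> E0; rewrite /logp_inv_dist dist_dE //; have := dE_ge0 (expi t) E0.
rewrite le_eqVlt => /predU1P[<-|d0]; first by rewrite eqxx inve0; apply: max_r; exact: leey.
by rewrite gt_eqF // inver gt_eqF //= leNgt invr_gt0 d0 /= lnV ?posrE // EFin_max.
Qed.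

Lemma logp_set0 t : logp_inv_dist set0 t = 0%E :> \bar R.
Proof.
by rewrite /logp_inv_dist /dist image_set0 ereal_inf0 invey /= lexx; apply: max_l; exact: leNye.
Qed.

Lemma logp_ge0 E t : (0 <= logp_inv_dist E t)%E.
Proof. by rewrite /logp_inv_dist le_max lexx. Qed.

Lemma dE_expi_lip E s t : E !=set0 -> `|dE E (expi s) - dE E (expi t)| <= `|s - t|.
Proof.
move=> E0; have h1 := dE_lip (expi s) (expi t) E0; have h2 := dE_lip (expi t) (expi s) E0.
have h3 := nm_expi_sub s t; rewrite nmBC in h2.
by rewrite ler_norml; apply/andP; split; lra.
Qed.

Lemma measurable_dE E (D : set R) : E !=set0 -> measurable D ->
  measurable_fun D (fun t => dE E (expi t)).
Proof.
move=> E0 mD; apply: measurable_funTS; apply: continuous_measurable_fun => t.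
apply/cvgrPdist_le => e e0; near=> s.
apply: le_trans (dE_expi_lip _ _ E0) _; near: s.
by exact: (@cvgrPdist_le _ _ _ (nbhs t) _ id t).1.
Unshelve. all: by end_near. Qed.

Lemma measurable_logp E (D : set R) : E !=set0 -> measurable D ->
  measurable_fun D (logp_inv_dist E).
Proof.
move=> E0 mD; apply: measurable_funTS.
have mdE := @measurable_dE E setT E0 measurableT.
apply: (eq_measurable_fun (fun t => if dE E (expi t) == 0 then +oo%E
   else (Num.max 0 (- ln (dE E (expi t))))%:E)); first by move=> t _; rewrite logpE.
apply: measurable_fun_ifT; first exact: measurable_fun_eqr.
  exact: measurable_cst.
apply/measurable_EFinP; apply: measurable_maxr; first exact: measurable_cst.
by apply: measurable_funN; apply: measurableT_comp => //; exact: measurable_ln.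
Qed.

(** Half-open, so that the arcs of one scale are disjoint. The offset moves them by whole turns, for
    intervals that leave [0, 2 pi). *)
Definition arc (a : R) n k : set R := `[2 * pi * k%:R * dl n + a, 2 * pi * k.+1%:R * dl n + a[.

Lemma measurable_arc a n k : measurable (arc a n k).
Proof. exact: measurable_itv. Qed.

Lemma arc_len a n k : lebesgue_measure (arc a n k) = (2 * pi * dl n)%:E.
Proof.
have d0 := dl_gt0 (R := R) n; have pi0 := pi_gt0 R.
have p0 : 0 < 2 * pi * dl n :> R by pos.
rewrite /arc lebesgue_measure_itv /= lte_fin ifT; last by rewrite -natr1; lra.
by rewrite -EFinD; congr EFin; rewrite -natr1; ring.
Qed.

Lemma arc_uniq a n k k' t : arc a n k t -> arc a n k' t -> k = k'.
Proof.
have d0 := dl_gt0 (R := R) n; have pi0 := pi_gt0 R.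
have p0 : 0 < 2 * pi * dl n :> R by pos.
rewrite /arc /= !in_itv /= => /andP[a1 a2] /andP[a3 a4].
have e (x : R) : 2 * pi * x * dl n = 2 * pi * dl n * x by ring.
rewrite !e in a1 a2 a3 a4; apply/eqP; rewrite eqn_leq -[(k <= k')%N]ltnS -[(k' <= k)%N]ltnS -2!(ltr_nat R).
by apply/andP; split; rewrite -(ltr_pM2l p0); clear d0 pi0 p0; lra.
Qed.

Lemma integral_psum E N (F : nat -> nat -> R -> R) (D : set R) : measurable D ->
  (forall n k, measurable_fun D (F n k)) -> (forall n k t, D t -> 0 <= F n k t) ->
  (\int[lebesgue_measure]_(t in D) (psum E N (fun n k => F n k t))%:E =
   \sum_(n < N) \sum_(k < 2 ^ n | active E n k) \int[lebesgue_measure]_(t in D) (F n k t)%:E)%E.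
Proof.
move=> mD mF F0; rewrite /psum; under eq_integral do rewrite -sumEFin.
rewrite ge0_integral_sum //; last first.
- by move=> n t Dt; rewrite lee_fin; apply: sumr_ge0 => k _; exact: F0.
- by move=> n; apply/measurable_EFinP; under eq_fun do rewrite -big_filter; apply: measurable_sum => k; exact: mF.
apply: eq_bigr => n _; under eq_integral do rewrite -big_filter -sumEFin.
rewrite ge0_integral_sum //; first by rewrite big_filter.
- by move=> k; apply/measurable_EFinP; exact: mF.
- by move=> k t Dt; rewrite lee_fin F0.
Qed.

Lemma count_le N (x : R) : 0 <= x -> \sum_(n < N) (if n%:R <= x then 1 else 0) <= x + 1.
Proof.
move=> x0; suff H : \sum_(n < N) (if n%:R <= x then 1 else 0) <= N%:R :> R /\
   \sum_(n < N) (if n%:R <= x then 1 else 0) <= x + 1 by case: H.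
elim: N => [|N [IH1 IH2]]; first by rewrite big_ord0; split => //; lra.
by rewrite big_ord_recr /= -natr1; case: ifP => h; split; lra.
Qed.

Definition log_cst : R := 2 * ln 24 + 1.

Lemma log_cst_ge0 : 0 <= log_cst.
Proof. by rewrite /log_cst; have : 0 <= ln 24 :> R; [rewrite ln_ge0 // ler1n|lra]. Qed.

(** At each scale t lies in at most one arc. If its root is active, that root is within [16 * dl n]
    of E and within [8 * dl n] of [expi t], so d <= 24 dl n; at most 2 (ln 1/d + ln 24) + 1 scales
    satisfy this when d <= 1. *)
Lemma psum_indic_le E N (P : nat -> nat -> bool) t : E !=set0 -> E `<=` unit_circle ->
  ((psum E N (fun n k => if P n k then \1_(arc 0 n k) t else 0))%:E <=
   2%:E * logp_inv_dist E t + log_cst%:E)%E.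
Proof.
move=> E0 ET; rewrite logpE //; have D0 := dE_ge0 (expi t) E0; case: eqP => [_|/eqP dn].
  by rewrite mulry gtr0_sg // mul1e addye ?leey.
have s0 : 0 < dE E (expi t) by rewrite lt_neqAle eq_sym dn.
rewrite -EFinM -EFinD lee_fin; set s := dE E (expi t) in D0 s0 *.
have M1 : - ln s <= Num.max 0 (- ln s) by rewrite le_max lexx orbT.
have M0 : 0 <= Num.max 0 (- ln s) by rewrite le_max lexx.
have c0 := log_cst_ge0; set x := Num.max _ _ in M1 M0 *.
have l24 : 0 <= ln 24 :> R by rewrite ln_ge0 // ler1n.
have x0 : 0 <= 2 * x + 2 * ln 24 by lra.
apply: le_trans (_ : (2 * x + 2 * ln 24) + 1 <= _); last by rewrite /log_cst addrA.
apply: le_trans (count_le N x0); rewrite /psum; apply: ler_sum => n _.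
have [[k [kn ak kt]]|none] := pselect (exists k, [/\ (k < 2 ^ n)%N, active E n k & arc 0 n k t]).
  have near : s <= 24 * dl n.
    move: ak => /asboolP ak; have := dE_lip (expi t) (pt n k) E0.
    have : nm (expi t - pt n k) <= 8 * dl n.
      by apply: pt_near_expi; move: kt; rewrite /arc /= in_itv /= !addr0 => /andP[-> /ltW ->].
    by rewrite -/s; lra.
  rewrite ifT; last first.
    have : ln s <= ln (24 * dl n) by rewrite ler_ln ?posrE //; have := dl_gt0 (R := R) n; clear; lra.
    rewrite lnM ?posrE ?dl_gt0 // ln_dl.
    have : n%:R * (1 / 2) <= n%:R * ln 2 :> R by rewrite ler_wpM2l // ln2_ge.
    by lra.
  rewrite (bigD1 (Ordinal kn)) //= big1 ?addr0; first by case: ifP => // _; rewrite indicE; case: (_ \in _).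
  move=> j /andP[_ jk]; case: ifP => // _; rewrite indicE memNset // => jt.
  by move/eqP: jk; apply; apply: val_inj; exact: arc_uniq jt kt.
rewrite big1; first by case: ifP.
move=> k ak; case: ifP => // _; rewrite indicE memNset // => kt; apply: none.
by exists k; split.
Qed.

Lemma arc_sub m n k : (m <= n)%N -> arc 0 n k `<=` arc 0 m (k %/ 2 ^ (n - m)).
Proof.
move=> mn t; set p := (n - m)%N; set j := (k %/ 2 ^ p)%N.
have nE : dl n = dl m * dl p :> R by rewrite -dl_add subnKC.
have d0 := dl_gt0 (R := R) m; have p0 := dl_gt0 (R := R) p; have pi0 := pi_gt0 R.
have q0 : 0 <= 2 * pi * dl m :> R by pos.
have h1 : j%:R <= k%:R * dl p :> R.
  have : (j * 2 ^ p)%:R <= k%:R :> R by rewrite ler_nat leq_trunc_div.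
  by rewrite natrM => /(ler_wpM2r (ltW p0)); rewrite -mulrA [(2 ^ p)%:R * dl p]mulrC dlE mulr1.
have h2 : k.+1%:R * dl p <= j.+1%:R :> R.
  have : k.+1%:R <= (j.+1 * 2 ^ p)%:R :> R by rewrite ler_nat ltn_ceil // expn_gt0.
  by rewrite natrM => /(ler_wpM2r (ltW p0)); rewrite -mulrA [(2 ^ p)%:R * dl p]mulrC dlE mulr1.
have e (x : R) : 2 * pi * x * dl m = 2 * pi * dl m * x by ring.
have e' (x : R) : 2 * pi * x * (dl m * dl p) = 2 * pi * dl m * (x * dl p) by ring.
rewrite /arc /= !in_itv /= !addr0 nE !e !e' => /andP[a1 a2].
have b1 := ler_wpM2l q0 h1; have b2 := ler_wpM2l q0 h2.
by apply/andP; split; clear -a1 a2 b1 b2; lra.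
Qed.

(** The count of [psum_indic_le] is integrated over the arc: the arc of a descendant is contained in
    it and contributes its full length 2 pi dl n. *)
Lemma desc_le_integral E N m j : E !=set0 -> E `<=` unit_circle ->
  ((2 * pi * psum E N (desc m j))%:E <=
   2%:E * \int[lebesgue_measure]_(t in arc 0 m j) logp_inv_dist E t +
   (log_cst * (2 * pi * dl m))%:E)%E.
Proof.
move=> E0 ET; have mA := measurable_arc 0 m j.
pose P n k := (m <= n)%N && (k %/ 2 ^ (n - m) == j)%N.
pose F n k t : R := if P n k then \1_(arc 0 n k) t else 0.
have mF n k : measurable_fun (arc 0 m j) (F n k).
  rewrite /F; case: (P n k); last exact: measurable_cst.
  exact: measurable_indic (measurable_arc 0 n k).
have F0 n k t : 0 <= F n k t by rewrite /F; case: ifP => // _; rewrite indicE ler0n.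
have -> : (2 * pi * psum E N (desc m j))%:E =
   (\int[lebesgue_measure]_(t in arc 0 m j) (psum E N (fun n k => F n k t))%:E)%E.
  rewrite integral_psum //.
  rewrite /psum mulr_sumr -sumEFin; apply: eq_bigr => n _.
  rewrite mulr_sumr -sumEFin; apply: eq_bigr => k _.
  rewrite /F /desc -/(P n k); case: ifP => [/andP[mn /eqP kj]|_]; last first.
    by rewrite mulr0 integral0.
  rewrite integral_indic //; last exact: measurable_arc.
  have sub : arc 0 n k `<=` arc 0 m j by rewrite -kj; exact: arc_sub.
  by rewrite (setIidl sub); exact/esym/arc_len.
apply: le_trans (_ : (\int[lebesgue_measure]_(t in arc 0 m j)
    (2%:E * logp_inv_dist E t + log_cst%:E))%E <= _)%E.
  apply: ge0_le_integral => //.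
  - by move=> t _; rewrite lee_fin; apply: psum_ge0 => *; exact: F0.
  - by apply/measurable_EFinP; apply: measurable_sum => n; under eq_fun do rewrite -big_filter; apply: measurable_sum => k; exact: mF.
  - apply: emeasurable_funD; last exact: measurable_cst.
    by apply: emeasurable_funM; [exact: measurable_cst|exact: measurable_logp].
  - by move=> t _; exact: psum_indic_le.
rewrite ge0_integralD //; last 3 first.
- by move=> t _; rewrite mule_ge0 // logp_ge0.
- by apply: emeasurable_funM; [exact: measurable_cst|exact: measurable_logp].
- by move=> t _; rewrite lee_fin log_cst_ge0.
rewrite ge0_integralZl_EFin //; last 2 first.
- by move=> t _; exact: logp_ge0.
- exact: measurable_logp.
by rewrite leeD2l // integral_cst // EFinM; apply: lee_wpmul2l; [rewrite lee_fin log_cst_ge0|rewrite -(arc_len 0 m j)].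
Qed.

(** Every root descends from the single arc of scale 0, so this is the case m = j = 0 of
    [desc_le_integral]. *)
Lemma mass_bounded E : E !=set0 -> E `<=` unit_circle ->
  (\int[lebesgue_measure]_(t in `[0%R, (2 * pi)%R]) logp_inv_dist E t < +oo)%E ->
  exists M, forall N, mass E N <= M.
Proof.
move=> E0 ET fin; have pi0 := pi_gt0 R.
set I := (\int[_]_(_ in _) _)%E in fin; have I0 : (0 <= I)%E.
  by apply: integral_ge0 => t _; exact: logp_ge0.
have fI : I \is a fin_num by rewrite ge0_fin_numE.
exists ((2 * fine I + log_cst * (2 * pi)) / (2 * pi)) => N.
rewrite ler_pdivlMr; last by pos.
have -> : mass E N = psum E N (desc 0 0).
  apply: eq_bigr => n _; apply: eq_bigr => k _.
  by rewrite /desc leq0n subn0 divn_small.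
rewrite mulrC -lee_fin; apply: le_trans (desc_le_integral N 0 0 E0 ET) _.
rewrite dl0 mulr1 [leRHS]EFinD; apply: leeD => //; rewrite EFinM fineK //; apply: lee_wpmul2l => //.
apply: ge0_subset_integral => //; [exact: measurable_arc|exact: measurable_logp|by move=> t _; exact: logp_ge0|].
by move=> t; rewrite /arc /= !in_itv /= mulr0 mul0r dl0 !mulr1 !addr0 => /andP[-> /ltW ->].
Qed.

Lemma ln_pi_ge0 : 0 <= ln (2 * pi) :> R.
Proof. by rewrite ln_ge0 //; have := @pi_ge2 R; lra. Qed.

(** The hypothesis is applied to the dyadic arc itself, where ln 1/|L| <= m because 2 pi >= 1 and ln
    2 <= 1. *)
Lemma integral_log_dense E (C1 C2 : R) : E !=set0 -> E `<=` unit_circle -> 0 < C1 -> 0 < C2 ->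
  (forall a b : R, a < b -> b - a <= 2 * pi ->
       (((b - a)^-1)%:E * \int[lebesgue_measure]_(t in `[a, b]) logp_inv_dist E t
          <= (C1 * ln (1 / (b - a)) + C2)%:E)%E) ->
  exists2 C, 0 <= C & log_dense E C.
Proof.
move=> E0 ET C10 C20 H; have pi0 := pi_gt0 R; have c0 := log_cst_ge0.
exists (2 * C1 + 2 * C2 + log_cst); first by lra.
move=> m j N jm; have d0 := dl_gt0 (R := R) m.
have p0 : 0 < 2 * pi * dl m :> R by pos.
pose a := 2 * pi * j%:R * dl m : R; pose b := 2 * pi * j.+1%:R * dl m : R.
have ab : b - a = 2 * pi * dl m by rewrite /b /a -natr1; ring.
have := H a b; rewrite ab.
have -> : (a < b) by rewrite -subr_gt0 ab.
have -> : 2 * pi * dl m <= 2 * pi :> R by rewrite ger_pMr ?dl_le1 //; pos.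
move=> /(_ isT isT) {}H.
set I := (\int[_]_(_ in _) _)%E in H.
have I0 : (0 <= I)%E by apply: integral_ge0 => t _; exact: logp_ge0.
have IA : (\int[lebesgue_measure]_(t in arc 0 m j) logp_inv_dist E t <= I)%E.
  apply: ge0_subset_integral => //; [exact: measurable_arc|exact: measurable_logp|by move=> t _; exact: logp_ge0|].
  by move=> t; rewrite /arc /= !in_itv /= !addr0 => /andP[-> /ltW ->].
have IC : (I <= (2 * pi * dl m * (C1 * m%:R + C2))%:E)%E.
  have -> : I = ((2 * pi * dl m)%:E * (((2 * pi * dl m)^-1)%:E * I))%E.
    by rewrite muleA -EFinM divff ?gt_eqF // mul1e.
  rewrite [leRHS]EFinM; apply: lee_wpmul2l; first by rewrite lee_fin ltW.
  apply: le_trans H _.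
  rewrite lee_fin lerD2r ler_pM2l // mul1r lnV ?posrE // lnM ?posrE //; last by pos.
  rewrite ln_dl; have h1 := ln_pi_ge0; have h2 := @ln2_le1 R.
  by have : m%:R * ln 2 <= m%:R :> R; [rewrite ler_piMr|lra].
have := le_trans (desc_le_integral N m j E0 ET) (leeD2r _ (lee_wpmul2l _ (le_trans IA IC))).
rewrite lee_fin ler0n => /(_ isT); rewrite -EFinM -EFinD lee_fin => K.
rewrite -(ler_pM2l (x := 2 * pi)); last by pos.
apply: le_trans K _.
rewrite (_ : 2 * (2 * pi * dl m * (C1 * m%:R + C2)) + log_cst * (2 * pi * dl m) =
   2 * pi * dl m * (2 * (C1 * m%:R + C2) + log_cst)); last by ring.
rewrite (_ : 2 * pi * ((2 * C1 + 2 * C2 + log_cst) * dl m * m.+1%:R) =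
   2 * pi * dl m * ((2 * C1 + 2 * C2 + log_cst) * m.+1%:R)); last by ring.
rewrite ler_pM2l // -(natr1 m); have m0 : 0 <= m%:R :> R by [].
by have := mulr_ge0 (ltW C20) m0; have := mulr_ge0 c0 m0; clear -C10; lra.
Qed.

End IntegralVsPotential.

(** * A Phragmen-Lindelof principle at isolated points *)

Section IsolatedPoint.
Context {R : realType}.
Implicit Types (E : set R[i]^o) (z c : R[i]).

(** The third hypothesis says that each ball contains the next; the point is found coordinatewise as
    a supremum of lower bounds. It serves the Baire argument below and, later, as completeness of
    the plane. *)
Lemma nested_balls (c : nat -> R[i]) (r : nat -> R) : (forall n, 0 < r n) ->
  (forall n, r n.+1 <= r n / 2) -> (forall n, nm (c n.+1 - c n) + r n.+1 <= r n) ->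
  exists z, forall n, nm (z - c n) <= r n.
Proof.
move=> r0 r2 H.
have mono n p : nm (c (p + n)%N - c n) + r (p + n)%N <= r n.
  elim: p => [|p IH]; first by rewrite add0n subrr nm0 add0r.
  rewrite addSn; have := H (p + n)%N; have := nm_tri (c (p + n)%N) (c (p + n).+1) (c n).
  by move: IH; lra.
have cross m n : nm (c m - c n) <= r m + r n.
  have [mn|/ltnW mn] := leqP n m.
    by have := mono n (m - n)%N; rewrite subnK //; have := r0 m; clear mn; lra.
  by have := mono m (n - m)%N; rewrite subnK //; have := r0 n; rewrite nmBC; lra.
have pick (f : nat -> R) : (forall m n, `|f m - f n| <= r m + r n) ->
    exists a, forall n, `|a - f n| <= r n.
  move=> fr; exists (sup (range (fun n => f n - r n))) => n.
  have ub m : f m - r m <= f n + r n by have := fr m n; rewrite ler_norml; lra.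
  rewrite ler_norml; apply/andP; split.
    have : f n - r n <= sup (range (fun n => f n - r n)).
      apply: ub_le_sup; last by exists n.
      by exists (f n + r n) => _ [m _ <-].
    lra.
  have : sup (range (fun n => f n - r n)) <= f n + r n.
    by apply: ge_sup => [|_ [m _ <-] //]; exists (f n - r n), n.
  lra.
have [a Ha] := pick (fun n => complex.Re (c n)) (fun m n => le_trans
  (eq_ind _ (fun x => `|x| <= _) (nm_Re _) _ (cReB _ _)) (cross m n)).
have [b Hb] := pick (fun n => complex.Im (c n)) (fun m n => le_trans
  (eq_ind _ (fun x => `|x| <= _) (nm_Im _) _ (cImB _ _)) (cross m n)).
have near n : nm ((a +i* b)%C - c n) <= r n + r n.
  apply: le_trans (nm_le_ReIm _) _; rewrite cReB cImB; apply: lerD; [exact: Ha|exact: Hb].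
exists (a +i* b)%C => n; apply/ler_addgt0Pr => e e0.
have small : exists p, r (p + n)%N <= e.
  have rp p : r (p + n)%N <= r n * dl p.
    elim: p => [|p IH]; first by rewrite dl0 mulr1.
    by rewrite addSn dlS; have := r2 (p + n)%N; lra.
  have [p hp] := dl_small (divr_gt0 e0 (r0 n)); exists p; apply: le_trans (rp p) _.
  by rewrite mulrC -ler_pdivlMr // ltW.
have [p hp] := small; have := mono n p; have := near (p + n)%N.
by have := nm_tri (c (p + n)%N) (a +i* b)%C (c n); clear e0; lra.
Qed.

(** Baire's argument: otherwise, along an injective numbering of E, balls centred in E are shrunk so
    that the n-th step excludes the point numbered n. Their common point lies in E by closedness and
    is excluded at the step bearing its own number. *)
Lemma isolated_point E : closed E -> countable E -> E !=set0 ->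
  exists2 l, E l & exists2 d, 0 < d & forall z, E z -> nm (z - l) < d -> z = l.
Proof.
move=> cE /countable_injP [f fi] [c0 Ec0].
apply: contrapT => /forall2NP noiso.
(* [q] packs the step number with the current centre and radius. Since the centre is not isolated,
   the ball contains a point of E with another number, which becomes the new centre. *)
have step (q : nat * (R[i] * R)) : exists p : R[i] * R, E q.2.1 -> 0 < q.2.2 ->
  [/\ E p.1, 0 < p.2, p.2 <= q.2.2 / 2, nm (p.1 - q.2.1) + p.2 <= q.2.2 &
      forall z, E z -> f z = q.1 -> p.2 < nm (z - p.1)].
  case: q => n [c r] /=; have [Ec|nE] := pselect (E c); last by exists (c, r).
  have [r0|nr] := pselect (0 < r); last by exists (c, r).
  have [c' [Ec' c'r c'n]] : exists c', [/\ E c', nm (c' - c) < r & f c' != n].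
    have [fc|fc] := eqVneq (f c) n; last by exists c; rewrite subrr nm0.
    case: (noiso c) => // nis; apply: contrapT => none; apply: nis; exists r => // z Ez zr.
    apply: contrapT => zc; apply: none; exists z; split => //; apply/eqP => fz; apply: zc.
    by apply: fi; rewrite ?mem_set // fz fc.
  have [[z [Ez fz]]|nz] := pselect (exists z, E z /\ f z = n).
    have zc' : 0 < nm (z - c').
      by rewrite nm_gt0 subr_eq0; apply: contraNneq c'n => <-; apply/eqP.
    pose r' := Num.min (r / 2) (Num.min (r - nm (c' - c)) (nm (z - c') / 2)).
    have r'0 : 0 < r' by rewrite !lt_min; apply/and3P; split; lra.
    have : r' <= r' by []; rewrite {2}/r' !le_min => /and3P[h1 h2 h3].
    exists (c', r') => /= _ _; split => //; first by clear -h2; lra.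
    move=> z' Ez' fz'; have -> : z' = z by apply: fi; rewrite ?mem_set // fz fz'.
    by lra.
  pose r' := Num.min (r / 2) (r - nm (c' - c)).
  have r'0 : 0 < r' by rewrite !lt_min; apply/andP; split; lra.
  have : r' <= r' by []; rewrite {2}/r' !le_min => /andP[h1 h2].
  exists (c', r') => /= _ _; split => //; first by lra.
  by move=> z' Ez' fz'; case: nz; exists z'.
have [F HF] := choice step.
pose s := fix s n : R[i] * R := if n is m.+1 then F (m, s m) else (c0, 1).
have inv n : E (s n).1 /\ 0 < (s n).2.
  elim: n => [|n [IH1 IH2]] //; by case: (HF (n, s n) IH1 IH2).
have S n := HF (n, s n) (inv n).1 (inv n).2.
have [z Hz] := @nested_balls (fun n => (s n).1) (fun n => (s n).2)
  (fun n => (inv n).2) (fun n => let: And5 _ _ h _ _ := S n in h)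
  (fun n => let: And5 _ _ _ h _ := S n in h).
have Ez : E z.
  apply: closed_nm => // e e0.
  have rp n : (s n).2 <= dl n.
    by elim: n => [|n IH]; rewrite ?dl0 // dlS; case: (S n) => _ _ /= h _ _; lra.
  have [n ne] := dl_small e0; exists (s n).1; first by case: (inv n).
  by apply: le_lt_trans (Hz n) _; apply: le_lt_trans (rp n) _.
case: (S (f z)) => _ _ _ _ /(_ z Ez erefl) /=; have := Hz (f z).+1.
by rewrite /= leNgt => /negP.
Qed.

End IsolatedPoint.

Section RhombusBarrier.
Context {R : realType}.
Implicit Types (s t x y r : R) (w : R[i]).

(** Minus the real part of 1/(s + i t)^2. With s and t the coordinates at a vertex of the rhombus,
    scaled by r, it is large and positive in the rhombus near that vertex. *)
Definition qf s t : R := (t ^+ 2 - s ^+ 2) / (t ^+ 2 + s ^+ 2) ^+ 2.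

Lemma Re_inv_sq s t : complex.Re (((s +i* t)%C)^-1 ^+ 2) = - qf s t.
Proof.
have [e|e] := eqVneq (t ^+ 2 + s ^+ 2) 0.
  have s0 : s = 0 by apply/eqP; rewrite -sqrf_eq0 eq_le sqr_ge0 andbT; have := sqr_ge0 t; lra.
  have t0 : t = 0 by apply/eqP; rewrite -sqrf_eq0 eq_le sqr_ge0 andbT; have := sqr_ge0 s; lra.
  by rewrite s0 t0 /qf invr0 expr0n /= subrr mul0r oppr0.
rewrite /qf expr2 /=; field.
by rewrite addrC in e *.
Qed.

Lemma qf_sym s t : qf s (- t) = qf s t.
Proof. by rewrite /qf sqrrN. Qed.

Lemma qf_lower s t : 0 < t -> 2 * `|s| <= t -> 12 / 25 / t ^+ 2 <= qf s t.
Proof.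
move=> t0 st; have s2 : 4 * s ^+ 2 <= t ^+ 2.
  rewrite -(real_normK (num_real s)); have := normr_ge0 s; move: st; move: `|s| => a st a0.
  by have : (2 * a) ^+ 2 <= t ^+ 2 by [rewrite lerXn2r ?nnegrE //; lra]; rewrite exprMn; lra.
have t2 : 0 < t ^+ 2 by pos.
rewrite /qf; move: (s ^+ 2) (t ^+ 2) (sqr_ge0 s) s2 t2 => a b a0 ab b0.
rewrite ler_pdivlMr; last by rewrite exprn_gt0 //; lra.
rewrite mulrAC ler_pdivrMr //.
suff : 0 <= (b - 4 * a) * (13 * b + 3 * a) by nra.
by rewrite mulr_ge0; clear b0 t0 st; lra.
Qed.

Lemma qf_lower2 s t : 0 < t -> (t ^+ 2)^-1 - 13 / 4 * s ^+ 2 / t ^+ 4 <= qf s t.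
Proof.
move=> t0; have t2 : 0 < t ^+ 2 by pos.
rewrite /qf (_ : t ^+ 4 = (t ^+ 2) ^+ 2); last by rewrite -exprM.
move: (s ^+ 2) (t ^+ 2) (sqr_ge0 s) t2 => a b a0 b0.
have ab : 0 < a + b by lra.
rewrite (_ : b^-1 - 13 / 4 * a / b ^+ 2 = (b - 13 / 4 * a) / b ^+ 2); last by field; rewrite gt_eqF.
rewrite ler_pdivlMr; last by rewrite exprn_gt0 //; lra.
rewrite mulrAC ler_pdivrMr ?exprn_gt0 // -subr_ge0.
rewrite (_ : _ - _ = 1 / 4 * (a * b ^+ 2) + 11 / 2 * (a ^+ 2 * b) + 13 / 4 * a ^+ 3); last by field.
have h1 : 0 <= a * b ^+ 2 by rewrite mulr_ge0 // sqr_ge0.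
have h2 : 0 <= a ^+ 2 * b by rewrite mulr_ge0 ?sqr_ge0 // ltW.
have h3 : 0 <= a ^+ 3 by rewrite exprn_ge0.
lra.
Qed.

(** On s = 0 the sum t^-2 + (2 - t)^-2 has its minimum 2 at t = 1, the centre of the rhombus: the
    tangent bounds there cancel, and s costs a multiple of |s|. For t <= 1/2 the bounds of
    [qf_lower] already add up to more than 2. *)
Lemma qf_sum_lower s t : 0 < t -> t <= 1 -> 2 * `|s| <= t ->
  - (28 * `|s|) <= qf s t + qf s (2 - t) - 2.
Proof.
move=> t0 t1 st; have a0 := normr_ge0 s.
have [th|th] := leP t (1 / 2).
  have h1 := qf_lower t0 st; have h2 := @qf_lower s (2 - t) ltac:(lra) ltac:(lra).
  have k1 : 4 <= (t ^+ 2)^-1.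
    rewrite -[4]invrK lef_pV2 ?posrE ?invr_gt0 ?exprn_gt0 //.
    have : t ^+ 2 <= (1 / 2) ^+ 2 by rewrite lerXn2r ?nnegrE //; lra.
    by rewrite expr2 => h; apply: le_trans h _; lra.
  have k2 : 1 / 4 <= ((2 - t) ^+ 2)^-1.
    rewrite mul1r lef_pV2 ?posrE // ?exprn_gt0 //; try lra.
    have : (2 - t) ^+ 2 <= 2 ^+ 2 by rewrite lerXn2r ?nnegrE //; clear -t0 t1; lra.
    by rewrite (_ : 2 ^+ 2 = 4 :> R) //; ring.
  by lra.
have h1 := @qf_lower2 s t t0; have h2 := @qf_lower2 s (2 - t) ltac:(lra).
have s2 : s ^+ 2 <= `|s| / 2.
  by rewrite -(real_normK (num_real s)) expr2; apply: ler_wpM2l => //; lra.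
have q0 := sqr_ge0 s.
have k1 : s ^+ 2 / t ^+ 4 <= 16 * s ^+ 2.
  rewrite ler_pdivrMr ?exprn_gt0 // mulrC mulrA -{1}[s ^+ 2]mul1r; apply: ler_wpM2r => //.
  have : (1 / 2) ^+ 4 <= t ^+ 4 by rewrite lerXn2r ?nnegrE //; clear -th; lra.
  rewrite (_ : (1 / 2) ^+ 4 = 1 / 16 :> R); last by field.
  clear; lra.
have k2 : s ^+ 2 / (2 - t) ^+ 4 <= s ^+ 2.
  rewrite ler_pdivrMr ?exprn_gt0 //; last by clear -t1; lra.
  by rewrite ler_peMr // exprn_ege1 //; clear -t1; lra.
have k3 : 2 <= (t ^+ 2)^-1 + ((2 - t) ^+ 2)^-1.
  have e1 : 1 - 2 * (t - 1) <= (t ^+ 2)^-1.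
    rewrite -[(_)^-1]mul1r ler_pdivlMr ?exprn_gt0 //.
    suff : 0 <= (t - 1) ^+ 2 * (1 + 2 * t) by nra.
    by rewrite mulr_ge0 ?sqr_ge0 //; clear -t0; lra.
  have e2 : 1 + 2 * (t - 1) <= ((2 - t) ^+ 2)^-1.
    rewrite -[(_)^-1]mul1r ler_pdivlMr ?exprn_gt0 //; last by clear -t1; lra.
    suff : 0 <= (t - 1) ^+ 2 * (5 - 2 * t) by nra.
    by rewrite mulr_ge0 ?sqr_ge0 //; clear -t1; lra.
  clear -e1 e2; lra.
lra.
Qed.

(* The barrier is built from the two vertices +-ir of the rhombus
   2 |Re w| < r - |Im w|; the constants make it dominate 12 r^2 / (r - |Im w|)
   on the outer half of the rhombus. *)
Definition barrier r w : R :=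
  16 * 67 * (1 - complex.Re w) -
  9 * r * (complex.Re ((w / r%:C%C - 'i%C)^-1 ^+ 2) + complex.Re ((w / r%:C%C + 'i%C)^-1 ^+ 2) + 2).

Lemma barrierE r w : 0 < r ->
  let s := complex.Re w / r in let t := (r - `|complex.Im w|) / r in
  barrier r w = 16 * 67 * (1 - complex.Re w) + 9 * r * (qf s t + qf s (2 - t) - 2).
Proof.
case: w => x y r0 /=; rewrite /barrier.
have rn : r != 0 by rewrite gt_eqF.
have q1 : ((x +i* y)%C / r%:C%C - 'i%C) = ((x / r) +i* (y / r - 1))%C.
  by apply/eqP; rewrite eq_complex /=; apply/andP; split; apply/eqP; field.
have q2 : ((x +i* y)%C / r%:C%C + 'i%C) = ((x / r) +i* (y / r + 1))%C.
  by apply/eqP; rewrite eq_complex /=; apply/andP; split; apply/eqP; field.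
rewrite q1 q2 !Re_inv_sq /=.
case: (ger0P y) => y0.
  have -> : (r - y) / r = - (y / r - 1) by field.
  have -> : 2 - - (y / r - 1) = y / r + 1 by ring.
  by rewrite qf_sym; ring.
have -> : (r - - y) / r = y / r + 1 by field.
have -> : 2 - (y / r + 1) = - (y / r - 1) by ring.
by rewrite qf_sym; ring.
Qed.

Lemma rhombus_st r w : 0 < r -> 2 * `|complex.Re w| < r - `|complex.Im w| ->
  let s := complex.Re w / r in let t := (r - `|complex.Im w|) / r in
  [/\ 0 < t, t <= 1, 2 * `|s| <= t, r * s = complex.Re w & r * t = r - `|complex.Im w|].
Proof.
move=> r0 h s t; have rn : r != 0 by rewrite gt_eqF.
have n1 := normr_ge0 (complex.Re w); have n2 := normr_ge0 (complex.Im w).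
split.
- by rewrite divr_gt0 //; lra.
- by rewrite ler_pdivrMr //; lra.
- by rewrite /s /t normrM normfV (gtr0_norm r0) mulrA ler_pM2r ?invr_gt0 // ltW.
- by rewrite /s mulrC divfK.
- by rewrite /t mulrC divfK.
Qed.

(** The vertices lose at most 28 . 9 |Re w|; this is at most 28 . 9 when Re w >= 0, and the linear
    term covers it when Re w < 0. *)
Lemma barrier_ge r w : 0 < r -> complex.Re w <= 1 ->
  2 * `|complex.Re w| < r - `|complex.Im w| -> - (28 * 9) <= barrier r w.
Proof.
move=> r0 x1 h; rewrite barrierE //=; have := rhombus_st r0 h.
set s := _ / r; set t := _ / r => /= -[t0 t1 st rs rt].
have q := qf_sum_lower t0 t1 st.
have q' : - (28 * 9 * `|complex.Re w|) <= 9 * r * (qf s t + qf s (2 - t) - 2).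
  rewrite -rs normrM (gtr0_norm r0).
  have : 9 * r * - (28 * `|s|) <= 9 * r * (qf s t + qf s (2 - t) - 2).
    by apply: ler_wpM2l => //; lra.
  lra.
have := ler_norm (complex.Re w); have := ler_norm (- complex.Re w); rewrite normrN.
by move: q'; case: (ger0P (complex.Re w)); clear q rt st rs h t0 t1 r0; lra.
Qed.

Lemma barrier_vertex r w : 0 < r -> complex.Re w <= 1 ->
  2 * `|complex.Re w| < r - `|complex.Im w| ->
  9 * r * (12 / 25 * (r / (r - `|complex.Im w|)) ^+ 2 - 2) <= barrier r w.
Proof.
move=> r0 x1 h; rewrite barrierE //=; have := rhombus_st r0 h.
set s := _ / r; set t := _ / r => /= -[t0 t1 st rs rt].
have h1 := qf_lower t0 st; have h2 := @qf_lower s (2 - t) ltac:(lra) ltac:(lra).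
have h3 : 0 <= 12 / 25 / (2 - t) ^+ 2 by rewrite divr_ge0 ?sqr_ge0.
have -> : (r / (r - `|complex.Im w|)) ^+ 2 = (t ^+ 2)^-1.
  by rewrite -exprVn /t invf_div.
apply: ler_wpDl; first by clear -x1; lra.
by apply: ler_wpM2l; clear -r0 h1 h2 h3; lra.
Qed.

(** Near a vertex, t <= 1/4, the pole of second order wins, and the factor 9 is large enough for
    that. Otherwise |Re w| >= r/16 > 1, so Re w <= - r/16 and the linear term is at least 67 r,
    where 67 = 48 + 1 + 18 covers 12 r/t, the extra r and the loss 9 r . 2. *)
Lemma barrier_outer r w : 16 < r -> complex.Re w <= 1 ->
  2 * `|complex.Re w| < r - `|complex.Im w| -> r - `|complex.Im w| <= 4 * `|complex.Re w| ->
  12 * r ^+ 2 / (r - `|complex.Im w|) + r <= barrier r w.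
Proof.
move=> r16 x1 h ho; have r0 : 0 < r by lra.
rewrite barrierE //=; have := rhombus_st r0 h.
set s := _ / r; set t := _ / r => /= -[t0 t1 st rs rt].
have h1 := qf_lower t0 st; have h2 := @qf_lower s (2 - t) ltac:(lra) ltac:(lra).
have h3 : 0 <= 12 / 25 / (2 - t) ^+ 2 by rewrite divr_ge0 ?sqr_ge0.
have rn : r != 0 by rewrite gt_eqF.
have -> : 12 * r ^+ 2 / (r - `|complex.Im w|) = 12 * r * t^-1.
  by rewrite -rt; field; rewrite !gt_eqF.
have k0 : 9 * r * (12 / 25 / t ^+ 2 - 2) <= 9 * r * (qf s t + qf s (2 - t) - 2).
  by apply: ler_wpM2l; clear -r16 h1 h2 h3; lra.
have [tq|tq] := leP t (1 / 4).
  have u4 : 4 <= t^-1 by rewrite -[4]invrK lef_pV2 ?posrE ?invr_gt0 //; clear -tq; lra.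
  have k1 : 12 * t^-1 + 1 <= 9 * (12 / 25 / t ^+ 2 - 2).
    by rewrite -exprVn; move: u4; set u := t^-1 => u4; nra.
  have : r * (12 * t^-1 + 1) <= r * (9 * (12 / 25 / t ^+ 2 - 2)) by rewrite ler_pM2l.
  have : 0 <= 16 * 67 * (1 - complex.Re w) by clear -x1; lra.
  move: k0; set Y := 9 * r * (qf s t + _ - 2); set X := 16 * 67 * _; set P := _ - 2.
  by clear; lra.
have ux : r / 16 <= `|complex.Re w|.
  have : r * (1 / 4) <= r * t by rewrite ler_pM2l // ltW.
  by rewrite rt; clear -ho; lra.
have xn : complex.Re w <= - (r / 16).
  by move: ux; case: (ger0P (complex.Re w)); clear tq k0 h3 rn rs rt h1 h2 r0 t0 t1 st h ho; lra.
have ut : t^-1 <= 4 by rewrite -[4]invrK lef_pV2 ?posrE ?invr_gt0 //; clear -tq; lra.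
have : r * t^-1 <= r * 4 by rewrite ler_pM2l.
have : 0 <= 9 * r * (12 / 25 / t ^+ 2) by rewrite !mulr_ge0 ?invr_ge0 ?sqr_ge0 //; clear -r16; lra.
by move: k0; rewrite mulrDr; clear ut ux tq rt h1 h2 h3 rn r16 x1 h ho r0 t0 t1 st rs; lra.
Qed.

(** With v = w/r the two inverse squares sum to -2 at v = 0 and their first-order terms cancel, so
    the bracket is O(v^2) and r times it is O(|w|^2/r). At a fixed point the bound is thus
    independent of r. *)
Lemma barrier_le r w : 1 <= r -> 2 * nm w <= r ->
  barrier r w <= 16 * 67 * (1 + nm w) + 9 * 12 * nm w ^+ 2.
Proof.
move=> r1 hw; have r0 : 0 < r by lra.
have rn : r%:C%C != 0 :> R[i] by rewrite -nm_gt0 nmR gtr0_norm.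
pose v := w / r%:C%C; have nv : nm v = nm w / r by rewrite nmM nmV nmR gtr0_norm.
have v2 : nm v <= 1 / 2 by rewrite nv ler_pdivrMr //; lra.
have v0 := nm_ge0 v.
have vv : nm (v ^+ 2) <= 1 / 4 by rewrite nmX expr2; nra.
have lw : 3 / 4 <= nm (v ^+ 2 + 1).
  have h : nm (1 : R[i]) - nm (v ^+ 2) <= nm (1 + v ^+ 2) := nm_addl _ _.
  by rewrite addrC; move: h; rewrite nm1; lra.
have nz : v ^+ 2 + 1 != 0 by rewrite -nm_gt0; lra.
have fac : (v - 'i%C) * (v + 'i%C) = v ^+ 2 + 1.
  rewrite mulrDr !mulrBl -expr2; have -> : 'i%C * 'i%C = -1 :> R[i] by rewrite -expr2 sqr_i.
  by ring.
have nz1 : v - 'i%C != 0 by apply: contraNneq nz; rewrite -fac => ->; rewrite mul0r.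
have nz2 : v + 'i%C != 0 by apply: contraNneq nz; rewrite -fac => ->; rewrite mulr0.
have id : (v - 'i%C)^-1 ^+ 2 + (v + 'i%C)^-1 ^+ 2 + 2 =
    2 * v ^+ 2 * (v ^+ 2 + 3) / (v ^+ 2 + 1) ^+ 2.
  apply: (mulIf (x := (v ^+ 2 + 1) ^+ 2)); first by rewrite expf_neq0.
  rewrite divfK ?expf_neq0 // -{1}fac.
  have i2 : 'i%C ^+ 2 = -1 :> R[i] by rewrite sqr_i.
  transitivity ((v + 'i%C) ^+ 2 + (v - 'i%C) ^+ 2 + 2 * ((v - 'i%C) * (v + 'i%C)) ^+ 2).
    by move: nz1 nz2; move: (v - 'i%C) (v + 'i%C) => a b a0 b0; field; apply/andP.
  rewrite fac; rewrite (_ : (v + 'i%C) ^+ 2 + (v - 'i%C) ^+ 2 = 2 * v ^+ 2 + 2 * 'i%C ^+ 2); last by ring.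
  by rewrite i2; ring.
have bd : nm (2 * v ^+ 2 * (v ^+ 2 + 3) / (v ^+ 2 + 1) ^+ 2) <= 12 * nm v ^+ 2.
  rewrite (nmM (2 * v ^+ 2 * _)) nmV (nmX (v ^+ 2 + 1)) (nmM (2 * v ^+ 2)) (nmM 2) nmn (nmX v).
  rewrite ler_pdivrMr; last by rewrite exprn_gt0 //; apply: lt_le_trans lw.
  have b3 : nm (v ^+ 2 + 3) <= 13 / 4.
    have h : nm (v ^+ 2 + 3) <= nm (v ^+ 2) + nm (3 : R[i]) := nmD _ _.
    by move: h; rewrite nmn; lra.
  have b4 : 9 / 16 <= nm (v ^+ 2 + 1) ^+ 2 by rewrite expr2; nra.
  have q0 := sqr_ge0 (nm v); have e3 := nm_ge0 (v ^+ 2 + 3).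
  have : 2 * nm v ^+ 2 * nm (v ^+ 2 + 3) <= 2 * nm v ^+ 2 * (13 / 4) by apply: ler_wpM2l;
    clear -b3 q0; lra.
  have : 12 * nm v ^+ 2 * (9 / 16) <= 12 * nm v ^+ 2 * nm (v ^+ 2 + 1) ^+ 2 by apply: ler_wpM2l;
    clear -b4 q0; lra.
  by clear -q0; lra.
rewrite /barrier -/v -!cReD.
have -> : (2 : R) = complex.Re (2 : R[i]) by [].
rewrite -cReD id; set Q := _ / _ in bd *.
have q1 : - complex.Re Q <= 12 * nm v ^+ 2.
  by have := nm_Re Q; rewrite ler_norml; clear -bd; lra.
have x1 : - complex.Re w <= nm w by have := nm_Re w; rewrite ler_norml; clear; lra.
have q2 : r * - complex.Re Q <= 12 * nm w ^+ 2.
  apply: le_trans (_ : r * (12 * nm v ^+ 2) <= _); first by rewrite ler_pM2l.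
  rewrite nv expr_div_n (_ : r * _ = 12 * nm w ^+ 2 / r); last by field; rewrite gt_eqF.
  by rewrite ler_pdivrMr // ler_peMr // mulr_ge0 ?sqr_ge0.
clear -x1 q2; lra.
Qed.

End RhombusBarrier.

Section Mobius.
Context {R : realType}.
Implicit Types (l z j : R[i]) (r : R).

Lemma open3_lt (D : R[i] -> Prop) (f : R[i] -> R) c : open3 D ->
  (forall z, D z -> cont_at f z) -> open3 (fun z => D z /\ f z < c).
Proof.
move=> oD cf z [Dz fz]; have [d d0 Hd] := oD z Dz.
have [d' d'0 Hd'] := cf z Dz (c - f z) ltac:(lra).
exists (Num.min d d'); first by rewrite lt_min d0.
move=> w; rewrite lt_min => /andP[w1 w2]; split; first exact: Hd.
by have := Hd' w w2; rewrite ltr_norml; lra.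
Qed.

Lemma cont_abs (f : R[i] -> R) z : cont_at f z -> cont_at (fun w => `|f w|) z.
Proof.
move=> cf e e0; have [d d0 H] := cf e e0; exists d => // w wd.
by apply: le_lt_trans (H w wd); exact: ler_dist_dist.
Qed.

(* The Moebius map z |-> (z + l) / (z - l) sends the unit circle to the
   imaginary axis and l to infinity. *)
Definition cayley l z : R[i] := 1 + 2 * l * (z - l)^-1.

Lemma cayley_sub1 l z : nm l = 1 -> nm (cayley l z - 1) = 2 / nm (z - l).
Proof. by move=> l1; rewrite /cayley addrC addKr nmM nmM nmV l1 nmn mulr1. Qed.

Lemma cayleyE l z : z != l -> cayley l z = (z + l) / (z - l).
Proof. by move=> zl; rewrite /cayley; field; rewrite subr_eq0. Qed.

Lemma Re_cayley l z : nm l = 1 -> z != l ->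
  complex.Re (cayley l z) = (nm z ^+ 2 - 1) / nm (z - l) ^+ 2.
Proof.
move=> l1 zl; rewrite cayleyE // cRe_div ?subr_eq0 //; congr (_ / _).
have -> : 1 = nm l ^+ 2 by rewrite l1 expr1n.
by rewrite !nm_sq; case: z {zl} => a b; case: l {l1} => c d /=; ring.
Qed.

Lemma an3_cayley l z : z != l -> an3 (cayley l : R[i] -> R[i]^o) z.
Proof.
by move=> zl; apply: an3D; [exact: an3_const|exact: (an3Z (2 * l) (an3_inv zl))].
Qed.

Lemma cont_cayley l z : z != l ->
  cont_at (fun w => complex.Re (cayley l w)) z /\ cont_at (fun w => complex.Im (cayley l w)) z.
Proof.
move=> zl; have a := an3_cayley zl; split; first exact: cont_Re.
have -> : (fun w => complex.Im (cayley l w)) = (fun w => complex.Re (- 'i%C * cayley l w)).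
  by apply/funext => w; case: (cayley l w) => p q /=; ring.
exact: (cont_Re (an3Z (- 'i%C) a)).
Qed.

(** [vinv] is (cayley l z/r - j)^-1 written as a Moebius function of z, and [vpole] is its pole; its
    expansion then follows from that of an inverse. *)
Definition vpole j l r : R[i] := - ((1 + j * r%:C%C) / (1 - j * r%:C%C) * l).

Definition vinv j l r z : R[i] := r%:C%C / (1 - j * r%:C%C) * ((z - l) * (z - vpole j l r)^-1).

Lemma vinvE j l r z : 0 < r -> j = 'i%C \/ j = - 'i%C -> z != l -> cayley l z / r%:C%C - j != 0 ->
  z != vpole j l r /\ vinv j l r z = (cayley l z / r%:C%C - j)^-1.
Proof.
move=> r0 jE zl nz; have rn : r%:C%C != 0 :> R[i] by rewrite -nm_gt0 nmR gtr0_norm.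
have jn : 1 - j * r%:C%C != 0.
  rewrite eq_complex negb_and; apply/orP; left.
  by case: jE => -> /=; rewrite !(mul0r, mulr0, subr0, oppr0, addr0, oner_eq0, mul1r, mulN1r, subrr, opprK).
have zl' : z - l != 0 by rewrite subr_eq0.
have F : (cayley l z / r%:C%C - j) * (r%:C%C * (z - l)) = (1 - j * r%:C%C) * (z - vpole j l r).
  by rewrite /vpole cayleyE //; field; rewrite zl' rn jn.
have zp : z - vpole j l r != 0.
  apply: contraNneq nz => h; have /eqP : (cayley l z / r%:C%C - j) * (r%:C%C * (z - l)) = 0 by rewrite F h mulr0.
  by rewrite !mulf_eq0 (negPf rn) (negPf zl') !orbF.
split; first by rewrite -subr_eq0.
apply: (mulfI nz); rewrite mulfV // /vinv.
move: F zp; move: (cayley l z / r%:C%C - j) (z - vpole j l r) => a b F b0.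
have -> : a * (r%:C%C / (1 - j * r%:C%C) * ((z - l) / b)) =
  (a * (r%:C%C * (z - l))) / ((1 - j * r%:C%C) * b) by field; rewrite b0 jn.
by rewrite F divff // mulf_neq0.
Qed.

Lemma an3_vinv j l r z : z != vpole j l r -> an3 (vinv j l r : R[i] -> R[i]^o) z.
Proof.
move=> zp; apply: (an3Z (r%:C%C / (1 - j * r%:C%C))).
by apply: an3M; [exact: an3_subr|exact: an3_inv].
Qed.

Definition cbarrier l r z : R := 16 * 67 * (1 - complex.Re (cayley l z)) -
  9 * r * (complex.Re (vinv 'i%C l r z * vinv 'i%C l r z) +
           complex.Re (vinv (- 'i%C) l r z * vinv (- 'i%C) l r z) + 2).

Lemma rhombus_neq r (w : R[i]) : 0 < r -> `|complex.Im w| < r ->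
  w / r%:C%C - 'i%C != 0 /\ w / r%:C%C - - 'i%C != 0.
Proof.
move=> r0; have rn : r%:C%C != 0 :> R[i] by rewrite -nm_gt0 nmR gtr0_norm.
rewrite ltr_norml => /andP[h1 h2]; split; rewrite subr_eq0; apply/eqP => h.
  have : w = 'i%C * r%:C%C by rewrite -h divfK.
  by move=> e; move: h1 h2; rewrite e /= mulr0 add0r mul1r; lra.
have : w = - 'i%C * r%:C%C by rewrite -h divfK.
by move=> e; move: h1 h2; rewrite e /= mulN1r mulr0 add0r; lra.
Qed.

Lemma cbarrierE l r z : 0 < r -> z != l -> `|complex.Im (cayley l z)| < r ->
  [/\ cbarrier l r z = barrier r (cayley l z), harm3 (cbarrier l r) z & cont_at (cbarrier l r) z].
Proof.
move=> r0 zl h; have [n1 n2] := rhombus_neq r0 h.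
have [p1 e1] := vinvE r0 (or_introl erefl) zl n1.
have [p2 e2] := vinvE r0 (or_intror erefl) zl n2.
have v1 := an3M (an3_vinv p1) (an3_vinv p1).
have v2 := an3M (an3_vinv p2) (an3_vinv p2).
have aW := an3_cayley zl.
have E : cbarrier l r = (fun z => (16 * 67 + -9 * r * 2) + (- (16 * 67) * complex.Re (cayley l z) +
  (- 9 * r * complex.Re (vinv 'i%C l r z * vinv 'i%C l r z) +
   - 9 * r * complex.Re (vinv (- 'i%C) l r z * vinv (- 'i%C) l r z)))).
  by apply/funext => x; rewrite /cbarrier; ring.
split.
- by rewrite /cbarrier /barrier e1 e2 opprK -!expr2.
- rewrite E; apply: harm3D; first exact: harm3_const.
  apply: harm3D; first by apply: harm3Z; exact: harm3_Re.
  by apply: harm3D; apply: harm3Z; exact: harm3_Re.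
rewrite E; apply: contD; first exact: cont_const.
apply: contD; first by apply: contZ; exact: cont_Re.
by apply: contD; apply: contZ; exact: cont_Re.
Qed.

End Mobius.

Section PhragmenLindelof.
Context {R : realType}.
Variables (E : set R[i]^o) (M : R) (U : R[i] -> R) (m : R).
Hypotheses (cE : closed E) (E0 : E !=set0) (ET : E `<=` unit_circle)
  (mM : forall N, mass E N <= M).
Hypothesis U_bdry : forall xi, ~ Om E xi -> ~ E xi -> forall e, 0 < e ->
  exists2 d, 0 < d & forall z, Om E z -> nm (z - xi) < d -> U z <= m + e.
Hypothesis U_growth : forall e, 0 < e -> exists C, forall z, Om E z -> nm z != 1 ->
  U z <= e / `|nm z - 1| + C.
Hypothesis U_sub : forall z, Om E z -> cont_at U z /\ sub3 U z.

Definition bdd_near l := exists d B, 0 < d /\ forall z, Om E z -> nm (z - l) < d -> U z <= B.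

(** g <= (ln d)/144 tends to minus infinity at points of E, so any positive multiple of g outweighs
    a local bound on U. *)
Lemma gE_to_minfty xi k c : E xi -> bdd_near xi -> 0 < k ->
  exists2 d, 0 < d & forall z, Om E z -> nm (z - xi) < d -> U z + k * gE E z <= c.
Proof.
move=> Exi [d [B [d0 H]]] k0.
exists (Num.min d (expR (144 * (c - B) / k))); first by rewrite lt_min d0 expR_gt0.
move=> z oz; rewrite lt_min => /andP[z1 z2].
have D0 := Om_dE_gt0 E0 ET oz.
have g1 := gE_le_ln E0 ET mM (Om_cl_dom oz) D0.
have l1 : ln (dE E z) <= 144 * (c - B) / k.
  rewrite -[leRHS]expRK ler_ln ?posrE ?expR_gt0 //.
  by apply: le_trans (ltW z2); exact: dE_le.
have g2 : gE E z <= (c - B) / k.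
  apply: le_trans g1 _; rewrite ler_pdivrMr //; apply: le_trans l1 _.
  by rewrite le_eqVlt; apply/orP; left; apply/eqP; field; rewrite gt_eqF.
have : k * gE E z <= c - B by rewrite mulrC -ler_pdivlMr.
by have := H z oz z1; lra.
Qed.

(** Large values of U on the annulus cluster at a single point, and U is bounded near it: by
    continuity in Om, by hypothesis at points of E, by [U_bdry] elsewhere. *)
Lemma circle_bound l d0 : 0 < d0 -> (forall xi, E xi -> xi != l -> nm (xi - l) < d0 -> bdd_near xi) ->
  exists m1, forall z, Om E z -> d0 / 4 <= nm (z - l) -> nm (z - l) <= d0 / 2 -> U z <= m1.
Proof.
move=> d00 H; pose D z := [/\ Om E z, d0 / 4 <= nm (z - l) & nm (z - l) <= d0 / 2].
have [[z0 Dz0]|none] := pselect (exists z, D z); last first.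
  by exists 0 => z oz h1 h2; case: none; exists z.
have [|xi Hxi] := @sup_cluster R D U 2 z0 Dz0; first by move=> z [[/ltW]].
have near e : 0 < e -> d0 / 4 - e <= nm (xi - l) /\ nm (xi - l) <= d0 / 2 + e.
  move=> e0; have [z [[_ h1 h2] h3 _]] := Hxi e e0 z0 Dz0.
  have k1 := nm_tri z xi l; have k2 := nm_tri xi z l.
  by rewrite [nm (xi - z)]nmBC in k1; split; lra.
have b1 : d0 / 4 <= nm (xi - l) by apply/ler_addgt0Pr => e /near[]; lra.
have b2 : nm (xi - l) <= d0 / 2 by apply/ler_addgt0Pr => e /near[].
have [d [B [dd HB]]] : bdd_near xi.
  have [oxi|nO] := pselect (Om E xi).
    have [cU _] := U_sub oxi; have [d dd Hd] := cU 1 ltr01.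
    by exists d, (U xi + 1); split => // z _ /Hd; rewrite ltr_norml; lra.
  have [Exi|nE] := pselect (E xi).
    by apply: H => //; [rewrite -subr_eq0 -nm_gt0; lra|lra].
  by have [d dd Hd] := U_bdry nO nE ltr01; exists d, (m + 1).
exists B => z oz h1 h2; have [w [[ow _ _] wd Uw]] := Hxi d dd z (And3 oz h1 h2).
by apply: le_trans Uw _; exact: HB.
Qed.

(** Re W <= 1 means |z|^2 - 1 <= |z - l|^2, the inner side of the tangent at l. Since |z| - 1 <= eta
    d(z,E)^2 and d(z,E) <= |z - l|, the quadratic width of Om is what makes this hold. *)
Lemma Om_Re_cayley l z : E l -> Om E z -> z != l /\ complex.Re (cayley l z) <= 1.
Proof.
move=> El oz; have l1 : nm l = 1 by rewrite /nm (ET El).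
have zl : z != l.
  by apply/eqP => e; have := Om_dE_gt0 E0 ET oz; rewrite e dE_mem // ltxx.
have nz : 0 < nm (z - l) by rewrite nm_gt0 subr_eq0.
split => //; rewrite Re_cayley // ler_pdivrMr ?exprn_gt0 // mul1r.
have [h1 h2] := oz; have := dE_le z El; have D0 := dE_ge0 z E0 => Dl.
have D2 : dE E z ^+ 2 <= nm (z - l) ^+ 2 by rewrite lerXn2r ?nnegrE // ltW.
have e0 := eta_gt0 (R := R); have es := eta_small (R := R).
have z0 := nm_ge0 z.
have [c|c] := leP (nm z) 1; first by have := sqr_ge0 (nm (z - l)); nra.
have -> : nm z ^+ 2 - 1 = (nm z - 1) * (nm z + 1) by ring.
apply: le_trans D2; have q0 := sqr_ge0 (dE E z).
apply: le_trans (_ : eta * dE E z ^+ 2 * 3 <= _); first by apply: ler_pM;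
  clear q0 z0 Dl e0 es D0 l1 zl nz; lra.
by rewrite mulrAC ler_piMl //; lra.
Qed.

(** For |W| <= r the distance |z - l| is at least 2/(r + 1), so the distance of |z| from 1 is at
    least |Re W|/(3 r^2); on the outer half of the rhombus |Re W| is at least a quarter of r - |Im
    W|. The outcome is the growth that [barrier_outer] dominates. *)
Lemma bdry_growth l r z e C : E l -> Om E z -> 1 <= r -> nm (cayley l z) <= r ->
  0 < r - `|complex.Im (cayley l z)| -> r - `|complex.Im (cayley l z)| <= 4 * `|complex.Re (cayley l z)| ->
  0 < e -> (forall z, Om E z -> nm z != 1 -> U z <= e / `|nm z - 1| + C) ->
  U z <= e * (12 * r ^+ 2 / (r - `|complex.Im (cayley l z)|)) + C.
Proof.
move=> El oz r1 wr t0 ho e0 HC; have [zl x1] := Om_Re_cayley El oz.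
have l1 : nm l = 1 by rewrite /nm (ET El).
have x0 : 0 < `|complex.Re (cayley l z)| by lra.
have nz : 0 < nm (z - l) by rewrite nm_gt0 subr_eq0.
have xE := Re_cayley l1 zl.
have z1 : nm z != 1.
  by apply/eqP => h; move: x0; rewrite xE h expr1n subrr mul0r normr0 ltxx.
have s0 : 0 < `|nm z - 1| by rewrite normr_gt0 subr_eq0.
apply: le_trans (HC z oz z1) _; rewrite lerD2r ler_pM2l //.
have zl2 : 2 <= (r + 1) * nm (z - l).
  have h1 : nm (cayley l z - 1) <= nm (cayley l z) + nm (1 : R[i]) := nmB _ _.
  rewrite cayley_sub1 // nm1 in h1.
  by rewrite -ler_pdivrMr //; clear s0 xE z1 l1 x0 nz ho e0 zl x1 t0 r1; lra.
have xa : `|complex.Re (cayley l z)| = `|nm z - 1| * (nm z + 1) / nm (z - l) ^+ 2.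
  rewrite xE normrM normfV; congr (_ / _); last by rewrite ger0_norm // sqr_ge0.
  have -> : nm z ^+ 2 - 1 = (nm z - 1) * (nm z + 1) by ring.
  by rewrite normrM [`|nm z + 1|]ger0_norm // addr_ge0 // nm_ge0.
have z3 : nm z + 1 <= 3 by case: oz; clear r1 wr t0 ho e0 zl x1 l1 x0 nz xE z1 s0 zl2 xa; lra.
have q4 : 4 <= (2 * r) ^+ 2 * nm (z - l) ^+ 2.
  rewrite -exprMn; have -> : (4 : R) = 2 ^+ 2 by ring.
  by rewrite lerXn2r ?nnegrE //; nra.
have sx : `|complex.Re (cayley l z)| <= 3 * r ^+ 2 * `|nm z - 1|.
  rewrite xa ler_pdivrMr ?exprn_gt0 //.
  apply: le_trans (_ : `|nm z - 1| * 3 <= _); first by rewrite ler_pM2l.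
  rewrite (_ : 3 * r ^+ 2 * `|nm z - 1| * nm (z - l) ^+ 2 =
     `|nm z - 1| * (3 * (r ^+ 2 * nm (z - l) ^+ 2))); last by ring.
  rewrite ler_pM2l //; move: q4; rewrite exprMn;
    clear z3 xa s0 zl2 x0 nz xE z1 r1 wr t0 ho e0 zl x1 l1; lra.
rewrite ler_pdivlMr // mulrC ler_pdivrMr //.
by apply: le_trans ho _; move: sx; set a := 3 * r ^+ 2 * _; have -> : 12 * r ^+ 2 * `|nm z - 1| = 4 * a by [rewrite /a; ring];
  clear q4 z3 zl2 xa nz xE z1 s0 e0 zl x1 l1 x0 t0 r1 wr; lra.
Qed.

Local Ltac lin := clear -cE E0 ET mM U_bdry U_growth U_sub; lra.

(** For given e and k, the maximum principle bounds U + k g - e [cbarrier] on the part of Om near l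
    that W sends into a rhombus of size r. The constant of [U_growth] for e fixes r; as [barrier_le]
    does not involve r, letting e and k tend to 0 at a fixed point leaves U <= m2. *)
Lemma phragmen_lindelof l d0 : E l -> 0 < d0 ->
  (forall xi, E xi -> xi != l -> nm (xi - l) < d0 -> bdd_near xi) -> bdd_near l.
Proof.
move=> El d00 H; have [m1 Hm1] := circle_bound d00 H.
have l1 : nm l = 1 by rewrite /nm (ET El).
pose m2 := Num.max m m1; have mm : m <= m2 by rewrite le_max lexx.
have mm1 : m1 <= m2 by rewrite le_max lexx orbT.
exists (d0 / 2), m2; split; first by lra.
move=> z0 oz0 zd; have [zl0 x0] := Om_Re_cayley El oz0.
pose w0 := cayley l z0.
have key e k : 0 < e -> 0 < k ->
    U z0 + k * gE E z0 <= m2 + e * (28 * 9) + e * (16 * 67 * (1 + nm w0) + 9 * 12 * nm w0 ^+ 2).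
  move=> e0 k0; have [C HC] := U_growth e0.
  (* Above 16 for [barrier_outer], above 3 |w0| so that z0 belongs to [D], and with e r >= C - m2 to
     absorb the additive constant of the growth hypothesis. *)
  pose r := 17 + 3 * nm w0 + (`|C| + `|m2|) / e.
  have nw := nm_ge0 w0.
  have Ce : 0 <= (`|C| + `|m2|) / e by rewrite divr_ge0 ?addr_ge0 // ltW.
  have r16 : 16 < r by rewrite /r; clear -nw Ce; lra.
  have r0 : 0 < r by exact: lt_trans r16.
  have r1 : 1 <= r by apply/ltW/(le_lt_trans _ r16); rewrite ler1n.
  have Cr : C - m2 <= e * r.
    rewrite /r mulrDr [e * (_ / e)]mulrC divfK ?gt_eqF //.
    have := ler_norm C; have := ler_norm (- m2); rewrite normrN; have : 0 <= e * (17 + 3 * nm w0) by rewrite mulr_ge0 ?(ltW e0) //;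
      clear Ce r16 r0 r1 k0 e0 d00 l1 mm mm1 zd zl0 x0; lra.
    by clear d00 l1 mm mm1 zd zl0 x0 e0 k0 nw Ce r16 r0 r1; lra.
  pose F z := 2 * `|complex.Re (cayley l z)| + `|complex.Im (cayley l z)|.
  pose D z := (Om E z /\ nm (z - l) < d0 / 2) /\ F z < r.
  have DW z : D z -> [/\ z != l, complex.Re (cayley l z) <= 1,
      2 * `|complex.Re (cayley l z)| < r - `|complex.Im (cayley l z)|,
      `|complex.Im (cayley l z)| < r & nm (cayley l z) <= r].
    move=> [[oz _]]; rewrite /F => Fz; have [zl xl] := Om_Re_cayley El oz.
    have a0 := normr_ge0 (complex.Re (cayley l z)).
    by split => //; [|move: Fz a0|apply: le_trans (nm_le_ReIm _) _; move: Fz a0]; try move: Fz; lin.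
  have cF z : z != l -> cont_at F z.
    move=> zl; have [c1 c2] := cont_cayley zl.
    by apply: contD; [apply: contZ|]; exact: cont_abs.
  pose u z := (U z + k * gE E z) + (- e) * cbarrier l r z.
  have hB z : D z -> - (e * cbarrier l r z) <= e * (28 * 9).
    move=> Dz; have [zl x1 h hi _] := DW z Dz; have [-> _ _] := cbarrierE r0 zl hi.
    by rewrite -mulrN ler_pM2l // lerNl; exact: barrier_ge.
  have ug z : Om E z -> k * gE E z <= 0.
    by move=> oz; rewrite pmulr_rle0 //; exact: gE_le0 (Om_cl_dom oz) (Om_dE_gt0 E0 ET oz).
  have Dz0 : D z0.
    split => //; rewrite /F; have := nm_Re w0; have := nm_Im w0; rewrite /w0 /r;
      clear r16 r0 r1 Cr nw e0 k0 d00 l1 mm mm1 zd zl0 x0; lra.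
  have: u z0 <= m2 + e * (28 * 9).
    apply: (@max_principle R D u 2) Dz0.
    - by move=> z [[[/ltW]]].
    - apply: open3_lt; last by move=> z [oz _]; apply: cF; case: (Om_Re_cayley El oz).
      apply: open3_lt; first exact: open3_Om.
      by move=> z _; exact: cont_nm (an3_subr l z).
    - move=> z Dz; have [zl x1 h hi _] := DW z Dz; have [_ hh hc] := cbarrierE r0 zl hi.
      have oz : Om E z by case: Dz => [[]].
      have [cU sU] := U_sub oz; split.
        apply: contD; last exact: contZ.
        by apply: contD => //; apply: contZ; apply: cont_gE mM _ oz.
      apply: sub3D; last by apply: sub3_harm; exact: harm3Z.
      by apply: sub3D => //; apply: sub3_harm; apply: harm3Z; apply: harm3_gE mM _ oz.
    move=> xi nD e' e'0.
    (* It suffices to bound U + k g by m2, or to let the barrier absorb it. *)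
    have simple d : 0 < d -> (forall z, D z -> nm (z - xi) < d -> U z + k * gE E z <= m2 + e') ->
        exists2 d, 0 < d & forall z, D z -> nm (z - xi) < d -> u z <= m2 + e * (28 * 9) + e'.
      move=> dd Hd; exists d => // z Dz zd'; have := Hd z Dz zd'; have := hB z Dz.
      by rewrite /u mulNr; move: (k * gE E z) (U z) => p q; lin.
    have [far|near] := leP (d0 / 2) (nm (xi - l)).
      apply: (simple (d0 / 4)); first by clear k0 nw Ce r16 r0 r1 Cr e'0 far zd zl0 x0 e0 mm mm1 l1; lra.
      move=> z [[oz zl] Fz] zx; have k1 := nm_tri z xi l; rewrite [nm (z - xi)]nmBC in zx.
      have zl' : d0 / 4 <= nm (z - l) by move: far zx k1; lin.
      by have := Hm1 z oz zl' (ltW zl); have := ug z oz; move: mm1 e'0; move: (k * gE E z) (U z) => p q; lin.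
    (* No point of [D] is close to l: |W| <= r on [D], while W tends to infinity at l. *)
    have [xl|xl] := eqVneq xi l.
      exists (2 / (r + 1)) => [|z Dz]; first by rewrite divr_gt0 //; clear -r16; lra.
      rewrite xl => zd'; have [zl _ _ _ wr] := DW z Dz.
      have nz : 0 < nm (z - l) by rewrite nm_gt0 subr_eq0.
      have h1 : nm (cayley l z - 1) <= nm (cayley l z) + nm (1 : R[i]) := nmB _ _.
      rewrite cayley_sub1 // nm1 ler_pdivrMr // in h1.
      move: zd'; rewrite ltr_pdivlMr; last by
        clear wr nz h1 zl xl Cr e'0 near r0 r1 d00 l1 mm mm1 zd zl0 x0 e0 k0 nw Ce; lra.
      have : (nm (cayley l z) + 1) * nm (z - l) <= (r + 1) * nm (z - l) by rewrite ler_pM2r //; move: wr; lin.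
      by move: h1; rewrite -/(u z); move: (u z) => v; lin.
    have [Exi|nE] := pselect (E xi).
      have [d dd Hd] := gE_to_minfty m2 Exi (H xi Exi xl ltac:(lra)) k0.
      by apply: (simple d) => // z [[oz _] _] zx; have := Hd z oz zx; move: e'0; move: (U z + _) => p; lin.
    have [oxi|nO] := pselect (Om E xi); last first.
      have [d dd Hd] := U_bdry nO nE e'0; apply: (simple d) => // z [[oz _] _] zx.
      by have := Hd z oz zx; have := ug z oz; move: mm; move: (k * gE E z) (U z) => p q; lin.
    have Fxi : r <= F xi by rewrite leNgt; apply/negP => h; apply: nD.
    have [cr ci] := cont_cayley xl.
    pose a := `|complex.Re (cayley l xi)|; have a0 : 0 <= a by exact: normr_ge0.
    (* Now xi is in Om and F xi >= r. If Re W is nonzero at xi, nearby points of [D] lie in the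
       outer half of the rhombus, where the barrier outweighs the growth of U; if Re W = 0, they
       approach a vertex, where the barrier blows up and U is bounded by continuity. *)
    have [ap|ap] := leP a 0; last first.
      have cG : cont_at (fun z => 4 * `|complex.Re (cayley l z)| + `|complex.Im (cayley l z)|) xi.
        by apply: contD; [apply: contZ|]; exact: cont_abs.
      have [d dd Hd] := cG a ap; exists d => // z Dz zx.
      have oz : Om E z by case: Dz => [[]].
      have [zl x1 h hi wr] := DW z Dz.
      have ho : r - `|complex.Im (cayley l z)| <= 4 * `|complex.Re (cayley l z)|.
        by have := Hd z zx; rewrite ltr_norml; move: Fxi; rewrite /F -/a; lin.
      have tz : 0 < r - `|complex.Im (cayley l z)| by rewrite subr_gt0.
      have bg := bdry_growth El oz r1 wr tz ho e0 HC.
      have [eq _ _] := cbarrierE r0 zl hi.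
      have := barrier_outer r16 x1 h ho; rewrite -eq -(ler_pM2l e0) mulrDr => bo.
      have := ug z oz; rewrite /u mulNr; move: bo bg Cr; set X := e * (12 * _ / _).
      by have : 0 <= e * (28 * 9) by [rewrite mulr_ge0 // ltW]; move: e'0; move: (e * (28 * 9)) (k * gE E z) (U z) => p q v; lin.
    have aE : complex.Re (cayley l xi) = 0.
      by apply/eqP; rewrite -normr_eq0 -/a eq_le ap a0.
    have Yr : r <= `|complex.Im (cayley l xi)| by move: Fxi; rewrite /F aE normr0; lin.
    have [d1 dd1 Hd1] := (U_sub oxi).1 1 ltr01.
    (* In units of 9 r, the size of the barrier for which e times it exceeds U xi + 1 - m2; [th] is
       the distance to the vertex that ensures this size. *)
    pose K := `|U xi + 1 - m2| / (9 * r * e) + 2.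
    have K0 : 2 <= K by rewrite lerDr divr_ge0 // !mulr_ge0 ?(ltW e0) ?(ltW r0).
    pose th := r / (3 * K); have th0 : 0 < th by rewrite divr_gt0 //; clear -K0; lra.
    have [d2 dd2 Hd2] := cont_abs ci th0.
    exists (Num.min d1 d2); first by rewrite lt_min dd1.
    move=> z Dz; rewrite lt_min => /andP[z1 z2].
    have oz : Om E z by case: Dz => [[]].
    have [zl x1 h hi wr] := DW z Dz.
    have [eq _ _] := cbarrierE r0 zl hi.
    have Uz : U z <= U xi + 1.
      by rewrite -lerBlDl; apply: le_trans (ler_norm _) (ltW (Hd1 z z1)).
    have tz : r - `|complex.Im (cayley l z)| <= th by have := Hd2 z z2; rewrite ltr_norml; move: Yr; lin.
    have t0 : 0 < r - `|complex.Im (cayley l z)| by rewrite subr_gt0.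
    have bv := barrier_vertex r0 x1 h.
    have big : 3 * K <= r / (r - `|complex.Im (cayley l z)|).
      rewrite ler_pdivlMr // mulrC -ler_pdivlMr //; clear -K0; lra.
    have sq : K <= 12 / 25 * (r / (r - `|complex.Im (cayley l z)|)) ^+ 2 - 2.
      have : (3 * K) ^+ 2 <= (r / (r - `|complex.Im (cayley l z)|)) ^+ 2.
        by rewrite lerXn2r ?nnegrE //; move: big K0; set y := r / _; lin.
      rewrite exprMn; move: K0; set y := r / _; clear; nra.
    have bK : 9 * r * K <= cbarrier l r z.
      by rewrite eq; apply: le_trans bv; rewrite ler_pM2l // mulr_gt0.
    have eK : `|U xi + 1 - m2| <= e * (9 * r * K).
      rewrite /K mulrDr mulrDr [9 * r * (_ / _)](_ : _ = `|U xi + 1 - m2| / e); last first.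
        by field; rewrite !gt_eqF.
      rewrite [e * (_ / e)]mulrC divfK ?gt_eqF // lerDl; apply: mulr_ge0 (ltW e0) _.
      by apply: mulr_ge0 => //; apply: mulr_ge0 => //; exact: ltW.
    have eB : e * (9 * r * K) <= e * cbarrier l r z by rewrite ler_pM2l.
    have := ug z oz; have := ler_norm (U xi + 1 - m2); rewrite /u mulNr.
    by have : 0 <= e * (28 * 9) by [rewrite mulr_ge0 // ltW]; move: e'0 Uz eK eB; move: (e * (28 * 9)) (e * cbarrier l r z) (k * gE E z) (U z) (U xi) => p q v v' v''; lin.
  rewrite /u mulNr => uz; have [zl x1 h hi _] := DW z0 Dz0.
  have [eq _ _] := cbarrierE r0 zl hi.
  have bl := @barrier_le R r w0 r1 ltac:(rewrite /r; clear -nw Ce; lra).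
  rewrite eq -/w0 lerBlDr in uz; apply: le_trans uz _.
  by rewrite lerD2l ler_pM2l.
apply/ler_addgt0Pr => e e0; set Q := 16 * 67 * (1 + nm w0) + 9 * 12 * nm w0 ^+ 2 in key.
have Q0 : 0 <= Q.
  by rewrite /Q; move: (nm w0) (nm_ge0 w0) => x; have := sqr_ge0 x; lin.
have g0 := gE_le0 E0 ET mM (Om_cl_dom oz0) (Om_dE_gt0 E0 ET oz0).
have Qp : 0 < 28 * 9 + Q by move: Q0; lin.
have gp : 0 < 1 - gE E z0 by rewrite subr_gt0 (le_lt_trans g0).
pose e1 := e / (2 * (28 * 9 + Q)); have e10 : 0 < e1 by rewrite divr_gt0 // mulr_gt0.
pose k1 := e / (2 * (1 - gE E z0)); have k10 : 0 < k1 by rewrite divr_gt0 // mulr_gt0.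
have K1 : e1 * (28 * 9) + e1 * Q = e / 2.
  by rewrite -mulrDr /e1; move: (28 * 9 + Q) Qp => q q0; field; rewrite gt_eqF.
have K2 : - (k1 * gE E z0) <= e / 2.
  have : k1 * (1 - gE E z0) = e / 2 by rewrite /k1; move: (1 - gE E z0) gp => q q0; field; rewrite gt_eqF.
  by rewrite mulrDr mulr1 mulrN; move: k10; move: (k1 * _) => p; lin.
by have := key e1 k1 e10 k10; move: K1 K2; move: (k1 * _) (U z0) => p v; lin.
Qed.

End PhragmenLindelof.

(** * Growth of the resolvent *)

Section ResolventBound.
Context {R : realType}.
Implicit Types (z : R[i]).

Lemma PL_bound (E : set R[i]^o) (M : R) (U : R[i] -> R) (m : R) :
  countable E -> closed E -> E !=set0 -> E `<=` unit_circle -> (forall N, mass E N <= M) ->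
  (forall xi, ~ Om E xi -> ~ E xi -> forall e, 0 < e ->
     exists2 d, 0 < d & forall z, Om E z -> nm (z - xi) < d -> U z <= m + e) ->
  (forall e, 0 < e -> exists C, forall z, Om E z -> nm z != 1 -> U z <= e / `|nm z - 1| + C) ->
  (forall z, Om E z -> cont_at U z /\ sub3 U z) ->
  forall z, Om E z -> U z <= m.
Proof.
move=> ctE cE E0 ET mM F1 F2 F3.
have bdd l : E l -> bdd_near E U l.
  move=> El; apply: contrapT => nl; pose E1 : set R[i]^o := [set l | E l /\ ~ bdd_near E U l].
  have cE1 : closed E1.
    move=> x xE; have Ex : E x by apply: cE => B /xE [y [[Ey _] By]]; exists y.
    split => // -[d [B [d0 HB]]].
    have bx : nbhs (x : R[i]^o) [set w | nm (x - w) < d / 2].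
      apply/nbhs_ballP; exists (d / 2)%:C%C => /=; first by rewrite ltcR divr_gt0.
      by move=> w; rewrite /ball /= nmE ltcR.
    have [y [[Ey ny] yd]] := xE _ bx; apply: ny; exists (d / 2), B; split; first by rewrite divr_gt0.
    move=> z oz zy; apply: HB => //.
    have := nm_tri (y : R[i]) z x; rewrite [nm (y - x)]nmBC; move: yd zy => /=; lra.
  have ct1 : countable E1 by apply: sub_countable ctE; apply: subset_card_le => w [].
  have [l1 [El1 nl1] [d d0 Hd]] := isolated_point cE1 ct1 (ex_intro _ l (conj El nl)).
  apply: nl1; apply: (phragmen_lindelof E0 ET mM F1 F2 F3 El1 d0) => xi Exi xl xd.
  by apply: contrapT => nb; move/eqP: xl; apply; apply: Hd.
(* With U bounded near every point of E, the term k g forces minus infinity there, so the maximum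
   principle applies on all of Om; afterwards k tends to 0. *)
have key k : 0 < k -> forall z, Om E z -> U z + k * gE E z <= m.
  move=> k0; apply: (@max_principle R (Om E) _ 2).
  - by move=> z [/ltW].
  - exact: open3_Om.
  - move=> z oz; have [cU sU] := F3 z oz; split.
      by apply: contD => //; apply: contZ; apply: cont_gE mM _ oz.
    by apply: sub3D => //; apply: sub3_harm; apply: harm3Z; apply: harm3_gE mM _ oz.
  move=> xi nO e e0; have [Exi|nE] := pselect (E xi).
    have [d dd Hd] := gE_to_minfty E0 ET mM m Exi (bdd xi Exi) k0.
    by exists d => // z oz zd; apply: le_trans (Hd z oz zd) _; rewrite lerDl ltW.
  have [d dd Hd] := F1 xi nO nE e e0; exists d => // z oz zd.
  have g0 := gE_le0 E0 ET mM (Om_cl_dom oz) (Om_dE_gt0 E0 ET oz).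
  by apply: le_trans (Hd z oz zd); rewrite gerDl pmulr_rle0.
move=> z oz; apply/ler_addgt0Pr => e e0.
have g0 := gE_le0 E0 ET mM (Om_cl_dom oz) (Om_dE_gt0 E0 ET oz).
pose k := e / (1 - gE E z); have k0 : 0 < k by rewrite divr_gt0 //; lra.
have := key k k0 z oz.
have : k * (1 - gE E z) = e by rewrite /k divfK // gt_eqF //; lra.
by rewrite mulrBr mulr1; lra.
Qed.

Section Operator.
Variables (V : completeNormedModType R[i]) (T S : V -> V) (E : set R[i]^o) (M : R).
Hypotheses (bT : bounded_operator T) (iTS : bounded_inverse T S).
Hypotheses (ctE : countable E) (cE : closed E) (E0 : E !=set0) (ET : E `<=` unit_circle)
  (mM : forall N, mass E N <= M).
Variables (Rz : R[i] -> V -> V) (C1 : R) (Q : nat).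
Hypothesis HR : forall z, ~ E z -> resolvent T z (Rz z).
Hypothesis C1_ge1 : 1 <= C1.
Hypothesis outer : forall z, ~ E z -> 1 < nm z -> nm z <= 2 ->
  forall y, nm (Rz z y) <= C1 * (nm z - 1) ^- Q * nm y.
Hypothesis inner : forall eps, 0 < eps -> exists2 C : R, 0 <= C &
  forall z, ~ E z -> nm z < 1 -> forall y, nm (Rz z y) <= C * expR (eps / (1 - nm z)) * nm y.

(** Near the outer boundary of Om, |z| - 1 >= eta d^2/2, so ln C1 - Q ln(|z| - 1) <= m - 2 Q ln d.
    With this [K], K g <= 2 Q ln d cancels the last term. *)
Let K : R := 2 * 144 * Q%:R.
Let m : R := ln C1 + Q%:R * (ln 2 - ln eta).

Lemma Om_notin z : Om E z -> ~ E z.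
Proof. by move=> oz Ez; have := Om_dE_gt0 E0 ET oz; rewrite dE_mem // ltxx. Qed.

Lemma res_neq0 z y : ~ E z -> y != 0 -> Rz z y != 0.
Proof.
move=> nE; apply: contraNneq => h; have := resK y (HR nE).
by rewrite h scaler0 (lin_0 bT.1) subr0 => <-.
Qed.

Let ln_eta : ln eta <= 0 :> R.
Proof. by apply: ln_le0; have := eta_small (R := R); have := eta_gt0 (R := R); lra. Qed.

Lemma ln_outer z y : y != 0 -> ~ E z -> 1 < nm z -> nm z <= 2 ->
  ln (nm (Rz z y)) - ln (nm y) <= ln C1 - Q%:R * ln (nm z - 1).
Proof.
move=> y0 nE z1 z2; have ny : 0 < nm y by rewrite nm_gt0.
have nR : 0 < nm (Rz z y) by rewrite nm_gt0 res_neq0.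
have d0 : 0 < nm z - 1 by rewrite subr_gt0.
have dq : 0 < (nm z - 1) ^- Q by rewrite invr_gt0 exprn_gt0.
have C10 : 0 < C1 by exact: lt_le_trans C1_ge1.
rewrite lerBlDr.
have : ln (nm (Rz z y)) <= ln (C1 * (nm z - 1) ^- Q * nm y).
  by rewrite ler_ln ?posrE ?outer // !mulr_gt0.
by rewrite !lnM ?posrE ?mulr_gt0 // lnV ?posrE ?exprn_gt0 // lnXn // mulr_natl.
Qed.

Lemma resolvent_potential z y : y != 0 -> Om E z ->
  ln (nm (Rz z y)) - ln (nm y) + K * gE E z <= m.
Proof.
move=> y0; have Q0 : 0 <= Q%:R :> R by [].
have K0 : 0 <= K by rewrite mulr_ge0.
have l2 : 0 <= ln 2 :> R by rewrite ln_ge0 // ler1n.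
have Kg w : Om E w -> K * gE E w <= 0.
  by move=> ow; rewrite mulr_ge0_le0 // (gE_le0 E0 ET mM (Om_cl_dom ow) (Om_dE_gt0 E0 ET ow)).
move: z; apply: (PL_bound (U := fun z => ln (nm (Rz z y)) - ln (nm y) + K * gE E z)
  ctE cE E0 ET mM).
- move=> xi nO nE e e0.
  (* The boundary at |xi| >= 2 comes from the truncation of Om; there |z| - 1 is at least 1/2 and g
     <= 0 suffices. *)
  have [x2|x2] := leP 2 (nm xi).
    exists (1 / 2); first by lra.
    move=> z oz zx; have h := nm_subl xi z; rewrite nmBC in h.
    have [z2 _] := oz; have z1 : 1 < nm z by lra.
    have lo := ln_outer y0 (Om_notin oz) z1 (ltW z2).
    have lz : - ln 2 <= ln (nm z - 1) by rewrite -lnV ?posrE // ler_ln ?posrE ?invr_gt0 //;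
      clear z2 z1 lo y0 Q0 K0 l2 e0; lra.
    have := ler_wpM2l Q0 lz; have := ler_wpM2l Q0 ln_eta; have := Kg z oz.
    by rewrite /m mulr0 mulrN mulrBr; clear lz z1 zx h z2 x2 l2 y0 Q0 K0; lra.
  have D0 : 0 < dE E xi by exact: dE_gt0.
  set D := dE E xi in D0.
  have xo : 1 + eta * D ^+ 2 <= nm xi by rewrite leNgt; apply/negP => h; apply: nO.
  have e1 := eta_gt0 (R := R).
  have s0 : 0 < eta * D ^+ 2 by pos.
  exists (Num.min (D / 10) (eta * D ^+ 2 / 4)); first by rewrite lt_min; apply/andP; split; lra.
  move=> z oz; rewrite lt_min => /andP[zx1 zx2].
  have h := nm_subl xi z; rewrite nmBC in h.
  have Dz := dE_lip z xi E0; have Dz0 := Om_dE_gt0 E0 ET oz; rewrite -/D in Dz.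
  have [z2 _] := oz; have z1 : 1 < nm z by clear Dz0 Dz zx1 e1 y0 Q0 K0 l2 e0 x2 D0; lra.
  have lo := ln_outer y0 (Om_notin oz) z1 (ltW z2).
  have big : eta / 2 * dE E z ^+ 2 <= nm z - 1.
    have q : dE E z ^+ 2 <= (11 / 10 * D) ^+ 2 by rewrite lerXn2r ?nnegrE //;
      clear z2 z1 lo zx2 h s0 y0 Q0 K0 l2 e0 x2 D0 xo e1; lra.
    rewrite exprMn in q; have := ler_wpM2l (ltW e1) q.
    by move: h zx2; clear Dz z2 z1 lo q Dz0 zx1 e1 D0 e0 x2 y0 Q0 K0 l2; lra.
  have lz : ln eta - ln 2 + 2 * ln (dE E z) <= ln (nm z - 1).
    rewrite -lnV ?posrE // -lnM ?posrE ?invr_gt0 //.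
    have -> : 2 * ln (dE E z) = ln (dE E z ^+ 2) by rewrite lnXn // mulr_natl.
    have p1 : 0 < eta / 2 :> R by rewrite divr_gt0.
    have p2 : 0 < dE E z ^+ 2 by rewrite exprn_gt0.
    by rewrite -lnM ?posrE // ler_ln ?posrE ?mulr_gt0 ?subr_gt0.
  have gl := gE_le_ln E0 ET mM (Om_cl_dom oz) Dz0.
  have := ler_wpM2l K0 gl; have := ler_wpM2l Q0 lz.
  by rewrite /m /K; move: e0 lo; clear big lz gl z1 z2 zx1 zx2 h Dz0 Dz x2 D0 xo e1 s0 l2 K0 y0 Q0; lra.
- move=> e e0; have [C C0 HC] := inner e0.
  pose e' := e / (Q%:R + 1); have e'0 : 0 < e' by rewrite divr_gt0 //; lra.
  pose B := ln (C + 1) + (ln C1 + Q%:R * `|ln e'|).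
  have c1 : 0 <= ln (C + 1) by rewrite ln_ge0 //; lra.
  have c2 : 0 <= ln C1 + Q%:R * `|ln e'| by rewrite addr_ge0 ?ln_ge0 ?mulr_ge0.
  exists B => z oz; have nE := Om_notin oz; have kg := Kg z oz.
  rewrite neq_lt => /orP[z1|z1].
    have ny : 0 < nm y by rewrite nm_gt0.
    have nR : 0 < nm (Rz z y) by rewrite nm_gt0 res_neq0.
    have : ln (nm (Rz z y)) <= ln ((C + 1) * expR (e / (1 - nm z)) * nm y).
      have C10 : 0 < C + 1 by lra.
      rewrite ler_ln ?posrE ?mulr_gt0 ?expR_gt0 //; apply: le_trans (HC z nE z1 y) _.
      by rewrite ler_wpM2r ?(ltW ny) // ler_wpM2r ?expR_ge0 // lerDl.
    rewrite !lnM ?posrE ?mulr_gt0 ?expR_gt0 //; try lra.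
    by rewrite expRK distrC gtr0_norm ?subr_gt0 // /B; move: kg c2; lra.
  have [z2 _] := oz; have lo := ln_outer y0 nE z1 (ltW z2).
  have d0 : 0 < nm z - 1 by rewrite subr_gt0.
  rewrite gtr0_norm //.
  (* ln x <= x - 1 turns - Q ln(|z| - 1) into a small multiple of 1/(|z| - 1) plus a constant, as
     the growth condition asks. *)
  have : ln (e' / (nm z - 1)) <= e' / (nm z - 1) - 1 by apply: ln_leB1; rewrite divr_gt0.
  rewrite ln_div ?posrE // => le1.
  have le2 := ler_norm (- ln e'); rewrite normrN in le2.
  have le3 : - ln (nm z - 1) <= e' / (nm z - 1) + `|ln e'| by lra.
  have le4 := ler_wpM2l Q0 le3.
  have le5 : Q%:R * (e' / (nm z - 1)) <= e / (nm z - 1).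
    rewrite mulrA ler_pM2r ?invr_gt0 // /e' mulrA ler_pdivrMr; last by
      clear kg z1 z2 lo d0 le1 le2 le3 le4 e0 C0 e'0 c1 c2 K0 l2 y0; lra.
    by rewrite mulrC ler_pM2l //; clear y0 Q0 K0 l2 e0 C0 e'0 c1 c2 kg z1 z2 lo d0 le1 le2 le3 le4; lra.
  by rewrite /B; move: lo le4 le5 kg c1; rewrite mulrDr mulrN;
    clear le3 le1 le2 d0 z2 z1 c2 e'0 e0 C0 y0 Q0 K0 l2; lra.
- move=> z oz; have [d d0 Hd] := open3_Om E0 ET oz.
  have a := @an3_resolvent R V T Rz z d y bT.1 d0 (fun w wz => HR (Om_notin (Hd w wz))).
  have n0 := res_neq0 (Om_notin oz) y0; split.
    apply: contD; last by apply: contZ; apply: cont_gE mM _ oz.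
    by apply: contD; [exact: cont_ln_nm|exact: cont_const].
  apply: sub3D; last by apply: sub3_harm; apply: harm3Z; apply: harm3_gE mM _ oz.
  by apply: sub3D; [exact: sub3_ln|apply: sub3_harm; exact: harm3_const].
Qed.

Lemma disc_Om z : nm z < 1 -> Om E z.
Proof.
move=> z1; split; first by lra.
by apply: lt_le_trans z1 _; rewrite lerDl mulr_ge0 ?sqr_ge0 // ltW // eta_gt0.
Qed.

Lemma resolvent_disc z y : nm z < 1 -> nm (Rz z y) <= expR (m - K * gE E z) * nm y.
Proof.
move=> z1; have [->|y0] := eqVneq y 0.
  by rewrite (lin_0 (res_lin (HR (Om_notin (disc_Om z1))))) !nm0 mulr0.
have oz := disc_Om z1; have := resolvent_potential y0 oz.
have nR := res_neq0 (Om_notin oz) y0.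
set a := ln (nm (Rz z y)); set b := ln (nm y) => h.
have -> : nm (Rz z y) = expR a by rewrite lnK // posrE nm_gt0.
have -> : nm y = expR b by rewrite lnK // posrE nm_gt0.
by rewrite -expRD ler_expR; lra.
Qed.

End Operator.
End ResolventBound.

(** * From the integral condition to property P *)

Section ForwardDirection.
Context {R : realType}.
Implicit Types (E : set R[i]^o) (s t : R).

(** The first terms are absorbed thanks to 1 <= G; [G] is kept apart from [g] because n^s may vanish
    at n = 0. *)
Lemma eqO_bound (f g G : nat -> R) : (f : nat -> R^o) =O_\oo (g : nat -> R^o) ->
  (forall n, `|g n| <= G n) -> (forall n, 1 <= G n) ->
  exists2 C, 0 <= C & forall n, `|f n| <= C * G n.
Proof.
move=> /eqO_exP [k k0 [N _ HN]] gG G1.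
exists (k + \sum_(i < N) `|f i|); first by rewrite addr_ge0 ?(ltW k0) ?sumr_ge0.
move=> n; rewrite mulrDl; have G0 : 0 <= G n by apply: le_trans (G1 n).
have S0 : 0 <= \sum_(i < N) `|f i| by rewrite sumr_ge0.
have [nN|Nn] := ltnP n N.
  apply: ler_wpDl; first by rewrite mulr_ge0 // ltW.
  apply: le_trans (ler_peMr S0 (G1 n)).
  by rewrite (bigD1 (Ordinal nN)) //= lerDl sumr_ge0.
apply: ler_wpDr; first by rewrite mulr_ge0.
by apply: le_trans (HN n Nn) _; rewrite ler_pM2l.
Qed.

Lemma bound_eqO (f g : nat -> R) C : 0 <= C -> (forall n, (0 < n)%N -> `|f n| <= C * `|g n|) ->
  (f : nat -> R^o) =O_\oo (g : nat -> R^o).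
Proof.
move=> C0 H; apply/eqO_exP; exists (C + 1); first by lra.
exists 1%N => // n /= n0; apply: le_trans (H n n0) _.
by rewrite ler_wpM2r // lerDl.
Qed.

Section OneOperator.
Variables (V : completeNormedModType R[i]) (T S : V -> V).
Hypotheses (bT : bounded_operator T) (iTS : bounded_inverse T S).

(** Liouville's argument through the maximum principle: on a circle of large radius r the resolvent
    applied to y' is at most |y'|/(r - ||T||), so R(0) T y = 0 and y = 0. This settles the case of
    empty E. *)
Lemma empty_spectrum : spectrum T `<=` set0 -> forall y : V, y = 0.
Proof.
move=> sp y.
have HR z : exists Q, resolvent T z Q by apply: contrapT => h; exact: (sp z h).
have [Rz HRz] := choice HR.
have big r y' : opnorm T < r -> forall z, nm z = r -> nm (Rz z y') <= nm y' / (r - opnorm T).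
  move=> Tr z zr; rewrite ler_pdivlMr ?subr_gt0 //.
  have e := resK y' (HRz z); have h1 := opnorm_ub (Rz z y') bT.
  have : nm (z *: Rz z y') <= nm y' + nm (T (Rz z y')).
    by rewrite -{2}e; have := nmD (z *: Rz z y' - T (Rz z y')) (T (Rz z y')); rewrite subrK.
  by rewrite nmZ zr mulrBr ![nm (Rz z y') * _]mulrC; lra.
have T0 := opnorm_ge0 bT.
suff : nm (Rz 0 (T y)) <= 0.
  rewrite le_eqVlt ltNge nm_ge0 orbF nm_eq0 => /eqP h.
  have := resK (T y) (HRz 0); rewrite h (lin_0 bT.1) scaler0 subr0 => Ty.
  have [[lS _] c _] := iTS; by rewrite -(c y) -Ty (lin_0 lS).
apply/ler_addgt0Pr => e e0; rewrite add0r.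
have n0 := nm_ge0 (T y).
pose r := opnorm T + (nm (T y) + 1) / e.
have p0 : 0 < (nm (T y) + 1) / e by rewrite divr_gt0 //; lra.
have : nm (Rz 0 (T y)) <= nm (T y) / (r - opnorm T).
  apply: (@max_disc R V (fun z => Rz z (T y)) r).
  - by rewrite divr_ge0 // /r; lra.
  - by move=> z _; apply: (@an3_resolvent R V T Rz z 1 (T y) bT.1 ltr01).
  - by apply: big; rewrite /r; lra.
  - by rewrite nm0 /r; lra.
move=> h; apply: le_trans h _; rewrite /r addrC addKr invf_div.
by rewrite mulrA ler_pdivrMr ?[nm (T y) * e]mulrC ?ler_pM2l ?lerDl // ltr_wpDl.
Qed.

(** On the circle of radius 1 - 1/(n + 2) the bound exp(m - K g) is a power of n + 2, by the
    logarithmic lower bound on g, and the factor r^-n of Cauchy's formula stays below e. *)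
Lemma power_bound E M (C0 C' : R) (q : nat) : countable E -> closed E -> E !=set0 ->
  E `<=` unit_circle -> (forall N, mass E N <= M) -> spectrum T `<=` E -> 0 <= C0 ->
  (forall n, opnorm (iter n T) <= C0 * n.+1%:R ^+ q) ->
  (forall eps, 0 < eps -> exists2 A : R, 0 <= A &
     forall n : nat, opnorm (iter n S) <= A * expR (eps * Num.sqrt n%:R)) ->
  0 <= C' -> (forall z, nm z < 1 -> - gE E z <= C' * (1 + ln (1 - nm z)^-1)) ->
  exists2 B, 0 <= B & forall n, opnorm (iter n.+1 S) <=
    B * n.+2%:R `^ (2 * 144 * (2 * q.+1)%:R * C').
Proof.
move=> ctE cE E0 ET mM sp C00 HT HS C'0 HC'.
have HR z : exists Q, ~ E z -> resolvent T z Q.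
  have [Ez|nE] := pselect (E z); first by exists id.
  have [Q HQ] : exists Q, resolvent T z Q by apply: contrapT => h; apply: nE; exact: sp.
  by exists Q.
have [Rz HRz] := choice HR.
have [C1' C10 outer] := res_outer bT C00 HT.
pose C1 := C1' + 1; have C11 : 1 <= C1 by rewrite lerDr.
have outer' z : ~ E z -> 1 < nm z -> nm z <= 2 ->
    forall y, nm (Rz z y) <= C1 * (nm z - 1) ^- (2 * q.+1) * nm y.
  move=> nE z1 z2 y; apply: le_trans (outer z _ (HRz z nE) z1 z2 y) _.
  apply: ler_wpM2r; first exact: nm_ge0.
  by apply: ler_wpM2r; [rewrite invr_ge0 exprn_ge0 // subr_ge0 ltW|rewrite lerDl].
have inner eps : 0 < eps -> exists2 C : R, 0 <= C & forall z, ~ E z -> nm z < 1 ->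
    forall y, nm (Rz z y) <= C * expR (eps / (1 - nm z)) * nm y.
  move=> eps0; have [C C20 H] := res_inner iTS HS eps0.
  by exists C => // z nE z1 y; exact: H (HRz z nE) z1 y.
have disc := resolvent_disc bT ctE cE E0 ET mM HRz C11 outer' inner.
set K : R := 2 * 144 * (2 * q.+1)%:R in disc *; set m : R := ln C1 + _ in disc.
have K0 : 0 <= K by rewrite mulr_ge0.
have KC0 : 0 <= K * C' by rewrite mulr_ge0.
pose B0 := expR (m + K * C'); exists (B0 * expR 1); first by rewrite mulr_ge0 ?expR_ge0.
move=> n; pose N : R := n.+2%:R; have N0 : 0 < N by rewrite ltr0n.
have N1 : 1 < N by rewrite ltr1n.
pose r := 1 - N^-1; have r1 : r < 1 by rewrite /r ltrBlDr ltrDl invr_gt0.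
have r0 : 0 < r by rewrite subr_gt0 invf_lt1.
pose B := B0 * N `^ (K * C'); have BB : 0 <= B by rewrite mulr_ge0 ?expR_ge0 ?powR_ge0.
have discr (z : R[i]) : nm z = r -> forall y, nm (Rz z y) <= B * nm y.
  move=> zr y; have z1 : nm z < 1 by rewrite zr.
  apply: le_trans (disc z y z1) _; apply: ler_wpM2r; first exact: nm_ge0.
  have -> : B = expR (m + K * C' + K * C' * ln N).
    by rewrite expRD /B /powR gt_eqF.
  rewrite ler_expR; have := ler_wpM2l K0 (HC' z z1); rewrite zr.
  have -> : (1 - r)^-1 = N by rewrite /r opprB addrC subrK invrK.
  lra.
have HRr z : nm z < 1 -> resolvent T z (Rz z).
  by move=> z1; apply: HRz; apply: (Om_notin E0 ET); exact: disc_Om.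
have lS : linear S by case: iTS => [[]].
apply: opnorm_le; [by rewrite !mulr_ge0 ?expR_ge0 ?powR_ge0|exact: lin_iter|].
move=> x; have h := @cauchy_resolvent R V T S Rz r 1 B n bT iTS r0 r1 BB HRr discr x.
apply: le_trans h _.
apply: ler_wpM2r; first exact: nm_ge0.
rewrite ler_pdivrMr ?exprn_gt0 // /B -/N.
have -> : B0 * expR 1 * N `^ (K * C') * r ^+ n = B0 * N `^ (K * C') * (expR 1 * r ^+ n) by ring.
apply: (ler_peMr BB).
have -> : expR 1 * r ^+ n = expR 1 / (1 + n.+1%:R^-1) ^+ n.
  congr (_ * _); rewrite -exprVn; congr (_ ^+ n); rewrite /r /N -[n.+2%:R]natr1.
  have : 0 < n.+1%:R :> R by rewrite ltr0n.
  by move: n.+1%:R => a a0; field; rewrite !gt_eqF //;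
    clear E0 ET sp C00 C'0 C10 C11 K0 KC0 N0 N1 r1 r0 BB; lra.
rewrite ler_pdivlMr ?mul1r; last by rewrite exprn_gt0 // ltr_wpDr // invr_ge0.
apply: le_trans (_ : expR (n.+1%:R^-1) ^+ n <= _).
  by rewrite lerXn2r ?nnegrE ?expR_ge0 ?expR_ge1Dx // addr_ge0 // invr_ge0.
rewrite -expRM_natl ler_expR mulr_natl -mulr_natr mulrC ler_pdivrMr ?ltr0n // mul1r ler_nat.
exact: leqnSn.
Qed.

End OneOperator.

Lemma opnorm_trivial (V : completeNormedModType R[i]) (A : V -> V) :
  (forall y : V, y = 0) -> opnorm A = 0.
Proof.
move=> triv; rewrite /opnorm (_ : [set _ | _ in _] = [set 0]) ?sup1 //.
apply/seteqP; split => [_ [u _ <-]|_ ->]; first by rewrite (triv (A u)) rnormE nm0.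
by exists 0; rewrite /= ?(triv (A 0)) rnormE nm0.
Qed.

Lemma integral_finite E (C1 C2 : R) :
  (forall a b : R, a < b -> b - a <= 2 * pi ->
       (((b - a)^-1)%:E * \int[lebesgue_measure]_(t in `[a, b]) logp_inv_dist E t
          <= (C1 * ln (1 / (b - a)) + C2)%:E)%E) ->
  (\int[lebesgue_measure]_(t in `[0%R, (2 * pi)%R]) logp_inv_dist E t < +oo)%E.
Proof.
move=> H; have pi0 := pi_gt0 R; have p0 : 0 < 2 * pi :> R by rewrite mulr_gt0.
have := H 0 (2 * pi) p0; rewrite subr0 lexx => /(_ isT).
set I := (\int[_]_(_ in _) _)%E => h.
have : ((2 * pi)%:E * (((2 * pi)^-1)%:E * I) <= (2 * pi)%:E * (C1 * ln (1 / (2 * pi)) + C2)%:E)%E.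
  by apply: lee_wpmul2l => //; rewrite lee_fin ltW.
by rewrite muleA -!EFinM divff ?gt_eqF // mul1e => h'; apply: le_lt_trans h' (ltry _).
Qed.

Lemma forward_property E : countable E -> closed E -> E `<=` unit_circle ->
  (exists C1 C2 : R, [/\ 0 < C1, 0 < C2 &
     forall a b : R, a < b -> b - a <= 2 * pi ->
       (((b - a)^-1)%:E * \int[lebesgue_measure]_(t in `[a, b]) logp_inv_dist E t
          <= (C1 * ln (1 / (b - a)) + C2)%:E)%E]) ->
  forall s, 0 <= s -> exists2 t, s <= t & property_P s t E.
Proof.
move=> ctE cE ET [C1 [C2 [C10 C20 H]]] s s0.
have [->|/set0P E0] := eqVneq E set0.
  exists s => // V T S bT iTS sp _ _.
  apply: (@bound_eqO _ _ 0) => // n _.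
  by rewrite opnorm_trivial ?normr0 ?mul0r //; exact: empty_spectrum bT iTS sp.
have [CD CD0 ld] := integral_log_dense E0 ET C10 C20 H.
have fin := integral_finite H.
have [M mM] := mass_bounded E0 ET fin.
have [C' C'0 HC'] := gE_log_dense E0 ET mM CD0 ld.
have [q [q0 sq _]] := ex_nat_ceil s0.
pose t0 : R := 2 * 144 * (2 * q.+1)%:R * C'.
have t00 : 0 <= t0 by rewrite !mulr_ge0.
exists (Num.max s t0); first by rewrite le_max lexx.
move=> V T S bT iTS sp OT OS.
have bS : bounded_operator S by case: iTS.
have gs n : `|n%:R `^ s| <= n.+1%:R ^+ q :> R.
  rewrite ger0_norm ?powR_ge0 //; apply: le_trans (_ : n.+1%:R `^ s <= _).
    by apply: ge0_ler_powR => //; rewrite ?nnegrE // ler_nat.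
  by rewrite -powR_mulrn //; apply: ler_powR; [rewrite ler1n|exact: ltW].
have q1 n : 1 <= n.+1%:R ^+ q :> R by rewrite exprn_ege1 // ler1n.
have [C0 C00 HT] := eqO_bound OT gs q1.
have HT' n : opnorm (iter n T) <= C0 * n.+1%:R ^+ q by apply: le_trans (HT n); exact: ler_norm.
have HS eps : 0 < eps -> exists2 A : R, 0 <= A &
    forall n : nat, opnorm (iter n S) <= A * expR (eps * Num.sqrt n%:R).
  move=> eps0.
  have e1 n : `|expR (eps * Num.sqrt n%:R)| <= expR (eps * Num.sqrt n%:R) :> R.
    by rewrite ger0_norm ?expR_ge0.
  have e2 n : 1 <= expR (eps * Num.sqrt n%:R) :> R.
    by rewrite -[leLHS]expR0 ler_expR mulr_ge0 ?(ltW eps0) ?sqrtr_ge0.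
  have [A A0 HA] := eqO_bound (OS eps eps0) e1 e2.
  by exists A => // n; apply: le_trans (HA n); exact: ler_norm.
have [B B0 HB] := power_bound bT iTS ctE cE E0 ET mM sp C00 HT' HS C'0 HC'.
(* The power of 2 accounts for passing from n + 2 to n + 1, as n + 2 <= 2 (n + 1). *)
apply: (@bound_eqO _ _ (B * 2 `^ t0)); first by rewrite mulr_ge0 // powR_ge0.
case=> // n _; rewrite !ger0_norm ?powR_ge0 ?opnorm_ge0 //; last exact: bounded_iter.
apply: le_trans (HB n) _; rewrite -[leRHS]mulrA; apply: ler_wpM2l => //.
apply: le_trans (_ : (2 * n.+1%:R) `^ t0 <= _).
  apply: ge0_ler_powR => //; rewrite ?nnegrE ?mulr_ge0 //.
  by rewrite -natrM ler_nat mul2n doubleS !ltnS -addnn leq_addr.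
rewrite powRM //; apply: ler_wpM2l; first exact: powR_ge0.
by apply: ler_powR; [rewrite ler1n|rewrite le_max lexx orbT].
Qed.

End ForwardDirection.

(** * The Banach space of restrictions to E *)

Section PolynomialLimits.
Context {R : realType}.
Implicit Types (D : R[i] -> Prop) (f g : R[i] -> R[i]) (M : R).

Definition polyapp D f := forall e : R, 0 < e ->
  exists p : {poly R[i]}, forall z, D z -> nm (f z - p.[z]) <= e.

Lemma polyapp_poly D (p : {poly R[i]}) : polyapp D (fun z => p.[z]).
Proof. by move=> e e0; exists p => z _; rewrite subrr nm0 ltW. Qed.

Lemma polyapp_ext D f g : (forall z, D z -> f z = g z) -> polyapp D f -> polyapp D g.
Proof.
by move=> fg H e e0; have [p Hp] := H e e0; exists p => z Dz; rewrite -fg //; exact: Hp.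
Qed.

Lemma polyapp_sub D D' f : (forall z, D' z -> D z) -> polyapp D f -> polyapp D' f.
Proof. by move=> s H e e0; have [p Hp] := H e e0; exists p => z /s; exact: Hp. Qed.

Lemma polyappD D f g : polyapp D f -> polyapp D g -> polyapp D (fun z => f z + g z).
Proof.
move=> Hf Hg e e0; have e2 : 0 < e / 2 by rewrite divr_gt0.
have [p Hp] := Hf _ e2; have [q Hq] := Hg _ e2; exists (p + q) => z Dz.
rewrite hornerD opprD addrACA; apply: le_trans (nmD _ _) _.
by have := Hp z Dz; have := Hq z Dz; lra.
Qed.

Lemma polyappM D f g (A B : R) : (forall z, D z -> nm (f z) <= A) -> (forall z, D z -> nm (g z) <= B) ->
  polyapp D f -> polyapp D g -> polyapp D (fun z => f z * g z).
Proof.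
move=> fA gB Hf Hg e e0.
pose c := 1 + `|A| + `|B|; have c0 : 0 < c by rewrite ltr_wpDr // ltr_wpDr.
pose d := Num.min 1 (e / c); have d0 : 0 < d by rewrite lt_min ltr01 divr_gt0.
have [d1 dc] : d <= 1 /\ d <= e / c by split; rewrite /d ge_min lexx ?orbT.
have [p Hp] := Hf _ d0; have [q Hq] := Hg _ d0; exists (p * q) => z Dz.
have -> : f z * g z - (p * q).[z] = f z * (g z - q.[z]) + (f z - p.[z]) * (g z - (g z - q.[z])).
  by rewrite hornerM; ring.
apply: le_trans (nmD _ _) _; rewrite !nmM.
have h1 := Hp z Dz; have h2 := Hq z Dz; have h3 := fA z Dz; have h4 := gB z Dz.
have h5 := nmB (g z) (g z - q.[z]).
have a1 : nm (f z) * nm (g z - q.[z]) <= `|A| * d.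
  by apply: ler_pM; rewrite ?nm_ge0 //; apply: le_trans h3 _; exact: ler_norm.
have a2 : nm (f z - p.[z]) * nm (g z - (g z - q.[z])) <= d * (`|B| + 1).
  apply: ler_pM; rewrite ?nm_ge0 //; apply: le_trans h5 _; apply: lerD; last by lra.
  by apply: le_trans h4 _; exact: ler_norm.
have : d * c <= e by rewrite -ler_pdivlMr.
by rewrite /c; lra.
Qed.

Lemma polyappZ D f (c : R[i]) : polyapp D f -> polyapp D (fun z => c * f z).
Proof.
move=> Hf e e0; have c1 : 0 < nm c + 1 by have := nm_ge0 c; lra.
have [p Hp] := Hf (e / (nm c + 1)) (divr_gt0 e0 c1).
exists (c *: p) => z Dz; rewrite hornerZ -mulrBr nmM.
have := Hp z Dz; rewrite ler_pdivlMr // => h; have := nm_ge0 (f z - p.[z]).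
by have := nm_ge0 c; lra.
Qed.

Lemma polyapp_lim D f : (forall e : R, 0 < e -> exists2 g, polyapp D g &
  forall z, D z -> nm (f z - g z) <= e) -> polyapp D f.
Proof.
move=> H e e0; have e2 : 0 < e / 2 by rewrite divr_gt0.
have [g Hg fg] := H _ e2; have [p Hp] := Hg _ e2; exists p => z Dz.
by have := nm_tri (g z) (f z) p.[z]; have := fg z Dz; have := Hp z Dz; lra.
Qed.

Lemma geo_limit (a : nat -> R[i]) (c : R) : 0 < c -> (forall n, nm (a n.+1 - a n) <= c * dl n) ->
  exists b, forall n, nm (b - a n) <= 2 * c * dl n.
Proof.
move=> c0 H; apply: (@nested_balls R a (fun n => 2 * c * dl n)) => n.
- by rewrite mulr_gt0 ?dl_gt0 // mulr_gt0.
- by rewrite dlS; have := dl_gt0 (R := R) n; nra.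
- by rewrite dlS; have := H n; have := dl_gt0 (R := R) n; nra.
Qed.

End PolynomialLimits.

Section RestrictionSpace.
Context {R : realType}.
Implicit Types (E : set R[i]^o) (f g : R[i] -> R[i]) (M : R).

Definition circ (z : R[i]) := nm z = 1.

(** One constant bounds the supremum and the Lipschitz quotients. These relate a point of E to a
    point of the circle, not two arbitrary points: the function vanishing on E built below satisfies
    |F| <= d, which gives exactly this. *)
Definition lipat E M f := [/\ polyapp circ f, forall z, circ z -> nm (f z) <= M &
  forall l z, E l -> circ z -> nm (f z - f l) <= M * nm (z - l)].

Lemma lipat_ge0 E M f : lipat E M f -> 0 <= M.
Proof. by case=> _ h _; apply: le_trans (h 1 (nm1 (R := R))); exact: nm_ge0. Qed.

Lemma lipat_le E M N f : M <= N -> lipat E M f -> lipat E N f.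
Proof.
move=> MN [h1 h2 h3]; split=> // [z cz|l z El cz]; first by apply: le_trans (h2 z cz) _.
by apply: le_trans (h3 l z El cz) _; rewrite ler_wpM2r // nm_ge0.
Qed.

Lemma lipat0 E : lipat E 0 (fun=> 0).
Proof.
split; last by move=> *; rewrite subrr nm0 mul0r.
  by apply: (polyapp_ext (f := fun z => (0 : {poly R[i]}).[z])) => [z|]; [rewrite horner0|exact: polyapp_poly].
by move=> z _; rewrite nm0.
Qed.

Lemma lipatD E M N f g : lipat E M f -> lipat E N g -> lipat E (M + N) (fun z => f z + g z).
Proof.
move=> [a1 a2 a3] [b1 b2 b3]; split; first exact: polyappD.
  by move=> z cz; apply: le_trans (nmD _ _) _; apply: lerD; auto.
move=> l z El cz; rewrite opprD addrACA mulrDl.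
by apply: le_trans (nmD _ _) _; apply: lerD; auto.
Qed.

Lemma lipatZ E M f c : lipat E M f -> lipat E (nm c * M) (fun z => c * f z).
Proof.
move=> [a1 a2 a3]; split; first exact: polyappZ.
  by move=> z cz; rewrite nmM; apply: ler_wpM2l; [exact: nm_ge0|exact: a2].
by move=> l z El cz; rewrite -mulrBr nmM -mulrA; apply: ler_wpM2l; [exact: nm_ge0|exact: a3].
Qed.

Lemma lipatM E M N f g : E `<=` unit_circle -> lipat E M f -> lipat E N g ->
  lipat E (2 * M * N) (fun z => f z * g z).
Proof.
move=> ET Lf Lg; have M0 := lipat_ge0 Lf; have N0 := lipat_ge0 Lg.
case: Lf => a1 a2 a3; case: Lg => b1 b2 b3; split; first exact: polyappM a2 b2 a1 b1.
  move=> z cz; rewrite nmM; apply: le_trans (_ : M * N <= _).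
    by apply: ler_pM; rewrite ?nm_ge0 //; auto.
  by have := mulr_ge0 M0 N0; lra.
move=> l z El cz; have cl : circ l by rewrite /circ /nm (ET l El).
have -> : f z * g z - f l * g l = f z * (g z - g l) + (f z - f l) * g l by ring.
apply: le_trans (nmD _ _) _; rewrite !nmM.
have h1 : nm (f z) * nm (g z - g l) <= M * (N * nm (z - l)).
  by apply: ler_pM; rewrite ?nm_ge0 //; auto.
have h2 : nm (f z - f l) * nm (g l) <= M * nm (z - l) * N.
  by apply: ler_pM; rewrite ?nm_ge0 //; auto.
by move: h1 h2; lra.
Qed.

Lemma lipat_lim E M (s : nat -> R[i] -> R[i]) f n : E `<=` unit_circle ->
  (forall m, (n <= m)%N -> lipat E M (fun z => s m z - s n z)) ->
  (forall e, 0 < e -> exists2 m, (n <= m)%N & forall z, circ z -> nm (f z - s m z) <= e) ->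
  lipat E M (fun z => f z - s n z).
Proof.
move=> ET H1 H2; split.
- apply: polyapp_lim => e e0; have [m nm' Hm] := H2 e e0.
  exists (fun z => s m z - s n z); first by case: (H1 m nm').
  by move=> z cz; rewrite opprB addrA subrK; exact: Hm.
- move=> z cz; apply/ler_addgt0Pr => e e0; have [m nm' Hm] := H2 e e0.
  have [_ h _] := H1 m nm'; have := h z cz; have := Hm z cz.
  by have := nm_tri (s m z) (f z) (s n z); lra.
move=> l z El cz; have cl : circ l by rewrite /circ /nm (ET l El).
apply/ler_addgt0Pr => e e0; have [m nm' Hm] := H2 (e / 2) (divr_gt0 e0 (ltr0n _ 2)).
have [_ _ h] := H1 m nm'; have h3 := h l z El cz; have h1 := Hm z cz; have h2 := Hm l cl.
have -> : f z - s n z - (f l - s n l) = (s m z - s n z - (s m l - s n l)) + (f z - s m z) - (f l - s m l) by ring.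
have k1 := nmB ((s m z - s n z - (s m l - s n l)) + (f z - s m z)) (f l - s m l).
have k2 := nmD (s m z - s n z - (s m l - s n l)) (f z - s m z).
by move: k1 k2 h1 h2 h3; lra.
Qed.

(** Elements are set to 0 outside E, so that agreement on E is equality of functions. *)
Definition restr_pred E : {pred (R[i] -> R[i]^o)} := fun v =>
  `[< (forall z, ~ E z -> v z = 0) /\ exists M f, lipat E M f /\ forall z, E z -> v z = f z >].

Lemma restr_submod E : submod_closed (restr_pred E).
Proof.
split.
  by apply/asboolP; split => //; exists 0, (fun=> 0); split => //; exact: lipat0.
move=> c u v /asboolP[u0 [M [f [Lf uf]]]] /asboolP[v0 [N [g [Lg vg]]]].
apply/asboolP; split=> [z nz|]; first by change (c * u z + v z = 0); rewrite u0 // v0 // mulr0 addr0.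
exists (nm c * M + N), (fun z => c * f z + g z); split; first by apply: lipatD => //; exact: lipatZ.
by move=> z Ez; change (c * u z + v z = c * f z + g z); rewrite uf // vg.
Qed.

HB.instance Definition _ E := GRing.isSubmodClosed.Build R[i] (R[i] -> R[i]^o) (restr_pred E) (restr_submod E).

Record restr E := Restr { rfun :> R[i] -> R[i]^o ; rfunP : rfun \in restr_pred E }.

HB.instance Definition _ E := [isSub for @rfun E].
HB.instance Definition _ E := [Choice of restr E by <:].
HB.instance Definition _ E := [SubChoice_isSubLmodule of restr E by <:].

Lemma restr_eq E (u v : restr E) : (forall z, E z -> u z = v z) -> u = v.
Proof.
move=> H; apply: val_inj; apply/funext => z /=; have [Ez|nE] := pselect (E z); first exact: H.
case: u {H} => u /= /asboolP[u0 _]; case: v => v /= /asboolP[v0 _].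
by rewrite u0 // v0.
Qed.

Definition ext_set E (v : restr E) : set R := [set M | exists f, lipat E M f /\ forall z, E z -> v z = f z].

(** The quotient norm: functions satisfying [lipat], modulo those vanishing on E. *)
Definition rN E (v : restr E) : R := inf (ext_set v).

Lemma has_inf_ext E (v : restr E) : has_inf (ext_set v).
Proof.
split; last by exists 0 => M [f [Lf _]]; exact: lipat_ge0 Lf.
by have /asboolP[_ [M [f [Lf vf]]]] := rfunP v; exists M, f.
Qed.

Lemma rN_le E (v : restr E) M f : lipat E M f -> (forall z, E z -> v z = f z) -> rN v <= M.
Proof. by move=> Lf vf; apply: ge_inf; [have [] := has_inf_ext v|exists f]. Qed.

Lemma rN_ge0 E (v : restr E) : 0 <= rN v.
Proof.
by apply: lb_le_inf; [have [] := has_inf_ext v|move=> M [f [Lf _]]; exact: lipat_ge0 Lf].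
Qed.

Lemma rN_ext E (v : restr E) e : 0 < e -> exists f, lipat E (rN v + e) f /\ forall z, E z -> v z = f z.
Proof.
move=> e0; have [M [f [Lf vf]] h] := inf_adherent e0 (has_inf_ext v).
by exists f; split => //; apply: lipat_le Lf; exact: ltW.
Qed.

Lemma rN_pt E (v : restr E) l : E `<=` unit_circle -> E l -> nm (v l : R[i]) <= rN v.
Proof.
move=> ET El; apply/ler_addgt0Pr => e e0; have [f [[_ h _] vf]] := rN_ext v e0.
by rewrite vf //; apply: h; rewrite /circ /nm (ET l El).
Qed.

Lemma rND E (u v : restr E) : rN (u + v) <= rN u + rN v.
Proof.
apply/ler_addgt0Pr => e e0; have e2 : 0 < e / 2 by rewrite divr_gt0.
have [f [Lf uf]] := rN_ext u e2; have [g [Lg vg]] := rN_ext v e2.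
have := rN_le (v := u + v) (lipatD Lf Lg).
have -> : rN u + e / 2 + (rN v + e / 2) = rN u + rN v + e by field.
by apply => z Ez; rewrite -uf // -vg.
Qed.

Lemma rNZ_le E (u : restr E) (c : R[i]) : rN (c *: u) <= nm c * rN u.
Proof.
apply/ler_addgt0Pr => e e0; have c1 : 0 < nm c + 1 by have := nm_ge0 c; lra.
have [f [Lf uf]] := rN_ext u (divr_gt0 e0 c1).
apply: le_trans (rN_le (v := c *: u) (lipatZ c Lf) _) _.
  by move=> z Ez; rewrite -uf.
rewrite mulrDr lerD2l mulrCA ler_piMr ?(ltW e0) // ler_pdivrMr // mul1r lerDl //.
Qed.

Lemma rNZ E (u : restr E) (c : R[i]) : rN (c *: u) = nm c * rN u.
Proof.
apply/eqP; rewrite eq_le rNZ_le /=; have [->|c0] := eqVneq c 0.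
  by rewrite nm0 mul0r rN_ge0.
have := rNZ_le (c *: u) c^-1; rewrite scalerA mulVf // scale1r nmV.
by rewrite mulrC ler_pdivlMr ?nm_gt0 // mulrC.
Qed.

End RestrictionSpace.

Section RestrictionBanach.
Context {R : realType} (E : set R[i]^o) (ET : E `<=` unit_circle).

(* The proof ET is a parameter of the type, so that the norm axioms can be
   packaged as canonical instances. *)
Definition banE (_ : E `<=` unit_circle) := restr E.

HB.instance Definition _ := GRing.Lmodule.on (banE ET).

Lemma rN_eq0 (v : banE ET) : (rN v)%:C%C = 0 -> v = 0.
Proof.
move=> h; have h0 : rN v = 0 by case: h.
apply: restr_eq => z Ez; have := rN_pt v ET Ez; rewrite h0.
by rewrite le_eqVlt ltNge nm_ge0 orbF nm_eq0 => /eqP.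
Qed.

Lemma ler_rND (u v : banE ET) : (rN (u + v))%:C%C <= (rN u)%:C%C + (rN v)%:C%C.
Proof. by rewrite -rmorphD lecR; exact: rND. Qed.

Lemma rNZC (c : R[i]) (u : banE ET) : (rN (c *: u))%:C%C = `|c| * (rN u)%:C%C.
Proof. by rewrite nmE -rmorphM; congr (_%:C%C); exact: rNZ. Qed.

HB.instance Definition _ := Lmodule_isNormed.Build R[i] (banE ET) ler_rND rNZC rN_eq0.

(** As for any quotient: a sequence with increments below [2 * dl n] is lifted increment by
    increment to extensions of the same size, and the sum of the lifts converges uniformly on the
    circle, keeping its Lipschitz bounds. *)
Lemma banE_complete (F : set_system (banE ET)) : ProperFilter F -> cauchy F -> cvg F.
Proof.
move=> FF /cauchyP Fc.
have ball_nm (x y : banE ET) (e : R) : ball x e%:C%C y <-> nm (x - y) < e.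
  by rewrite -ball_normE /= nmE ltcR.
have ex n : exists x : banE ET, F (ball x (dl n)%:C%C).
  by apply: Fc; rewrite ltcR dl_gt0.
have [x Hx] := choice ex.
have step n : nm (x n.+1 - x n) < 2 * dl n.
  have [y [/ball_nm h1 /ball_nm h2]] := filter_ex (filterI (Hx n) (Hx n.+1)).
  apply: le_lt_trans (nm_tri y (x n.+1) (x n)) _; rewrite [nm (y - x n)]nmBC.
  apply: lt_trans (ltrD h2 h1) _.
  by rewrite dlS; have := dl_gt0 (R := R) n; clear; lra.
have exf n : exists f, lipat E (2 * dl n) f /\ forall z, E z -> (x n.+1 - x n : banE ET) z = f z.
  have p0 : 0 < 2 * dl n - nm (x n.+1 - x n) by rewrite subr_gt0.
  have [f [Lf Hf]] := rN_ext (x n.+1 - x n) p0.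
    exists f; split => //; apply: lipat_le Lf; by rewrite -[rN _]/(nm (x n.+1 - x n)) addrC subrK.
have [f Hf] := choice exf.
have [M [f0 [Lf0 Hf0]]] : exists M f0, lipat E M f0 /\ forall z, E z -> (x 0%N) z = f0 z.
  by have /asboolP[_] := rfunP (x 0%N).
pose s n z := f0 z + \sum_(k < n) f k z.
have sS n z : s n.+1 z = s n z + f n z by rewrite /s big_ord_recr addrA.
have xs n z : E z -> (x n) z = s n z.
  move=> Ez; elim: n => [|n IH]; first by rewrite /s big_ord0 addr0 Hf0.
  rewrite sS -IH; have [_ /(_ z Ez) <-] := Hf n.
  by rewrite addrC; change ((x n.+1) z = (x n.+1) z - (x n) z + (x n) z); rewrite subrK.
have Ls n p : lipat E (4 * (dl n - dl (p + n))) (fun z => s (p + n)%N z - s n z).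
  elim: p => [|p IH].
    rewrite add0n subrr mulr0; have -> : (fun z => s n z - s n z) = fun=> 0 by apply/funext => z; rewrite subrr.
    exact: lipat0.
  rewrite addSn; have [Lf _] := Hf (p + n)%N; have := lipatD IH Lf.
  have -> : 4 * (dl n - dl (p + n)) + 2 * dl (p + n) = 4 * (dl n - dl (p + n).+1) :> R by rewrite dlS; field.
  by have -> : (fun z => s (p + n)%N z - s n z + f (p + n)%N z) = (fun z => s (p + n).+1 z - s n z) by apply/funext => z; rewrite sS addrAC.
have lim z : exists b, circ z -> forall n, nm (b - s n z) <= 4 * dl n.
  have [cz|nc] := pselect (circ z); last by exists 0.
  have [|b Hb] := @geo_limit R (fun n => s n z) 2 (ltr0n _ 2).
    by move=> n; rewrite sS addrAC subrr add0r; have [[_ h _] _] := Hf n; exact: h.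
  by exists b => _ n; apply: le_trans (Hb n) _; lra.
have [g Hg] := choice lim.
have Lg n : lipat E (4 * dl n) (fun z => g z - s n z).
  apply: lipat_lim => // [m nm'|e e0].
    have := Ls n (m - n)%N; rewrite subnK // => h; apply: lipat_le h.
    by have := dl_gt0 (R := R) m; lra.
  have [m hm] := dl_small (divr_gt0 e0 (ltr0n _ 4)); exists (m + n)%N; first exact: leq_addl.
  move=> z cz; apply: le_trans (Hg z cz (m + n)%N) _.
  by have := dl_le (R := R) (leq_addr n m); move: hm; lra.
pose gv : R[i] -> R[i]^o := fun z => if `[< E z >] then g z else 0.
have gP : gv \in restr_pred E.
  apply/asboolP; split => [z nE|]; first by rewrite /gv asboolF.
  exists (4 * dl 0 + M), (fun z => (g z - s 0%N z) + f0 z); split; first exact: lipatD.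
  by move=> z Ez; rewrite /gv asboolT // /s big_ord0 addr0 subrK.
pose G : banE ET := Restr gP.
have GxN n : nm (G - x n) <= 4 * dl n.
  apply: rN_le (Lg n) _ => z Ez.
  change (gv z - (x n) z = g z - s n z); by rewrite /gv asboolT // xs.
apply/cvg_ex; exists G; apply/cvg_ballP => e e0.
have er : e = (complex.Re e)%:C%C by rewrite RRe_real // gtr0_real.
have e0' : 0 < complex.Re e by rewrite -ltcR -er.
have [n hn] := dl_small (divr_gt0 e0' (ltr0n _ 5)).
apply: filterS (Hx n) => y /ball_nm xy; rewrite er; apply/ball_nm.
apply: le_lt_trans (nm_tri (x n) G y) _; apply: lt_trans (ler_ltD (GxN n) xy) _.
by move: hn; clear; lra.
Qed.

HB.instance Definition _ := Uniform_isComplete.Build (banE ET) banE_complete.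

Definition banE_type : completeNormedModType R[i] := banE ET.

End RestrictionBanach.

Section GeometricApproximation.
Context {R : realType}.

Lemma geo_sum_inv (a z : R[i]) n : a != 0 -> a != z ->
  \sum_(k < n) z ^+ k / a ^+ k.+1 = (1 - (z / a) ^+ n) / (a - z).
Proof.
move=> a0 az; have d0 : a - z != 0 by rewrite subr_eq0.
elim: n => [|n IH]; first by rewrite big_ord0 expr0 subrr mul0r.
have an : a ^+ n != 0 by rewrite expf_neq0.
rewrite big_ord_recr /= IH !exprMn !exprVn !exprS.
by move: (a ^+ n) (z ^+ n) an => A B A0; field; rewrite A0 a0 d0.
Qed.

Lemma expr_small (q e : R) : 1 < q -> 0 < e -> exists n, (q ^+ n)^-1 <= e.
Proof.
move=> q1 e0; have d0 : 0 < q - 1 by rewrite subr_gt0.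
have [n [n0 hn _]] := ex_nat_ceil (ltW (divr_gt0 ltr01 (mulr_gt0 e0 d0))).
exists n; have b := bernoulli_le n (ltW d0).
have -> : q = 1 + (q - 1) by ring.
rewrite -[e]invrK lef_pV2 ?posrE ?invr_gt0 ?exprn_gt0 //; last by lra.
apply: le_trans b.
have : 1 / (e * (q - 1)) * (q - 1) < n%:R * (q - 1) by rewrite ltr_pM2r.
have -> : 1 / (e * (q - 1)) * (q - 1) = 1 / e by field; rewrite !gt_eqF.
by rewrite div1r; lra.
Qed.

(** Partial sums of the geometric series in z/a, which converge uniformly because |a| > 1. *)
Lemma polyapp_inv (D : R[i] -> Prop) (a : R[i]) : (forall z, D z -> nm z <= 1) -> 1 < nm a ->
  polyapp D (fun z => (a - z)^-1).
Proof.
move=> D1 a1 e e0; have d0 : 0 < nm a - 1 by rewrite subr_gt0.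
have [n Hn] := expr_small a1 (mulr_gt0 e0 d0).
exists (\sum_(k < n) (a ^- k.+1) *: 'X^k) => z Dz.
have z1 := D1 z Dz; have a0 : a != 0 by rewrite -nm_gt0; lra.
have az : a != z by apply/eqP => h; move: a1; rewrite h; lra.
rewrite horner_sum; under eq_bigr => k _ do rewrite hornerZ hornerXn mulrC.
rewrite geo_sum_inv // -{1}[(a - z)^-1]mul1r -mulrBl opprB addrC subrK.
rewrite nmM nmV nmX nmM nmV expr_div_n.
have az1 : nm a - 1 <= nm (a - z) by apply: le_trans (nm_subl a z); lra.
have az0 : 0 < nm (a - z) by lra.
rewrite ler_pdivrMr //; apply: le_trans (_ : e * (nm a - 1) <= _); last by rewrite ler_pM2l.
apply: le_trans Hn; rewrite ler_piMl ?invr_ge0 ?exprn_ge0 ?nm_ge0 //.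
by rewrite exprn_ile1 ?nm_ge0.
Qed.

End GeometricApproximation.

Section Multiplication.
Context {R : realType} (E : set R[i]^o) (ET : E `<=` unit_circle).
Local Notation V := (banE_type ET).
Implicit Types (h f : R[i] -> R[i]) (v : V) (M : R) (z mu : R[i]).

(** [insubd] falls back on 0 when the product leaves the space; [mulVE] shows that this does not
    happen for h satisfying [lipat]. *)
Definition mulV h v : V := insubd (0 : V) ((fun z => h z * (v : restr E) z) : R[i] -> R[i]^o).

Lemma mulVE h M v z : lipat E M h -> (mulV h v : restr E) z = h z * (v : restr E) z.
Proof.
move=> Lh; rewrite /mulV /insubd insubT //=.
have /asboolP[v0 [N [f [Lf vf]]]] := rfunP (v : restr E); apply/asboolP; split.
  by move=> w nE; rewrite v0 // mulr0.
exists (2 * M * N), (fun z => h z * f z); split; first exact: lipatM.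
by move=> w Ew; rewrite vf.
Qed.

Lemma nm_le_ext v M f : lipat E M f -> (forall z, E z -> (v : restr E) z = f z) -> nm v <= M.
Proof. exact: rN_le. Qed.

Lemma nm_ext v e : 0 < e -> exists f, lipat E (nm v + e) f /\ forall z, E z -> (v : restr E) z = f z.
Proof. exact: rN_ext. Qed.

Lemma mulV_nm h M v : lipat E M h -> nm (mulV h v) <= 2 * M * nm v.
Proof.
move=> Lh; have M0 := lipat_ge0 Lh; apply/ler_addgt0Pr => e e0.
have c0 : 0 < 2 * M + 1 by lra.
have [f [Lf vf]] := nm_ext v (divr_gt0 e0 c0).
apply: le_trans (nm_le_ext (lipatM ET Lh Lf) _) _.
  by move=> z Ez; rewrite (mulVE v z Lh) vf.
rewrite mulrDr lerD2l mulrCA ler_piMr ?(ltW e0) // ler_pdivrMr // mul1r; lra.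
Qed.

Lemma mulV_lin h M : lipat E M h -> linear (mulV h).
Proof.
move=> Lh c u v; apply: restr_eq => z Ez.
rewrite (mulVE _ z Lh); change (h z * (c * (u : restr E) z + (v : restr E) z) =
  c * (mulV h u : restr E) z + (mulV h v : restr E) z).
by rewrite !(mulVE _ z Lh); ring.
Qed.

Lemma mulV_bounded h M : lipat E M h -> bounded_operator (mulV h).
Proof.
by move=> Lh; split; [exact: mulV_lin Lh|exists (2 * M) => v; exact: mulV_nm].
Qed.

Lemma lipat_id : lipat E 1 id.
Proof.
split; last by move=> l z _ _; rewrite mul1r.
  by apply: (polyapp_ext (f := fun z => ('X : {poly R[i]}).[z])) => [z|]; [rewrite hornerX|exact: polyapp_poly].
by move=> z ->.
Qed.

(** |z^n| = 1 preserves the supremum, while each factor z adds M to the Lipschitz constant. The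
    linear growth of the powers of [Tz] that results is why property P is used with s = 1. *)
Lemma lipat_pow n M f : lipat E M f -> lipat E (n.+1%:R * M) (fun z => z ^+ n * f z).
Proof.
move=> Lf; have M0 := lipat_ge0 Lf; elim: n => [|n IH].
  rewrite mul1r; have -> : (fun z => z ^+ 0 * f z) = f by apply/funext => z; rewrite mul1r.
  exact: Lf.
case: (IH) => a1 a2 a3; case: Lf => f1 f2 f3.
have c2 z : circ z -> nm (z ^+ n * f z) <= M.
  by move=> cz; rewrite nmM nmX cz expr1n mul1r; exact: f2.
have MN : M <= n.+2%:R * M by rewrite ler_peMl // ler1n.
split.
- apply: (polyapp_ext (f := fun z => ('X : {poly R[i]}).[z] * (z ^+ n * f z))).
    by move=> z _; rewrite hornerX mulrA -exprS.
  apply: (@polyappM _ _ _ _ 1 M) => //; last exact: polyapp_poly.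
  by move=> z cz; rewrite hornerX cz.
- by move=> z cz; rewrite nmM nmX cz expr1n mul1r; apply: le_trans MN; exact: f2.
move=> l z El cz; have cl : circ l by rewrite /circ /nm (ET El).
have -> : z ^+ n.+1 * f z - l ^+ n.+1 * f l =
   z * (z ^+ n * f z - l ^+ n * f l) + (z - l) * (l ^+ n * f l) by rewrite !exprS; ring.
apply: le_trans (nmD _ _) _; rewrite !(nmM z) cz mul1r (nmM (z - l)) -natr1 mulrDl mul1r mulrDl.
apply: lerD; first exact: a3.
by rewrite mulrC; apply: ler_wpM2r; [exact: nm_ge0|exact: c2].
Qed.

Definition Tz : V -> V := mulV id.

Lemma Tz_bounded : bounded_operator Tz.
Proof. exact: mulV_bounded lipat_id. Qed.

Lemma iter_Tz n v z : (iter n Tz v : restr E) z = z ^+ n * (v : restr E) z.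
Proof.
elim: n => [|n IH] /=; first by rewrite mul1r.
by rewrite /Tz (mulVE _ z lipat_id) -/Tz IH exprS mulrA.
Qed.

Lemma opnorm_Tz n : opnorm (iter n Tz) <= n.+1%:R.
Proof.
apply: opnorm_le => //; first by apply: lin_iter; exact: Tz_bounded.1.
move=> v; apply/ler_addgt0Pr => e e0.
have [f [Lf vf]] := nm_ext v (divr_gt0 e0 (ltr0Sn R n)).
apply: le_trans (nm_le_ext (lipat_pow n Lf) _) _; first by move=> z Ez; rewrite iter_Tz vf.
by rewrite mulrDr lerD2l mulrC divfK // pnatr_eq0.
Qed.

(** The inverse relation is asked on E alone: any [lipat] function agreeing there with 1/(mu - l)
    will do. This freedom gives access to mu in the disc, where 1/(mu - z) is not a uniform limit of
    polynomials on the circle. *)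
Lemma res_mulV h M mu : lipat E M h -> (forall l, E l -> h l * (mu - l) = 1) ->
  resolvent Tz mu (mulV h).
Proof.
move=> Lh hmu.
have TE v z : (mu *: v - Tz v : restr E) z = (mu - z) * (v : restr E) z.
  change (mu * (v : restr E) z - (Tz v : restr E) z = (mu - z) * (v : restr E) z).
  by rewrite (mulVE _ z lipat_id); ring.
split; first exact: mulV_bounded Lh.
- move=> v; apply: restr_eq => z Ez; rewrite (mulVE _ z Lh) TE.
  by rewrite mulrA hmu // mul1r.
- move=> v; apply: restr_eq => z Ez; rewrite TE (mulVE _ z Lh).
  by rewrite mulrCA mulrA hmu // mul1r.
Qed.

Lemma res_outside mu : 1 < nm mu -> exists Q, resolvent Tz mu Q.
Proof.
move=> m1; have d0 : 0 < nm mu - 1 by rewrite subr_gt0.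
pose D := (nm mu - 1)^-1; have D0 : 0 < D by rewrite invr_gt0.
have far z : circ z -> nm mu - 1 <= nm (mu - z) by move=> cz; have := nm_subl mu z; rewrite cz.
have ne z : circ z -> mu - z != 0 by move=> /far h; rewrite -nm_gt0; lra.
have inv z : circ z -> nm (mu - z)^-1 <= D.
  by move=> cz; rewrite nmV lef_pV2 ?posrE ?far ?nm_gt0 ?ne.
have cE l : E l -> circ l by move=> El; rewrite /circ /nm (ET El).
exists (mulV (fun z => (mu - z)^-1)); apply: (@res_mulV _ (D + D ^+ 2)); last first.
  by move=> l El; rewrite mulVf // ne //; exact: cE.
split.
- by apply: polyapp_inv m1 => z ->.
- by move=> z cz; apply: le_trans (inv z cz) _; rewrite lerDl sqr_ge0.
move=> l z El cz.
have -> : (mu - z)^-1 - (mu - l)^-1 = (z - l) * ((mu - z)^-1 * (mu - l)^-1).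
  by have := ne z cz; have := ne l (cE l El) => h1 h2; field; rewrite h1 h2.
rewrite nmM [leRHS]mulrC; apply: ler_wpM2l; first exact: nm_ge0.
apply: le_trans (_ : D ^+ 2 <= _); last by rewrite lerDr ltW.
by rewrite nmM expr2; apply: ler_pM; rewrite ?nm_ge0 ?inv //; exact: cE.
Qed.

End Multiplication.

(** * An infinite product vanishing on E *)

Section BlaschkeLikeProduct.
Context {R : realType}.
Implicit Types (E : set R[i]^o) (z w : R[i]) (n k N : nat).

Definition disc z : Prop := nm z <= 1.

Lemma prod_diff (I : Type) (r : seq I) (P : pred I) (a b : I -> R[i]) :
  (forall i, P i -> nm (a i) <= 1) -> (forall i, P i -> nm (b i) <= 1) ->
  nm (\prod_(i <- r | P i) a i - \prod_(i <- r | P i) b i) <=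
  \sum_(i <- r | P i) nm (a i - b i) /\ nm (\prod_(i <- r | P i) a i) <= 1.
Proof.
move=> Ha Hb; elim: r => [|i r [IH1 IH2]].
  by rewrite !big_nil subrr nm0 nm1.
rewrite !big_cons; case: ifP => Pi //; set A := \prod_(_ <- _ | _) a _ in IH1 IH2 *.
set B := \prod_(_ <- _ | _) b _ in IH1 *.
split; last first.
  by rewrite nmM -[leRHS]mulr1; apply: ler_pM; rewrite ?nm_ge0 ?Ha.
have -> : a i * A - b i * B = (a i - b i) * A + b i * (A - B) by ring.
apply: le_trans (nmD _ _) _; rewrite !nmM; apply: lerD.
  by rewrite ler_piMr ?nm_ge0.
by apply: le_trans IH1; rewrite ler_piMl ?nm_ge0 // Hb.
Qed.

Lemma polyapp_prod (D : R[i] -> Prop) (I : Type) (r : seq I) (P : pred I) (f : I -> R[i] -> R[i]) :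
  (forall i, P i -> polyapp D (f i)) -> (forall i z, P i -> D z -> nm (f i z) <= 1) ->
  polyapp D (fun z => \prod_(i <- r | P i) f i z) /\
  forall z, D z -> nm (\prod_(i <- r | P i) f i z) <= 1.
Proof.
move=> Hp Hb; elim: r => [|i r [IH1 IH2]].
  split; last by move=> z _; rewrite big_nil nm1.
  apply: (polyapp_ext (f := fun z => (1 : {poly R[i]}).[z])) => [z _|]; last exact: polyapp_poly.
  by rewrite big_nil hornerC.
have [Pi|nPi] := boolP (P i); last first.
  by under eq_fun do rewrite big_cons (negPf nPi); split => // z Dz; rewrite big_cons (negPf nPi) IH2.
split; last first.
  move=> z Dz; rewrite big_cons Pi nmM -[leRHS]mulr1.
  by apply: ler_pM; rewrite ?nm_ge0 ?Hb ?IH2.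
under eq_fun do rewrite big_cons Pi.
by apply: (@polyappM _ D _ _ 1 1) => //; [move=> z Dz; exact: Hb|exact: Hp].
Qed.

Lemma ucauchy_limit (D : R[i] -> Prop) (f : nat -> R[i] -> R[i]) :
  (forall e : R, 0 < e -> exists N0, forall N, (N0 <= N)%N -> forall z, D z -> nm (f N z - f N0 z) <= e) ->
  exists g, forall e : R, 0 < e -> exists N0, forall N, (N0 <= N)%N -> forall z, D z -> nm (g z - f N z) <= e.
Proof.
move=> H; have [Nk HN] := choice (fun k => H (dl k) (dl_gt0 k)).
pose s k := (\sum_(i < k.+1) Nk i)%N.
have sN k : (Nk k <= s k)%N by rewrite /s big_ord_recr /= leq_addl.
have sS k : (s k <= s k.+1)%N by rewrite {2}/s big_ord_recr /= leq_addr.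
have lim z : exists b, D z -> forall k, nm (b - f (s k) z) <= 4 * dl k.
  have [Dz|nD] := pselect (D z); last by exists 0.
  have [|b Hb] := @geo_limit R (fun k => f (s k) z) 2 (ltr0n _ 2).
    move=> k; apply: le_trans (nm_tri (f (Nk k) z) _ _) _.
    have h1 := HN k _ (leq_trans (sN k) (sS k)) z Dz; have := HN k _ (sN k) z Dz.
    by rewrite [nm (f (Nk k) z - _)]nmBC => h2; lra.
  by exists b => _ k; apply: le_trans (Hb k) _; lra.
have [g Hg] := choice lim; exists g => e e0.
have [k hk] := dl_small (divr_gt0 e0 (ltr0n R 6)).
exists (s k) => N sNk z Dz.
have h1 := Hg z Dz k; have h2 := HN k _ (sN k) z Dz.
have h3 := HN k N (leq_trans (sN k) sNk) z Dz.
have t1 := nm_tri (f (s k) z) (g z) (f N z).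
have t2 := nm_tri (f (Nk k) z) (f (s k) z) (f N z); rewrite [nm (f (Nk k) z - _)]nmBC in t2.
by lra.
Qed.

Definition phi n k z : R[i] := (z - zeta (1 + dl n) n k) / (z - zeta (1 + 2 * dl n) n k).

Lemma disc_poles n k z : disc z -> dl n <= nm (z - zeta (1 + dl n) n k) /\
  2 * dl n <= nm (z - zeta (1 + 2 * dl n) n k).
Proof.
move=> z1; have d0 := dl_gt0 (R := R) n; rewrite /disc in z1.
have a1 := @zeta_far R (1 + dl n) n k z ltac:(lra).
have a2 := @zeta_far R (1 + 2 * dl n) n k z ltac:(lra).
by split; lra.
Qed.

Lemma nm_phi n k z : disc z -> nm (phi n k z) = expR (dipole n k z).
Proof.
move=> z1; have [p1 p2] := disc_poles n k z1; have d0 := dl_gt0 (R := R) n.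
rewrite /phi /dipole expRB !lnK ?posrE ?nmM ?nmV //; lra.
Qed.

Lemma phiE n k z : disc z ->
  phi n k z = 1 + (zeta (1 + 2 * dl n) n k - zeta (1 + dl n) n k) / (z - zeta (1 + 2 * dl n) n k).
Proof.
move=> z1; have [p1 p2] := disc_poles n k z1; have d0 := dl_gt0 (R := R) n.
have : z - zeta (1 + 2 * dl n) n k != 0 by rewrite -nm_gt0; lra.
by move=> h; rewrite /phi; field.
Qed.

Lemma polyapp_phi n k : polyapp disc (phi n k).
Proof.
apply: (polyapp_ext (f := fun z => (1%:P : {poly R[i]}).[z] +
  - (zeta (1 + 2 * dl n) n k - zeta (1 + dl n) n k) * (zeta (1 + 2 * dl n) n k - z)^-1)).
  move=> z z1; rewrite phiE // hornerC mulNr -mulrN -invrN opprB //.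
apply: polyappD; first exact: polyapp_poly.
apply: polyappZ; apply: polyapp_inv => //.
have d0 := dl_gt0 (R := R) n; rewrite nm_zeta; lra.
Qed.

Definition HN E N z : R[i] := \prod_(n < N) \prod_(k < 2 ^ n | active E n k) phi n k z.

Section Bounded.
Variables (E : set R[i]^o) (M : R).
Hypotheses (E0 : E !=set0) (ET : E `<=` unit_circle) (cE : closed E) (mM : forall N, mass E N <= M).

Lemma phi_le1 n k z : disc z -> active E n k -> nm (phi n k z) <= 1.
Proof.
move=> z1 ak; rewrite nm_phi // -expR0 ler_expR.
exact: (dipole_le0 E0 ET (disc_cl_dom E0 z1)).
Qed.

Lemma nm_HN N z : disc z -> nm (HN E N z) = expR (gN E N z).
Proof.
move=> z1; rewrite /HN nm_prod /gN /psum expR_sum; apply: eq_bigr => n _.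
by rewrite nm_prod expR_sum; apply: eq_bigr => k _; rewrite nm_phi.
Qed.

Lemma HN_le1 N z : disc z -> nm (HN E N z) <= 1.
Proof. by move=> z1; rewrite nm_HN // -expR0 ler_expR gN_le0 //; exact: disc_cl_dom. Qed.

Lemma polyapp_HN N : polyapp disc (HN E N).
Proof.
have lev n : polyapp disc (fun z => \prod_(k < 2 ^ n | active E n k) phi n k z) /\
    forall z, disc z -> nm (\prod_(k < 2 ^ n | active E n k) phi n k z) <= 1.
  apply: polyapp_prod => [k _|k z ak z1]; first exact: polyapp_phi.
  exact: phi_le1.
by have [] := @polyapp_prod disc _ (index_enum 'I_N) xpredT _ (fun i _ => (lev i).1)
  (fun i z => fun=> (lev i).2 z).
Qed.

Lemma HN_diff N z w : disc z -> disc w ->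
  nm (HN E N z - HN E N w) <= psum E N (fun n k => nm (phi n k z - phi n k w)).
Proof.
move=> z1 w1.
have lev (n : nat) v : disc v -> nm (\prod_(k < 2 ^ n | active E n k) phi n k v) <= 1.
  move=> v1; have [] := @prod_diff _ (index_enum 'I_(2 ^ n)) (fun i => active E n i)
    (fun i => phi n i v) (fun i => phi n i v) (fun i ai => phi_le1 v1 ai) (fun i ai => phi_le1 v1 ai).
  by [].
have [h _] := @prod_diff _ (index_enum 'I_N) xpredT
  (fun i => \prod_(k < 2 ^ i | active E i k) phi i k z)
  (fun i => \prod_(k < 2 ^ i | active E i k) phi i k w) (fun i _ => lev i z z1) (fun i _ => lev i w w1).
apply: le_trans h _; rewrite /psum; apply: ler_sum => n _.
by have [] := @prod_diff _ (index_enum 'I_(2 ^ n)) (fun i => active E n i)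
    (fun i => phi n i z) (fun i => phi n i w) (fun i ai => phi_le1 z1 ai) (fun i ai => phi_le1 w1 ai).
Qed.

Lemma HN_lip N z w : disc z -> disc w -> 0 < dE E z -> 0 < dE E w ->
  nm (HN E N z - HN E N w) <= 40 ^+ 2 * M / (dE E z * dE E w) * nm (z - w).
Proof.
move=> z1 w1 Dz Dw; apply: le_trans (HN_diff N z1 w1) _.
have -> : 40 ^+ 2 * M / (dE E z * dE E w) * nm (z - w) =
  40 ^+ 2 / (dE E z * dE E w) * nm (z - w) * M by ring.
have c0 : 0 <= 40 ^+ 2 / (dE E z * dE E w) * nm (z - w).
  by rewrite mulr_ge0 ?nm_ge0 // divr_ge0 ?exprn_ge0 // mulr_ge0 // ltW.
apply: (psum_mass_le c0 (mM N)) => n k ak.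
have [_ p] := far_from_poles E0 ET (disc_cl_dom E0 z1) ak.
have [_ q] := far_from_poles E0 ET (disc_cl_dom E0 w1) ak.
rewrite !phiE // opprD addrACA subrr add0r -mulrBr nmM zeta_sub [leRHS]mulrC.
apply: ler_wpM2l; first by rewrite ltW // dl_gt0.
move: p q; set a := zeta _ n k => p q.
have za : 0 < nm (z - a) by apply: lt_le_trans p; rewrite divr_gt0.
have wa : 0 < nm (w - a) by apply: lt_le_trans q; rewrite divr_gt0.
have -> : (z - a)^-1 - (w - a)^-1 = (w - z) * ((z - a)^-1 * (w - a)^-1).
  by rewrite !nm_gt0 in za wa; field; rewrite za wa.
rewrite nmM nmBC mulrC; apply: ler_wpM2r; first exact: nm_ge0.
have iv (x D : R) : 0 < D -> D / 40 <= x -> x^-1 <= 40 / D.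
  by move=> D0 h; rewrite -[40 / D]invrK invf_div lef_pV2 ?posrE ?divr_gt0 // (lt_le_trans _ h) // divr_gt0.
have -> : 40 ^+ 2 / (dE E z * dE E w) = (40 / dE E z) * (40 / dE E w).
  by field; rewrite !gt_eqF.
by rewrite nmM !nmV; apply: ler_pM; rewrite ?invr_ge0 ?nm_ge0 // iv.
Qed.

Lemma HN_near m N z : disc z -> dE E z <= dl m -> (m <= N)%N -> nm (HN E N z) <= expR (- (m%:R / 144)).
Proof.
move=> z1 h mN; have cz := disc_cl_dom E0 z1.
rewrite nm_HN // ler_expR; apply: le_trans (gN_anti E0 ET cz mN) _.
apply: (gN_drop E0 ET cz) => n nm; apply: le_trans h _; apply: dl_le; exact: ltnW.
Qed.

Lemma expR_small (e : R) : 0 < e -> exists m : nat, expR (- (m%:R / 144)) <= e.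
Proof.
move=> e0; have p : 0 <= 144 / e by rewrite divr_ge0 // ltW.
have [m [_ h _]] := ex_nat_ceil p; exists m.
rewrite expRN -[e]invrK lef_pV2 ?posrE ?invr_gt0 ?expR_gt0 //.
apply: le_trans (expR_ge1Dx _); apply: le_trans (_ : m%:R / 144 <= _); last by rewrite lerDr.
by rewrite ler_pdivlMr // mulrC ltW.
Qed.

(** Two zones. Within [dl m] of E, m scales already make all later products small. Farther away each
    later factor differs from 1 by at most 40 dl n/dl m, and the tail of the mass makes the sum
    small. *)
Lemma HN_ucauchy (e : R) : 0 < e ->
  exists N0, forall N, (N0 <= N)%N -> forall z, disc z -> nm (HN E N z - HN E N0 z) <= e.
Proof.
move=> e0; have [m hm] := expR_small (divr_gt0 e0 (ltr0n _ 2)).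
have d0 := dl_gt0 (R := R) m.
have p0 : 0 < e * dl m / 40 by rewrite divr_gt0 // mulr_gt0.
have [N1 tail] := mass_tail mM p0.
exists (maxn m N1) => N NN z z1.
have [h|h] := leP (dE E z) (dl m).
  have h1 := HN_near z1 h (leq_trans (leq_maxl m N1) NN).
  have h2 := HN_near z1 h (leq_maxl m N1).
  by apply: le_trans (nmB _ _) _; lra.
set N2 := maxn m N1 in NN *.
have K N' : (N2 <= N')%N -> nm (HN E N' z - HN E N2 z) <= 40 / dl m * (mass E N' - mass E N2).
  move=> /subnK <-; elim: (N' - N2)%N => [|p IH]; first by rewrite add0n !subrr nm0 mulr0.
  rewrite addSn; apply: le_trans (nm_tri (HN E (p + N2) z) _ _) _.
  rewrite {1}/mass psumS -/(mass E (p + N2)) addrAC mulrDr [leRHS]addrC; apply: lerD IH.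
  rewrite /HN big_ord_recr /= -/(HN E (p + N2) z).
  set A := HN E (p + N2) z; set B := \prod_(_ < _ | _) _.
  have -> : A * B - A = A * (B - 1) by ring.
  rewrite nmM; apply: le_trans (_ : nm (B - 1) <= _).
    by rewrite ler_piMl ?nm_ge0 // HN_le1.
  have -> : B - 1 = B - \prod_(k < 2 ^ (p + N2) | active E (p + N2) k) 1 by rewrite big1.
  have one1 (i : 'I_(2 ^ (p + N2))) : active E (p + N2) i -> nm (1 : R[i]) <= 1 by rewrite nm1.
  have [q _] := @prod_diff _ (index_enum 'I_(2 ^ (p + N2))) (fun i => active E (p + N2) i)
    (fun i => phi (p + N2) i z) (fun=> 1) (fun i ai => phi_le1 z1 ai) one1.
  apply: le_trans q _; rewrite mulr_sumr; apply: ler_sum => k ak.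
  have [_ far] := far_from_poles E0 ET (disc_cl_dom E0 z1) ak.
  rewrite phiE // addrC addKr nmM nmV zeta_sub mulrC.
  apply: ler_wpM2r; first by rewrite ltW // dl_gt0.
  have f0 : dl m / 40 <= nm (z - zeta (1 + 2 * dl (p + N2)) (p + N2) k) by lra.
  rewrite -[40 / dl m]invrK invf_div lef_pV2 ?posrE ?divr_gt0 //.
  by apply: lt_le_trans f0; rewrite divr_gt0.
apply: le_trans (K N NN) _.
have hm2 : mass E N1 <= mass E N2.
  have : (N1 <= N2)%N by exact: leq_maxr.
  by move/subnK <-; elim: (N2 - N1)%N => [|p IH]; rewrite ?add0n // addSn (le_trans IH) // massS.
have : mass E N - mass E N2 <= e * dl m / 40 by have := tail N; lra.
move=> h3; apply: le_trans (ler_wpM2l _ h3) _; first by rewrite divr_ge0 // ltW.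
by rewrite le_eqVlt; apply/orP; left; apply/eqP; field; rewrite gt_eqF.
Qed.

(* F is the exponential of 144 (g + i g~), with g~ a harmonic conjugate of g = gE E. *)
Lemma vanishing_function : exists F : R[i] -> R[i],
  [/\ polyapp disc F, forall z, disc z -> nm (F z) <= dE E z,
      forall z, disc z -> ~ E z -> 0 < nm (F z),
      forall z, nm z < 1 -> expR (144 * gE E z) <= nm (F z) &
      exists2 C, 0 <= C & forall z w, disc z -> disc w -> 0 < dE E z -> 0 < dE E w ->
        nm (F z - F w) <= C / (dE E z * dE E w) * nm (z - w)].
Proof.
have [H HH] := ucauchy_limit HN_ucauchy.
have Hlow z : disc z -> 0 < dE E z -> expR (gE E z) <= nm (H z).
  move=> z1 D0; apply/ler_addgt0Pr => e e0; have [N HNe] := HH e e0.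
  have cz := disc_cl_dom E0 z1.
  have : expR (gE E z) <= nm (HN E N z).
    by rewrite nm_HN // ler_expR; exact: (gE_le_gN E0 ET mM).
  by have := HNe N (leqnn _) z z1; have := nm_subl (HN E N z) (H z); rewrite nmBC; lra.
have Hup z c m0 : disc z -> (forall N, (m0 <= N)%N -> nm (HN E N z) <= c) -> nm (H z) <= c.
  move=> z1 Hc; apply/ler_addgt0Pr => e e0; have [N HNe] := HH e e0.
  have := Hc _ (leq_maxl m0 N); have := HNe _ (leq_maxr m0 N) z z1.
  by have := nm_subl (H z) (HN E (maxn m0 N) z); lra.
have H1 z : disc z -> nm (H z) <= 1.
  by move=> z1; apply: (@Hup z 1 0%N) => // N _; exact: HN_le1.
(* The power 144 turns g <= (ln d)/144 into |F| <= d; the numeral is locked so that it is not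
   unfolded. *)
pose K : nat := locked 144%N; have KE : K%:R = 144 :> R by rewrite /K -lock.
have K0 : K != 0%N by rewrite /K -lock.
have HK z : disc z -> nm (H z ^+ K) <= dE E z.
  move=> z1; have cz := disc_cl_dom E0 z1; rewrite nmX.
  have := dE_ge0 z E0; rewrite le_eqVlt => /predU1P[D0|D0].
    suff -> : nm (H z) = 0 by rewrite expr0n (negPf K0) -D0.
    apply/eqP; rewrite eq_le nm_ge0 andbT; apply/ler_addgt0Pr => e e0; rewrite add0r.
    have [m hm] := expR_small e0; apply: le_trans hm; apply: (@Hup z _ m z1) => N mN.
    by apply: HN_near => //; rewrite -D0 ltW // dl_gt0.
  have [m hm] := gN_le_ln E0 ET cz D0.
  have h : nm (H z) <= expR (ln (dE E z) / 144).
    apply: (@Hup z _ m z1) => N mN; rewrite nm_HN // ler_expR.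
    by apply: le_trans hm; exact: gN_anti.
  apply: le_trans (_ : expR (ln (dE E z) / 144) ^+ K <= _).
    by rewrite lerXn2r ?nnegrE ?nm_ge0 ?expR_ge0.
  by rewrite -expRM_natl KE mulrC divfK // lnK.
exists (fun z => H z ^+ K); split => //.
- have pH : polyapp disc H.
    apply: polyapp_lim => e e0; have [N HNe] := HH e e0.
    by exists (HN E N); [exact: polyapp_HN|exact: HNe].
  have := @polyapp_prod disc _ (index_enum 'I_K) xpredT (fun _ => H) (fun _ _ => pH) (fun _ z _ => H1 z).
  by case=> h _; apply: polyapp_ext h => z _; rewrite prodr_const card_ord.
- move=> z z1 nE; rewrite nmX exprn_gt0 //.
  by apply: lt_le_trans (Hlow z z1 (dE_gt0 cE E0 nE)); exact: expR_gt0.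
- move=> z z1; have zd : disc z by exact: ltW.
  have D0 : 0 < dE E z by apply: lt_le_trans (dE_ge_circle z E0 ET); rewrite subr_gt0.
  by rewrite nmX -KE expRM_natl lerXn2r ?nnegrE ?nm_ge0 ?expR_ge0 // Hlow.
have M0 : 0 <= M by apply: le_trans (mM 0); rewrite /mass /psum big_ord0.
exists (K%:R * (40 ^+ 2 * M)); first by rewrite !mulr_ge0 ?exprn_ge0.
move=> z w z1 w1 Dz Dw.
have lip : nm (H z - H w) <= 40 ^+ 2 * M / (dE E z * dE E w) * nm (z - w).
  apply/ler_addgt0Pr => e e0; have [N HNe] := HH (e / 2) (divr_gt0 e0 (ltr0n _ 2)).
  have := HNe N (leqnn _) z z1; have := HNe N (leqnn _) w w1; have := HN_lip N z1 w1 Dz Dw.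
  have := nm_tri (HN E N z) (H z) (H w); have := nm_tri (HN E N w) (HN E N z) (H w).
  by rewrite [nm (HN E N w - H w)]nmBC; lra.
have [h _] := @prod_diff _ (index_enum 'I_K) xpredT (fun=> H z) (fun=> H w)
  (fun _ _ => H1 z z1) (fun _ _ => H1 w w1).
rewrite !prodr_const card_ord sumr_const card_ord in h; apply: le_trans h _.
have -> : nm (H z - H w) *+ K = K%:R * nm (H z - H w) by rewrite mulr_natl.
rewrite (_ : K%:R * (40 ^+ 2 * M) / (dE E z * dE E w) * nm (z - w) =
  K%:R * (40 ^+ 2 * M / (dE E z * dE E w) * nm (z - w))); last by ring.
by apply: ler_wpM2l.
Qed.

End Bounded.
End BlaschkeLikeProduct.

(** * Spectrum and inverse powers of multiplication by z *)

Section InversePowers.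
Context {R : realType} (E : set R[i]^o) (ET : E `<=` unit_circle).
Local Notation V := (banE_type ET).
Implicit Types (z w mu l : R[i]) (F : R[i] -> R[i]).

(** A polynomial p close to F is small at mu; p - p(mu) is divisible by X - mu, and the quotient
    approximates because |z - mu| >= 1 - |mu| on the circle. *)
Lemma polyapp_div F mu : polyapp disc F -> F mu = 0 -> nm mu < 1 ->
  polyapp circ (fun z => F z / (z - mu)).
Proof.
move=> pF Fmu m1 e e0; have d0 : 0 < 1 - nm mu by rewrite subr_gt0.
have [p Hp] := pF (e * (1 - nm mu) / 2) (divr_gt0 (mulr_gt0 e0 d0) (ltr0n _ 2)).
have pm : nm p.[mu] <= e * (1 - nm mu) / 2.
  by have := Hp mu (ltW m1); rewrite Fmu sub0r nmN.
have rt : root (p - p.[mu]%:P) mu by rewrite rootE hornerD hornerN hornerC subrr.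
have [q qE] := factor_theorem _ _ rt; exists q => z cz.
have zm : 1 - nm mu <= nm (z - mu) by have := nm_subl z mu; rewrite cz.
have zm0 : 0 < nm (z - mu) by lra.
have zn : z - mu != 0 by rewrite -nm_gt0.
have pz : p.[z] - p.[mu] = q.[z] * (z - mu).
  by have := congr1 (fun s => s.[z]) qE; rewrite /= hornerD hornerN hornerC hornerM hornerXsubC.
have -> : F z / (z - mu) - q.[z] = (F z - p.[z] + p.[mu]) / (z - mu).
  apply: (mulIf zn); rewrite mulrBl !divfK // -pz; ring.
rewrite nmM nmV ler_pdivrMr //; apply: le_trans (nmD _ _) _.
have cz' : disc z by rewrite /disc cz.
have := Hp z cz'; have : e * (1 - nm mu) <= e * nm (z - mu) by rewrite ler_pM2l.
by move: pm; lra.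
Qed.

Section Bounded.
Variable (M : R).
Hypotheses (E0 : E !=set0) (cE : closed E) (mM : forall N, mass E N <= M).

Let circE l : E l -> circ l.
Proof. by move=> El; rewrite /circ /nm (ET El). Qed.

(** F vanishes on E, so h(z) = (F(z)/F(mu) - 1)/(z - mu) agrees there with 1/(mu - z), and its
    singularity at mu cancels. The cost is 1/|F(mu)| <= exp(-144 g(mu)), controlled by [gE_small],
    and a power of 1/(1 - |mu|). *)
Lemma res_inside (eps : R) : 0 < eps -> exists2 B, 0 <= B & forall mu, nm mu < 1 ->
  exists Q, resolvent (@Tz R E ET) mu Q /\ forall v, nm (Q v) <= B * expR (eps / (1 - nm mu)) * nm v.
Proof.
move=> eps0; have [F [pF FD F0 Fg _]] := vanishing_function E0 ET cE mM.
(* Half of eps goes to 144 times the bound on -g; the other half, [e2], absorbs the factor (1 -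
   |mu|)^-2. *)
pose e1 := eps / (2 * 144); have e10 : 0 < e1 by rewrite divr_gt0.
have [C C0 HC] := gE_small E0 ET mM e10.
pose e2 := eps / 2; have e20 : 0 < e2 by rewrite divr_gt0.
exists (8 * (4 / e2 ^+ 2) * expR (144 * C)).
  by rewrite !mulr_ge0 ?expR_ge0 // invr_ge0 exprn_ge0 // ltW.
move=> mu m1; have d0 : 0 < 1 - nm mu by rewrite subr_gt0.
have nE : ~ E mu by move=> Emu; have := circE Emu; rewrite /circ => h; move: m1; rewrite h ltxx.
set d := 1 - nm mu in d0 *.
have md : disc mu by exact: ltW.
have a0 := F0 mu md nE; have a2 : nm (F mu) <= 2.
  by apply: le_trans (FD mu md) _; apply: le_trans (dE_le_circle mu E0 ET) _; lra.
have d1 : d <= 1 by rewrite /d; have := nm_ge0 mu; lra.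
have Fn : F mu != 0 by rewrite -nm_gt0.
have far z : circ z -> d <= nm (z - mu) by move=> cz; have := nm_subl z mu; rewrite cz.
have ne z : circ z -> z - mu != 0 by move=> /far h; rewrite -nm_gt0; lra.
have F2 z : circ z -> nm (F z) <= 2.
  move=> cz; apply: le_trans (FD z _) _; first by rewrite /disc cz.
  by apply: le_trans (dE_le_circle z E0 ET) _; rewrite cz; lra.
have FE l : E l -> F l = 0.
  move=> El; apply/eqP; rewrite -nm_eq0 eq_le nm_ge0 andbT.
  by have := FD l; rewrite /disc (circE El) dE_mem //; apply.
have inv z : circ z -> nm (z - mu)^-1 <= d^-1.
  by move=> cz; rewrite nmV lef_pV2 ?posrE ?far ?nm_gt0 ?ne.
pose h z := (F z / F mu - 1) / (z - mu).
pose B := 4 / (nm (F mu) * d ^+ 2).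
have ia : 1 <= 2 / nm (F mu) by rewrite ler_pdivlMr // mul1r.
have dd : d^-1 <= (d ^+ 2)^-1 by rewrite lef_pV2 ?posrE ?exprn_gt0 // expr2 ler_piMr // ltW.
have BE : B = 4 / nm (F mu) * (d ^+ 2)^-1 by rewrite /B invfM mulrA.
have Lh : lipat E B h.
  split.
  - apply: polyapp_div m1; last by rewrite divff // subrr.
    have pc : polyapp disc (fun z => (F mu)^-1 * F z) by exact: polyappZ.
    apply: (polyapp_ext (f := fun z => (F mu)^-1 * F z + (- 1%:P : {poly R[i]}).[z])).
      by move=> z _; rewrite hornerN hornerC mulrC.
    by apply: polyappD => //; exact: polyapp_poly.
  - move=> z cz; rewrite /h nmM BE; apply: ler_pM; rewrite ?nm_ge0 //; last exact: le_trans (inv z cz) dd.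
    apply: le_trans (nmB _ _) _; rewrite nmM nmV nm1.
    have : nm (F z) / nm (F mu) <= 2 / nm (F mu) by rewrite ler_pM2r ?invr_gt0 ?F2.
    have -> : 4 / nm (F mu) = 2 / nm (F mu) + 2 / nm (F mu) by field; rewrite gt_eqF.
    by clear dd BE Fn a0 a2 d1 eps0 e10 C0 e20 m1 d0; lra.
  move=> l z El cz; rewrite /h (FE l El) mul0r sub0r.
  have -> : (F z / F mu - 1) / (z - mu) - -1 / (l - mu) =
     F z / F mu * (z - mu)^-1 + (z - l) * ((z - mu)^-1 * (l - mu)^-1).
    have := ne z cz; have := ne l (circE El); move: (F z / F mu) => q h1 h2.
    by field; rewrite h1 h2.
  apply: le_trans (nmD _ _) _; rewrite !nmM [nm (F mu)^-1]nmV BE.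
  have n0 := nm_ge0 (z - l).
  have t1 : nm (F z) / nm (F mu) * nm (z - mu)^-1 <= nm (z - l) / nm (F mu) * (d ^+ 2)^-1.
    apply: ler_pM; rewrite ?divr_ge0 ?nm_ge0 //; last exact: le_trans (inv z cz) dd.
    rewrite ler_pM2r ?invr_gt0 //; apply: le_trans (FD z _) (dE_le z El).
    by rewrite /disc cz.
  have t2 : nm (z - l) * (nm (z - mu)^-1 * nm (l - mu)^-1) <= nm (z - l) * (2 / nm (F mu) * (d ^+ 2)^-1).
    apply: ler_wpM2l => //; apply: le_trans (_ : 1 * (d ^+ 2)^-1 <= _); last first.
      by apply: ler_wpM2r => //; rewrite invr_ge0 exprn_ge0 // ltW.
    rewrite mul1r expr2 invfM; apply: ler_pM; rewrite ?nm_ge0 ?inv //; exact: circE.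
  have k0 : 0 <= nm (z - l) * ((nm (F mu))^-1 * (d ^+ 2)^-1).
    by rewrite !mulr_ge0 ?invr_ge0 ?exprn_ge0 ?nm_ge0 // ltW.
  by move: t1 t2 k0; clear BE n0 d1 Fn ia dd eps0 e10 C0 e20 m1 d0 a0 a2; lra.
exists (mulV h); split.
  apply: res_mulV Lh _ => l El; rewrite /h (FE l El) mul0r sub0r.
  by have := ne l (circE El) => h1; rewrite -[mu - l]opprB; move: (l - mu) h1 => x x0; field.
move=> v; apply: le_trans (mulV_nm v Lh) _; apply: ler_wpM2r; first exact: nm_ge0.
have ig : (nm (F mu))^-1 <= expR (144 * (e1 / d + C)).
  have := Fg mu m1 => fg; rewrite -[leRHS]invrK -expRN lef_pV2 ?posrE ?expR_gt0 //.
  apply: le_trans fg; rewrite ler_expR -mulrN; apply: ler_wpM2l => //.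
  by have := HC mu m1; rewrite -/d; clear; lra.
have id : (d ^+ 2)^-1 <= 4 / e2 ^+ 2 * expR (e2 / d).
  have h1 : e2 / d / 2 <= expR (e2 / d / 2) by apply: le_trans (expR_ge1Dx _); rewrite lerDr.
  have h2 : (e2 / d / 2) ^+ 2 <= expR (e2 / d).
    have -> : expR (e2 / d) = expR (e2 / d / 2) ^+ 2 by rewrite -expRM_natl; congr expR; field; rewrite gt_eqF.
    by rewrite lerXn2r ?nnegrE ?expR_ge0 // !divr_ge0 // ltW.
  have -> : (d ^+ 2)^-1 = 4 / e2 ^+ 2 * (e2 / d / 2) ^+ 2 by field; rewrite !gt_eqF.
  by apply: ler_wpM2l h2; rewrite divr_ge0 // sqr_ge0.
have -> : 2 * B = 8 * ((d ^+ 2)^-1 * (nm (F mu))^-1) by rewrite BE; ring.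
have -> : 8 * (4 / e2 ^+ 2) * expR (144 * C) * expR (eps / d) =
   8 * ((4 / e2 ^+ 2 * expR (e2 / d)) * expR (144 * (e1 / d + C))).
  have -> : expR (eps / d) = expR (e2 / d) * expR (144 * (e1 / d)).
    by rewrite -expRD; congr expR; rewrite /e1 /e2; field; rewrite gt_eqF.
  by rewrite mulrDr expRD; ring.
apply: ler_wpM2l => //; apply: ler_pM => //.
  by rewrite invr_ge0 sqr_ge0.
by rewrite invr_ge0 nm_ge0.
Qed.

(* Squaring 1 - F/F(mu) makes the quotient by mu - z vanish at mu, so that the
   pole can be pushed out of the disc at no cost. *)
Lemma res_circle mu : nm mu = 1 -> ~ E mu -> exists Q, resolvent (@Tz R E ET) mu Q.
Proof.
move=> m1 nE; have [F [pF FD F0 _ [C C0 FL]]] := vanishing_function E0 ET cE mM.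
have md : disc mu by rewrite /disc m1.
have a0 := F0 mu md nE; have Fn : F mu != 0 by rewrite -nm_gt0.
have r0 := dE_gt0 cE E0 nE; set r := dE E mu in r0.
have F2 z : circ z -> nm (F z) <= 2.
  move=> cz; apply: le_trans (FD z _) _; first by rewrite /disc cz.
  by apply: le_trans (dE_le_circle z E0 ET) _; rewrite cz; lra.
have FE l : E l -> F l = 0.
  move=> El; apply/eqP; rewrite -nm_eq0 eq_le nm_ge0 andbT.
  by have := FD l; rewrite /disc (circE El) dE_mem //; apply.
pose q z := 1 - F z / F mu; pose Q0 := 1 + 2 / nm (F mu).
have Q01 : 1 <= Q0 by rewrite lerDl divr_ge0 ?nm_ge0.
have qb z : circ z -> nm (q z) <= Q0.
  move=> cz; apply: le_trans (nmB _ _) _; rewrite nm1 lerD2l nmM nmV.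
  by rewrite ler_pM2r ?invr_gt0 ?F2.
pose B := Q0 * (2 / r) + C / (r / 2 * r) / nm (F mu).
have B0 : 0 <= B.
  apply: addr_ge0; first by rewrite mulr_ge0 ?divr_ge0 ?(ltW r0) //; lra.
  by rewrite !divr_ge0 ?nm_ge0 // !mulr_ge0 // ?invr_ge0 ltW.
(* Away from E this is the Lipschitz bound on F; where z is close to E it is far from mu, and the
   supremum of [q] is enough. *)
have ql z : circ z -> nm (q z) <= B * nm (z - mu).
  move=> cz; have zd : disc z by rewrite /disc cz.
  have n0 := nm_ge0 (z - mu).
  have [h|h] := leP (dE E z) (r / 2).
    have far : r / 2 <= nm (z - mu).
      by have := dE_lip mu z E0; rewrite -/r nmBC; lra.
    apply: le_trans (qb z cz) _; rewrite /B mulrDl; apply: ler_wpDr.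
      by rewrite mulr_ge0 // divr_ge0 ?nm_ge0 // divr_ge0 // mulr_ge0 // ?divr_ge0 // ltW.
    rewrite -mulrA -[leLHS]mulr1; apply: ler_wpM2l; first by lra.
    apply: le_trans (_ : 2 / r * (r / 2) <= _); last by rewrite ler_wpM2l // divr_ge0 // ltW.
    by rewrite le_eqVlt; apply/orP; left; apply/eqP; field; rewrite gt_eqF.
  have -> : q z = (F mu - F z) / F mu by rewrite /q mulrBl divff.
  rewrite nmM nmV nmBC; have Dz : 0 < dE E z by apply: lt_trans h; rewrite divr_gt0.
  have f1 := FL z mu zd md Dz r0.
  apply: le_trans (_ : C / (r / 2 * r) / nm (F mu) * nm (z - mu) <= _); last first.
    by apply: ler_wpM2r => //; rewrite /B lerDr mulr_ge0 ?divr_ge0 ?(ltW r0) //; lra.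
  rewrite [leRHS]mulrAC; apply: ler_wpM2r; first by rewrite invr_ge0 nm_ge0.
  apply: le_trans f1 _; apply: ler_wpM2r => //; apply: ler_wpM2l => //.
  by rewrite lef_pV2 ?posrE ?mulr_gt0 ?divr_gt0 // ler_pM2r // ltW.
have pq : polyapp circ q.
  apply: (polyapp_ext (f := fun z => (1%:P : {poly R[i]}).[z] + - (F mu)^-1 * F z)).
    by move=> z _; rewrite hornerC /q mulNr mulrC.
  apply: polyappD; first exact: polyapp_poly.
  by apply: polyappZ; apply: polyapp_sub pF => z; rewrite /circ /disc => ->.
pose h z := q z ^+ 2 / (mu - z).
have ph : polyapp circ h.
  (* The pole is moved to (1 + d) mu. The error is q^2 d over the product of the two denominators,
     at most 2 B^2 d because q is O(|z - mu|). *)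
  apply: polyapp_lim => e e0; pose d := e / (2 * B ^+ 2 + 1).
  have c0 : 0 < 2 * B ^+ 2 + 1 by have := sqr_ge0 B; lra.
  have d0 : 0 < d by rewrite divr_gt0.
  have dmu : nm ((1 + d)%:C%C * mu) = 1 + d by rewrite nmM m1 mulr1 nmR gtr0_norm //; lra.
  have am1 : 1 < nm ((1 + d)%:C%C * mu) by rewrite dmu ltrDl.
  have farz z : circ z -> d <= nm ((1 + d)%:C%C * mu - z).
    by move=> cz; have := nm_subl ((1 + d)%:C%C * mu) z; rewrite dmu cz; lra.
  exists (fun z => q z * q z * ((1 + d)%:C%C * mu - z)^-1).
    apply: (@polyappM _ _ _ _ (Q0 * Q0) d^-1).
    - by move=> z cz; rewrite nmM; apply: ler_pM; rewrite ?nm_ge0 ?qb.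
    - move=> z cz; rewrite nmV lef_pV2 ?posrE ?farz //.
      exact: lt_le_trans (farz z cz).
    - exact: (polyappM qb qb).
    by apply: polyapp_inv am1 => z ->.
  move=> z cz; rewrite /h expr2.
  have [->|zm] := eqVneq z mu.
    by rewrite /q divff // subrr !mul0r subrr nm0 ltW.
  have z1 : mu - z != 0 by rewrite subr_eq0 eq_sym.
  have z2 : (1 + d)%:C%C * mu - z != 0 by rewrite -nm_gt0; apply: lt_le_trans (farz z cz).
  have -> : q z * q z / (mu - z) - q z * q z / ((1 + d)%:C%C * mu - z) =
     q z * q z * (d%:C%C * mu) / ((mu - z) * ((1 + d)%:C%C * mu - z)).
    move: z1 z2; rewrite rmorphD rmorph1 /=; move: (q z) (d%:C%C) => Qz D z1 z2.
    by field; rewrite z1 z2.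
  have n1 : 0 < nm (mu - z) by rewrite nm_gt0.
  have n2 : 0 < nm ((1 + d)%:C%C * mu - z) by rewrite nm_gt0.
  rewrite nmM nmV !nmM m1 mulr1 nmR gtr0_norm // ler_pdivrMr ?mulr_gt0 //.
  have h1 := ql z cz; rewrite [nm (z - mu)]nmBC in h1.
  have h2 : nm (q z) * nm (q z) <= B ^+ 2 * (nm (mu - z) * nm (mu - z)).
    have -> : B ^+ 2 * (nm (mu - z) * nm (mu - z)) = (B * nm (mu - z)) * (B * nm (mu - z)) by ring.
    by apply: ler_pM; rewrite ?nm_ge0.
  have h3 : nm (mu - z) <= 2 * nm ((1 + d)%:C%C * mu - z).
    have e1 : mu - z = ((1 + d)%:C%C * mu - z) - d%:C%C * mu by rewrite rmorphD rmorph1; ring.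
    have := nmB ((1 + d)%:C%C * mu - z) (d%:C%C * mu); rewrite -e1 nmM m1 mulr1 nmR gtr0_norm //.
    by have := farz z cz; clear; lra.
  apply: le_trans (_ : B ^+ 2 * (nm (mu - z) * nm (mu - z)) * d <= _).
    by apply: ler_wpM2r => //; exact: ltW.
  apply: le_trans (_ : B ^+ 2 * (nm (mu - z) * (2 * nm ((1 + d)%:C%C * mu - z))) * d <= _).
    apply: ler_wpM2r; first exact: ltW.
    by apply: ler_wpM2l; [exact: sqr_ge0|apply: ler_wpM2l => //; exact: ltW].
  have -> : B ^+ 2 * (nm (mu - z) * (2 * nm ((1 + d)%:C%C * mu - z))) * d =
    (2 * B ^+ 2 * d) * (nm (mu - z) * nm ((1 + d)%:C%C * mu - z)) by ring.
  apply: ler_wpM2r; first by rewrite mulr_ge0 // ltW.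
  rewrite /d mulrA ler_pdivrMr //.
  by rewrite mulrC; apply: ler_wpM2l; [exact: ltW|rewrite lerDl].
pose M1 := 2 * B ^+ 2.
have hb z : circ z -> nm (h z) <= M1.
  move=> cz; rewrite /h; have [->|zm] := eqVneq z mu.
    by rewrite /q divff // subrr expr0n mul0r nm0 mulr_ge0 ?sqr_ge0.
  have n1 : 0 < nm (mu - z) by rewrite nm_gt0 subr_eq0 eq_sym.
  have h1 := ql z cz; rewrite [nm (z - mu)]nmBC in h1.
  rewrite nmM nmV nmX ler_pdivrMr //.
  have z2 : nm (mu - z) <= 2 by apply: le_trans (nmB _ _) _; rewrite m1 cz; lra.
  apply: le_trans (_ : (B * nm (mu - z)) ^+ 2 <= _).
    by rewrite lerXn2r ?nnegrE ?nm_ge0 // mulr_ge0 ?nm_ge0.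
  have -> : M1 * nm (mu - z) = B ^+ 2 * (2 * nm (mu - z)) by rewrite /M1; ring.
  rewrite exprMn; apply: ler_wpM2l; first exact: sqr_ge0.
  by rewrite expr2; apply: ler_wpM2r; [exact: nm_ge0|].
have faru l : E l -> r <= nm (mu - l) by exact: dE_le.
(* One summand per estimate: the supremum; z near mu, hence far from l; and for z away from mu, the
   share of F(z) and that of 1/(mu - z) - 1/(mu - l). *)
pose K := M1 + (M1 + r^-1) * (2 / r) + (Q0 + 1) / nm (F mu) * (2 / r) + (2 / r) * r^-1.
have p1 : 0 <= M1 by rewrite mulr_ge0 ?sqr_ge0.
have p2 : 0 <= r^-1 by rewrite invr_ge0 ltW.
have p3 : 0 <= 2 / r by rewrite divr_ge0 // ltW.
have p4 : 0 <= (Q0 + 1) / nm (F mu) by rewrite divr_ge0 ?nm_ge0 //; lra.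
have p5 := mulr_ge0 p4 p3; have p6 := mulr_ge0 p3 p2; have p7 := mulr_ge0 (addr_ge0 p1 p2) p3.
have hE l : E l -> h l = (mu - l)^-1 by move=> El; rewrite /h /q (FE l El) mul0r subr0 expr1n mul1r.
have Lh : lipat E K h.
  split=> // [z cz|l z El cz].
    apply: le_trans (hb z cz) _; rewrite /K.
    by apply: ler_wpDr p6 _; apply: ler_wpDr p5 _; rewrite lerDl.
  rewrite (hE l El); have n0 := nm_ge0 (z - l).
  have lm : 0 < nm (mu - l) by apply: lt_le_trans (faru l El).
  have il : nm (mu - l)^-1 <= r^-1 by rewrite nmV lef_pV2 ?posrE ?faru.
  have [near|far] := ltP (nm (mu - z)) (r / 2).
    have zl : r / 2 <= nm (z - l).
      by have := nm_tri z mu l; have := faru l El; clear -near; lra.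
    apply: le_trans (nmB _ _) _.
    apply: le_trans (_ : (M1 + r^-1) * (2 / r) * nm (z - l) <= _).
      rewrite -mulrA -[leLHS]mulr1; apply: ler_pM; rewrite ?addr_ge0 ?nm_ge0 //.
        by apply: lerD => //; exact: hb.
      apply: le_trans (ler_wpM2l p3 zl).
      by rewrite le_eqVlt; apply/orP; left; apply/eqP; field; rewrite gt_eqF.
    apply: ler_wpM2r => //; rewrite /K.
    by apply: ler_wpDr p6 _; apply: ler_wpDr p5 _; rewrite lerDr.
  have zm : 0 < nm (mu - z) by apply: lt_le_trans far; rewrite divr_gt0.
  have iz : nm (mu - z)^-1 <= 2 / r.
    by rewrite nmV -[2 / r]invrK invf_div lef_pV2 ?posrE ?divr_gt0.
  have -> : h z - (mu - l)^-1 = - (F z / F mu) * (q z + 1) * (mu - z)^-1 +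
     (z - l) * ((mu - z)^-1 * (mu - l)^-1).
    rewrite /h /q; rewrite !nm_gt0 in zm lm; move: (F z / F mu) => G.
    by field; rewrite zm lm.
  apply: le_trans (nmD _ _) _.
  have t1 : nm (- (F z / F mu) * (q z + 1) * (mu - z)^-1) <= (Q0 + 1) / nm (F mu) * (2 / r) * nm (z - l).
    rewrite !nmM nmN nmM nmV.
    have -> : (Q0 + 1) / nm (F mu) * (2 / r) * nm (z - l) =
      nm (z - l) / nm (F mu) * (Q0 + 1) * (2 / r) by ring.
    apply: ler_pM; rewrite ?mulr_ge0 ?invr_ge0 ?nm_ge0 //.
    apply: ler_pM; rewrite ?mulr_ge0 ?invr_ge0 ?nm_ge0 //.
      rewrite ler_pM2r ?invr_gt0 //; apply: le_trans (FD z _) (dE_le z El).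
      by rewrite /disc cz.
    by apply: le_trans (nmD _ _) _; rewrite nm1 lerD2r qb.
  have t2 : nm ((z - l) * ((mu - z)^-1 * (mu - l)^-1)) <= (2 / r) * r^-1 * nm (z - l).
    rewrite nmM [leRHS]mulrC; apply: ler_wpM2l => //; rewrite nmM.
    by apply: ler_pM; rewrite ?nm_ge0.
  have -> : K * nm (z - l) = (M1 + (M1 + r^-1) * (2 / r)) * nm (z - l) +
    ((Q0 + 1) / nm (F mu) * (2 / r) * nm (z - l) + (2 / r) * r^-1 * nm (z - l)) by rewrite /K; ring.
  apply: ler_wpDl; first by rewrite mulr_ge0 // addr_ge0.
  exact: lerD.
exists (mulV h); apply: res_mulV Lh _ => l El; rewrite hE // mulVf //.
by rewrite -nm_gt0; apply: lt_le_trans (faru l El).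
Qed.

Lemma spectrum_Tz : spectrum (@Tz R E ET) `<=` E.
Proof.
move=> mu /= h; apply: contrapT => nE; apply: h.
have [m1|m1|m1] := ltgtP (nm mu) 1.
- by have [B _ H] := res_inside ltr01; have [Q [rQ _]] := H mu m1; exists Q.
- exact: res_outside.
exact: res_circle.
Qed.

(** S is - R(0). In Cauchy's formula the radius 1 - c/sqrt(n + 1) balances the costs: the resolvent
    bound and the factor r^-n each give at most exp(eps/2 sqrt(n + 1)), up to a constant. *)
Lemma Tz_inverse : exists S, bounded_inverse (@Tz R E ET) S /\
  forall eps : R, 0 < eps -> exists2 A : R, 0 <= A &
    forall n : nat, opnorm (iter n S) <= A * expR (eps * Num.sqrt n%:R).
Proof.
have z1 : nm (0 : R[i]) < 1 by rewrite nm0.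
have [B B0 HB] := res_inside ltr01; have [Q0 [[[lQ [MQ bQ]] k1 k2] _]] := HB 0 z1.
pose S v := - Q0 v.
have iS : bounded_inverse (@Tz R E ET) S.
  split.
  - split; first by move=> c u v; rewrite /S lQ opprD scalerN.
    by exists MQ => x; rewrite rnormE /S nmN; exact: bQ.
  - move=> v; have := k1 v; rewrite scale0r sub0r => h; rewrite /S -[RHS]h.
    by rewrite (lin_N _ lQ).
  move=> v; have := k2 v; rewrite scale0r sub0r /S => h.
  by rewrite (lin_N _ (@Tz_bounded R E ET).1).
exists S; split => // eps eps0.
pose c := Num.min (1 / 2) (eps / 4); have c0 : 0 < c by rewrite lt_min !divr_gt0.
have [c2 c4] : c <= 1 / 2 /\ c <= eps / 4 by split; rewrite /c ge_min lexx ?orbT.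
have ce0 : 0 < c * eps / 2 by rewrite divr_gt0 // mulr_gt0.
have [A A0 HA] := res_inside ce0.
have ex mu : exists Q, nm mu < 1 -> resolvent (@Tz R E ET) mu Q /\
    forall v, nm (Q v) <= A * expR (c * eps / 2 / (1 - nm mu)) * nm v.
  have [m1|] := pselect (nm mu < 1); last by exists id.
  by have [Q HQ] := HA mu m1; exists Q.
have [Rz HRz] := choice ex.
exists (A + opnorm (iter 0 S)).
  by rewrite addr_ge0 // opnorm_ge0 //; apply: bounded_iter; case: iS.
case=> [|n].
  rewrite sqrtr0 mulr0 expR0 mulr1 lerDr //.
pose N : R := Num.sqrt n.+1%:R; have N1 : 1 <= N by rewrite -[1]sqrtr1 ler_sqrt // ler1n.
have N0 : 0 < N by clear A0 ce0 c0 c2 c4 z1 B0 k1 k2 iS eps0; lra.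
pose r := 1 - c / N.
have cN : c / N <= 1 / 2.
  by rewrite ler_pdivrMr //; apply: le_trans c2 _; rewrite ler_peMr.
have cN0 : 0 < c / N by rewrite divr_gt0.
have r0 : 0 < r by rewrite /r; clear cN0 N1 N0 c2 c4 ce0 A0 z1 B0 k1 k2 iS eps0 c0; lra.
have r1 : r < 1 by rewrite /r; clear r0 N0 cN c4 ce0 A0 N1 z1 B0 k1 k2 iS eps0 c0 c2; lra.
pose B1 := A * expR (eps / 2 * N).
have B10 : 0 <= B1 by rewrite mulr_ge0 ?expR_ge0.
have bd (z : R[i]) : nm z = r -> forall y, nm (Rz z y) <= B1 * nm y.
  move=> zr y; have [_ h] := HRz z ltac:(by rewrite zr).
  apply: le_trans (h y) _; rewrite zr /B1 /r opprB addrC subrK.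
  have -> // : c * eps / 2 / (c / N) = eps / 2 * N by field; rewrite !gt_eqF.
have := @cauchy_resolvent R V (@Tz R E ET) S Rz r 1 B1 n (@Tz_bounded R E ET) iS r0 r1 B10
  (fun z zl => (HRz z zl).1) bd.
move=> H; have bS : bounded_operator S by case: iS.
apply: le_trans (_ : B1 / r ^+ n <= _).
  apply: opnorm_le H; first by rewrite divr_ge0 // exprn_ge0 // ltW.
  by apply: lin_iter; case: bS.
have rinv : r^-1 <= expR (2 * (c / N)).
  apply: le_trans (expR_ge1Dx _); rewrite -[leLHS]mul1r ler_pdivrMr // /r.
  by move: cN cN0; move: (c / N) => x x2 x0; nra.
have rn : (r ^+ n)^-1 <= expR (eps / 2 * N).
  rewrite -exprVn; apply: le_trans (_ : expR (2 * (c / N)) ^+ n <= _).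
    by rewrite lerXn2r ?nnegrE ?expR_ge0 // invr_ge0 ltW.
  rewrite -expRM_natl ler_expR.
  have NN : N ^+ 2 = n.+1%:R by rewrite sqr_sqrtr.
  apply: le_trans (_ : N ^+ 2 * (2 * (c / N)) <= _).
    by apply: ler_wpM2r; [lra|rewrite NN ler_nat].
  have -> : N ^+ 2 * (2 * (c / N)) = 2 * c * N by field; rewrite gt_eqF.
  by rewrite ler_pM2r //; clear A0 N1 N0 cN cN0 r0 r1 B10 rinv NN ce0 c2 eps0 c0 z1 B0 k1 k2 iS; lra.
apply: le_trans (_ : B1 * expR (eps / 2 * N) <= _); first by apply: ler_wpM2l.
have -> : B1 * expR (eps / 2 * N) = A * expR (eps * N).
  by rewrite /B1 -mulrA -expRD; congr (_ * expR _); field.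
by apply: ler_wpM2r; [exact: expR_ge0|rewrite lerDl opnorm_ge0 //; exact: bounded_iter].
Qed.

(** [f] extends T^-n applied to the constant 1, a vector of norm at most 1, and property P bounds
    its norm; multiplying back by z^n gives 1 on E. *)
Lemma inverse_power_bound (t : R) : 1 <= t -> property_P 1 t E ->
  exists2 C : R, 0 <= C & forall n : nat, exists f : R[i] -> R[i],
    lipat E (C * n.+1%:R `^ t) f /\ forall l, E l -> l ^+ n * f l = 1.
Proof.
move=> t1 P; have [S [iS HS]] := Tz_inverse; have bT := @Tz_bounded R E ET.
have bS : bounded_operator S by case: iS.
have OT : ((fun n => opnorm (iter n (@Tz R E ET))) : nat -> R^o) =O_\oo ((fun n => n%:R `^ 1) : nat -> R^o).
  apply: (@bound_eqO _ _ _ 2) => // n n0.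
  rewrite powRr1 // ger0_norm; last by apply: opnorm_ge0; exact: bounded_iter.
  rewrite ger0_norm //; apply: le_trans (opnorm_Tz _ n) _.
  by rewrite -natrM ler_nat mul2n -addnn -addn1 leq_add2l.
have OS (eps : R) : 0 < eps -> ((fun n => opnorm (iter n S)) : nat -> R^o) =O_\oo
    ((fun n => expR (eps * Num.sqrt n%:R)) : nat -> R^o).
  move=> eps0; have [A A0 HA] := HS eps eps0; apply: (@bound_eqO _ _ _ A) => // n _.
  rewrite ger0_norm ?opnorm_ge0 //; last exact: bounded_iter.
  by rewrite ger0_norm ?expR_ge0.
have t0 : 0 <= t by lra.
have := P V (@Tz R E ET) S bT iS spectrum_Tz OT OS => /eqO_bound.
move=> /(_ (fun n => n.+1%:R `^ t)) [n|n|C C0 HC].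
- by rewrite ger0_norm ?powR_ge0 //; apply: ge0_ler_powR => //; rewrite ?nnegrE // ler_nat.
- by rewrite -[leLHS](powRr0 n.+1%:R); apply: ler_powR => //; rewrite ler1n.
exists (C + 1); first by lra.
move=> n.
have oneP : ((fun z => if `[< E z >] then 1 else 0) : R[i] -> R[i]^o) \in restr_pred E.
  apply/asboolP; split=> [z nE|]; first by rewrite asboolF.
  exists 1, (fun=> 1); split; last by move=> z Ez; rewrite asboolT.
  split=> [|z _|l z _ _]; last by rewrite subrr nm0 mul1r nm_ge0.
    by apply: (polyapp_ext (f := fun z => (1%:P : {poly R[i]}).[z])) => [z _|]; [rewrite hornerC|exact: polyapp_poly].
  by rewrite nm1.
pose one : V := Restr oneP.
have n1 : nm one <= 1.
  apply: (@nm_le_ext R E ET one 1 (fun=> 1)); last by move=> z Ez /=; rewrite asboolT.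
  split=> [|z _|l z _ _]; last by rewrite subrr nm0 mul1r nm_ge0.
    by apply: (polyapp_ext (f := fun z => (1%:P : {poly R[i]}).[z])) => [z _|]; [rewrite hornerC|exact: polyapp_poly].
  by rewrite nm1.
have [f [Lf Hf]] := @nm_ext R E ET (iter n S one) 1 ltr01; exists f; split.
  apply: lipat_le Lf; rewrite mulrDl mul1r; apply: lerD; last first.
    by rewrite -[leLHS](powRr0 n.+1%:R); apply: ler_powR => //; rewrite ler1n.
  apply: le_trans (iter_ub n one bS) _.
  have := HC n; rewrite ger0_norm; last by apply: opnorm_ge0; exact: bounded_iter.
  move=> h; apply: le_trans h; rewrite ler_piMr // opnorm_ge0 //; exact: bounded_iter.
move=> l El; rewrite -Hf // -(@iter_Tz R E ET n).
have -> : iter n (@Tz R E ET) (iter n S one) = one.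
  case: iS => _ _ TS; elim: n {HC Lf Hf f} => [//|n IH].
  by rewrite iterSr /= TS IH.
by rewrite /= asboolT.
Qed.

End Bounded.
End InversePowers.

(** * A logarithmic lower bound for the potential *)

Section PolynomialMaximum.
Context {R : realType}.
Implicit Types (z w xi : R[i]) (E : set R[i]^o).

Lemma an3_poly (p : {poly R[i]}) z : an3 ((fun x => p.[x]) : R[i] -> R[i]^o) z.
Proof.
elim/poly_ind: p => [|p c IH].
  have -> : (fun x => (0 : {poly R[i]}).[x]) = fun=> 0 by apply/funext => x; rewrite horner0.
  exact: an3_const.
have -> : (fun x => (p * 'X + c%:P).[x]) = fun x => p.[x] * x + c.
  by apply/funext => x; rewrite hornerMXaddC.
by apply: an3D; [apply: an3M => //; exact: an3_id|exact: an3_const].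
Qed.

Lemma gN_regular E N z : E !=set0 -> E `<=` unit_circle -> disc z ->
  harm3 (gN E N) z /\ cont_at (gN E N) z.
Proof.
move=> E0 ET z1.
have pole n k : z != zeta (1 + dl n) n k /\ z != zeta (1 + 2 * dl n) n k.
  have [p1 p2] := disc_poles n k z1; have d0 := dl_gt0 (R := R) n.
  by rewrite -![z == _]subr_eq0 -!nm_gt0; split; lra.
have dE' n k : (fun w => dipole n k w) = (fun w => ln (nm (w - zeta (1 + dl n) n k)) +
    -1 * ln (nm (w - zeta (1 + 2 * dl n) n k))).
  by apply/funext => w; rewrite /dipole mulN1r.
split.
  apply: harm3_sum => n _; apply: harm3_sum => k _; rewrite dE'.
  by have [q1 q2] := pole n k; apply: harm3D; [exact: harm3_ln|apply: harm3Z; exact: harm3_ln].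
apply: cont_sum => n _; apply: cont_sum => k _; rewrite dE'.
by have [q1 q2] := pole n k; apply: contD; [exact: cont_ln_dist|apply: contZ; exact: cont_ln_dist].
Qed.

(** Unlike g, the truncation [gN] is continuous up to the circle, so boundary values make sense.
    Zeros of Q are removed from the domain; near them ln |Q| tends to minus infinity while - gN
    stays below 3 N. *)
Lemma poly_potential_max E N (Q : {poly R[i]}) (m : R) z0 : E !=set0 -> E `<=` unit_circle ->
  (forall w, nm w = 1 -> Q.[w] != 0 -> ln (nm Q.[w]) - gN E N w <= m) ->
  nm z0 < 1 -> Q.[z0] != 0 -> ln (nm Q.[z0]) - gN E N z0 <= m.
Proof.
move=> E0 ET bd z01 Q0.
pose u z := ln (nm Q.[z]) + -1 * gN E N z.
have uE z : u z = ln (nm Q.[z]) - gN E N z by rewrite /u mulN1r.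
pose D z := nm z < 1 /\ - nm Q.[z] < 0.
have DQ z : D z -> Q.[z] != 0 by case=> _; rewrite oppr_lt0 nm_gt0.
have cQ z : cont_at (fun w => nm Q.[w]) z by exact: cont_nm (an3_poly Q z).
rewrite -uE; apply: (@max_principle R D u 1) => //.
- by move=> z [/ltW].
- apply: open3_lt.
    move=> z z1; exists (1 - nm z); first by rewrite subr_gt0.
    by move=> w h; have := nm_subl w z; lra.
  move=> z _; have -> : (fun w => - nm Q.[w]) = (fun w => -1 * nm Q.[w]).
    by apply/funext => w; rewrite mulN1r.
  by apply: contZ; exact: cQ.
- move=> z Dz; have [z1 _] := Dz; have [hg cg] := gN_regular N E0 ET (ltW z1).
  have n0 := DQ z Dz; split.
    by apply: contD; [exact: (cont_ln_nm (an3_poly Q z) n0)|exact: contZ].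
  by apply: sub3D; [exact: (sub3_ln (an3_poly Q z) n0)|apply: sub3_harm; exact: harm3Z].
- move=> xi nD e e0; have [x1|x1] := ltP 1 (nm xi).
    exists (nm xi - 1); first by rewrite subr_gt0.
    move=> z [z1 _] zx; have := nm_subl xi z; rewrite [nm (xi - z)]nmBC; lra.
  have [Qx|Qx] := eqVneq Q.[xi] 0.
    have [d d0 Hd] := cQ xi _ (expR_gt0 (m - 3 * N%:R)).
    exists d => // z Dz zx; have [z1 _] := Dz.
    have gl := gN_levels E N (ltW z1); have n0 := DQ z Dz.
    have : ln (nm Q.[z]) <= m - 3 * N%:R.
      rewrite -[leRHS]expRK ler_ln ?posrE ?expR_gt0 ?nm_gt0 //.
      have := Hd z zx; rewrite Qx nm0 subr0 => h; apply: ltW; apply: le_lt_trans h.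
      exact: ler_norm.
    by rewrite uE; lra.
  have x1' : nm xi = 1.
    apply/eqP; rewrite eq_le x1 leNgt; apply/negP => h; apply: nD; split => //.
    by rewrite oppr_lt0 nm_gt0.
  have [_ cg] := gN_regular N E0 ET x1.
  have cu : cont_at u xi.
    by apply: contD; [exact: (cont_ln_nm (an3_poly Q xi) Qx)|exact: contZ].
  have [d d0 Hd] := cu e e0; exists d => // z _ zx.
  have := Hd z zx; have := bd xi x1' Qx; rewrite -uE ltr_norml; lra.
by split => //; rewrite oppr_lt0 nm_gt0.
Qed.

Lemma poly_max_disc (p : {poly R[i]}) (B : R) z : (forall w, nm w = 1 -> nm p.[w] <= B) ->
  nm z < 1 -> nm p.[z] <= B.
Proof.
move=> H z1; have B0 : 0 <= B by apply: le_trans (H 1 (nm1 (R := R))); exact: nm_ge0.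
apply: (@max_disc R R[i]^o (fun z => p.[z]) 1) => // w _.
exact: an3_poly.
Qed.

Lemma ln_power_bound (X D d : R) q : 0 < X -> 0 < D -> 0 < d ->
  ln (X * (2 * D / d ^+ 2) ^+ q) = ln X + q%:R * ln (2 * D) + 2 * q%:R * ln d^-1.
Proof.
move=> X0 D0 d0; have d20 : 0 < d ^+ 2 by rewrite exprn_gt0.
have D20 : 0 < 2 * D by rewrite mulr_gt0.
have r0 : 0 < 2 * D / d ^+ 2 by rewrite divr_gt0.
rewrite lnM ?posrE //; last by rewrite exprn_gt0.
rewrite (lnXn q r0) ln_div ?posrE // (lnXn 2 d0) lnV ?posrE // -[_ *+ q]mulr_natl -[_ *+ 2]mulr_natl.
by ring.
Qed.

(** With p close to an extension of z^-n from E, 1 - z^n p is at most M1 (d + dl N) on the circle,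
    but at least 1/2 at z0 once |z0|^n is small against the bound on p. For n of order (1 -
    |z0|)^-2, property P makes M1 a power of 1/(1 - |z0|), so that ln M1 is logarithmic. *)
Lemma potential_log_bound E (M t : R) : closed E -> E !=set0 -> E `<=` unit_circle ->
  (forall N, mass E N <= M) -> 1 <= t -> property_P 1 t E ->
  exists2 C, 0 <= C & forall z N, nm z < 1 -> - gN E N z <= C * (1 + ln (1 - nm z)^-1).
Proof.
move=> cE E0 ET mM t1 HP.
have [C0 C00 HC0] := @inverse_power_bound R E ET M E0 cE mM t t1 HP.
have [Cg Cg0 HCg] := gN_circle E0 ET mM.
have [q [q0 tq _]] := ex_nat_ceil (le_trans ler01 t1).
pose P := (2 * q.+1)%N; pose c1 := C0 + 1; have c10 : 0 < c1 by rewrite /c1; lra.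
pose p : R := P.+1%:R; have p0 : 0 < p by rewrite ltr0n.
have p1 : 1 <= p by rewrite ler1n.
pose D := 4 * c1 * p ^+ q.
have D1 : 1 <= D.
  have : 1 <= c1 * p ^+ q by rewrite -[leLHS]mulr1; apply: ler_pM; rewrite ?exprn_ege1 // /c1; lra.
  by rewrite /D; lra.
have D0 : 0 < D by lra.
pose a1 := ln (2 * c1 * p ^+ q.+1) + q.+1%:R * ln (2 * D).
have l20 : 0 <= ln 2 :> R by rewrite ln_ge0 // ler1n.
have l2D : 0 <= ln (2 * D) by rewrite ln_ge0 //; lra.
have a10 : 0 <= a1.
  apply: addr_ge0; last by rewrite mulr_ge0.
  rewrite ln_ge0 // -mulrA -[leLHS]mulr1; apply: ler_pM => //; first by rewrite ler1n.
  by rewrite -[leLHS]mulr1; apply: ler_pM; rewrite ?exprn_ege1 // /c1; lra.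
exists (6 * a1 + Cg + 6 * ln 2 + 12 * q.+1%:R); first by have : 0 <= q.+1%:R :> R by []; lra.
move=> z0 N z01; set d := 1 - nm z0; have d0 : 0 < d by rewrite subr_gt0.
have z00 := nm_ge0 z0; have d1 : d <= 1 by rewrite /d; lra.
have ld0 : 0 <= ln d^-1 by rewrite ln_ge0 // invf_ge1.
have Dd0 : 0 <= D / d ^+ 2 by rewrite divr_ge0 ?sqr_ge0 // ltW.
have [l [l0 l1 l2]] := ex_nat_ceil Dd0.
have lR : 1 <= l%:R :> R by rewrite ler1n.
have lR0 : 0 < l%:R :> R by clear -Dd0 l1; lra.
(* As in [res_outer], the exponent 2 (q + 1) lets Bernoulli beat the polynomial growth of the bound
   [Bn]: (1 + d)^n >= 4 Bn, while |z0| (1 + d) <= 1. *)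
pose n := (P * l)%N.
have np : n.+1%:R <= p * l%:R :> R.
  by rewrite /p -natrM ler_nat mulSn -addn1 addnC leq_add2r.
have n10 : 0 < n.+1%:R :> R by rewrite ltr0n.
pose Bn := c1 * (p * l%:R) ^+ q.
have Bn1 : 1 <= Bn.
  rewrite -[leLHS]mulr1; apply: ler_pM => //; first by rewrite /c1; clear -C00; lra.
  by rewrite exprn_ege1 // -[leLHS]mulr1; apply: ler_pM.
have [f [Lf0 fE]] := HC0 n.
have Lf : lipat E Bn f.
  apply: lipat_le Lf0; apply: ler_pM; rewrite ?powR_ge0 //; first by rewrite /c1; clear; lra.
  apply: le_trans (_ : n.+1%:R ^+ q <= _); last by rewrite lerXn2r ?nnegrE // ltW // mulr_gt0.
  by rewrite -powR_mulrn //; apply: ler_powR; [rewrite ler1n|exact: ltW].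
have [pf fB _] := Lf; have [_ _ gL] := lipat_pow ET n Lf.
have e0 := dl_gt0 (R := R) N; have e1 := dl_le1 (R := R) N.
(* The precision [dl N] is the one at which [gN_circle] cuts off the distance to E. *)
have [pp Hpp] := pf _ e0.
(* The sixth power matches the slope 6 in [gN_circle], so that the logarithms of d + dl N cancel on
   the circle. *)
pose Q1 := 1 - 'X^n * pp; pose Q := Q1 ^+ 6.
have Q1E z : Q1.[z] = 1 - z ^+ n * pp.[z] by rewrite hornerD hornerN hornerC hornerM hornerXn.
have QE z : nm Q.[z] = nm Q1.[z] ^+ 6 by rewrite horner_exp nmX.
have lnQ z : Q1.[z] != 0 -> ln (nm Q.[z]) = 6 * ln (nm Q1.[z]).
  by move=> h; rewrite QE lnXn ?nm_gt0 // mulr_natl.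
have Qn0 z : (Q.[z] != 0) = (Q1.[z] != 0) by rewrite horner_exp expf_eq0.
pose M1 := 2 * (n.+1%:R * Bn); have Bn0 : 0 < Bn by exact: lt_le_trans Bn1.
have M10 : 0 < M1 by rewrite mulr_gt0 // mulr_gt0.
have circ_bd w : nm w = 1 -> nm Q1.[w] <= M1 * (dE E w + dl N).
  move=> cw; have [l' El' h'] := dE_adherent w E0 e0.
  have -> : Q1.[w] = (l' ^+ n * f l' - w ^+ n * f w) + w ^+ n * (f w - pp.[w]).
    by rewrite Q1E (fE l' El'); ring.
  apply: le_trans (nmD _ _) _; rewrite nmBC (nmM (w ^+ n)) nmX cw expr1n mul1r.
  have g1 := gL l' w El' cw; have g2 := Hpp w cw.
  have nB : 1 <= n.+1%:R * Bn by rewrite -[leLHS]mulr1; apply: ler_pM => //; rewrite ler1n.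
  have g3 : n.+1%:R * Bn * nm (w - l') <= n.+1%:R * Bn * (dE E w + dl N).
    by rewrite ler_pM2l ?(ltW h') //; move: nB; clear; lra.
  have g4 : dl N <= n.+1%:R * Bn * (dE E w + dl N).
    have Dw := dE_ge0 w E0; apply: le_trans (_ : 1 * (dE E w + dl N) <= _); first by move: Dw; clear; lra.
    by rewrite ler_pM2r //; move: Dw e0; clear; lra.
  by rewrite /M1; move: g1 g2 g3 g4; clear; lra.
have pz0 : nm pp.[z0] <= 2 * Bn.
  apply: poly_max_disc z01 => w cw.
  have := nm_subl pp.[w] (f w); rewrite [nm (pp.[w] - _)]nmBC.
  by have := Hpp w cw; have := fB w cw; move: e1 Bn1; clear; lra.
have zn : nm z0 ^+ n * (4 * Bn) <= 1.
  have zd : nm z0 * (1 + d) <= 1 by rewrite /d; have := sqr_ge0 (1 - nm z0); clear; nra.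
  have pw : (nm z0 * (1 + d)) ^+ n <= 1.
    by rewrite exprn_ile1 // mulr_ge0 //; move: d0; clear; lra.
  rewrite exprMn in pw; apply: le_trans pw; apply: ler_wpM2l; first by rewrite exprn_ge0.
  have b1 : (1 + l%:R * d) ^+ P <= (1 + d) ^+ n.
    have b0 : 0 <= 1 + l%:R * d by rewrite addr_ge0 // mulr_ge0 // ltW.
    have b0' : 0 <= 1 + d by rewrite addr_ge0 // ltW.
    rewrite /n mulnC exprM; apply: lerXn2r; rewrite ?nnegrE ?exprn_ge0 //.
    exact: bernoulli_le (ltW d0).
  have s1 : 4 * Bn = D * l%:R ^+ q by rewrite /Bn /D exprMn; ring.
  have s2 : D * l%:R ^+ q <= (l%:R * D) ^+ q.+1.
    rewrite exprMn [leLHS]mulrC; apply: ler_pM.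
    - by rewrite exprn_ge0.
    - exact: ltW.
    - exact: ler_weXn2l.
    by rewrite exprS ler_peMr ?(ltW D0) // exprn_ege1.
  have s3 : l%:R * D <= (1 + l%:R * d) ^+ 2.
    have ld : 0 <= l%:R * d by rewrite mulr_ge0 // ltW.
    apply: le_trans (_ : (l%:R * d) ^+ 2 <= _).
      rewrite exprMn expr2 -mulrA; apply: ler_wpM2l; first exact: ltW.
      by rewrite -ler_pdivrMr ?exprn_gt0 // ltW.
    by apply: lerXn2r; rewrite ?nnegrE ?addr_ge0 // lerDr.
  rewrite s1; apply: le_trans s2 (le_trans _ b1); rewrite /P exprM.
  by apply: lerXn2r; rewrite ?nnegrE ?sqr_ge0 // mulr_ge0 // ltW.
have Q1z0 : 1 / 2 <= nm Q1.[z0].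
  have := nm_subl 1 (z0 ^+ n * pp.[z0]); rewrite nm1 -Q1E nmM nmX.
  have : nm z0 ^+ n * nm pp.[z0] <= nm z0 ^+ n * (2 * Bn) by apply: ler_wpM2l; rewrite ?exprn_ge0.
  by move: zn; clear; lra.
have Q1n : Q1.[z0] != 0 by rewrite -nm_gt0; move: Q1z0; clear; lra.
have key : ln (nm Q.[z0]) - gN E N z0 <= 6 * ln M1 + Cg.
  apply: poly_potential_max => //; last by rewrite Qn0.
  move=> w cw; rewrite Qn0 => Qw; rewrite lnQ //.
  have Dw : 0 < dE E w + dl N by have := dE_ge0 w E0; move: e0; clear; lra.
  have : ln (nm Q1.[w]) <= ln (M1 * (dE E w + dl N)).
    have n1 : 0 < nm Q1.[w] by rewrite nm_gt0.
    have n2 := mulr_gt0 M10 Dw; rewrite ler_ln ?posrE //; exact: (circ_bd w cw).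
  by rewrite lnM ?posrE //; have := HCg w N cw; clear; lra.
have lz : - ln 2 <= ln (nm Q1.[z0]).
  by rewrite -lnV ?posrE // ler_ln ?posrE ?invr_gt0 ?nm_gt0 //; move: Q1z0; clear; lra.
rewrite lnQ // in key.
have lM : ln M1 <= a1 + 2 * q.+1%:R * ln d^-1.
  have l2' : l%:R <= 2 * D / d ^+ 2.
    apply: le_trans l2 _; have : 1 <= D / d ^+ 2.
      by rewrite ler_pdivlMr ?exprn_gt0 // mul1r (le_trans _ D1) // exprn_ile1 // ltW.
    by clear; lra.
  have : M1 <= 2 * c1 * p ^+ q.+1 * (2 * D / d ^+ 2) ^+ q.+1.
    apply: le_trans (_ : 2 * c1 * p ^+ q.+1 * l%:R ^+ q.+1 <= _); last first.
      apply: ler_wpM2l; first by rewrite !mulr_ge0 ?exprn_ge0 // ltW.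
      by apply: lerXn2r; rewrite ?nnegrE // (le_trans _ l2').
    rewrite (_ : 2 * c1 * p ^+ q.+1 * l%:R ^+ q.+1 = 2 * (p * l%:R * Bn)); last first.
      by rewrite /Bn exprMn !exprS; ring.
    by rewrite ler_pM2l // ler_pM2r //; lra.
  have dd : 0 < 2 * D / d ^+ 2 by rewrite divr_gt0 ?exprn_gt0 // mulr_gt0.
  have cc : 0 < 2 * c1 * p ^+ q.+1 by rewrite !mulr_gt0 ?exprn_gt0.
  move=> h; rewrite /a1 -(ln_power_bound q.+1 cc D0 d0).
  by rewrite ler_ln ?posrE // mulr_gt0 ?exprn_gt0.
have q00 : 0 <= q.+1%:R :> R by [].
have k1 := mulr_ge0 a10 ld0; have k2 := mulr_ge0 Cg0 ld0; have k3 := mulr_ge0 l20 ld0.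
by move: key lz lM k1 k2 k3 q00; set x := ln d^-1; set Y := q.+1%:R; set Z := ln M1; set W := ln (nm _); clear; lra.
Qed.

End PolynomialMaximum.

(** * From the potential back to integrals over arcs *)

Section IntegralFromPotential.
Context {R : realType}.
Implicit Types (E : set R[i]^o) (n k m N : nat) (s t : R).

(** From depth s below the circle, the squared distances to the two poles differ by at least 2 s dl
    n, and the outer pole is at distance at most s + K s + 2 dl n <= (K + 3) s. So -g at this point
    counts the nearby active roots of scale at most s, each with weight dl n/s up to a constant. *)
Lemma dipole_near n k (a s K : R) : 0 < s -> s <= 1 -> 0 <= K -> dl n <= s ->
  nm (pt n k - expi a) <= K * s ->
  dl n <= (K + 3) ^+ 2 * s * - dipole n k ((1 - s)%:C%C * expi a).
Proof.
move=> s0 s1 K0 ns near; set z := _ * expi a; have d0 := dl_gt0 (R := R) n.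
have nz : nm z = 1 - s by rewrite /z nmM nm_expi mulr1 nmR ger0_norm // subr_ge0.
have f1 := @zeta_far R (1 + dl n) n k z; have f2 := @zeta_far R (1 + 2 * dl n) n k z.
have g1 : 0 < nm (z - zeta (1 + dl n) n k) by lra.
have g2 : 0 < nm (z - zeta (1 + 2 * dl n) n k) by lra.
have sq := dipole_sq n k z; have xl := xco_le n k z; rewrite nz in xl.
have far : nm (z - zeta (1 + 2 * dl n) n k) <= (K + 3) * s.
  have h1 := nm_tri (expi a) z (zeta (1 + 2 * dl n) n k).
  have h2 := nm_tri (pt n k) (expi a) (zeta (1 + 2 * dl n) n k).
  rewrite [nm (expi a - pt n k)]nmBC in h2; rewrite [nm (pt n k - zeta _ _ _)]nmBC nm_zeta_pt in h2; last by lra.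
  have h3 : nm (z - expi a) = s.
    rewrite nmBC /z -[X in nm (X - _)]mul1r -mulrBl nmM nm_expi mulr1.
    have -> : 1 - (1 - s)%:C%C = s%:C%C :> R[i] by rewrite rmorphB rmorph1 /=; ring.
    by rewrite nmR gtr0_norm.
  rewrite h3 in h1; lra.
rewrite (dipoleE g1 g2) opprK; move: g1 g2 sq far; move: (nm _) (nm _) => B A A0 B0 sq far.
have A20 : 0 < A ^+ 2 by rewrite exprn_gt0.
have B20 : 0 < B ^+ 2 by rewrite exprn_gt0.
have r0 : 0 < B ^+ 2 / A ^+ 2 by rewrite divr_gt0.
have l := ln_ge1VB r0; rewrite invf_div in l.
have gap : 2 * s * dl n <= B ^+ 2 - A ^+ 2.
  rewrite sq [2 * s * _]mulrC; apply: ler_wpM2l; first exact: ltW.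
  by lra.
have K3 : 0 < (K + 3) * s by rewrite mulr_gt0 //; lra.
have B2 : B ^+ 2 <= ((K + 3) * s) ^+ 2 by apply: lerXn2r; rewrite ?nnegrE // ltW.
have rat : s * dl n / ((K + 3) * s) ^+ 2 <= ln (B ^+ 2 / A ^+ 2) / 2.
  apply: le_trans (_ : s * dl n / B ^+ 2 <= _).
    apply: ler_wpM2l; first by rewrite mulr_ge0 // ltW.
    by rewrite lef_pV2 ?posrE ?exprn_gt0.
  apply: le_trans (_ : (1 - A ^+ 2 / B ^+ 2) / 2 <= _); last by lra.
  rewrite ler_pdivrMr // (_ : (1 - A ^+ 2 / B ^+ 2) / 2 * B ^+ 2 = (B ^+ 2 - A ^+ 2) / 2); first by lra.
  by field; rewrite gt_eqF.
have c0 : 0 <= (K + 3) ^+ 2 * s by rewrite mulr_ge0 ?sqr_ge0 // ltW.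
apply: le_trans (ler_wpM2l c0 rat); rewrite le_eqVlt; apply/orP; left; apply/eqP.
by field; apply/andP; split; rewrite gt_eqF //; lra.
Qed.

Definition near_scale (a s K : R) n k : bool := (dl n <= s) && (nm (pt n k - expi a) <= K * s).

Lemma near_mass_le E N (a s K G : R) : E !=set0 -> E `<=` unit_circle ->
  0 < s -> s <= 1 -> 0 <= K -> - gN E N ((1 - s)%:C%C * expi a) <= G ->
  psum E N (fun n k => if near_scale a s K n k then dl n else 0) <= (K + 3) ^+ 2 * s * G.
Proof.
move=> E0 ET s0 s1 K0 gG.
have c0 : 0 <= (K + 3) ^+ 2 * s by rewrite mulr_ge0 ?sqr_ge0 // ltW.
apply: le_trans (ler_wpM2l c0 gG); rewrite /gN psumN.
rewrite /psum mulr_sumr; apply: ler_sum => n _; rewrite mulr_sumr; apply: ler_sum => k ak.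
case: ifP => [/andP[h1 h2]|_]; first exact: dipole_near.
apply: mulr_ge0 => //; rewrite oppr_ge0; apply: dipole_le0 ak => //; apply: disc_cl_dom => //.
by rewrite nmM nm_expi mulr1 nmR ger0_norm; lra.
Qed.

Lemma near_arc (c : R) n k t : expi c = 1 -> arc c n k t -> nm (expi t - pt n k) <= 8 * dl n.
Proof.
move=> c1; rewrite /arc /= in_itv /= => /andP[h1 h2].
have -> : expi t = expi (t - c) by have := expiD (t - c) c; rewrite subrK c1 mulr1.
by apply: pt_near_expi; apply/andP; split; lra.
Qed.

(** An interval of length at most 2 pi, anywhere on the line, is covered by two consecutive turns of
    the dyadic arcs, the first starting at [A]. This is why [hits] uses two offsets. *)
Lemma turn_base (a b : R) : b - a <= 2 * pi -> exists A : R, [/\ expi A = 1 & forall t, a <= t <= b ->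
  0 <= t - A < 2 * pi \/ 0 <= t - (A + 2 * pi) < 2 * pi].
Proof.
move=> ab; have [u [u0 u2 eu]] := circle_expi (nm_expi a).
exists (a - u); split.
  have : expi (a - u) * expi a = 1 * expi a by rewrite mul1r {1}eu -expiD subrK.
  by apply: mulIf; rewrite -nm_gt0 nm_expi.
move=> t /andP[t1 t2]; have [h|h] := ltP (t - (a - u)) (2 * pi).
  by left; apply/andP; split; lra.
by right; apply/andP; split; lra.
Qed.

Lemma arc_cover (A : R) n t : 0 <= t - A < 2 * pi -> exists2 k, (k < 2 ^ n)%N & arc A n k t.
Proof.
move=> /andP[t0 t2]; have [k kn /andP[h1 h2]] := pt_cover n t0 t2; exists k => //.
by rewrite /arc /= in_itv /=; apply/andP; split; lra.
Qed.

Section Cover.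
Variables (E : set R[i]^o) (a b A : R) (m : nat).
Hypotheses (E0 : E !=set0) (A1 : expi A = 1).
Hypothesis cov : forall t, a <= t <= b -> 0 <= t - A < 2 * pi \/ 0 <= t - (A + 2 * pi) < 2 * pi.

Let A'1 : expi (A + 2 * pi) = 1. Proof. by rewrite expiD A1 expi_2pi mulr1. Qed.

Definition hits n k t : R := \1_(arc A n k) t + \1_(arc (A + 2 * pi) n k) t.

(** Scales coarser than m are left out; the constant m pays for them. *)
Definition level_hits n t : R :=
  if (m <= n)%N then \sum_(k < 2 ^ n | active E n k) hits n k t else 0.

Lemma hits_ge0 n k t : 0 <= hits n k t.
Proof. by rewrite addr_ge0 // indicE ler0n. Qed.

Lemma level_hits_ge0 n t : 0 <= level_hits n t.
Proof. by rewrite /level_hits; case: ifP => // _; apply: sumr_ge0 => k _; exact: hits_ge0. Qed.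

Lemma measurable_hits n k (D : set R) : measurable_fun D (hits n k).
Proof.
by apply: measurable_funD; exact: measurable_indic (measurable_arc _ _ _).
Qed.

Lemma measurable_level_hits n (D : set R) : measurable_fun D (level_hits n).
Proof.
rewrite /level_hits; case: (m <= n)%N; last exact: measurable_cst.
under eq_fun do rewrite -big_filter; apply: measurable_sum => k; exact: measurable_hits.
Qed.

Lemma level_hits_ge1 n t : a <= t <= b -> (m <= n)%N -> dE E (expi t) <= dl n -> 1 <= level_hits n t.
Proof.
move=> ht mn De; have d0 := dl_gt0 (R := R) n.
suff [k [kn kt nk]] : exists k, [/\ (k < 2 ^ n)%N, 1 <= hits n k t & nm (expi t - pt n k) <= 8 * dl n].
  have ak : active E n k.
    by apply/asboolP; have := dE_lip (pt n k) (expi t) E0; rewrite nmBC; lra.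
  rewrite /level_hits mn (bigD1 (Ordinal kn)) //=; apply: le_trans kt _; rewrite lerDl.
  by apply: sumr_ge0 => j _; exact: hits_ge0.
case: (cov ht) => /arc_cover => /(_ n) [k kn kt]; exists k; split => //; try exact: near_arc kt.
  by rewrite /hits [X in X + _]indicE mem_set // lerDl indicE ler0n.
by rewrite /hits [X in _ + X]indicE mem_set // lerDr indicE ler0n.
Qed.

Lemma series_level_hits l t : a <= t <= b -> (forall n, (n < l)%N -> dE E (expi t) <= dl n) ->
  (l%:R%:E <= m%:R%:E + \sum_(n <oo) (level_hits n t)%:E)%E.
Proof.
move=> ht H; apply: le_trans (_ : m%:R%:E + \sum_(0 <= n < l) (level_hits n t)%:E <= _)%E; last first.
  by apply: leeD => //; apply: nneseries_lim_ge => n _ _; rewrite lee_fin level_hits_ge0.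
rewrite sumEFin -EFinD lee_fin big_mkord.
elim: l H => [|l IH] H; first by rewrite big_ord0 addr0.
rewrite big_ord_recr /= addrA -natr1; have [ml|lm] := leqP m l.
  by apply: lerD; [apply: IH => n nl; apply: H; exact: ltnW|apply: level_hits_ge1 => //; exact: H].
apply: le_trans (_ : m%:R <= _); first by rewrite natr1 ler_nat.
by rewrite -addrA lerDl addr_ge0 ?level_hits_ge0 //; apply: sumr_ge0 => n _; exact: level_hits_ge0.
Qed.

(** log^+ 1/d is at most the number of scales with dl n >= d, since ln 2 <= 1. At a point of E every
    scale counts, so the series is infinite, as is the left side. *)
Lemma logp_le_hits t : a <= t <= b ->
  (logp_inv_dist E t <= m%:R%:E + \sum_(n <oo) (level_hits n t)%:E)%E.
Proof.
move=> ht; rewrite logpE //; case: eqP => [D0|/eqP Dn].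
  rewrite leye_eq; apply/eqP/eqyP => r r0.
  have [l [_ rl _]] := ex_nat_ceil (ltW r0); apply: le_trans (_ : l%:R%:E <= _)%E; first by rewrite lee_fin ltW.
  by apply: series_level_hits => // n _; rewrite D0 ltW ?dl_gt0.
have s0 : 0 < dE E (expi t) by rewrite lt_neqAle eq_sym Dn dE_ge0.
set x := Num.max 0 _; have x0 : 0 <= x by rewrite le_max lexx.
have [xn|xp] := leP (- ln (dE E (expi t))) 0.
  by rewrite /x max_l // adde_ge0 ?lee_fin //; apply: nneseries_ge0 => n _ _; rewrite lee_fin level_hits_ge0.
have xE : x = - ln (dE E (expi t)) by rewrite /x max_r // ltW.
have [l [_ xl l1]] := ex_nat_ceil x0; apply: le_trans (_ : l%:R%:E <= _)%E; first by rewrite lee_fin ltW.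
apply: series_level_hits => // n nl.
have nx : n%:R <= x by have : n.+1%:R <= l%:R :> R; [rewrite ler_nat|rewrite -natr1; lra].
rewrite -ler_ln ?posrE ?dl_gt0 // ln_dl.
have : n%:R * ln 2 <= n%:R :> R by rewrite ler_piMr // ln2_le1.
by lra.
Qed.

End Cover.
(** If the arc of a root meets [a, b], that root is within 8 dl n + (b - a) <= 16 s of [expi a],
    whence 16; two offsets give 4 pi instead of 2 pi. *)
Lemma integral_hits E n k (a b A K s : R) : a <= b -> expi A = 1 -> b - a <= 8 * s -> dl n <= s ->
  (\int[lebesgue_measure]_(t in `[a, b]) (hits A n k t)%:E <=
   (4 * pi * (if near_scale a s 16 n k then dl n else 0))%:E)%E.
Proof.
move=> ab A1 bs ns; have d0 := dl_gt0 (R := R) n; have pi0 := pi_gt0 R.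
have A'1 : expi (A + 2 * pi) = 1 by rewrite expiD A1 expi_2pi mulr1.
have one c : expi c = 1 -> (\int[lebesgue_measure]_(t in `[a, b]) (\1_(arc c n k) t)%:E <=
   (2 * pi * (if near_scale a s 16 n k then dl n else 0))%:E)%E.
  move=> c1; rewrite integral_indic //; last exact: measurable_arc.
  have [e|/set0P [t [ct]]] := eqVneq (arc c n k `&` `[a, b]) set0.
    by rewrite e measure0 lee_fin; case: ifP => _; [pos|rewrite mulr0].
  rewrite /= in_itv /= => /andP[t1 t2]; rewrite ifT.
    by rewrite -(arc_len c n k); apply: le_measure; rewrite ?inE; [apply: measurableI; [exact: measurable_arc|]|exact: measurable_arc|exact: subIsetl].
  have h1 := near_arc c1 ct; have h2 := nm_expi_sub t a.
  rewrite ger0_norm in h2; last by rewrite subr_ge0.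
  rewrite nmBC in h1; have h3 := nm_tri (expi t) (pt n k) (expi a).
  by rewrite /near_scale ns /=; lra.
rewrite /hits; under eq_integral do rewrite EFinD.
rewrite ge0_integralD //; last 2 first.
- by apply/measurable_EFinP; exact: measurable_indic (measurable_arc _ _ _).
- by apply/measurable_EFinP; exact: measurable_indic (measurable_arc _ _ _).
apply: le_trans (leeD (one _ A1) (one _ A'1)) _.
by rewrite -EFinD lee_fin; lra.
Qed.

Lemma integral_level_hits E m n (a b A s : R) : a <= b -> expi A = 1 -> b - a <= 8 * s -> dl m <= s ->
  (\int[lebesgue_measure]_(t in `[a, b]) (level_hits E A m n t)%:E <=
   (4 * pi * \sum_(k < 2 ^ n | active E n k) (if near_scale a s 16 n k then dl n else 0))%:E)%E.
Proof.
move=> ab A1 bs ms; have pi0 := pi_gt0 R; have p4 : 0 <= 4 * pi :> R by pos.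
have near0 k : 0 <= (if near_scale a s 16 n k then dl n else 0) :> R.
  by case: ifP => // _; rewrite ltW ?dl_gt0.
rewrite /level_hits; case: leqP => [mn|_]; last first.
  by rewrite integral0 lee_fin mulr_ge0 //; apply: sumr_ge0 => k _.
have ns : dl n <= s by apply: le_trans ms; exact: dl_le.
under eq_integral do rewrite -big_filter -sumEFin.
rewrite ge0_integral_sum //; last 2 first.
- by move=> k; apply/measurable_EFinP; exact: measurable_hits.
- by move=> k t _; rewrite lee_fin hits_ge0.
rewrite big_filter mulr_sumr -sumEFin; apply: lee_sum => k _; exact: integral_hits.
Qed.

(** Scales coarser than s give the first term, their number m being of order ln 1/s. The finer ones
    give a mass of active roots near [expi a], which [near_mass_le] bounds by the potential at depth
    s. The constants are 4 pi <= 16 and 19 = 16 + 3. *)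
Lemma integral_logp_le E (a b s C : R) : E !=set0 -> E `<=` unit_circle -> a < b ->
  b - a <= 2 * pi -> b - a <= 8 * s -> 0 < s -> s <= 1 -> 0 <= C ->
  (forall N, - gN E N ((1 - s)%:C%C * expi a) <= C) ->
  (\int[lebesgue_measure]_(t in `[a, b]) logp_inv_dist E t <=
   ((b - a) * (2 * ln s^-1 + 2) + 16 * (19 ^+ 2 * s * C))%:E)%E.
Proof.
move=> E0 ET ab ab2 bs s0 s1 C0 HC; have pi0 := pi_gt0 R; have p4 := @pi_le4 R.
have [m [m1 m2]] := dl_scale s0 (le_trans s1 (ler1n R 2)).
have ml := dl_log s0 m2.
have [A [A1 cov]] := turn_base ab2.
have mI : measurable (`[a, b]%classic : set R) by [].
have mu n : measurable_fun `[a, b] (fun t => (level_hits E A m n t)%:E).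
  by apply/measurable_EFinP; exact: measurable_level_hits.
have u0 n t : (0 <= (level_hits E A m n t)%:E)%E by rewrite lee_fin level_hits_ge0.
apply: le_trans (_ : (\int[lebesgue_measure]_(t in `[a, b])
    (m%:R%:E + \sum_(n <oo) (level_hits E A m n t)%:E))%E <= _)%E.
  apply: ge0_le_integral => //.
  - by move=> t _; exact: logp_ge0.
  - exact: measurable_logp.
  - apply: emeasurable_funD; first exact: measurable_cst.
    by apply: ge0_emeasurable_sum => // n _; exact: mu.
  - by move=> t; rewrite /= in_itv /= => ht; apply: (@logp_le_hits E a b A m) => //; exact: cov.
rewrite ge0_integralD //; last 2 first.
- by move=> t _; exact: nneseries_ge0.
- by apply: ge0_emeasurable_sum => // n _; exact: mu.
rewrite EFinD; apply: leeD.
  have len : lebesgue_measure `[a, b] = (b - a)%:E.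
    by rewrite lebesgue_measure_itv /= lte_fin ab EFinB.
  apply: le_trans (_ : (m%:R * (b - a))%:E <= _)%E; first by rewrite integral_cst // EFinM -len.
  rewrite lee_fin mulrC.
  by rewrite ler_pM2l ?subr_gt0.
rewrite integral_nneseries //; apply: lime_le.
  by apply: is_cvg_nneseries => n _ _; apply: integral_ge0 => t _; exact: u0.
apply: nearW => N; rewrite /= big_mkord.
apply: le_trans (_ : (\sum_(n < N) (4 * pi * \sum_(k < 2 ^ n | active E n k)
    (if near_scale a s 16 n k then dl n else 0))%:E)%E <= _)%E.
  by apply: lee_sum => n _; apply: integral_level_hits => //; exact: ltW.
rewrite sumEFin lee_fin -mulr_sumr; apply: ler_pM.
- by pos.
- by apply: sumr_ge0 => n _; apply: sumr_ge0 => k _; case: ifP => // _; rewrite ltW ?dl_gt0.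
- lra.
have := @near_mass_le E N a s 16 C E0 ET s0 s1 (ler0n R 16) (HC N).
by rewrite (_ : 16 + 3 = 19) //; ring.
Qed.

Lemma log_integral_bound E (C : R) : E !=set0 -> E `<=` unit_circle -> 0 <= C ->
  (forall z N, nm z < 1 -> - gN E N z <= C * (1 + ln (1 - nm z)^-1)) ->
  exists C1 C2 : R, [/\ 0 < C1, 0 < C2 &
     forall a b : R, a < b -> b - a <= 2 * pi ->
       (((b - a)^-1)%:E * \int[lebesgue_measure]_(t in `[a, b]) logp_inv_dist E t
          <= (C1 * ln (1 / (b - a)) + C2)%:E)%E].
Proof.
move=> E0 ET C0 HC; pose D := 2 + 2 * 19 ^+ 2 * C.
have c0 : 0 <= 2 * 19 ^+ 2 * C by rewrite !mulr_ge0 ?sqr_ge0.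
have D0 : 0 < D by rewrite /D; lra.
have l8 : 0 <= ln 8 :> R by rewrite ln_ge0 // ler1n.
exists D, (D * (1 + ln 8)); split => //; first by rewrite mulr_gt0 //; lra.
move=> a b ab ab2; have L0 : 0 < b - a by rewrite subr_gt0.
(* Division by 8 ensures s <= 1, because b - a <= 2 pi <= 8. *)
have p4 := @pi_le4 R; pose s := (b - a) / 8.
have s0 : 0 < s by rewrite divr_gt0.
have s1 : s <= 1 by rewrite /s; lra.
have ls0 : 0 <= ln s^-1 by rewrite ln_ge0 // invf_ge1.
have B N : - gN E N ((1 - s)%:C%C * expi a) <= C * (1 + ln s^-1).
  have nz : nm ((1 - s)%:C%C * expi a) = 1 - s by rewrite nmM nm_expi mulr1 nmR ger0_norm // subr_ge0.
  have e : 1 - nm ((1 - s)%:C%C * expi a) = s by rewrite nz; ring.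
  by have := HC ((1 - s)%:C%C * expi a) N; rewrite e; apply; rewrite nz; lra.
have L8 : b - a = 8 * s by rewrite /s; field.
have CB : 0 <= C * (1 + ln s^-1) by rewrite mulr_ge0 //; lra.
have := integral_logp_le E0 ET ab ab2 _ s0 s1 CB B; rewrite -L8 => /(_ (lexx _)) H.
have iL : (0 <= ((b - a)^-1)%:E)%E by rewrite lee_fin invr_ge0 ltW.
apply: le_trans (lee_wpmul2l iL H) _; rewrite -EFinM lee_fin.
have -> : ln (1 / (b - a)) = ln s^-1 - ln 8.
  by rewrite div1r L8 !lnV ?posrE ?mulr_gt0 // lnM ?posrE //; lra.
have -> : (b - a)^-1 * ((b - a) * (2 * ln s^-1 + 2) + 16 * (19 ^+ 2 * s * (C * (1 + ln s^-1)))) =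
    D * (1 + ln s^-1).
  by rewrite L8 /D; field; rewrite gt_eqF.
by rewrite le_eqVlt; apply/orP; left; apply/eqP; ring.
Qed.

End IntegralFromPotential.

Lemma integral_bound_set0 (R : realType) : exists C1 C2 : R, [/\ 0 < C1, 0 < C2 &
     forall a b : R, a < b -> b - a <= 2 * pi ->
       (((b - a)^-1)%:E * \int[lebesgue_measure]_(t in `[a, b]) logp_inv_dist set0 t
          <= (C1 * ln (1 / (b - a)) + C2)%:E)%E].
Proof.
(* ln(b - a) <= b - a - 1 <= 7, as 2 pi <= 8. *)
exists 1, 8; split => // a b ab ab2; have L0 : 0 < b - a by rewrite subr_gt0.
rewrite integral0_eq; last by move=> t _; exact: logp_set0.
rewrite mule0 lee_fin mul1r div1r lnV ?posrE //; have := ln_leB1 L0; have := @pi_le4 R; lra.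
Qed.

Theorem mainTheorem3 (R : realType) (E : set R[i]^o)
    (E_countable : countable E) (E_closed : closed E)
    (E_circle : E `<=` unit_circle) :
  (exists C1 C2 : R, [/\ 0 < C1, 0 < C2 &
     forall a b : R, a < b -> b - a <= 2 * pi ->
       (((b - a)^-1)%:E * \int[lebesgue_measure]_(t in `[a, b]) logp_inv_dist E t
          <= (C1 * ln (1 / (b - a)) + C2)%:E)%E])
  <->
  ((\int[lebesgue_measure]_(t in `[0%R, (2 * pi)%R]) logp_inv_dist E t < +oo)%E /\
   forall s : R, 0 <= s -> exists2 t : R, s <= t & property_P s t E).

Proof.
(* The empty set is treated apart: the real-valued distance [dE] is meaningful for nonempty E. *)
have E0P : E = set0 \/ E !=set0 by have [->|/set0P] := eqVneq E set0; [left|right].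
split=> [H|[fin HP]].
  split; first by case: H => C1 [C2 [_ _ H]]; exact: integral_finite H.
  exact: forward_property.
case: E0P => [->|E0]; first exact: integral_bound_set0.
have [t t1 P1] := HP 1 ler01.
have [M mM] := mass_bounded E0 E_circle fin.
have [C C0 HC] := potential_log_bound E_closed E0 E_circle mM t1 P1.
exact: log_integral_bound HC.
Qed.
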